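(* Fix $\alpha>0$, $E\in\mathbb R$ and $\zeta=\sigma+i\tau\in\mathbb C$ with $\tau>0$. Let $\beta=\beta_n>0$ be such that $n\beta\to2\alpha$ as $n\to\infty$. Let $\lambda_1,\dots,\lambda_n$ be the eigenvalues of the random matrix $T_{n,\beta}$, let $\xi_n=\sum_{j=1}^n\delta_{n(\lambda_j-E)}$, and let $m_n(z)=(T_{n,\beta}-z)^{-1}(1,1)$. Then, as $n\to\infty$, $$\mathbb E[\xi_n(f_\zeta)]=\mathbb E\Big[\operatorname{Im}m_n\Big(E+\frac\zeta n\Big)\Big]\longrightarrow\pi\,\bar\mu_\alpha(E).$$
   Context: For $k>0$, $\tilde\chi_k$ denotes the law of the square root of a $\mathrm{Gamma}(k/2,1)$ random variable. $T_{n,\beta}$ is the $n\times n$ random symmetric tridiagonal matrix with independent entries (up to symmetry): diagonal entries $\sim\mathcal N(0,1)$ and subdiagonal entries $b_i\sim\tilde\chi_{(n-i)\beta}$, $i=1,\dots,n-1$. Its eigenvalues have joint density proportional to $\prod_{i<j}|\lambda_j-\lambda_i|^\beta e^{-\frac12(\lambda_1^2+\cdots+\lambda_n^2)}$. For $\zeta=\sigma+i\tau$, $\tau>0$: $f_\zeta(x)=\operatorname{Im}\frac1{x-\zeta}=\frac{\tau}{(x-\sigma)^2+\tau^2}$, and $\xi_n(f_\zeta)=\int f_\zeta\,d\xi_n$. $\bar\mu_\alpha(E)=\frac{e^{-E^2/2}}{\sqrt{2\pi}}\frac1{|\hat f_\alpha(E)|^2}$ with $\hat f_\alpha(E)=\sqrt{\frac{\alpha}{\Gamma(\alpha)}}\int_0^\infty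 t^{\alpha-1}e^{-\frac{t^2}2+iEt}\,dt$ (a probability density on $\mathbb R$). *)

(* Defs.v *)
From HB Require Import structures.
From mathcomp Require Import all_boot all_order all_algebra.
From mathcomp Require Import all_classical all_reals all_analysis.
From mathcomp Require Import complex.

Set Implicit Arguments.
Unset Strict Implicit.
Unset Printing Implicit Defensive.

Import Order.TTheory GRing.Theory Num.Theory.
Import numFieldNormedType.Exports.

Local Open Scope classical_set_scope.
Local Open Scope ring_scope.
Local Open Scope complex_scope.

Section laws.
Context {R : realType}.

Definition gamma_fun (a : R) : R :=
  \int[lebesgue_measure]_(t in `]0, +oo[) (t `^ (a - 1) * expR (- t)).

Definition gamma_pdf (a x : R) : R :=
  if 0 < x then x `^ (a - 1) * expR (- x) / gamma_fun a else 0.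

(* Shape a, rate 1. *)
Definition gamma_prob (a : R) : set _ -> \bar R :=
  fun V => (\int[lebesgue_measure]_(x in V) (gamma_pdf a x)%:E)%E.

(* The law of the square root of a Gamma(k/2, 1) random variable; it differs
   from the classical chi law with k degrees of freedom by a factor sqrt 2. *)
Definition chi_prob (k : R) : set (measurableTypeR R) -> \bar R :=
  pushforward (gamma_prob (k / 2) : set (measurableTypeR R) -> \bar R)
    (Num.sqrt : measurableTypeR R -> measurableTypeR R).

(* Laws are compared on measurable sets only: [distribution P X] is not
   meaningful on the other ones. *)
Definition has_law d (T : measurableType d) (P : probability T R)
    (X : {RV P >-> R}) (mu : set (measurableTypeR R) -> \bar R) : Prop :=
  forall A : set (measurableTypeR R), measurable A -> distribution P X A = mu A.

Definition mutually_independent d (T : measurableType d) (P : probability T R)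
    (I : finType) (X : I -> {RV P >-> R}) : Prop :=
  forall (J : {set I}) (A : I -> set (measurableTypeR R)),
    (forall i, i \in J -> measurable (A i)) ->
    P (\bigcap_(i in [set` J]) (X i @^-1` A i)) =
    (\prod_(i in J) P (X i @^-1` A i))%E.

End laws.

Section tridiagonal.
Context {R : realType}.

(* [lift ord0 k] is k + 1 and [widen_ord (leqnSn n) k] is k: the entry b k sits
   in row k + 1, column k (counted from 0) and at the transposed position. *)
Definition subdiag_mx n (b : 'I_n -> R) : 'M[R]_n.+1 :=
  \sum_(k < n) b k *: delta_mx (lift ord0 k) (widen_ord (leqnSn n) k).

Definition tridiag_mx n (a : 'I_n.+1 -> R) (b : 'I_n -> R) : 'M[R]_n.+1 :=
  diag_mx (\row_i a i) + subdiag_mx b + (subdiag_mx b)^T.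

(* a and b are the diagonal and subdiagonal entries of the (n + 1) x (n + 1)
   random matrix T_{n+1,beta}. With subdiagonal entries counted from 0, [b k] is
   the (k + 1)-st one, of parameter ((n + 1) - (k + 1)) * beta. *)
Definition tridiag_ensemble d (T : measurableType d) (P : probability T R) n
    (beta : R) (a : 'I_n.+1 -> {RV P >-> R}) (b : 'I_n -> {RV P >-> R}) : Prop :=
  [/\ forall i, has_law (a i) (normal_prob 0 1),
      forall k : 'I_n, has_law (b k) (chi_prob ((n.+1 - k.+1)%:R * beta)) &
      mutually_independent (fun i : 'I_n.+1 + 'I_n =>
        match i with inl i => a i | inr k => b k end)].

(* s lists the eigenvalues of A, repeated with their multiplicity. *)
Definition eigenvalues_of n (A : 'M[R]_n) (s : n.-tuple R) : Prop :=
  char_poly A = \prod_(x <- s) ('X - x%:P).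

(* The counting measure of the points n (lambda_j - E), 1 <= j <= n. *)
Definition point_measure n (E : R) (s : n.-tuple R)
    : set (measurableTypeR R) -> \bar R :=
  msum (fun j => \d_(n%:R * (nth 0 s j - E) : measurableTypeR R)) n.

(* For A real symmetric and z not real, A - z is invertible, so [invmx] is the
   inverse; [ord0 ord0] is the (1, 1) entry, counted from 1. *)
Definition resolvent11 n (A : 'M[R]_n.+1) (z : R[i]) : R[i] :=
  invmx (map_mx (real_complex R) A - z%:M) ord0 ord0.

Definition poisson_fun (zeta : R[i]) (x : R) : R :=
  complex.Im (x%:C - zeta)^-1.

End tridiagonal.

Section density.
Context {R : realType}.

Definition expC (z : R[i]) : R[i] :=
  (expR (complex.Re z))%:C *
  (cos (complex.Im z) +i* sin (complex.Im z)).

Definition Cintegral (D : set (measurableTypeR R)) (f : R -> R[i]) : R[i] :=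
  (\int[lebesgue_measure]_(t in D) complex.Re (f t)) +i*
  (\int[lebesgue_measure]_(t in D) complex.Im (f t)).

Definition fhat (alpha E : R) : R[i] :=
  (Num.sqrt (alpha / gamma_fun alpha))%:C *
  Cintegral `]0, +oo[ (fun t =>
    (t `^ (alpha - 1))%:C * expC ((- (t ^+ 2 / 2))%:C + 'i * (E * t)%:C)).

(* On R[i] the norm `|z| is itself in R[i]; [normc] is the modulus in R. *)
Definition mubar (alpha E : R) : R :=
  expR (- (E ^+ 2 / 2)) / Num.sqrt (2 * pi) /
  (ComplexField.Normc.normc (fhat alpha E)) ^+ 2.

End density.

(* Main.v *)
Require Import Defs.
From HB Require Import structures.
From mathcomp Require Import all_boot all_order all_algebra.
From mathcomp Require Import all_classical all_reals all_analysis.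
From mathcomp Require Import measurable_realfun.
From mathcomp Require Import complex.
From mathcomp Require Import ring lra.
Set Implicit Arguments.
Unset Strict Implicit.
Unset Printing Implicit Defensive.

Import Order.TTheory GRing.Theory Num.Theory.
Import numFieldNormedType.Exports.
Local Open Scope classical_set_scope.
Local Open Scope ring_scope.
Local Open Scope complex_scope.

(** Write [N] for the size of the matrix [T], [z = E + zeta / N] and [G = (T - z)^-1], so that the integral
    of [f_zeta] against [xi] is [N^-1 Im tr G]. Two things are to be shown: [E Im G_11 = N^-1 E Im tr G] for
    every [N], and the limit of [E Im G_11].

    The identity. Let [S] be the subdiagonal part of [T]. Integrate by parts against the Gaussian law of
    each diagonal entry, with the test function [((S^T - S) G)_ii], and against the law of each subdiagonal
    entry [b_k], with the test function [G_(k+1,k+1) - G_kk]. In the sum of these relations the terms that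
    are quadratic in [G] cancel, because [G] is symmetric ([sum_toda_flow]); those which still contain
    entries of [T] add up to the trace of [[T, S] G], which is zero ([trace_flow]); and because the parameter
    of [b_k] is proportional to [N - k], summation by parts turns what remains into
    [beta (tr G - N G_11)] ([expected_trace]).

    The limit. Here [G_11 = - 1 / U_0], where [U_j = z - a_j - b_j^2 / U_(j+1)] is a continued fraction: at
    each level [a_j], [b_j] and [U_(j+1)] are independent ([resolvent11_level]). Put
    [chf_j t = E e^(i t U_j)] and [ghf_j t = E e^(- i t g / U_(j+1))], with [g] of law Gamma of parameter
    [kap_j = (N - 1 - j) beta / 2], which tends to [alpha] for fixed [j]. Then
    [chf_j t = e^(i t z - t^2 / 2) ghf_j t] ([chf_step]), and the expectation of [G_11] is [i] times the
    integral of [chf_0] over the half-line ([expected_resolvent11]).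

    If [kap] does not depend on [j] this recursion has the explicit fixed point
    [stat t = cyl kap (z + i t) / cyl kap z], where
    [cyl k w = int_0^oo s^(k-1) e^(- s^2 / 2 + i w s) ds] is a parabolic cylinder function. It comes from a
    complex measure of mass one on the line [z + R] which the recursion preserves; the computation behind
    this is [Lap_scale].

    The recursion contracts in a weighted [L^2] norm. On the half-line, [e^(i s u)] and [e^(i s u')] have the
    scalar product [i / (u - conj u')], and the inversion [w |-> - g / w] preserves this kernel up to the
    factor [g / (u conj u')]; divided by [s], the kernel of differences is preserved exactly
    ([frullani_inv]). So for each [g] the passage from [u] to [- g / u] is an isometry for the weight [1 / s]
    on transforms of measures of mass zero, and its average over [g] does not increase this norm
    ([gtr_div_le]). The Gaussian factor makes it decrease, except near [t = 0], where the average is small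
    because it is controlled by the unweighted norm ([gtr_sqr_le]). Together: a factor [1 - ep^2 / 4] that is
    uniform for [kap] bounded ([gtr_contraction]). Replacing [kap_j] by [kap_(j+1)] in the fixed point
    costs an error that tends to zero for each [j]; starting from an a priori bound at a fixed depth
    [L], then letting [L] tend to infinity, [ghf_0 - stat_0] tends to zero ([cvg_expected_resolvent11]).

    The integral of [e^(i t z - t^2 / 2) stat t] is [cyl (kap + 1) z / (kap cyl kap z)], because its integrand is a
    derivative ([integral_stationary]). So the limit of [E Im G_11] is
    [Re (cyl (alpha + 1) E / (alpha cyl alpha E))]. The numerator of this real part,
    [Re (cyl (k + 1) E conj (cyl k E))], satisfies [f' = - E f] in the real variable [E], and its
    value at [0] is given by a duplication formula; this is the density of the statement ([pi_mubar]). *)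

(** * Complex numbers *)

Notation cRe := complex.Re.
Notation cIm := complex.Im.
Notation cabs := ComplexField.Normc.normc.

Section complex_numbers.
Context {R : realType}.
Implicit Types (z w : R[i]) (x t : R).

Lemma cReD z w : cRe (z + w) = cRe z + cRe w. Proof. by case: z w => [? ?] []. Qed.
Lemma cImD z w : cIm (z + w) = cIm z + cIm w. Proof. by case: z w => [? ?] []. Qed.
Lemma cReN z : cRe (- z) = - cRe z. Proof. by case: z. Qed.
Lemma cImN z : cIm (- z) = - cIm z. Proof. by case: z. Qed.
Lemma cReB z w : cRe (z - w) = cRe z - cRe w. Proof. by rewrite cReD cReN. Qed.
Lemma cImB z w : cIm (z - w) = cIm z - cIm w. Proof. by rewrite cImD cImN. Qed.
Lemma cReM z w : cRe (z * w) = cRe z * cRe w - cIm z * cIm w.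
Proof. by case: z w => [? ?] []. Qed.
Lemma cImM z w : cIm (z * w) = cRe z * cIm w + cIm z * cRe w.
Proof. by case: z w => [? ?] []. Qed.
Lemma cReC x : cRe x%:C = x. Proof. by []. Qed.
Lemma cImC x : cIm x%:C = 0. Proof. by []. Qed.
Lemma cRei : cRe 'i = 0 :> R. Proof. by []. Qed.
Lemma cImi : cIm 'i = 1 :> R. Proof. by []. Qed.
Lemma cReJ z : cRe z^* = cRe z. Proof. by case: z. Qed.
Lemma cImJ z : cIm z^* = - cIm z. Proof. by case: z. Qed.
Lemma cRe_sum (I : Type) (s : seq I) (Q : pred I) (F : I -> R[i]) :
  cRe (\sum_(i <- s | Q i) F i) = \sum_(i <- s | Q i) cRe (F i).
Proof. by elim/big_rec2: _ => // i y1 y2 _ <-; rewrite cReD. Qed.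
Lemma cIm_sum (I : Type) (s : seq I) (Q : pred I) (F : I -> R[i]) :
  cIm (\sum_(i <- s | Q i) F i) = \sum_(i <- s | Q i) cIm (F i).
Proof. by elim/big_rec2: _ => // i y1 y2 _ <-; rewrite cImD. Qed.

Definition cE := (cReD, cImD, cReN, cImN, cReM, cImM, cReC, cImC, cRei, cImi, cReJ, cImJ).

Lemma complexP z w : cRe z = cRe w -> cIm z = cIm w -> z = w.
Proof. by case: z w => [? ?] [? ?] /= -> ->. Qed.

Lemma cabsE z : cabs z = Num.sqrt (cRe z ^+ 2 + cIm z ^+ 2). Proof. by case: z. Qed.

Lemma cabs_sqr z : cabs z ^+ 2 = cRe z ^+ 2 + cIm z ^+ 2.
Proof. by rewrite cabsE sqr_sqrtr// addr_ge0// sqr_ge0. Qed.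

Lemma cabs_ge0 z : 0 <= cabs z. Proof. by rewrite cabsE sqrtr_ge0. Qed.

Lemma cabsJ z : cabs z^* = cabs z. Proof. by rewrite !cabsE !cE sqrrN. Qed.

Lemma cabsM z w : cabs (z * w) = cabs z * cabs w.
Proof. exact: ComplexField.Normc.normcM. Qed.

Lemma cabsV z : cabs z^-1 = (cabs z)^-1.
Proof. exact: ComplexField.Normc.normcV. Qed.

Lemma cabsN z : cabs (- z) = cabs z.
Proof. by rewrite !cabsE !cE !sqrrN. Qed.

Lemma cabsD z w : cabs (z + w) <= cabs z + cabs w.
Proof. exact: le_normcD. Qed.

Lemma cabsB z w : cabs (z - w) <= cabs z + cabs w.
Proof. by rewrite -(cabsN w); exact: cabsD. Qed.

Lemma cabsC x : cabs x%:C = `|x|.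
Proof. by rewrite cabsE /= expr0n/= addr0 sqrtr_sqr. Qed.

Lemma cabs0 : cabs (0 : R[i]) = 0. Proof. exact: ComplexField.Normc.normc0. Qed.
Lemma cabs1 : cabs (1 : R[i]) = 1. Proof. exact: ComplexField.Normc.normc1. Qed.
Lemma cabsi : cabs ('i : R[i]) = 1.
Proof. by rewrite cabsE /= expr0n add0r expr1n sqrtr1. Qed.

Lemma cabs_eq0 z : (cabs z == 0) = (z == 0).
Proof.
apply/eqP/eqP => [|->]; last exact: cabs0.
exact: ComplexField.Normc.eq0_normc.
Qed.

Lemma cabs_gt0 z : (0 < cabs z) = (z != 0).
Proof. by rewrite lt0r cabs_ge0 andbT cabs_eq0. Qed.

Lemma Re_cabs z : `|cRe z| <= cabs z.
Proof.
rewrite -(ler_pXn2r (n := 2))// ?nnegrE ?cabs_ge0// real_normK ?num_real//.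
by rewrite cabs_sqr lerDl sqr_ge0.
Qed.

Lemma Im_cabs z : `|cIm z| <= cabs z.
Proof.
rewrite -(ler_pXn2r (n := 2))// ?nnegrE ?cabs_ge0// real_normK ?num_real//.
by rewrite cabs_sqr lerDr sqr_ge0.
Qed.

Lemma cabs_le_ReIm z : cabs z <= `|cRe z| + `|cIm z|.
Proof.
have h : 0 <= `|cRe z| + `|cIm z| by rewrite addr_ge0.
rewrite -(ler_pXn2r (n := 2))// ?nnegrE ?cabs_ge0// cabs_sqr sqrrD.
rewrite !real_normK ?num_real// -addrA lerD2l lerDr.
by rewrite mulrn_wge0// mulr_ge0.
Qed.

Lemma cReV z : cRe z^-1 = cRe z / cabs z ^+ 2.
Proof. by rewrite cabs_sqr; case: z. Qed.

Lemma cImV z : cIm z^-1 = - cIm z / cabs z ^+ 2.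
Proof. by rewrite cabs_sqr; case: z => a b /=; rewrite mulNr. Qed.

Lemma mulJ z : z * z^* = (cabs z ^+ 2)%:C.
Proof. by apply: complexP; rewrite !cE ?cabs_sqr; ring. Qed.

Lemma Im_neq0 z : 0 < cIm z -> z != 0.
Proof. by apply: contraTneq => ->; rewrite ltxx. Qed.

Lemma Im_le_cabs z : cIm z <= cabs z.
Proof. exact: le_trans (ler_norm _) (Im_cabs z). Qed.

Lemma CD x t : (x + t)%:C = x%:C + t%:C :> R[i].
Proof. exact: rmorphD. Qed.
Lemma CN x : (- x)%:C = - x%:C :> R[i].
Proof. exact: rmorphN. Qed.
Lemma CM x t : (x * t)%:C = x%:C * t%:C :> R[i].
Proof. exact: rmorphM. Qed.
Lemma CB x t : (x - t)%:C = x%:C - t%:C :> R[i].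
Proof. exact: rmorphB. Qed.
Lemma CV x : (x^-1)%:C = (x%:C)^-1 :> R[i].
Proof. exact: fmorphV. Qed.
Lemma CX x n : (x ^+ n)%:C = (x%:C) ^+ n :> R[i].
Proof. exact: rmorphXn. Qed.
Lemma C_eq0 x : (x%:C == 0 :> R[i]) = (x == 0).
Proof. by rewrite -(inj_eq (@complexI R)). Qed.

(** ** The exponential *)

Lemma Re_expC z : cRe (expC z) = expR (cRe z) * cos (cIm z).
Proof. by rewrite /expC !cE /= mul0r subr0. Qed.

Lemma Im_expC z : cIm (expC z) = expR (cRe z) * sin (cIm z).
Proof. by rewrite /expC !cE /= mul0r addr0. Qed.

Lemma expCD z w : expC (z + w) = expC z * expC w.
Proof.
apply: complexP; rewrite !(Re_expC, Im_expC, cE) expRD (cosD, sinD); ring.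
Qed.

Lemma expC0 : expC 0 = 1 :> R[i].
Proof. by apply: complexP; rewrite ?Re_expC ?Im_expC /= ?cos0 ?sin0 ?expR0 ?mulr1 ?mulr0. Qed.

Lemma expCJ z : (expC z)^* = expC z^*.
Proof. by apply: complexP; rewrite !(Re_expC, Im_expC, cE) ?cosN ?sinN ?mulrN. Qed.

Lemma cabs_expC z : cabs (expC z) = expR (cRe z).
Proof.
rewrite cabsE Re_expC Im_expC !exprMn -mulrDr cos2Dsin2 mulr1 sqrtr_sqr.
by rewrite ger0_norm ?expR_ge0.
Qed.

End complex_numbers.

(** * Integration of complex functions *)

Section measurable_complex.
Context {R : realType} {d} {T : measurableType d}.
Implicit Types (f g : T -> R[i]) (h : T -> R).

Definition cmeas f :=
  measurable_fun setT (fun x => cRe (f x)) /\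
  measurable_fun setT (fun x => cIm (f x)).

Lemma cmeas_Re f : cmeas f -> measurable_fun setT (fun x => cRe (f x)).
Proof. by case. Qed.

Lemma cmeas_Im f : cmeas f -> measurable_fun setT (fun x => cIm (f x)).
Proof. by case. Qed.

Lemma cmeas_cst (c : R[i]) : cmeas (fun=> c).
Proof. by split; exact: measurable_cst. Qed.

Lemma cmeasC h : measurable_fun setT h -> cmeas (fun x => (h x)%:C).
Proof. by move=> mh; split => //; exact: measurable_cst. Qed.

Lemma cmeasD f g : cmeas f -> cmeas g -> cmeas (fun x => f x + g x).
Proof.
move=> [f1 f2] [g1 g2]; split.
  by under eq_fun do rewrite cReD; exact: measurable_funD.
by under eq_fun do rewrite cImD; exact: measurable_funD.
Qed.

Lemma cmeasN f : cmeas f -> cmeas (fun x => - f x).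
Proof.
move=> [f1 f2]; split.
  by under eq_fun do rewrite cReN; exact: measurableT_comp.
by under eq_fun do rewrite cImN; exact: measurableT_comp.
Qed.

Lemma cmeasB f g : cmeas f -> cmeas g -> cmeas (fun x => f x - g x).
Proof. by move=> mf mg; apply: cmeasD => //; exact: cmeasN. Qed.

Lemma cmeasM f g : cmeas f -> cmeas g -> cmeas (fun x => f x * g x).
Proof.
move=> [f1 f2] [g1 g2]; split.
  under eq_fun do rewrite cReM.
  by apply: measurable_funB; exact: measurable_funM.
under eq_fun do rewrite cImM.
by apply: measurable_funD; exact: measurable_funM.
Qed.

Lemma cmeasJ f : cmeas f -> cmeas (fun x => (f x)^*).
Proof.
move=> [f1 f2]; split; first by under eq_fun do rewrite cReJ.
by under eq_fun do rewrite cImJ; exact: measurableT_comp.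
Qed.

Lemma measurable_cabs2 f : cmeas f -> measurable_fun setT (fun x => cabs (f x) ^+ 2).
Proof.
move=> [f1 f2]; under eq_fun do rewrite cabs_sqr.
by apply: measurable_funD; exact: measurable_funX.
Qed.

Lemma measurable_cabs f : cmeas f -> measurable_fun setT (fun x => cabs (f x)).
Proof.
move=> mf.
have -> : (fun x => cabs (f x)) = Num.sqrt \o (fun x => cabs (f x) ^+ 2).
  by apply/funext => x /=; rewrite sqrtr_sqr ger0_norm ?cabs_ge0.
have ms : measurable_fun [set: R] (@Num.sqrt R).
  by apply: continuous_measurable_fun; exact: sqrt_continuous.
by apply: measurableT_comp => //; exact: measurable_cabs2.
Qed.

Lemma measurable_ge0V h : (forall x, 0 <= h x) -> measurable_fun setT h ->
  measurable_fun setT (fun x => (h x)^-1).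
Proof.
move=> h0 mh; have -> : (fun x => (h x)^-1) = (fun x => h x `^ (-1)).
  apply/funext => x; have [->|hx] := eqVneq (h x) 0.
    by rewrite invr0 powR0// oppr_eq0 oner_eq0.
  by rewrite powRN powRr1.
have mp := @measurable_powR R (-1).
exact: (measurableT_comp mp mh).
Qed.

Lemma cmeasV f : cmeas f -> cmeas (fun x => (f x)^-1).
Proof.
move=> mf; have [f1 f2] := mf.
have m2 : measurable_fun setT (fun x => (cabs (f x) ^+ 2)^-1).
  apply: measurable_ge0V; last exact: measurable_cabs2.
  by move=> x; exact: sqr_ge0.
split.
  by under eq_fun do rewrite cReV; exact: measurable_funM.
under eq_fun do rewrite cImV.
by apply: measurable_funM => //; exact: measurableT_comp.
Qed.

Lemma cmeas_expC f : cmeas f -> cmeas (fun x => expC (f x)).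
Proof.
move=> [f1 f2].
have me : measurable_fun setT (fun x => expR (cRe (f x))).
  exact: measurableT_comp.
split.
  under eq_fun do rewrite Re_expC.
  apply: measurable_funM => //.
  apply: measurableT_comp => //.
  by apply: continuous_measurable_fun; exact: continuous_cos.
under eq_fun do rewrite Im_expC.
apply: measurable_funM => //.
apply: measurableT_comp => //.
by apply: continuous_measurable_fun; exact: continuous_sin.
Qed.

Lemma cmeas_sum (I : Type) (s : seq I) (Q : pred I) (F : I -> T -> R[i]) :
  (forall i, cmeas (F i)) -> cmeas (fun x => \sum_(i <- s | Q i) F i x).
Proof.
move=> mF; elim: s => [|i s ih].
  by under eq_fun do rewrite big_nil; exact: cmeas_cst.
under eq_fun do rewrite big_cons.
by case: (Q i) => //; exact: cmeasD.
Qed.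

Lemma cmeas_prod (I : Type) (s : seq I) (Q : pred I) (F : I -> T -> R[i]) :
  (forall i, cmeas (F i)) -> cmeas (fun x => \prod_(i <- s | Q i) F i x).
Proof.
move=> mF; elim: s => [|i s ih].
  by under eq_fun do rewrite big_nil; exact: cmeas_cst.
under eq_fun do rewrite big_cons.
by case: (Q i) => //; exact: cmeasM.
Qed.

End measurable_complex.

Lemma cmeas_comp {R : realType} d d' (T : measurableType d) (S : measurableType d')
    (f : T -> R[i]) (u : S -> T) :
  cmeas f -> measurable_fun setT u -> cmeas (fun x => f (u x)).
Proof. by move=> [f1 f2] mu; split; [exact: (measurableT_comp f1)|exact: (measurableT_comp f2)]. Qed.

(** Locked, so that unification does not unfold an integral into its two parts. *)
HB.lock Definition cint {R : realType} d (T : measurableType d)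
    (mu : {measure set T -> \bar R}) (f : T -> R[i]) : R[i] :=
  (\int[mu]_x cRe (f x)) +i* (\int[mu]_x cIm (f x)).

Section complex_integral.
Context {R : realType} {d} {T : measurableType d}.
Variable mu : {measure set T -> \bar R}.
Implicit Types (f g : T -> R[i]) (h : T -> R).
Local Notation cint := (@cint R d T mu).

Definition cintegrable f :=
  cmeas f /\ mu.-integrable setT (fun x => (cabs (f x))%:E).

Lemma le_cintegrable f h : cmeas f -> mu.-integrable setT (fun x => (h x)%:E) ->
  (forall x, cabs (f x) <= h x) -> cintegrable f.
Proof.
move=> mf ih fh; split => //; apply: le_integrable ih => //.
  by apply/measurable_EFinP; exact: measurable_cabs.
move=> x _; rewrite /= lee_fin ger0_norm ?cabs_ge0//.
by rewrite (le_trans (fh x))// ler_norm.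
Qed.

Lemma cintegrable_cabs f : cintegrable f -> mu.-integrable setT (fun x => (cabs (f x))%:E).
Proof. by case. Qed.

Lemma cintegrable_Re f : cintegrable f -> mu.-integrable setT (fun x => (cRe (f x))%:E).
Proof.
move=> [mf]; apply: le_integrable => //.
  by apply/measurable_EFinP; exact: cmeas_Re.
by move=> x _; rewrite /= lee_fin (ger0_norm (cabs_ge0 _)) Re_cabs.
Qed.

Lemma cintegrable_Im f : cintegrable f -> mu.-integrable setT (fun x => (cIm (f x))%:E).
Proof.
move=> [mf]; apply: le_integrable => //.
  by apply/measurable_EFinP; exact: cmeas_Im.
by move=> x _; rewrite /= lee_fin (ger0_norm (cabs_ge0 _)) Im_cabs.
Qed.

Lemma cintegrableD f g : cintegrable f -> cintegrable g -> cintegrable (fun x => f x + g x).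
Proof.
move=> fi gi; apply: (@le_cintegrable _ (fun x => cabs (f x) + cabs (g x))).
- by apply: cmeasD; [case: fi|case: gi].
- under eq_fun do rewrite EFinD.
  by apply: integrableD => //; exact: cintegrable_cabs.
- by move=> x; exact: cabsD.
Qed.

Lemma cintegrableN f : cintegrable f -> cintegrable (fun x => - f x).
Proof.
move=> fi; apply: (@le_cintegrable _ (fun x => cabs (f x))).
- by apply: cmeasN; case: fi.
- exact: cintegrable_cabs.
- by move=> x; rewrite cabsN.
Qed.

Lemma cintegrableB f g : cintegrable f -> cintegrable g -> cintegrable (fun x => f x - g x).
Proof. by move=> fi gi; apply: cintegrableD => //; exact: cintegrableN. Qed.

Lemma cintegrableJ f : cintegrable f -> cintegrable (fun x => (f x)^*).
Proof.
move=> fi; apply: (@le_cintegrable _ (fun x => cabs (f x))).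
- by apply: cmeasJ; case: fi.
- exact: cintegrable_cabs.
- by move=> x; rewrite cabsJ.
Qed.

Lemma cintegrableZl c f : cintegrable f -> cintegrable (fun x => c * f x).
Proof.
move=> fi; apply: (@le_cintegrable _ (fun x => cabs c * cabs (f x))).
- by apply: cmeasM; [exact: cmeas_cst|case: fi].
- under eq_fun do rewrite EFinM.
  by apply: integrableZl => //; exact: cintegrable_cabs.
- by move=> x; rewrite cabsM.
Qed.

Lemma eq_cint f g : f =1 g -> cint f = cint g.
Proof. by move=> /funext ->. Qed.

Lemma Re_cint f : cRe (cint f) = \int[mu]_x cRe (f x). Proof. by rewrite unlock. Qed.
Lemma Im_cint f : cIm (cint f) = \int[mu]_x cIm (f x). Proof. by rewrite unlock. Qed.

Lemma cintD f g : cintegrable f -> cintegrable g ->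
  cint (fun x => f x + g x) = cint f + cint g.
Proof.
move=> fi gi; apply: complexP; rewrite !cE !(Re_cint, Im_cint).
  under eq_Rintegral do rewrite cReD.
  by rewrite RintegralD//; exact: cintegrable_Re.
under eq_Rintegral do rewrite cImD.
by rewrite RintegralD//; exact: cintegrable_Im.
Qed.

Lemma RintegralN h : \int[mu]_x (- h x) = - \int[mu]_x h x :> R.
Proof.
rewrite /Rintegral.
have -> : (fun x => (- h x)%:E) = (\- (fun x => (h x)%:E))%E by [].
rewrite integralE [in RHS]integralE funeposN funenegN.
set A : \bar R := (\int[mu]_x _)%E; set B : \bar R := (\int[mu]_x _)%E.
have : (0 <= A)%E by exact: integral_ge0.
have : (0 <= B)%E by exact: integral_ge0.
by case: A B => [r| |] [s| |] //= _ _; rewrite ?oppr0 ?opprB.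
Qed.

Lemma cintN f : cint (fun x => - f x) = - cint f.
Proof.
apply: complexP; rewrite !cE !(Re_cint, Im_cint).
  by under eq_Rintegral do rewrite cReN; exact: RintegralN.
by under eq_Rintegral do rewrite cImN; exact: RintegralN.
Qed.

Lemma cintB f g : cintegrable f -> cintegrable g ->
  cint (fun x => f x - g x) = cint f - cint g.
Proof. by move=> fi gi; rewrite cintD ?cintN//; exact: cintegrableN. Qed.

Lemma cintJ f : cint (fun x => (f x)^*) = (cint f)^*.
Proof.
apply: complexP; rewrite !cE !(Re_cint, Im_cint).
  by under eq_Rintegral do rewrite cReJ.
by under eq_Rintegral do rewrite cImJ; exact: RintegralN.
Qed.

Lemma cintZl c f : cintegrable f -> cint (fun x => c * f x) = c * cint f.
Proof.
move=> fi; have fRe := cintegrable_Re fi; have fIm := cintegrable_Im fi.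
have iZ k h : mu.-integrable setT (fun x => (h x)%:E) ->
    mu.-integrable setT (fun x => (k * h x)%:E).
  by move=> ih; under eq_fun do rewrite EFinM; exact: integrableZl.
apply: complexP; rewrite !cE !(Re_cint, Im_cint).
  under eq_Rintegral do rewrite cReM.
  by rewrite RintegralB ?RintegralZl//; exact: iZ.
under eq_Rintegral do rewrite cImM.
by rewrite RintegralD ?RintegralZl//; exact: iZ.
Qed.

Lemma cintZr c f : cintegrable f -> cint (fun x => f x * c) = cint f * c.
Proof. by move=> fi; rewrite mulrC -cintZl//; apply: eq_cint => x; rewrite mulrC. Qed.

Lemma cintC h : cint (fun x => (h x)%:C) = (\int[mu]_x h x)%:C.
Proof.
apply: complexP; rewrite (Re_cint, Im_cint) ?cE//.
by rewrite /Rintegral integral0.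
Qed.

(** Rotating the integral to the positive axis reduces the triangle inequality
    to the monotonicity of the real integral. *)
Lemma cabs_cint f : cintegrable f -> cabs (cint f) <= \int[mu]_x cabs (f x).
Proof.
move=> fi; have [->|c0] := eqVneq (cint f) 0.
  by rewrite cabs0; apply: Rintegral_ge0 => x _; exact: cabs_ge0.
rewrite -(ler_pM2l (_ : 0 < cabs (cint f))) ?cabs_gt0// -expr2.
have -> : cabs (cint f) ^+ 2 = \int[mu]_x cRe ((cint f)^* * f x).
  by rewrite -Re_cint cintZl// mulrC mulJ cReC.
rewrite -RintegralZl//; last exact: cintegrable_cabs.
apply: le_Rintegral => //.
- by apply: cintegrable_Re; exact: cintegrableZl.
- have -> : EFin \o (fun x => cabs (cint f) * cabs (f x)) =
      (fun x => (cabs (cint f))%:E * (cabs (f x))%:E)%E by [].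
  by apply: integrableZl => //; exact: cintegrable_cabs.
- move=> x _; rewrite (le_trans (ler_norm _))// (le_trans (Re_cabs _))//.
  by rewrite cabsM cabsJ.
Qed.

End complex_integral.
Arguments cint {R d T} mu f.
Arguments cintegrable {R d T} mu f.

Section real_integral.
Context {R : realType} {d} {T : measurableType d}.
Variable mu : {measure set T -> \bar R}.
Implicit Types (f g h : T -> R).

Lemma Rintegral_EFin f : mu.-integrable setT (fun x => (f x)%:E) ->
  (\int[mu]_x f x)%:E = (\int[mu]_x (f x)%:E)%E.
Proof. by move=> fi; rewrite /Rintegral fineK//; exact: integrable_fin_num. Qed.

Lemma Rdct (f_ : nat -> T -> R) f g :
  (forall n, measurable_fun setT (f_ n)) -> measurable_fun setT f ->
  (forall x, f_ n x @[n --> \oo] --> f x) ->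
  mu.-integrable setT (fun x => (g x)%:E) ->
  (forall n x, `|f_ n x| <= g x) ->
  \int[mu]_x f_ n x @[n --> \oo] --> \int[mu]_x f x.
Proof.
move=> mf_ mf cf ig fg.
have [] := @dominated_convergence _ _ _ mu setT measurableT
  (fun n x => (f_ n x)%:E) (fun x => (f x)%:E) (fun x => (g x)%:E).
- by move=> n; exact/measurable_EFinP.
- exact/measurable_EFinP.
- by apply: aeW => x _; apply/fine_cvgP; split; [exact: nearW|exact: cf].
- exact: ig.
- by apply: aeW => x n _; rewrite /= lee_fin.
by move=> fi _ h; apply: fine_cvg; rewrite Rintegral_EFin.
Qed.

Lemma cdct (f_ : nat -> T -> R[i]) (f : T -> R[i]) g :
  (forall n, cmeas (f_ n)) -> cmeas f ->
  (forall x, cabs (f_ n x - f x) @[n --> \oo] --> 0) ->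
  mu.-integrable setT (fun x => (g x)%:E) ->
  (forall n x, cabs (f_ n x) <= g x) -> (forall x, cabs (f x) <= g x) ->
  cabs (cint mu (f_ n) - cint mu f) @[n --> \oo] --> 0.
Proof.
move=> mf_ mf cf ig fg fg0.
have fi_ n : cintegrable mu (f_ n) by exact: le_cintegrable (fg n).
have fi : cintegrable mu f by exact: le_cintegrable fg0.
apply: (@squeeze_cvgr _ _ _ _ (fun=> 0) (fun n => \int[mu]_x cabs (f_ n x - f x))).
- apply: nearW => n; rewrite cabs_ge0 /= -cintB//.
  by apply: cabs_cint; exact: cintegrableB.
- exact: cvg_cst.
have -> : 0 = \int[mu]_(x in setT) (0 : R) by rewrite /Rintegral integral0.
apply: (@Rdct _ _ (fun x => 2 * g x)) => //.
- by move=> n; apply: measurable_cabs; exact: cmeasB.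
- by under eq_fun do rewrite EFinM; exact: integrableZl.
- move=> n x; rewrite ger0_norm ?cabs_ge0// (le_trans (cabsB _ _))//.
  by have := fg n x; have := fg0 x; lra.
Qed.

End real_integral.

(** * Measures with a density, and Fubini's theorem *)

Section density_measure.
Local Open Scope ereal_scope.
Context {R : realType} {d} {T : measurableType d}.
Variable mu : {sigma_finite_measure set T -> \bar R}.
Variables (f : T -> R) (mf : measurable_fun setT f) (f0 : forall x, (0 <= f x)%R).

Definition dens of measurable_fun setT f & (forall x, (0 <= f x)%R) :
    set T -> \bar R :=
  fun V => \int[mu]_(x in V) (f x)%:E.

Local Notation nu := (dens mf f0).

Let nu0 : nu set0 = 0.
Proof. by rewrite /dens integral_set0. Qed.

Let nu_ge0 A : 0 <= nu A.
Proof. by apply: integral_ge0 => x _; rewrite lee_fin. Qed.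

Let nu_sigma_additive : semi_sigma_additive nu.
Proof.
move=> A mA tA mUA; rewrite /dens ge0_integral_bigcup//.
- apply: is_cvg_ereal_nneg_natsum_cond => n _ _.
  by apply: integral_ge0 => x _; rewrite lee_fin.
- by apply/measurable_funTS; exact/measurable_EFinP.
- by move=> x _; rewrite lee_fin.
Qed.

HB.instance Definition _ := isMeasure.Build _ _ _ nu nu0 nu_ge0 nu_sigma_additive.

Let nu_sigma_finite : sigma_finite setT nu.
Proof.
have [F UF mF] := sigma_finiteT mu.
pose G n := (\big[setU/set0]_(i < n.+1) F i) `&` [set x | (f x <= n%:R)%R].
have mG n : measurable (G n).
  apply: measurableI; first by apply: bigsetU_measurable => i _; case: (mF i).
  have -> : [set x | (f x <= n%:R)%R] = setT `&` f @^-1` `]-oo, n%:R].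
    by rewrite setTI; apply/seteqP; split => x /=; rewrite in_itv.
  exact: mf.
exists G.
  apply/esym/seteqP; split => // x _.
  have [i _ Fix] : (\bigcup_i F i) x by rewrite -UF.
  exists (maxn i (Num.truncn (f x)).+1) => //; split.
    rewrite -bigcup_mkord; exists i => //=; exact: leq_maxl.
  rewrite /= (@le_trans _ _ (Num.truncn (f x)).+1%:R)//.
    exact/ltW/truncnS_gt.
  by rewrite ler_nat leq_maxr.
move=> n; split; first exact: mG.
apply: (@le_lt_trans _ _ (\int[mu]_(x in G n) n%:R%:E)).
  apply: ge0_le_integral => //.
  - by move=> x _; rewrite lee_fin.
  - by apply/measurable_funTS; exact/measurable_EFinP.
  - by move=> x [_ h]; rewrite lee_fin.
rewrite integral_cst//.
rewrite lte_mul_pinfty ?lee_fin//.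
apply: (@le_lt_trans _ _ (mu (\big[setU/set0]_(i < n.+1) F i))).
  apply: le_measure; rewrite ?inE//; last exact: subIsetl.
  by apply: bigsetU_measurable => i _; case: (mF i).
elim: n.+1 => [|m ih]; first by rewrite big_ord0 measure0.
rewrite big_ord_recr/=; apply: (@le_lt_trans _ _ (mu (\big[setU/set0]_(i < m) F i) + mu (F m))).
  apply: measureU2; last by case: (mF m).
  by apply: bigsetU_measurable => i _; case: (mF i).
by apply: lte_add_pinfty => //; case: (mF m).
Qed.

HB.instance Definition _ := @Measure_isSigmaFinite.Build _ _ _ nu nu_sigma_finite.

Import HBNNSimple.

Lemma ge0_integral_dens (g : T -> \bar R) : (forall x, 0 <= g x) ->
  measurable_fun setT g -> \int[nu]_x g x = \int[mu]_x (g x * (f x)%:E).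
Proof.
move=> g0 mg; pose h := nnsfun_approx measurableT mg.
have mfE : measurable_fun setT (fun x => (f x)%:E) by exact/measurable_EFinP.
have -> : \int[nu]_x g x = lim (\int[nu]_x (EFin \o h n) x @[n --> \oo]).
  have gE x : g x = lim ((EFin \o h n) x @[n --> \oo]).
    by apply/esym/cvg_lim => //; exact: cvg_nnsfun_approx.
  under eq_integral => x _ do rewrite gE.
  apply: monotone_convergence => //.
  - by move=> n; exact/measurable_EFinP.
  - by move=> n x _ /=; rewrite lee_fin.
  - by move=> x _ a b ab; rewrite lee_fin; exact/lefP/nd_nnsfun_approx.
have -> : \int[mu]_x (g x * (f x)%:E) =
    lim (\int[mu]_x ((EFin \o h n) x * (f x)%:E) @[n --> \oo]).
  have gE x : g x * (f x)%:E = lim ((EFin \o h n) x * (f x)%:E @[n --> \oo]).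
    apply/esym/cvg_lim => //; apply: cvgeZr => //.
    exact: cvg_nnsfun_approx.
  under eq_integral => x _ do rewrite gE.
  apply: monotone_convergence => //.
  - by move=> n; apply: emeasurable_funM => //; exact/measurable_EFinP.
  - by move=> n x _ /=; rewrite mule_ge0 ?lee_fin.
  - move=> x _ a b ab; rewrite lee_wpmul2r ?lee_fin//.
    exact/lefP/nd_nnsfun_approx.
suff suf n : \int[nu]_x (EFin \o h n) x = \int[mu]_x ((EFin \o h n) x * (f x)%:E).
  by under eq_fun do rewrite suf.
transitivity (\int[nu]_x
   (\sum_(y \in range (h n)) (y * \1_(h n @^-1` [set y]) x)%:E)).
  by apply: eq_integral => t tE; rewrite /= fimfunE -fsumEFin.
have indich r : measurable_fun setT (fun x => (r * \1_(h n @^-1` [set r]) x)%:E).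
  by apply/measurable_EFinP; exact: measurable_funM.
rewrite ge0_integral_fsum//; last by move=> m y Ey; exact: nnfun_muleindic_ge0.
transitivity (\int[mu]_x (\sum_(y \in range (h n))
    (y * \1_(h n @^-1` [set y]) x)%:E * (f x)%:E)); last first.
  apply: eq_integral => x xE.
  rewrite -ge0_mule_fsuml => [|y]; last exact: nnfun_muleindic_ge0.
  by rewrite fsumEFin // -(fimfunE _ x).
rewrite ge0_integral_fsum//; last 2 first.
  - by move=> y; exact: emeasurable_funM.
  - by move=> m y Ey; rewrite mule_ge0 ?lee_fin// -lee_fin nnfun_muleindic_ge0.
apply: eq_fsbigr => r rhn.
under eq_integral do rewrite EFinM.
rewrite integralZl_indic_nnsfun => //.
under [RHS]eq_integral do rewrite EFinM -muleA.
rewrite ge0_integralZl//.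
- under [in RHS]eq_integral do rewrite muleC.
  rewrite [in RHS](eq_integral ((fun x => (f x)%:E) \_ (h n @^-1` [set r]))); last first.
    by move=> x xE; rewrite epatch_indic.
  by rewrite -integral_mkcond integral_indic//= setIT.
- by apply: emeasurable_funM => //; exact/measurable_EFinP.
- by move=> t Et; rewrite mule_ge0 ?lee_fin.
- by move: rhn; rewrite inE => -[t _ <-]; rewrite lee_fin.
Qed.

Lemma integrable_dens (g : T -> R) : measurable_fun setT g ->
  mu.-integrable setT (fun x => (g x * f x)%:E) ->
  nu.-integrable setT (fun x => (g x)%:E).
Proof.
move=> mg /integrableP[_ h]; apply/integrableP; split; first exact/measurable_EFinP.
rewrite ge0_integral_dens//; last by do 2 apply: measurableT_comp => //.
apply: le_lt_trans h; rewrite le_eqVlt; apply/orP; left; apply/eqP.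
by apply: eq_integral => x _; rewrite /= normrM (ger0_norm (f0 x)).
Qed.

Lemma Rintegral_dens (g : T -> R) : measurable_fun setT g ->
  (\int[nu]_x g x = \int[mu]_x (g x * f x))%R.
Proof.
move=> mg; rewrite /Rintegral; congr fine.
rewrite integralE [in RHS]integralE; congr (_ - _).
- rewrite ge0_integral_dens//; last first.
    by apply: measurable_funepos; exact/measurable_EFinP.
  apply: eq_integral => x _; rewrite !funeposE EFinM.
  by rewrite maxe_pMl ?lee_fin// mul0e.
- rewrite ge0_integral_dens//; last first.
    by apply: measurable_funeneg; exact/measurable_EFinP.
  apply: eq_integral => x _; rewrite !funenegE EFinM.
  by rewrite maxe_pMl ?lee_fin// mul0e mulNe.
Qed.

Lemma integrable_densP (g : T -> R) : measurable_fun setT g ->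
  nu.-integrable setT (fun x => (g x)%:E) ->
  mu.-integrable setT (fun x => (g x * f x)%:E).
Proof.
move=> mg /integrableP[_ h]; apply/integrableP; split.
  by apply/measurable_EFinP; exact: measurable_funM.
apply: le_lt_trans h; rewrite ge0_integral_dens//; last first.
  by do 2 apply: measurableT_comp => //.
rewrite le_eqVlt; apply/orP; left; apply/eqP; apply/esym.
by apply: eq_integral => x _; rewrite /= normrM (ger0_norm (f0 x)).
Qed.

End density_measure.

Section fubini.
Context {R : realType} {d1 d2} {T1 : measurableType d1} {T2 : measurableType d2}.
Variables (m1 : {sigma_finite_measure set T1 -> \bar R}).
Variables (m2 : {sigma_finite_measure set T2 -> \bar R}).

Lemma measurable_Rintegral1 (f : T1 * T2 -> R) : measurable_fun setT f ->
  measurable_fun setT (fun x => \int[m2]_y f (x, y)).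
Proof.
move=> mf; rewrite /Rintegral.
have mfE : measurable_fun setT (fun z => (f z)%:E) by exact/measurable_EFinP.
pose F (g : T1 * T2 -> \bar R) x := (\int[m2]_y g (x, y))%E.
have -> : (fun x => fine (\int[m2]_y (f (x, y))%:E)) =
    fine \o (F (fun z => (f z)%:E)^\+%E \- F (fun z => (f z)%:E)^\-%E)%E.
  apply/funext => x /=; rewrite integralE; congr (fine (_ - _)).
    by apply: eq_integral => y _; rewrite !funeposE.
  by apply: eq_integral => y _; rewrite !funenegE.
apply: measurableT_comp => //; apply: emeasurable_funB.
  by apply: measurable_fun_fubini_tonelli_F => //; exact: measurable_funepos.
by apply: measurable_fun_fubini_tonelli_F => //; exact: measurable_funeneg.
Qed.

Lemma Rfubini (f : T1 * T2 -> R) :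
  (m1 \x m2)%E.-integrable setT (fun z => (f z)%:E) ->
  \int[m1]_x \int[m2]_y f (x, y) = \int[m2]_y \int[m1]_x f (x, y).
Proof.
move=> fi; rewrite /Rintegral; congr fine.
have h1 : (\int[m1]_x (fine (\int[m2]_y (f (x, y))%:E))%:E =
    \int[m1]_x \int[m2]_y (f (x, y))%:E)%E.
  have mF := measurable_fubini_F fi.
  apply: ae_eq_integral => //.
    by apply/measurable_EFinP; exact: measurableT_comp.
  have := ae_integrable1 fi; apply: filterS => x /= ix _.
  by rewrite fineK//; exact: integrable_fin_num.
have h2 : (\int[m2]_y (fine (\int[m1]_x (f (x, y))%:E))%:E =
    \int[m2]_y \int[m1]_x (f (x, y))%:E)%E.
  have mG := measurable_fubini_G fi.
  apply: ae_eq_integral => //.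
    by apply/measurable_EFinP; exact: measurableT_comp.
  have := ae_integrable2 fi; apply: filterS => x /= ix _.
  by rewrite fineK//; exact: integrable_fin_num.
by rewrite h1 h2; exact: (Fubini fi).
Qed.

Lemma Rintegral_prod (f : T1 * T2 -> R) :
  (m1 \x m2)%E.-integrable setT (fun z => (f z)%:E) ->
  \int[(m1 \x m2)%E]_z f z = \int[m2]_y \int[m1]_x f (x, y).
Proof.
move=> fi; rewrite /Rintegral; congr fine.
have mG := measurable_fubini_G fi.
have -> : (\int[m2]_y (fine (\int[m1]_x (f (x, y))%:E))%:E =
    \int[m2]_y \int[m1]_x (f (x, y))%:E)%E.
  apply: ae_eq_integral => //.
    by apply/measurable_EFinP; exact: measurableT_comp.
  have := ae_integrable2 fi; apply: filterS => x /= ix _.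
  by rewrite fineK//; exact: integrable_fin_num.
exact/esym/integral21_prod_meas1.
Qed.

Lemma integrable_prod (e : T1 -> R) (q : T2 -> R) :
  (forall x, 0 <= e x) -> (forall y, 0 <= q y) ->
  m1.-integrable setT (fun x => (e x)%:E) -> m2.-integrable setT (fun y => (q y)%:E) ->
  (m1 \x m2)%E.-integrable setT (fun z => (e z.1 * q z.2)%:E).
Proof.
move=> e0 q0 ie iq.
have me : measurable_fun setT e by exact/measurable_EFinP/(measurable_int _ ie).
have mq : measurable_fun setT q by exact/measurable_EFinP/(measurable_int _ iq).
apply/integrable12ltyP.
  apply/measurable_EFinP; apply: measurable_funM.
    exact: (measurableT_comp me measurable_fst).
  exact: (measurableT_comp mq measurable_snd).
have -> : (\int[m1]_x \int[m2]_y `|(e (x, y).1 * q (x, y).2)%:E| =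
    \int[m1]_x ((e x)%:E * \int[m2]_y (q y)%:E))%E.
  apply: eq_integral => x _; rewrite -ge0_integralZl//=; last 3 first.
  - exact/measurable_EFinP.
  - by move=> y _; rewrite lee_fin.
  - by rewrite lee_fin.
  by apply: eq_integral => y _; rewrite ger0_norm// mulr_ge0.
rewrite ge0_integralZr//; last 3 first.
- exact/measurable_EFinP.
- by move=> x _; rewrite lee_fin.
- by apply: integral_ge0 => y _; rewrite lee_fin.
have iq1 := integrable_fin_num measurableT iq.
have ie1 := integrable_fin_num measurableT ie.
by rewrite -(fineK iq1) -(fineK ie1) -EFinM ltry.
Qed.

Lemma cintegrable_prod (f : T1 * T2 -> R[i]) (e : T1 -> R) (q : T2 -> R) :
  cmeas f -> (forall x, 0 <= e x) -> (forall y, 0 <= q y) ->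
  m1.-integrable setT (fun x => (e x)%:E) -> m2.-integrable setT (fun y => (q y)%:E) ->
  (forall x y, cabs (f (x, y)) <= e x * q y) ->
  cintegrable (m1 \x m2)%E f.
Proof.
move=> mf e0 q0 ie iq feq.
apply: (le_cintegrable mf (integrable_prod e0 q0 ie iq)).
by move=> [x y]; exact: feq.
Qed.

Lemma cmeas_cint1 (f : T1 * T2 -> R[i]) : cmeas f ->
  cmeas (fun x => cint m2 (fun y => f (x, y))).
Proof.
move=> [f1 f2]; split.
  by under eq_fun do rewrite Re_cint; exact: (measurable_Rintegral1 (f := fun z => cRe (f z))).
by under eq_fun do rewrite Im_cint; exact: (measurable_Rintegral1 (f := fun z => cIm (f z))).
Qed.

Lemma cint_fubini (f : T1 * T2 -> R[i]) : cintegrable (m1 \x m2)%E f ->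
  cint m1 (fun x => cint m2 (fun y => f (x, y))) =
  cint m2 (fun y => cint m1 (fun x => f (x, y))).
Proof.
move=> fi; apply: complexP; rewrite !(Re_cint, Im_cint).
  under eq_Rintegral do rewrite Re_cint.
  under [RHS]eq_Rintegral do rewrite Re_cint.
  by apply: (Rfubini (f := fun z => cRe (f z))); exact: cintegrable_Re.
under eq_Rintegral do rewrite Im_cint.
under [RHS]eq_Rintegral do rewrite Im_cint.
by apply: (Rfubini (f := fun z => cIm (f z))); exact: cintegrable_Im.
Qed.

End fubini.

Lemma cmeas_cint2 {R : realType} {d1 d2} {T1 : measurableType d1}
    {T2 : measurableType d2} (m1 : {sigma_finite_measure set T1 -> \bar R})
    (f : T1 * T2 -> R[i]) : cmeas f ->
  cmeas (fun y => cint m1 (fun x => f (x, y))).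
Proof.
move=> mf; apply: (@cmeas_cint1 _ _ _ _ _ m1 (fun z => f (z.2, z.1))).
apply: (cmeas_comp (u := fun z : T2 * T1 => (z.2, z.1))) => //.
exact: measurable_swap.
Qed.

(** * Calculus *)

Section calculus.
Context {R : realType}.
Implicit Types (f g F : R -> R) (x t : R).
Local Notation leb := (@lebesgue_measure R).

Lemma is_derive_continuous f x l : is_derive x 1 f l -> {for x, continuous f}.
Proof. by move=> [df _]; exact/differentiable_continuous/derivable1_diffP. Qed.

Lemma FTC_itv f F (a b : R) : a < b ->
  (forall x, a <= x <= b -> is_derive x 1 F (f x)) ->
  (forall x, a <= x <= b -> {for x, continuous f}) ->
  (\int[leb]_(x in `[a, b]) (f x)%:E)%E = (F b - F a)%:E.
Proof.
move=> ab dF cf; rewrite (@continuous_FTC2 _ f F)//.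
- by apply: continuous_in_subspaceT => x /[!inE]/= /[!in_itv]/=; exact: cf.
- have dFx x : a <= x <= b -> {for x, continuous F}.
    by move=> axb; exact/is_derive_continuous/dF.
  split.
  + move=> x; rewrite in_itv/= => /andP[ax xb].
    by apply: ex_derive; apply/dF; rewrite !ltW.
  + by apply: cvg_at_right_filter; apply: dFx; rewrite lexx ltW.
  + by apply: cvg_at_left_filter; apply: dFx; rewrite lexx ltW.
- move=> x; rewrite in_itv/= => /andP[ax xb].
  by rewrite derive1E; apply: derive_val; apply: dF; rewrite !ltW.
Qed.

(** Only the limits of the antiderivative at the two ends matter, so that improper
    integrals and singular end points are covered: dominated convergence passes from
    the intervals [a n, b n] to their union. *)
Lemma improper_FTC (D : set R) f F (a b : nat -> R) (l0 l1 : R) :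
  measurable D -> (forall n, a n < b n) ->
  (forall n x, a n <= x <= b n -> D x) ->
  (forall x, D x -> \forall n \near \oo, a n <= x <= b n) ->
  (forall x, D x -> is_derive x 1 F (f x)) ->
  (forall x, D x -> {for x, continuous f}) ->
  leb.-integrable D (fun x => (f x)%:E) ->
  F (a n) @[n --> \oo] --> l0 -> F (b n) @[n --> \oo] --> l1 ->
  \int[leb]_(x in D) f x = l1 - l0.
Proof.
move=> mD ab abD Dab dF cf fi Fa Fb.
have FTC n : \int[leb]_(x in `[a n, b n]) f x = F (b n) - F (a n).
  transitivity (fine (F (b n) - F (a n))%:E) => //; congr fine.
  by apply: FTC_itv => // x axb; [exact/dF/(abD n)|exact/cf/(abD n)].
have mf : measurable_fun D f by move/measurable_int: (fi) => /measurable_EFinP.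
pose fn n := f \_ `[a n, b n].
have fnD : \int[leb]_x (f \_ D) x = \int[leb]_(x in D) f x.
  by rewrite [RHS]Rintegral_mkcond.
have h : \int[leb]_x fn n x @[n --> \oo] --> \int[leb]_x (f \_ D) x.
  apply: (@Rdct R _ _ leb fn (f \_ D) (fun x => `|(f \_ D) x|)).
  - move=> n; apply/(measurable_restrictT _ _).1 => //.
    by apply: measurable_funS mf => // x /=; rewrite in_itv; exact: abD.
  - by apply/(measurable_restrictT _ _).1.
  - move=> x; have [Dx|Dx] := pselect (D x); last first.
      rewrite /patch memNset//; apply: cvg_near_cst; apply: nearW => n.
      rewrite /fn /patch memNset// => /=; rewrite in_itv => axb.
      exact/Dx/(abD n).
    apply: cvg_near_cst; have := Dab x Dx; apply: filterS => n axb.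
    by rewrite /fn /patch !mem_set//= in_itv.
  - have /integrable_abse : leb.-integrable setT ((fun x => (f x)%:E) \_ D).
      by rewrite -integrable_mkcond.
    apply: eq_integrable => // x _ /=.
    by rewrite /patch; case: ifPn.
  - move=> n x; rewrite /fn /patch; case: ifPn => [|_]; last by rewrite normr0.
    by rewrite inE/= in_itv => /(abD n) Dx; rewrite mem_set.
apply/esym/(@cvg_unique R^o _ (F (b n) - F (a n) @[n --> \oo])) => //.
  exact: cvgB.
rewrite -fnD; have -> : (fun n => F (b n) - F (a n)) = (fun n => \int[leb]_x fn n x) => //.
by apply/funext => n; rewrite -FTC [LHS]Rintegral_mkcond.
Qed.

(** For a nonnegative integrand integrability is a conclusion, by monotone convergence. *)
Lemma ge0_improper_FTC (D : set R) f F (a b : nat -> R) (l0 l1 : R) :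
  measurable D -> (forall n, a n < b n) ->
  (forall m n x, (m <= n)%N -> a m <= x <= b m -> a n <= x <= b n) ->
  (forall n x, a n <= x <= b n -> D x) ->
  (forall x, D x -> \forall n \near \oo, a n <= x <= b n) ->
  (forall x, D x -> is_derive x 1 F (f x)) ->
  (forall x, D x -> {for x, continuous f}) ->
  (forall x, D x -> 0 <= f x) ->
  F (a n) @[n --> \oo] --> l0 -> F (b n) @[n --> \oo] --> l1 ->
  (\int[leb]_(x in D) (f x)%:E = (l1 - l0)%:E)%E.
Proof.
move=> mD ab nd abD Dab dF cf f0 Fa Fb.
have FTC n : (\int[leb]_(x in `[a n, b n]) (f x)%:E)%E = (F (b n) - F (a n))%:E.
  by apply: FTC_itv => // x axb; [exact/dF/(abD n)|exact/cf/(abD n)].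
have DE : D = \bigcup_n [set` `[a n, b n]].
  apply/seteqP; split => x.
    by move=> /Dab[N _ h]; exists N => //=; rewrite in_itv/=; exact: (h N (leqnn N)).
  by move=> [n _ /=]; rewrite in_itv; exact: abD.
apply/esym/(@cvg_unique _ _ ((F (b n) - F (a n))%:E @[n --> \oo])) => //.
  by apply: cvg_EFin; [exact: nearW|exact: cvgB].
have -> : (fun n => (F (b n) - F (a n))%:E) =
    (fun n => \int[leb]_(x in `[a n, b n]) (f x)%:E)%E by apply/funext => n; rewrite FTC.
rewrite /= {1}DE; apply: ge0_nondecreasing_set_cvg_integral => //.
- move=> m n mn; apply/subsetPset => x /=; rewrite !in_itv; exact: nd.
- move=> n; apply/measurable_EFinP; apply: subspace_continuous_measurable_fun => //.
  apply: continuous_in_subspaceT => x /[!inE]/= /[!in_itv]/= axb.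
  exact/cf/(abD n).
- by move=> n x /=; rewrite in_itv => /(abD n) Dx; rewrite lee_fin f0.
Qed.

End calculus.

Section pointwise_derivatives.
Context {R : realType}.
Implicit Types (f g : R -> R) (x a b : R).

Lemma rderive_eq f x a b : is_derive x 1 f a -> a = b -> is_derive x 1 f b.
Proof. by move=> h <-. Qed.

Lemma rderiveD f g x a b : is_derive x 1 f a -> is_derive x 1 g b ->
  is_derive x 1 (fun y => f y + g y) (a + b).
Proof. exact: is_deriveD. Qed.

Lemma rderiveN f x a : is_derive x 1 f a -> is_derive x 1 (fun y => - f y) (- a).
Proof. exact: is_deriveN. Qed.

Lemma rderiveB f g x a b : is_derive x 1 f a -> is_derive x 1 g b ->
  is_derive x 1 (fun y => f y - g y) (a - b).
Proof. exact: is_deriveB. Qed.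

Lemma rderiveM f g x a b : is_derive x 1 f a -> is_derive x 1 g b ->
  is_derive x 1 (fun y => f y * g y) (a * g x + f x * b).
Proof.
move=> fa gb; apply: (rderive_eq (is_deriveM fa gb)).
by rewrite addrC [_ *: _]mulrC.
Qed.

Lemma rderive_cst x a : is_derive x 1 (fun=> a) 0.
Proof. exact: is_derive_cst. Qed.

Lemma rderive_id x : is_derive x 1 (fun y => y) 1.
Proof. exact: is_derive_id. Qed.

Lemma rderiveZ f x a k : is_derive x 1 f a -> is_derive x 1 (fun y => k * f y) (k * a).
Proof. by move=> fa; apply: (rderive_eq (rderiveM (rderive_cst x k) fa)); rewrite mul0r add0r. Qed.

Lemma rderive_comp f g x a b : is_derive (g x) 1 f a -> is_derive x 1 g b ->
  is_derive x 1 (fun y => f (g y)) (a * b).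
Proof. exact: is_derive1_comp. Qed.

Lemma rderiveV f x a : f x != 0 -> is_derive x 1 f a ->
  is_derive x 1 (fun y => (f y)^-1) (- a / f x ^+ 2).
Proof.
move=> fx fa; apply: (rderive_eq (is_deriveV fx fa)).
by rewrite [_ *: _]mulrC mulrN mulNr.
Qed.

Lemma rderive_sqr f x a : is_derive x 1 f a ->
  is_derive x 1 (fun y => f y ^+ 2) (2 * f x * a).
Proof. by move=> fa; apply: (rderive_eq (rderiveM fa fa)); ring. Qed.

End pointwise_derivatives.

Section complex_derivatives.
Context {R : realType}.
Implicit Types (f g : R -> R[i]) (x t : R) (a b c : R[i]).

Definition is_cderive f t a :=
  is_derive t 1 (fun s => cRe (f s)) (cRe a) /\
  is_derive t 1 (fun s => cIm (f s)) (cIm a).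

Lemma cderive_eq f t a b : is_cderive f t a -> a = b -> is_cderive f t b.
Proof. by move=> h <-. Qed.

Lemma eq_cderive f g t a : f =1 g -> is_cderive f t a -> is_cderive g t a.
Proof. by move=> /funext ->. Qed.

Lemma cderive_cst t c : is_cderive (fun=> c) t 0.
Proof. by split; exact: rderive_cst. Qed.

Lemma cderiveC (h : R -> R) t l : is_derive t 1 h l -> is_cderive (fun s => (h s)%:C) t l%:C.
Proof. by split => //; exact: rderive_cst. Qed.

Lemma cderiveD f g t a b : is_cderive f t a -> is_cderive g t b ->
  is_cderive (fun s => f s + g s) t (a + b).
Proof.
move=> [f1 f2] [g1 g2]; split.
  by under eq_fun do rewrite cReD; rewrite cReD; exact: rderiveD.
by under eq_fun do rewrite cImD; rewrite cImD; exact: rderiveD.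
Qed.

Lemma cderiveN f t a : is_cderive f t a -> is_cderive (fun s => - f s) t (- a).
Proof.
move=> [f1 f2]; split.
  by under eq_fun do rewrite cReN; rewrite cReN; exact: rderiveN.
by under eq_fun do rewrite cImN; rewrite cImN; exact: rderiveN.
Qed.

Lemma cderiveB f g t a b : is_cderive f t a -> is_cderive g t b ->
  is_cderive (fun s => f s - g s) t (a - b).
Proof. by move=> fa gb; apply: cderiveD => //; exact: cderiveN. Qed.

Lemma cderiveM f g t a b : is_cderive f t a -> is_cderive g t b ->
  is_cderive (fun s => f s * g s) t (a * g t + f t * b).
Proof.
move=> [f1 f2] [g1 g2]; split.
  under eq_fun do rewrite cReM.
  by apply: (rderive_eq (rderiveB (rderiveM f1 g1) (rderiveM f2 g2))); rewrite !cE; ring.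
under eq_fun do rewrite cImM.
by apply: (rderive_eq (rderiveD (rderiveM f1 g2) (rderiveM f2 g1))); rewrite !cE; ring.
Qed.

Lemma cderiveZ f t a c : is_cderive f t a -> is_cderive (fun s => c * f s) t (c * a).
Proof. by move=> fa; apply: (cderive_eq (cderiveM (cderive_cst t c) fa)); rewrite mul0r add0r. Qed.

Lemma cderive_expC f t a : is_cderive f t a ->
  is_cderive (fun s => expC (f s)) t (a * expC (f t)).
Proof.
move=> [f1 f2].
have e := rderive_comp (is_derive_expR (cRe (f t))) f1.
split.
  under eq_fun do rewrite Re_expC.
  apply: (rderive_eq (rderiveM e (rderive_comp (is_derive_cos (cIm (f t))) f2))).
  by rewrite cReM Re_expC Im_expC; ring.
under eq_fun do rewrite Im_expC.
apply: (rderive_eq (rderiveM e (rderive_comp (is_derive_sin (cIm (f t))) f2))).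
by rewrite cImM Re_expC Im_expC; ring.
Qed.

Lemma cderive_cabs2 f t a : is_cderive f t a ->
  is_derive t 1 (fun s => cabs (f s) ^+ 2) (2 * cRe (a * (f t)^*)).
Proof.
move=> [f1 f2]; under eq_fun do rewrite cabs_sqr.
apply: (rderive_eq (rderiveD (rderive_sqr f1) (rderive_sqr f2))).
by rewrite !cE; ring.
Qed.

Lemma cderiveV f t a : f t != 0 -> is_cderive f t a ->
  is_cderive (fun s => (f s)^-1) t (- a / f t ^+ 2).
Proof.
move=> ft0 fa; have [f1 f2] := fa.
have n0 : cabs (f t) ^+ 2 != 0 by rewrite expf_eq0 /= cabs_eq0.
have dV := rderiveV (f := fun s => cabs (f s) ^+ 2) n0 (cderive_cabs2 fa).
have e : - a / f t ^+ 2 = - a * ((f t)^* * (f t)^*) * ((cabs (f t) ^+ 2) ^- 2)%:C.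
  have h : ((cabs (f t) ^+ 2) ^+ 2)%:C = f t ^+ 2 * (f t)^* ^+ 2.
    by rewrite CX -mulJ exprMn.
  have J0 : (f t)^* != 0 by rewrite -cabs_eq0 cabsJ cabs_eq0.
  by rewrite CV h; field; rewrite J0 ft0.
have u0 : (cRe (f t) ^+ 2 + cIm (f t) ^+ 2) != 0 by rewrite -cabs_sqr.
split.
  under eq_fun do rewrite cReV.
  apply: (rderive_eq (rderiveM f1 dV)); rewrite e !cE cabs_sqr.
  by field.
under eq_fun do rewrite cImV.
apply: (rderive_eq (rderiveM (rderiveN f2) dV)); rewrite e !cE cabs_sqr.
by field.
Qed.

Lemma cderive_id t : is_cderive (fun s => s%:C) t 1.
Proof. by apply: (@cderiveC (fun s => s)); exact: rderive_id. Qed.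

Lemma cderive_lin (c w : R[i]) t : is_cderive (fun s => c + s%:C * w) t w.
Proof.
apply: (cderive_eq (cderiveD (cderive_cst t c) (cderiveM (cderive_id t) (cderive_cst t w)))).
by rewrite add0r mul1r mulr0 addr0.
Qed.

Lemma cderive_expi (w : R[i]) t :
  is_cderive (fun s => expC (s%:C * w)) t (w * expC (t%:C * w)).
Proof.
apply: (@cderive_expC (fun s => s%:C * w)).
by apply: (eq_cderive _ (cderive_lin 0 w t)) => s; rewrite add0r.
Qed.

End complex_derivatives.

(** * The half-line *)

Section half_line.
Context {R : realType}.
Local Notation leb := (@lebesgue_measure R).

Definition posind (x : R) : R := (0 < x)%R%:R.

Lemma posind_ge0 x : 0 <= posind x. Proof. by rewrite /posind ler0n. Qed.

Lemma measurable_posind : measurable_fun setT posind.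
Proof.
have -> : posind = \1_(`]0, +oo[%classic : set R).
  apply/funext => x; rewrite /posind indicE; congr (_ %:R); congr nat_of_bool.
  apply/idP/idP; first by move=> x0; rewrite inE/= in_itv/= x0.
  by rewrite inE/= in_itv/= andbT.
exact: measurable_indic.
Qed.

(** The half-line is a measure on the whole line, not a domain of integration: so it
    is a factor of the product measures in the applications of Fubini's theorem. *)
Definition hl : {sigma_finite_measure set (measurableTypeR R) -> \bar R} :=
  dens leb measurable_posind posind_ge0.

Lemma patch_posind (g : R -> R) :
  (fun x => (g x * posind x)%:E) = (fun x => (g x)%:E) \_ (`]0, +oo[%classic : set R).
Proof.
apply/funext => x; rewrite /patch /posind; case: ifPn.
  by rewrite inE/= in_itv/= andbT => ->; rewrite mulr1.
by rewrite notin_setE/= in_itv/= andbT => /negP/negbTE ->; rewrite mulr0.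
Qed.

Lemma Rintegral_hl (g : R -> R) : measurable_fun setT g ->
  \int[hl]_x g x = \int[leb]_(x in `]0, +oo[) g x.
Proof.
move=> mg; rewrite Rintegral_dens// /Rintegral patch_posind.
by rewrite [in RHS]integral_mkcond.
Qed.

Lemma integrable_hl (g : R -> R) : measurable_fun setT g ->
  leb.-integrable `]0, +oo[ (fun x => (g x)%:E) <->
  hl.-integrable setT (fun x => (g x)%:E).
Proof.
move=> mg; split => [gi|].
  apply: integrable_dens => //; rewrite patch_posind.
  by rewrite -integrable_mkcond.
by move=> /integrable_densP; rewrite patch_posind -integrable_mkcond//; exact.
Qed.

Lemma le_integral_hl (g h : R -> \bar R) : measurable_fun setT g -> measurable_fun setT h ->
  (forall x, 0 <= g x)%E -> (forall x, 0 <= h x)%E ->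
  (forall x : R, 0 < x -> (g x <= h x)%E) -> (\int[hl]_x g x <= \int[hl]_x h x)%E.
Proof.
have mp : measurable_fun setT (fun x : measurableTypeR R => (posind x)%:E).
  by apply/measurable_EFinP; exact: measurable_posind.
move=> mg mh g0 h0 gh; rewrite !ge0_integral_dens//; apply: ge0_le_integral => //.
- by move=> x _; rewrite mule_ge0 ?lee_fin ?posind_ge0.
- exact: emeasurable_funM.
- exact: emeasurable_funM.
move=> x _; rewrite /posind; case: ltP => [/gh ?|_]; last by rewrite !mule0.
by rewrite lee_wpmul2r.
Qed.

Lemma eq_Rintegral_hl (g h : R -> R) : measurable_fun setT g -> measurable_fun setT h ->
  (forall x : R, 0 < x -> g x = h x) -> \int[hl]_x g x = \int[hl]_x h x.
Proof.
move=> mg mh gh; rewrite !Rintegral_hl//; apply: eq_Rintegral => x.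
by rewrite inE/= in_itv/= andbT; exact: gh.
Qed.

Lemma eq_cint_hl (g h : R -> R[i]) : cmeas g -> cmeas h ->
  (forall x : R, 0 < x -> g x = h x) -> cint hl g = cint hl h.
Proof.
move=> [g1 g2] [h1 h2] gh; apply: complexP; rewrite !(Re_cint, Im_cint).
  by apply: eq_Rintegral_hl => // x x0; rewrite gh.
by apply: eq_Rintegral_hl => // x x0; rewrite gh.
Qed.

Lemma le_integrable_hl (g h : R -> R) : measurable_fun setT g ->
  hl.-integrable setT (fun x => (h x)%:E) ->
  (forall x : R, 0 < x -> `|g x| <= h x) -> hl.-integrable setT (fun x => (g x)%:E).
Proof.
move=> mg ih gh; have mh : measurable_fun setT h.
  by move/measurable_int: (ih) => /measurable_EFinP.
apply/integrable_hl => //; move/integrable_hl: ih => /(_ mh); apply: le_integrable => //.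
  by apply/measurable_EFinP; exact: measurable_funTS.
move=> x; rewrite /= in_itv/= andbT => x0; rewrite lee_fin.
by rewrite (le_trans (gh x x0))// ler_norm.
Qed.

Lemma le_cintegrable_hl (g : R -> R[i]) (h : R -> R) : cmeas g ->
  hl.-integrable setT (fun x => (h x)%:E) ->
  (forall x : R, 0 < x -> cabs (g x) <= h x) -> cintegrable hl g.
Proof.
move=> mg ih gh; split => //; apply: le_integrable_hl ih _.
  exact: measurable_cabs.
by move=> x x0; rewrite ger0_norm ?cabs_ge0// gh.
Qed.

Lemma le_Rintegral_hl (g h : R -> R) :
  hl.-integrable setT (fun x => (g x)%:E) -> hl.-integrable setT (fun x => (h x)%:E) ->
  (forall x : R, 0 < x -> g x <= h x) -> \int[hl]_x g x <= \int[hl]_x h x.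
Proof.
move=> ig ih gh.
have mg : measurable_fun setT g by move/measurable_int: (ig) => /measurable_EFinP.
have mh : measurable_fun setT h by move/measurable_int: (ih) => /measurable_EFinP.
rewrite !Rintegral_hl//; apply: le_Rintegral => //.
- exact/integrable_hl.
- exact/integrable_hl.
- by move=> x; rewrite /= in_itv/= andbT; exact: gh.
Qed.

Let an (n : nat) : R := n.+1%:R^-1.
Let bn (n : nat) : R := n.+2%:R.

Let anbn n : an n < bn n.
Proof. by rewrite /an /bn (@le_lt_trans _ _ 1)// ?ltr1n// invf_le1 ?ler1n ?ltr0n. Qed.

Let anbn0 n x : an n <= x <= bn n -> (`]0, +oo[%classic : set R) x.
Proof.
by move=> /andP[h _]; rewrite /= in_itv/= andbT (lt_le_trans _ h)// invr_gt0 ltr0n.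
Qed.

Let cvg_an : an n @[n --> \oo] --> (0 : R).
Proof. exact: cvg_harmonic. Qed.

Let cvg_bn : bn n @[n --> \oo] --> +oo%R.
Proof.
apply/cvgryPge => M; near=> n; apply: (@le_trans _ _ n%:R).
  by near: n; move/cvgryPge: (@cvgr_idn R); exact.
by rewrite ler_nat; apply: leq_trans (leqnSn _); exact: leqnSn.
Unshelve. all: by end_near. Qed.

Let near_anbn x : (`]0, +oo[%classic : set R) x -> \forall n \near \oo, an n <= x <= bn n.
Proof.
rewrite /= in_itv/= andbT => x0; near=> n; apply/andP; split.
  by near: n; apply: (cvgr_le 0) => //; exact: cvg_an.
by near: n; move/cvgryPge: cvg_bn; apply.
Unshelve. all: by end_near. Qed.

Lemma FTC0y (f F : R -> R) (l0 l1 : R) : measurable_fun setT f ->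
  (forall x : R, 0 < x -> is_derive x 1 F (f x)) ->
  (forall x : R, 0 < x -> {for x, continuous f}) ->
  hl.-integrable setT (fun x => (f x)%:E) ->
  F x @[x --> 0^'+] --> l0 -> F x @[x --> +oo%R] --> l1 ->
  \int[hl]_x f x = l1 - l0.
Proof.
move=> mf dF cf /(integrable_hl mf) fi F0 Fy; rewrite Rintegral_hl//.
apply: (@improper_FTC _ _ _ F an bn) => //.
- by move=> x; rewrite /= in_itv/= andbT; exact: dF.
- by move=> x; rewrite /= in_itv/= andbT; exact: cf.
- by move/cvg_at_rightP : F0; apply; split => // n; rewrite invr_gt0 ltr0n.
- by move/cvg_pinftyP : Fy; exact.
Qed.

Lemma ge0_FTC0y (f F : R -> R) (l0 l1 : R) : measurable_fun setT f ->
  (forall x : R, 0 < x -> is_derive x 1 F (f x)) ->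
  (forall x : R, 0 < x -> {for x, continuous f}) ->
  (forall x : R, 0 < x -> 0 <= f x) ->
  F x @[x --> 0^'+] --> l0 -> F x @[x --> +oo%R] --> l1 ->
  hl.-integrable setT (fun x => (f x)%:E) /\ \int[hl]_x f x = l1 - l0.
Proof.
move=> mf dF cf f0 F0 Fy.
have E : (\int[leb]_(x in `]0%R, +oo[) (f x)%:E = (l1 - l0)%:E)%E.
  apply: (@ge0_improper_FTC _ _ _ F an bn) => //.
  - move=> m n x mn /andP[h1 h2]; apply/andP; split.
      by rewrite (le_trans _ h1)// lef_pV2 ?posrE ?ltr0n// ler_nat.
    by rewrite (le_trans h2)// ler_nat.
  - by move=> x; rewrite /= in_itv/= andbT; exact: dF.
  - by move=> x; rewrite /= in_itv/= andbT; exact: cf.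
  - by move=> x; rewrite /= in_itv/= andbT; exact: f0.
  - by move/cvg_at_rightP : F0; apply; split => // n; rewrite invr_gt0 ltr0n.
  - by move/cvg_pinftyP : Fy; exact.
split; last by rewrite Rintegral_hl// /Rintegral E.
apply/integrable_hl => //; apply/integrableP; split.
  by apply/measurable_EFinP; exact: measurable_funTS.
rewrite (_ : integral _ _ _ = (l1 - l0)%:E) ?ltry// -E.
apply: eq_integral => x; rewrite inE/= in_itv/= andbT => x0.
by rewrite ger0_norm// f0.
Qed.

End half_line.

(** * Special integrals *)

Section limits.
Context {R : realType}.

Lemma cvg_expRN (c : R) : 0 < c -> expR (- (c * x)) @[x --> +oo%R] --> (0 : R).
Proof.
move=> c0; apply/cvgrPdist_le => e e0; near=> x.
rewrite sub0r normrN ger0_norm ?expR_ge0//.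
have x0 : 0 < x by near: x; exact: nbhs_pinfty_gt.
have : (c * e)^-1 <= x by near: x; apply: nbhs_pinfty_ge; rewrite num_real.
rewrite -ler_pV2 ?inE ?unitfE ?gt_eqF ?invr_gt0 ?mulr_gt0// invrK => h.
rewrite expRN (@le_trans _ _ (c * x)^-1)//; last first.
  by rewrite invfM mulrC -ler_pdivlMr ?invr_gt0// invrK mulrC.
rewrite lef_pV2 ?posrE ?expR_gt0 ?mulr_gt0//.
by rewrite (le_trans _ (expR_ge1Dx _))// lerDr.
Unshelve. all: by end_near. Qed.

Lemma cvg_powRy (k : R) : 0 < k -> x `^ k @[x --> +oo%R] --> +oo%R.
Proof.
move=> k0; apply/cvgryPge => A; near=> x.
pose B := Num.max A 1.
have B0 : 0 < B by rewrite lt_max ltr01 orbT.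
have : B `^ k^-1 <= x by near: x; apply: nbhs_pinfty_ge; rewrite num_real.
move=> h; rewrite (@le_trans _ _ B)// ?le_max ?lexx//.
have <- : (B `^ k^-1) `^ k = B by rewrite -powRrM mulVf ?gt_eqF// powRr1// ltW.
by apply: (ge0_ler_powR (ltW k0)) => //; rewrite ?nnegrE ?powR_ge0// (le_trans (powR_ge0 _ _) h).
Unshelve. all: by end_near. Qed.

Lemma cvgM0 (T : Type) (F : set_system T) {FF : Filter F} (f : T -> R) (c : R) :
  f x @[x --> F] --> 0 -> c * f x @[x --> F] --> 0.
Proof. by move=> f0; rewrite -[X in _ --> X](mulr0 c); exact: cvgMr. Qed.

Lemma cvg0_le (T : Type) (F : set_system T) {FF : Filter F} (f g : T -> R) :
  (\forall x \near F, `|f x| <= g x) -> g x @[x --> F] --> 0 -> f x @[x --> F] --> 0.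
Proof.
move=> fg /cvgrPdist_le g0; apply/cvgrPdist_le => e e0.
apply: filterS2 fg (g0 e e0) => x h1; rewrite !sub0r !normrN => h2.
exact: le_trans h1 (le_trans (ler_norm _) h2).
Qed.

Lemma powR_le_expR (p d : R) : 0 <= p -> 0 < d ->
  exists2 C : R, 0 <= C & forall x, 0 < x -> x `^ p <= C * expR (d * x).
Proof.
move=> p0 d0; pose e := d / (p + 1).
have p1 : 0 < p + 1 by rewrite ltr_wpDl.
have e0 : 0 < e by rewrite divr_gt0.
exists (expR (- (p * ln e))); first exact: expR_ge0.
move=> x x0; rewrite /powR gt_eqF// -expRD ler_expR.
have : ln (e * x) <= e * x by rewrite ltW// ln_sublinear// mulr_gt0.
rewrite lnM ?posrE// => h.
have h2 : p * (ln e + ln x) <= p * (e * x) by rewrite ler_wpM2l.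
have h3 : p * (e * x) <= d * x.
  rewrite mulrA ler_pM2r// /e mulrA ler_pdivrMr// mulrC ler_pM2l//.
  by rewrite lerDl.
lra.
Qed.

Lemma cabs_cvg0_Re (T : Type) (F : set_system T) {FF : Filter F} (f : T -> R[i]) (l : R[i]) :
  cabs (f x - l) @[x --> F] --> 0 -> cRe (f x) @[x --> F] --> cRe l.
Proof.
move=> /cvgrPdist_le h; apply/cvgrPdist_le => e e0.
have := h e e0; apply: filterS => x; rewrite sub0r normrN ger0_norm ?cabs_ge0//.
by apply: le_trans; rewrite distrC -cReB Re_cabs.
Qed.

Lemma cabs_cvg0_Im (T : Type) (F : set_system T) {FF : Filter F} (f : T -> R[i]) (l : R[i]) :
  cabs (f x - l) @[x --> F] --> 0 -> cIm (f x) @[x --> F] --> cIm l.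
Proof.
move=> /cvgrPdist_le h; apply/cvgrPdist_le => e e0.
have := h e e0; apply: filterS => x; rewrite sub0r normrN ger0_norm ?cabs_ge0//.
by apply: le_trans; rewrite distrC -cImB Im_cabs.
Qed.

Lemma cderive_continuous (f : R -> R[i]) (x : R) a : is_cderive f x a ->
  cabs (f y - f x) @[y --> x] --> 0.
Proof.
move=> [/is_derive_continuous c1 /is_derive_continuous c2].
apply/cvgrPdist_le => e e0.
have e2 : 0 < e / 2 by rewrite divr_gt0.
move/cvgrPdist_le: c1 => /(_ _ e2) c1; move/cvgrPdist_le: c2 => /(_ _ e2) c2.
near=> y; rewrite sub0r normrN ger0_norm ?cabs_ge0//.
rewrite (le_trans (cabs_le_ReIm _))// cReB cImB [e]splitr lerD//.
  by rewrite distrC; near: y; exact: c1.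
by rewrite distrC; near: y; exact: c2.
Unshelve. all: by end_near. Qed.

End limits.

Section special_integrals.
Context {R : realType}.
Local Notation leb := (@lebesgue_measure R).
Local Notation hl := (@hl R).

Lemma cFTC0y (f F : R -> R[i]) (l0 l1 : R[i]) : cintegrable hl f ->
  (forall x : R, 0 < x -> is_cderive F x (f x)) ->
  (forall x : R, 0 < x -> exists b, is_cderive f x b) ->
  cabs (F x - l0) @[x --> 0^'+] --> 0 -> cabs (F x - l1) @[x --> +oo%R] --> 0 ->
  cint hl f = l1 - l0.
Proof.
move=> fi dF df F0 Fy; have [[m1 m2] _] := fi.
apply: complexP; rewrite !(Re_cint, Im_cint, cReB, cImB).
  apply: (@FTC0y _ _ (fun s => cRe (F s))) => //.
  - by move=> x /dF[].
  - by move=> x /df[b [] /is_derive_continuous].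
  - exact: cintegrable_Re.
  - exact: cabs_cvg0_Re.
  - exact: cabs_cvg0_Re.
apply: (@FTC0y _ _ (fun s => cIm (F s))) => //.
- by move=> x /dF[].
- by move=> x /df[b [_ /is_derive_continuous]].
- exact: cintegrable_Im.
- exact: cabs_cvg0_Im.
- exact: cabs_cvg0_Im.
Qed.

Lemma measurable_expRN (c : R) : measurable_fun setT (fun x : R => expR (- (c * x))).
Proof.
by apply: measurableT_comp => //; apply: measurableT_comp => //; exact: measurable_funM.
Qed.

Lemma rderive_expRN (c x : R) :
  is_derive x 1 (fun x => expR (- (c * x))) (- c * expR (- (c * x))).
Proof.
apply: (rderive_eq (rderive_comp (is_derive_expR _) (rderiveN (rderiveZ c (rderive_id x))))).
ring.
Qed.

Lemma integrable_expRN (c : R) : 0 < c ->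
  hl.-integrable setT (fun x => (expR (- (c * x)))%:E) /\
  \int[hl]_x expR (- (c * x)) = c^-1.
Proof.
move=> c0.
have -> : c^-1 = 0 - (- c^-1 * expR (- (c * 0))) by rewrite mulr0 oppr0 expR0; ring.
apply: (@ge0_FTC0y _ _ (fun x => - c^-1 * expR (- (c * x)))).
- exact: measurable_expRN.
- move=> x x0; apply: (rderive_eq (rderiveZ _ (rderive_expRN c x))).
  by field; rewrite gt_eqF.
- by move=> x _; exact: is_derive_continuous (rderive_expRN c x).
- by move=> x _; exact: expR_ge0.
- apply: cvg_at_right_filter.
  exact: is_derive_continuous (rderiveZ _ (rderive_expRN c 0)).
- by apply: cvgM0; exact: cvg_expRN.
Qed.

Lemma cabs_expi (s : R) (w : R[i]) :
  cabs (expC (s%:C * ('i * w))) = expR (- (cIm w * s)).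
Proof. by rewrite cabs_expC !cE; congr expR; rewrite !(mul0r,mul1r,mulr0,addr0,subr0,sub0r) mulrN mulrC. Qed.

Lemma cmeas_id : cmeas (fun s : R => s%:C).
Proof. by apply: cmeasC; exact: measurable_id. Qed.

Lemma cmeas_expi (w : R[i]) : cmeas (fun s : R => expC (s%:C * w)).
Proof.
apply: (@cmeas_expC _ _ _ (fun s : measurableTypeR R => s%:C * w)).
by apply: cmeasM; [exact: cmeas_id|exact: cmeas_cst].
Qed.

Lemma cint_expi (w : R[i]) : 0 < cIm w ->
  cintegrable hl (fun s => expC (s%:C * ('i * w))) /\
  cint hl (fun s => expC (s%:C * ('i * w))) = 'i / w.
Proof.
move=> w0; have [ie _] := integrable_expRN w0.
have fi : cintegrable hl (fun s => expC (s%:C * ('i * w))).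
  apply: le_cintegrable ie _; first exact: cmeas_expi.
  by move=> s; rewrite cabs_expi.
have wn0 := Im_neq0 w0.
have in0 : 'i != 0 :> R[i] by rewrite -cabs_eq0 cabsi oner_eq0.
split=> //.
have -> : 'i / w = 0 - ('i * w)^-1.
  have : 'i * 'i = -1 :> R[i] by rewrite -expr2 sqr_i.
  move=> h; rewrite sub0r invfM.
  have -> : ('i : R[i])^-1 = - 'i by apply: (mulfI in0); rewrite mulfV// mulrN h opprK.
  ring.
have dE x : is_cderive (fun s => ('i * w)^-1 * expC (s%:C * ('i * w))) x
    (expC (x%:C * ('i * w))).
  apply: (cderive_eq (cderiveZ ('i * w)^-1 (cderive_expi ('i * w) x))).
  by rewrite mulrA mulVf ?mul1r// mulf_neq0.
apply: (@cFTC0y _ (fun s => ('i * w)^-1 * expC (s%:C * ('i * w)))) => //.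
- by move=> x _; eexists; exact: cderive_expi.
- apply: cvg_at_right_filter.
  by have := cderive_continuous (dE 0); rewrite mul0r expC0 mulr1.
- have -> : (fun x => cabs (('i * w)^-1 * expC (x%:C * ('i * w)) - 0)) =
      (fun x => cabs ('i * w)^-1 * expR (- (cIm w * x))).
    by apply/funext => x; rewrite subr0 cabsM cabs_expi.
  by apply: cvgM0; exact: cvg_expRN.
Qed.

Lemma measurable_powRl (p : R) : measurable_fun setT (fun x : R => x `^ p).
Proof. exact: measurable_powR. Qed.

Lemma integrable_powexp (k c : R) : 0 < k -> 0 < c ->
  hl.-integrable setT (fun x => (x `^ (k - 1) * expR (- (c * x)))%:E).
Proof.
move=> k0 c0.
have mpe : measurable_fun setT (fun x : R => x `^ (k - 1) * expR (- x `^ k)).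
  apply: measurable_funM; first exact: measurable_powRl.
  by apply: measurableT_comp => //; apply: measurableT_comp => //; exact: measurable_powRl.
have dp (x : R) : 0 < x -> is_derive x 1 (fun x => expR (- x `^ k))
    (expR (- x `^ k) * - (k * x `^ (k - 1))).
  by move=> x0; apply: rderive_comp; apply: rderiveN; exact: is_derive1_powR.
have [i0 _] : hl.-integrable setT (fun x => (x `^ (k - 1) * expR (- x `^ k))%:E) /\
    \int[hl]_x (x `^ (k - 1) * expR (- x `^ k)) = 0 - (- k^-1 * 1).
  apply: (@ge0_FTC0y R (fun x => x `^ (k - 1) * expR (- x `^ k))
    (fun x => - k^-1 * expR (- x `^ k)) (- k^-1 * 1) 0).
  - exact: mpe.
  - move=> x x0; apply: (rderive_eq (rderiveZ (- k^-1) (dp x x0))).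
    by field; rewrite gt_eqF.
  - move=> x x0; have dx := is_derive1_powR (k - 1) x0.
    exact: is_derive_continuous (rderiveM dx (dp x x0)).
  - by move=> x x0; rewrite mulr_ge0 ?powR_ge0 ?expR_ge0.
  - apply: cvgMr; rewrite -(expR0 R) -[X in expR X]oppr0.
    apply: (@cvg_comp _ _ _ (fun x : R => x `^ k) (fun y => expR (- y)) _ _ _ (powR_cvg0 k0)).
    have d0 : is_derive (0 : R) 1 (fun y : R => expR (- y)) (expR (- 0) * - 1).
      by apply: (rderive_comp (is_derive_expR _)); exact: (rderiveN (rderive_id _)).
    exact: is_derive_continuous d0.
  - apply: cvgM0.
    exact: (@cvg_comp _ _ _ (fun x : R => x `^ k) (fun y => expR (- y)) _ _ _ (cvg_powRy k0) (@cvgr_expR R)).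
have c2 : 0 < c / 2 by rewrite divr_gt0.
have [C C0 hC] := powR_le_expR (ltW k0) c2.
have [i1 _] := integrable_expRN c2.
apply: (@le_integrable_hl _ _ (fun x => expR 1 * (x `^ (k - 1) * expR (- x `^ k)) +
    C * expR (- (c / 2 * x)))).
- by apply: measurable_funM; [exact: measurable_powRl|exact: measurable_expRN].
- under eq_fun do rewrite EFinD !(EFinM (expR 1)) (EFinM C).
  by apply: integrableD => //; exact: integrableZl.
move=> x x0; rewrite ger0_norm ?mulr_ge0 ?powR_ge0 ?expR_ge0//.
have [x1|x1] := leP x 1.
  rewrite (@le_trans _ _ (x `^ (k - 1)))//.
    by rewrite ler_piMr ?powR_ge0// -expR0 ler_expR oppr_le0 mulr_ge0 ?ltW.
  rewrite (@le_trans _ _ (expR 1 * (x `^ (k - 1) * expR (- x `^ k))))//; last first.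
    by rewrite lerDl mulr_ge0 ?expR_ge0.
  rewrite mulrCA ler_peMr ?powR_ge0// -expRD -expR0 ler_expR subr_ge0.
  have h1 : (1 : R) `^ k = 1 by rewrite powR1.
  rewrite expR0 -h1; apply: (ge0_ler_powR (ltW k0)) => //.
    by rewrite nnegrE ltW.
  by rewrite nnegrE.
rewrite (@le_trans _ _ (C * expR (- (c / 2 * x))))//; last first.
  by rewrite lerDr !mulr_ge0 ?expR_ge0 ?powR_ge0.
have -> : expR (- (c * x)) = expR (- (c / 2 * x)) * expR (- (c / 2 * x)).
  by rewrite -expRD; congr expR; field.
rewrite mulrA ler_pM2r ?expR_gt0// expRN ler_pdivrMr ?expR_gt0//.
apply: le_trans (hC x x0); rewrite ler_powR ?(ltW x1)//; lra.
Qed.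

End special_integrals.

(** * Gamma laws *)

Section gamma_law.
Context {R : realType}.
Local Notation leb := (@lebesgue_measure R).
Local Notation hl := (@hl R).
Implicit Types (k : R) (g h : R -> R).

Lemma Rintegral_hl_gt0 (f : R -> R) (c : R) : hl.-integrable setT (fun x => (f x)%:E) -> 0 < c ->
  (forall x, 0 < x -> 0 <= f x) -> (forall x, 1 <= x -> x <= 2 -> c <= f x) ->
  0 < \int[hl]_x f x.
Proof.
move=> fi c0 f0 fc.
pose g (x : R) := c * \1_(`[1, 2]%classic : set R) x.
have mI : measurable (`[1%R, 2%R]%classic : set R) by exact: measurable_itv.
have mg : measurable_fun setT g by apply: measurable_funM => //; exact: measurable_indic.
have gle x : 0 < x -> g x <= f x.
  move=> x0; rewrite /g indicE; case: (boolP (x \in _)) => [|_]; last by rewrite mulr0 f0.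
  by rewrite inE/= in_itv/= mulr1 => /andP[x1 x2]; exact: fc.
have g0 x : 0 <= g x by rewrite /g indicE mulr_ge0 ?ler0n ?(ltW c0).
have gi : hl.-integrable setT (fun x => (g x)%:E).
  by apply: (le_integrable_hl mg fi) => x x0; rewrite ger0_norm// gle.
apply: lt_le_trans (le_Rintegral_hl gi fi gle).
rewrite Rintegral_hl// /Rintegral /g.
under eq_integral do rewrite EFinM.
rewrite ge0_integralZl//; last 2 first.
- by apply/measurable_EFinP; exact/measurable_funTS/measurable_indic.
- by rewrite lee_fin ltW.
rewrite integral_indic//= (_ : _ `&` _ = `[1, 2]%classic); last first.
  apply/setIidPl => x /=; rewrite !in_itv/= andbT => /andP[h _].
  exact: lt_le_trans h.
rewrite lebesgue_measure_itv/= lte_fin ltr1n -EFinD -EFinM /=.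
by rewrite mulr_gt0// subr_gt0 ltr1n.
Qed.

Lemma powR_predM k (x : R) : 0 < x -> x `^ k = x * x `^ (k - 1).
Proof.
move=> x0; rewrite /powR gt_eqF//.
transitivity (expR (ln x) * expR ((k - 1) * ln x)); last by rewrite lnK.
by rewrite -expRD; congr expR; ring.
Qed.

Definition powexp k (x : R) : R := x `^ (k - 1) * expR (- x).

Lemma measurable_powexp k : measurable_fun setT (powexp k).
Proof.
apply: measurable_funM; first exact: measurable_powRl.
by apply: measurableT_comp => //; exact: measurableT_comp.
Qed.

Lemma powexp_ge0 k x : 0 <= powexp k x.
Proof. by rewrite mulr_ge0 ?powR_ge0 ?expR_ge0. Qed.

Lemma integrable_powexp1 k : 0 < k -> hl.-integrable setT (fun x => (powexp k x)%:E).
Proof.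
move=> k0; have := integrable_powexp k0 ltr01; apply: eq_integrable => // x _.
by rewrite mul1r.
Qed.

Lemma gamma_funE k : gamma_fun k = \int[hl]_x powexp k x.
Proof. by rewrite Rintegral_hl//; exact: measurable_powexp. Qed.

Lemma gamma_fun_ge0 k : 0 <= gamma_fun k.
Proof. by rewrite gamma_funE; apply: Rintegral_ge0 => x _; exact: powexp_ge0. Qed.

Lemma gamma_fun_gt0 k : 0 < k -> 0 < gamma_fun k.
Proof.
move=> k0; rewrite gamma_funE.
have h (x : R) : 1 <= x -> x <= 2 -> 2^-1 * expR (- 2) <= powexp k x.
  move=> x1 x2; have x0 : 0 < x := lt_le_trans ltr01 x1.
  apply: ler_pM; rewrite ?expR_ge0 ?invr_ge0//; last by rewrite ler_expR lerN2.
  have -> : x `^ (k - 1) = x `^ k * x^-1.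
    by rewrite (powR_predM k x0); field; rewrite gt_eqF.
  apply: (@le_trans _ _ x^-1); first by rewrite lef_pV2 ?posrE.
  have h1 : (1 : R) `^ k = 1 by rewrite powR1.
  rewrite ler_peMl ?invr_ge0 ?(ltW x0)// -h1.
  by apply: (ge0_ler_powR (ltW k0)); rewrite ?nnegrE ?(ltW x0).
apply: (Rintegral_hl_gt0 (integrable_powexp1 k0) _ _ h); first by rewrite mulr_gt0 ?expR_gt0.
by move=> x _; exact: powexp_ge0.
Qed.

Lemma gamma_pdfE k x : gamma_pdf k x = powexp k x / gamma_fun k * posind x.
Proof. by rewrite /gamma_pdf /posind; case: ifPn => _; rewrite ?mulr1 ?mulr0. Qed.

Lemma measurable_gamma_pdf k : measurable_fun setT (gamma_pdf k).
Proof.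
rewrite (_ : gamma_pdf k = fun x => powexp k x / gamma_fun k * posind x).
  apply: measurable_funM; last exact: measurable_posind.
  by apply: measurable_funM => //; exact: measurable_powexp.
by apply/funext => x; rewrite gamma_pdfE.
Qed.

Lemma gamma_pdf_ge0 k x : 0 <= gamma_pdf k x.
Proof.
rewrite gamma_pdfE; apply: mulr_ge0; last exact: posind_ge0.
by apply: mulr_ge0; [exact: powexp_ge0|rewrite invr_ge0 gamma_fun_ge0].
Qed.

Definition gam k : {sigma_finite_measure set (measurableTypeR R) -> \bar R} :=
  dens leb (measurable_gamma_pdf k) (gamma_pdf_ge0 k).

Lemma gamE k (A : set R) : gam k A = gamma_prob k A. Proof. by []. Qed.

Lemma integrable_gamP k g : 0 < k -> measurable_fun setT g ->
  (gam k).-integrable setT (fun x => (g x)%:E) <->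
  hl.-integrable setT (fun x => (g x * powexp k x)%:E).
Proof.
move=> k0 mg; have G0 := gamma_fun_gt0 k0.
have mgp : measurable_fun setT (fun x => g x * powexp k x).
  by apply: measurable_funM => //; exact: measurable_powexp.
split => gi.
  apply: integrable_dens => //.
  have gi2 : leb.-integrable setT (fun x => (g x * gamma_pdf k x)%:E).
    by move/integrable_densP: gi; exact.
  have := integrableZl measurableT (gamma_fun k) gi2.
  apply: eq_integrable => // x _ /=.
  by rewrite -EFinM gamma_pdfE; congr EFin; field; rewrite gt_eqF.
apply: integrable_dens => //.
have gi2 : leb.-integrable setT (fun x => (g x * powexp k x * posind x)%:E).
  by move/integrable_densP: gi; exact.
have := integrableZl measurableT (gamma_fun k)^-1 gi2.
apply: eq_integrable => // x _ /=.
by rewrite -EFinM gamma_pdfE; congr EFin; field; rewrite gt_eqF.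
Qed.

Lemma Rintegral_gam k g : 0 < k -> measurable_fun setT g ->
  (gam k).-integrable setT (fun x => (g x)%:E) ->
  \int[gam k]_x g x = (\int[hl]_x (g x * powexp k x)) / gamma_fun k.
Proof.
move=> k0 mg gi.
have mgp : measurable_fun setT (fun x => g x * powexp k x).
  by apply: measurable_funM => //; exact: measurable_powexp.
rewrite Rintegral_dens// Rintegral_dens// -RintegralZr//.
  by apply: eq_Rintegral => x _; rewrite gamma_pdfE; ring.
by move/(integrable_gamP k0 mg)/integrable_densP: gi; exact.
Qed.

Lemma integrable_gam_linear k g (C : R) : 0 < k -> measurable_fun setT g ->
  (forall x : R, 0 < x -> `|g x| <= C * (1 + x)) ->
  (gam k).-integrable setT (fun x => (g x)%:E).
Proof.
move=> k0 mg gC; apply/integrable_gamP => //.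
have k1 : 0 < k + 1 by rewrite addr_gt0.
apply: (@le_integrable_hl _ _ (fun x => C * powexp k x + C * powexp (k + 1) x)).
- by apply: measurable_funM => //; exact: measurable_powexp.
- under eq_fun do rewrite EFinD !(EFinM C).
  by apply: integrableD => //; apply: integrableZl => //; exact: integrable_powexp1.
move=> x x0; rewrite normrM (ger0_norm (powexp_ge0 _ _)).
have -> : powexp (k + 1) x = x * powexp k x.
  rewrite /powexp mulrA; congr (_ * _).
  by rewrite (powR_predM (k + 1 - 1) x0) addrK.
rewrite -mulrDr -[X in X + _]mul1r -mulrDl mulrA ler_wpM2r ?powexp_ge0//.
exact: gC.
Qed.

Lemma gam_setT k : 0 < k -> gam k setT = 1%E.
Proof.
move=> k0; rewrite /gam/= /dens.
have gi := integrable_gam_linear (g := fun=> 1) (C := 1) k0 (measurable_cst _).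
have h : \int[gam k]_x (1 : R) = 1.
  rewrite Rintegral_gam//; last by apply: gi => x x0; rewrite normr1 mul1r lerDl ltW.
  under eq_Rintegral do rewrite mul1r.
  by rewrite -gamma_funE divff// gt_eqF// gamma_fun_gt0.
have gi1 : (gam k).-integrable setT (fun x => (1 : R)%:E).
  by apply: gi => x x0; rewrite normr1 mul1r lerDl ltW.
have := Rintegral_EFin gi1; rewrite h => ->.
by rewrite integral_cst//= mul1e.
Qed.

(** The integrand times the unnormalized density is the derivative of
    [x ^ k e^- x h x], which vanishes at both ends. *)
Lemma gamma_stein k h h' (C : R) : 0 < k -> measurable_fun setT h -> measurable_fun setT h' ->
  (forall x : R, 0 < x -> is_derive x 1 h (h' x)) ->
  (forall x : R, 0 < x -> {for x, continuous h'}) ->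
  (forall x : R, 0 < x -> `|h x| <= C) -> (forall x : R, 0 < x -> `|x * h' x| <= C * (1 + x)) ->
  \int[gam k]_x (x * h' x + (k - x) * h x) = 0.
Proof.
move=> k0 mh mh' dh ch' hC h'C.
have C0 : 0 <= C by apply: le_trans (hC 1 ltr01).
have mf : measurable_fun setT (fun x : R => x * h' x + (k - x) * h x).
  apply: measurable_funD; first exact: measurable_funM.
  by apply: measurable_funM => //; exact: measurable_funB.
have gi : (gam k).-integrable setT (fun x => (x * h' x + (k - x) * h x)%:E).
  apply: (@integrable_gam_linear _ _ (C * (2 + k))) => // x x0.
  rewrite (le_trans (ler_normD _ _))//.
  have h2 : `|(k - x) * h x| <= (k + x) * C.
    rewrite normrM ler_pM//; last exact: hC.
    by rewrite (le_trans (ler_normB _ _))// !ger0_norm// ltW.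
  have h1 := h'C x x0.
  have h3 : 0 <= C * k * x by rewrite !mulr_ge0// ltW.
  lra.
rewrite Rintegral_gam//.
suff -> : \int[hl]_x ((x * h' x + (k - x) * h x) * powexp k x) = 0 by rewrite mul0r.
have -> : (0 : R) = 0 - 0 by rewrite subrr.
pose F x := x `^ k * expR (- x) * h x.
have xk (x : R) : 0 < x -> x `^ k = x * x `^ (k - 1).
  exact: powR_predM.
have dexp (x : R) : is_derive x 1 (fun x => expR (- x)) (expR (- x) * - 1).
  by apply: (rderive_comp (is_derive_expR _)); exact: (rderiveN (rderive_id _)).
have mfp : measurable_fun setT (fun x : R => (x * h' x + (k - x) * h x) * powexp k x).
  by apply: measurable_funM => //; exact: measurable_powexp.
apply: (@FTC0y R _ F 0 0) => //.
- move=> x x0; apply: (rderive_eq (rderiveM (rderiveM (is_derive1_powR k x0) (dexp x)) (dh x x0))).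
  by rewrite /powexp xk//; ring.
- move=> x x0.
  have c1 : {for x, continuous (fun x : R => x `^ (k - 1) * expR (- x))}.
    exact: is_derive_continuous (rderiveM (is_derive1_powR (k - 1) x0) (dexp x)).
  have c2 : {for x, continuous (fun x : R => (k - x) * h x)}.
    exact: is_derive_continuous (rderiveM (rderiveB (rderive_cst x k) (rderive_id x)) (dh x x0)).
  have c3 : {for x, continuous (fun x : R => x)} by exact: is_derive_continuous (rderive_id x).
  apply: (@cvgM R); last exact: c1.
  by apply: cvgD; [apply: cvgM; [exact: c3|exact: ch']|exact: c2].
- exact/integrable_gamP.
- have Fle x : 0 < x -> `|F x| <= C * x `^ k.
    move=> x0; rewrite /F normrM mulrC ler_pM ?hC//.
    rewrite normrM !ger0_norm ?powR_ge0 ?expR_ge0// ler_piMr ?powR_ge0//.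
    by rewrite -expR0 ler_expR oppr_le0 ltW.
  apply: (@cvg0_le _ _ _ _ _ (fun x => C * x `^ k)).
    by apply: filterS (nbhs_right_gt (0 : R)).
  by apply: cvgM0; exact: powR_cvg0.
- have h12 : 0 < 1 / 2 :> R by rewrite divr_gt0.
  have [D D0 hD] := powR_le_expR (ltW k0) h12.
  have Fle x : 0 < x -> `|F x| <= C * D * expR (- (1 / 2 * x)).
    move=> x0; rewrite /F normrM mulrC -mulrA ler_pM ?hC//.
    rewrite normrM !ger0_norm ?powR_ge0 ?expR_ge0//.
    have -> : expR (- (1 / 2 * x)) = expR (1 / 2 * x) * expR (- x).
      by rewrite -expRD; congr expR; field.
    by rewrite mulrA ler_pM2r ?expR_gt0// hD.
  apply: (@cvg0_le _ _ _ _ _ (fun x => C * D * expR (- (1 / 2 * x)))).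
    by apply: filterS (nbhs_pinfty_gt (num_real (0 : R))).
  by apply: cvgM0; exact: cvg_expRN.
Qed.

Lemma gam_mean k : 0 < k -> \int[gam k]_x x = k.
Proof.
move=> k0.
have mid : measurable_fun setT (fun x : R => x) by exact: measurable_id.
have := @gamma_stein k (fun=> 1) (fun=> 0) 1 k0 (measurable_cst _) (measurable_cst _).
have i1 : (gam k).-integrable setT (fun=> (1 : R)%:E).
  by apply: (@integrable_gam_linear _ _ 1) => // x x0; rewrite normr1 mul1r lerDl ltW.
have ix : (gam k).-integrable setT (fun x => x%:E).
  by apply: (@integrable_gam_linear _ _ 1) => // x x0; rewrite mul1r ger0_norm ?ltW// ltrDr.
under eq_Rintegral do rewrite mulr0 add0r mulr1.
have ik : (gam k).-integrable setT (EFin \o (fun=> k)).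
  have -> : (EFin \o (fun=> k)) = (fun x : R => k%:E * 1%:E)%E.
    by apply/funext => x /=; rewrite mule1.
  exact: integrableZl.
rewrite RintegralB//; have -> : \int[gam k]_x k = k.
  transitivity (k * fine (gam k setT)); first exact: Rintegral_cst.
  by rewrite gam_setT// mulr1.
move=> h.
apply/esym/eqP; rewrite -subr_eq0; apply/eqP; apply: h.
- by move=> x _; exact: cvg_cst.
- by move=> x _; rewrite normr1.
- by move=> x x0; rewrite mulr0 normr0 mul1r addr_ge0// ltW.
Qed.

End gamma_law.

(** * Linear differential equations and integrals depending on a parameter *)

Section parameter.
Context {R : realType}.
Local Notation leb := (@lebesgue_measure R).
Local Notation hl := (@hl R).

Lemma cderive_cint d (T : measurableType d) (mu : {measure set T -> \bar R})
    (f f' : R -> T -> R[i]) (G : T -> R) (a u v : R) :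
  u < a < v -> (forall t, u < t < v -> cintegrable mu (f t)) ->
  (forall t x, u < t < v -> is_cderive (fun s => f s x) t (f' t x)) ->
  mu.-integrable setT (fun x => (G x)%:E) ->
  (forall t x, u < t < v -> cabs (f' t x) <= G x) ->
  is_cderive (fun t => cint mu (f t)) a (cint mu (f' a)).
Proof.
move=> uav fi df iG f'G.
have Ia : `]u, v[%classic a by rewrite /= in_itv.
have G0 x : 0 <= G x by apply: le_trans (f'G a x uav); exact: cabs_ge0.
have key (p : R[i] -> R) (f1 : R -> T -> R) (f1' : R -> T -> R) :
    (forall t, u < t < v -> mu.-integrable setT (fun x => (f1 t x)%:E)) ->
    (forall t x, u < t < v -> is_derive t 1 (fun s => f1 s x) (f1' t x)) ->
    (forall t x, u < t < v -> `|f1' t x| <= G x) ->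
    is_derive a 1 (fun t => \int[mu]_x f1 t x) (\int[mu]_x f1' a x).
  move=> f1i df1 f1G.
  have dE t x : u < t < v -> partial1of2 f1 t x = f1' t x.
    by move=> h; rewrite partial1of2E; apply: derive_val; exact: df1.
  have H1 : forall t, `]u, v[%classic t -> mu.-integrable setT (EFin \o f1 t).
    by move=> t /=; rewrite in_itv; exact: f1i.
  have H2 : forall t x, `]u, v[%classic t -> setT x -> derivable (f1 ^~ x) t 1.
    by move=> t x /=; rewrite in_itv => h _; apply: ex_derive; exact: df1.
  have H3 : forall t x, `]u, v[%classic t -> setT x -> `|partial1of2 f1 t x| <= G x.
    by move=> t x /=; rewrite in_itv => h _; rewrite dE// f1G.
  apply: DeriveDef.
    exact: (derivable_under_integral measurableT Ia H1 H2 G0 iG H3).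
  rewrite -derive1E (differentiation_under_integral measurableT Ia H1 H2 G0 iG H3).
  by apply: eq_Rintegral => x _; rewrite dE.
split.
  under eq_fun do rewrite Re_cint.
  rewrite Re_cint; apply: (key (@complex.Re R) (fun t x => cRe (f t x)) (fun t x => cRe (f' t x))).
  - by move=> t /fi; exact: cintegrable_Re.
  - by move=> t x /df => /(_ x)[].
  - by move=> t x h; rewrite (le_trans (Re_cabs _))// f'G.
under eq_fun do rewrite Im_cint.
rewrite Im_cint; apply: (key (@complex.Im R) (fun t x => cIm (f t x)) (fun t x => cIm (f' t x))).
- by move=> t /fi; exact: cintegrable_Im.
- by move=> t x /df => /(_ x)[].
- by move=> t x h; rewrite (le_trans (Im_cabs _))// f'G.
Qed.

(** Along a dissipative linear equation the modulus decreases. *)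
Lemma dissipative_eq0 (Z q : R -> R[i]) (t : R) :
  (forall s : R, 0 <= s <= t -> is_cderive Z s (q s * Z s)) ->
  (forall s : R, 0 <= s <= t -> cRe (q s) <= 0) -> Z 0 = 0 -> 0 <= t -> Z t = 0.
Proof.
move=> dZ q0 Z0 t0.
pose N s := cabs (Z s) ^+ 2.
have dN (s : R) : 0 <= s <= t -> is_derive s 1 N (2 * cRe (q s) * cabs (Z s) ^+ 2).
  move=> s0; apply: (rderive_eq (cderive_cabs2 (dZ s s0))).
  by rewrite -mulrA mulJ [in LHS]cReM cReC cImC; ring.
have : N t <= N 0.
  apply: (@ler0_derive1_nincr _ N 0 t) => //.
  - move=> s; rewrite in_itv/= => /andP[s0 st].
    by apply: ex_derive; apply: dN; rewrite !ltW.
  - move=> s; rewrite in_itv/= => /andP[s0 st].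
    have s0t : 0 <= s <= t by rewrite !ltW.
    rewrite derive1E (@derive_val _ _ _ _ _ _ _ (dN s s0t)).
    by rewrite mulr_le0_ge0 ?sqr_ge0// mulr_ge0_le0// q0.
  - apply: continuous_in_subspaceT => s; rewrite inE/= in_itv/= => s0.
    exact: is_derive_continuous (dN s s0).
rewrite /N Z0 cabs0 expr0n/= => h.
have /eqP : cabs (Z t) ^+ 2 == 0 by rewrite eq_le h sqr_ge0.
by move/eqP; rewrite sqrf_eq0 cabs_eq0 => /eqP.
Qed.

Lemma cderive_cint_hl (f f' : R -> R -> R[i]) (G : R -> R) (a u v : R) :
  u < a < v -> (forall t, u < t < v -> cintegrable hl (f t)) -> cmeas (f' a) ->
  (forall t x : R, u < t < v -> 0 < x -> is_cderive (fun s => f s x) t (f' t x)) ->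
  hl.-integrable setT (fun x => (G x)%:E) ->
  (forall t x : R, u < t < v -> 0 < x -> cabs (f' t x) <= G x) ->
  is_cderive (fun t => cint hl (f t)) a (cint hl (f' a)).
Proof.
move=> uav fi mf' df iG f'G.
pose pp (x : R) : R[i] := (posind x)%:C.
have mpp : cmeas pp by apply: cmeasC; exact: measurable_posind.
have E (g : R -> R[i]) : cmeas g -> cint hl g = cint hl (fun x => pp x * g x).
  move=> mg; apply: eq_cint_hl => //; first exact: cmeasM.
  by move=> x x0; rewrite /pp /posind x0 mul1r.
have mG : measurable_fun setT G by move/measurable_int: (iG) => /measurable_EFinP.
have h : is_cderive (fun t => cint hl (fun x => pp x * f t x)) a (cint hl (fun x => pp x * f' a x)).
  apply: (@cderive_cint _ _ hl (fun s x => pp x * f s x) (fun s x => pp x * f' s x)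
    (fun x => posind x * G x) a u v) => //.
  - move=> t ut; have [mf inf] := fi t ut; apply: le_cintegrable inf _; first exact: cmeasM.
    move=> x; rewrite cabsM ler_piMl ?cabs_ge0// /pp /posind.
    by case: (0 < x)%R; rewrite cabsC ?normr1 ?normr0.
  - move=> t x ut; rewrite /pp /posind; case: (ltP 0 x) => x0.
      by apply: (cderive_eq (cderiveM (cderive_cst t _) (df t x ut x0))); rewrite !mul0r add0r.
    by rewrite mul0r; apply: eq_cderive (cderive_cst t 0) => q; rewrite mul0r.
  - apply: le_integrable_hl iG _.
      by apply: measurable_funM => //; exact: measurable_posind.
    move=> x x0; rewrite /posind x0 mul1r ger0_norm//.
    by apply: le_trans (f'G a x uav x0); exact: cabs_ge0.
  - move=> t x ut; rewrite /pp /posind; case: (ltP 0 x) => x0.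
      by rewrite !mul1r f'G.
    by rewrite !mul0r cabs0.
rewrite -E// in h.
have e t : u < t < v -> cint hl (fun x => pp x * f t x) = cint hl (f t).
  by move=> /fi[mf _]; rewrite -E.
have near_e : \forall t \near a, u < t < v.
  by case/andP: uav => ua av; near=> t; apply/andP; split; near: t;
    [exact: lt_nbhsr|exact: lt_nbhsl].
by case: h => h1 h2; split; [apply: near_eq_is_derive h1|apply: near_eq_is_derive h2] => //;
  apply: filterS near_e => t /e ->.
Unshelve. all: by end_near. Qed.

End parameter.

(** * The Gaussian law *)

Section gaussian.
Context {R : realType}.
Local Notation leb := (@lebesgue_measure R).
Local Notation hl := (@hl R).

Definition gpdf (x : R) : R := normal_pdf 0 1 x.

Lemma measurable_gpdf : measurable_fun setT gpdf.
Proof. exact: measurable_normal_pdf. Qed.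

Lemma gpdf_ge0 x : 0 <= gpdf x. Proof. exact: normal_pdf_ge0. Qed.

Lemma normal_pdf0E (s x : R) : s != 0 ->
  normal_pdf 0 s x = normal_peak s * expR (- (x ^+ 2 / (s ^+ 2 * 2))).
Proof.
move=> s0; rewrite /normal_pdf (negbTE s0) /= /normal_fun subr0.
by rewrite -mulr_natr mulNr.
Qed.

Lemma gpdfE x : gpdf x = (Num.sqrt (2 * pi))^-1 * expR (- (x ^+ 2 / 2)).
Proof.
rewrite /gpdf normal_pdf0E ?oner_eq0// /normal_peak expr1n !mul1r.
by rewrite -mulr_natl.
Qed.

Definition gau : {sigma_finite_measure set (measurableTypeR R) -> \bar R} :=
  dens leb measurable_gpdf gpdf_ge0.

Lemma gauE (A : set R) : gau A = normal_prob 0 1 A. Proof. by []. Qed.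

Lemma gau_setT : gau setT = 1%E.
Proof. by rewrite /gau/= /dens integral_normal_pdf. Qed.

Lemma integrable_gau (g : R -> R) (C : R) : measurable_fun setT g ->
  (forall x, `|g x| <= C * expR (x ^+ 2 / 4)) ->
  gau.-integrable setT (fun x => (g x)%:E).
Proof.
move=> mg gC; apply: integrable_dens => //.
have s0 : Num.sqrt 2 != 0 :> R by rewrite gt_eqF// sqrtr_gt0.
have hK := integrable_normal_pdf (0 : R) (Num.sqrt 2).
set K := normal_peak (Num.sqrt 2 : R).
have K0 : 0 < K by exact: normal_peak_gt0.
have := integrableZl measurableT (C * (Num.sqrt (2 * pi))^-1 * K^-1) hK.
apply: le_integrable => //.
  by apply/measurable_EFinP; apply: measurable_funM => //; exact: measurable_gpdf.
move=> x _; rewrite /= -?EFinM lee_fin.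
apply: le_trans (ler_norm _).
rewrite normrM (ger0_norm (gpdf_ge0 x)) gpdfE normal_pdf0E// -/K sqr_sqrtr//.
have h := gC x.
have -> : C / Num.sqrt (2 * pi) / K * (K * expR (- (x ^+ 2 / (2 * 2)))) =
    C * expR (x ^+ 2 / 4) * ((Num.sqrt (2 * pi))^-1 * expR (- (x ^+ 2 / 2))).
  have -> : expR (- (x ^+ 2 / (2 * 2))) = expR (x ^+ 2 / 4) * expR (- (x ^+ 2 / 2)).
    by rewrite -expRD; congr expR; field.
  by set k := (Num.sqrt (2 * pi))^-1; field; rewrite gt_eqF.
by rewrite ler_wpM2r// mulr_ge0 ?expR_ge0// invr_ge0 sqrtr_ge0.
Qed.

Lemma abs_le_expR4 (x : R) : 1 + `|x| <= 2 * expR (x ^+ 2 / 4).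
Proof.
have h : 1 + x ^+ 2 / 4 <= expR (x ^+ 2 / 4) by exact: expR_ge1Dx.
have : 0 <= (1 - `|x| / 2) ^+ 2 by exact: sqr_ge0.
have : `|x| ^+ 2 = x ^+ 2 by rewrite real_normK// num_real.
have : 0 <= x ^+ 2 by exact: sqr_ge0.
nra.
Qed.

Lemma integrable_gau_linear (g : R -> R) (C : R) : measurable_fun setT g ->
  (forall x, `|g x| <= C * (1 + `|x|)) -> gau.-integrable setT (fun x => (g x)%:E).
Proof.
move=> mg gC; have C0 : 0 <= C.
  by have := le_trans (normr_ge0 _) (gC 0); rewrite normr0 addr0 mulr1.
apply: (@integrable_gau _ (C * 2)) => // x; rewrite (le_trans (gC x))// -mulrA.
by rewrite ler_wpM2l// abs_le_expR4.
Qed.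

Lemma rderive_gpdf (x : R) : is_derive x 1 gpdf (- x * gpdf x).
Proof.
have -> : gpdf = fun x => (Num.sqrt (2 * pi))^-1 * expR (- (2^-1 * x ^+ 2)).
  by apply/funext => y; rewrite gpdfE mulrC [y ^+ 2 / 2]mulrC mulrC.
set K := (Num.sqrt _)^-1.
apply: (rderive_eq (rderiveZ _ (rderive_comp (is_derive_expR _)
  (rderiveN (rderiveZ 2^-1 (rderive_sqr (rderive_id x))))))).
by field.
Qed.

Lemma cvg_gpdf : gpdf n.+1%:R @[n --> \oo] --> (0 : R).
Proof.
apply: (@cvg0_le _ _ _ _ _ (fun n => n.+1%:R^-1)); last exact: cvg_harmonic.
apply: nearW => n; rewrite ger0_norm ?gpdf_ge0// gpdfE.
have s1 : (Num.sqrt (2 * pi))^-1 <= 1 :> R.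
  rewrite invf_le1 ?sqrtr_gt0 ?mulr_gt0 ?pi_gt0//.
  have := pi_ge2 R => h; have h1 : 1 <= 2 * pi :> R by lra.
  by have := h1; rewrite -ler_sqrt ?(le_trans ler01)// sqrtr1.
rewrite (@le_trans _ _ (1 * expR (- (n.+1%:R ^+ 2 / 2))))//.
  by rewrite ler_wpM2r ?expR_ge0.
rewrite mul1r expRN lef_pV2 ?posrE ?expR_gt0 ?ltr0n//.
apply: le_trans (expR_ge1Dx _).
have : 0 <= (n.+1%:R - 1 : R) ^+ 2 by exact: sqr_ge0.
nra.
Qed.

(** The integrand times the density is the derivative of [f] times the density. *)
Lemma gauss_stein (f f' : R -> R) (C : R) : measurable_fun setT f -> measurable_fun setT f' ->
  (forall x : R, is_derive x 1 f (f' x)) -> (forall x : R, {for x, continuous f'}) ->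
  (forall x, `|f x| <= C) -> (forall x, `|f' x| <= C) ->
  \int[gau]_x (f' x - x * f x) = 0.
Proof.
move=> mf mf' df cf' fC f'C.
have mx : measurable_fun setT (fun x : R => x) by exact: measurable_id.
have mg : measurable_fun setT (fun x : R => f' x - x * f x).
  by apply: measurable_funB => //; exact: measurable_funM.
have gi : gau.-integrable setT (fun x => (f' x - x * f x)%:E).
  apply: (@integrable_gau_linear _ C) => // x.
  rewrite (le_trans (ler_normB _ _))// normrM.
  have h1 := fC x; have h2 := f'C x.
  have : `|x| * `|f x| <= `|x| * C by rewrite ler_wpM2l.
  lra.
rewrite Rintegral_dens//.
have -> : (0 : R) = 0 - 0 by rewrite subrr.
pose F x := f x * gpdf x.
have -> : \int[leb]_x ((f' x - x * f x) * gpdf x) =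
  \int[leb]_(x in setT) ((f' x - x * f x) * gpdf x) by [].
have Fle x : `|F x| <= C * gpdf x.
  by rewrite /F normrM (ger0_norm (gpdf_ge0 x)) ler_wpM2r ?gpdf_ge0.
apply: (@improper_FTC R setT _ F (fun n => - n.+1%:R) (fun n => n.+1%:R)) => //.
- by move=> n; rewrite (@lt_trans _ _ 0)// ?oppr_lt0 ltr0n.
- move=> x _; near=> n; rewrite -ler_norml.
  near: n; apply: filterS (nbhs_infty_ger `|x|) => n; move/le_trans; apply.
  by rewrite ler_nat.
- move=> x _; apply: (rderive_eq (rderiveM (df x) (rderive_gpdf x))); ring.
- move=> x _; apply: (@cvgM R); last exact: is_derive_continuous (rderive_gpdf x).
  apply: (@cvgB R _ R); first exact: cf'.
  exact: is_derive_continuous (rderiveM (rderive_id x) (df x)).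
- by move/integrable_densP: gi; exact.
- apply: (@cvg0_le _ _ _ _ _ (fun n => C * gpdf n.+1%:R)).
    apply: nearW => n; rewrite (le_trans (Fle _))// !gpdfE.
    by rewrite sqrrN.
  by apply: cvgM0; exact: cvg_gpdf.
- apply: (@cvg0_le _ _ _ _ _ (fun n => C * gpdf n.+1%:R)).
    exact: nearW.
  by apply: cvgM0; exact: cvg_gpdf.
Unshelve. all: by end_near. Qed.

End gaussian.

(** * Characteristic functions *)

Section characteristic_functions.
Context {R : realType}.
Local Notation leb := (@lebesgue_measure R).
Local Notation hl := (@hl R).
Local Notation gau := (@gau R).

Lemma cint1 d (T : measurableType d) (mu : {measure set T -> \bar R}) :
  mu setT = 1%E -> cint mu (fun=> 1) = 1.
Proof.
move=> mu1; apply: complexP; rewrite ?Re_cint ?Im_cint /=.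
  by rewrite /Rintegral integral_cst// mul1e mu1.
by rewrite /Rintegral integral_cst// mul0e.
Qed.

Lemma cintegrable_gau (f : R -> R[i]) (C : R) : cmeas f ->
  (forall x, cabs (f x) <= C * (1 + `|x|)) -> cintegrable gau f.
Proof.
move=> mf fC; split => //; apply: (@integrable_gau_linear _ _ C).
  exact: measurable_cabs.
by move=> x; rewrite ger0_norm ?cabs_ge0.
Qed.

Lemma cabs_expim (t x : R) : cabs (expC (x%:C * (- 'i * t%:C))) = 1.
Proof.
rewrite cabs_expC -[RHS]expR0; congr expR.
by rewrite mulNr cReM cReN cImN cImC cReM cReC cImC cRei cImi; ring.
Qed.

(** By Gaussian integration by parts both sides solve [Z' = - t Z]. *)
Lemma gau_char (t : R) : 0 <= t ->
  cint gau (fun x => expC (x%:C * (- 'i * t%:C))) = (expR (- (t ^+ 2 / 2)))%:C.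
Proof.
move=> t0; pose e (t x : R) : R[i] := expC (x%:C * (- 'i * t%:C)).
have me s : cmeas (e s) by exact: cmeas_expi.
have ie s : cintegrable gau (e s).
  by apply: (@cintegrable_gau _ 1) => // x; rewrite cabs_expim mul1r lerDl.
have ixe s : cintegrable gau (fun x => x%:C * e s x).
  apply: (@cintegrable_gau _ 1); first by apply: cmeasM => //; exact: cmeas_id.
  by move=> x; rewrite cabsM cabs_expim cabsC mulr1 mul1r lerDr.
have dx s x : is_cderive (e s) x ((- 'i * s%:C) * e s x) by exact: cderive_expi.
have stein s : cint gau (fun x => x%:C * e s x) = (- 'i * s%:C) * cint gau (e s).
  rewrite -cintZl//; apply/eqP; rewrite eq_sym -subr_eq0; apply/eqP.
  rewrite -cintB//; last exact: cintegrableZl.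
  have b1 x : cabs (e s x) <= 1 + `|s| by rewrite cabs_expim lerDl.
  have b2 x : cabs ((- 'i * s%:C) * e s x) <= 1 + `|s|.
    by rewrite cabsM cabs_expim mulr1 cabsM cabsN cabsi mul1r cabsC lerDr.
  have m2 : cmeas (fun x => (- 'i * s%:C) * e s x) by case: (cintegrableZl (- 'i * s%:C) (ie s)).
  have dd x : exists b, is_cderive (fun x => (- 'i * s%:C) * e s x) x b.
    by eexists; apply: cderiveZ; exact: dx.
  apply: complexP; rewrite (Re_cint, Im_cint).
    rewrite -[RHS](@gauss_stein R (fun x => cRe (e s x)) (fun x => cRe ((- 'i * s%:C) * e s x)) (1 + `|s|)).
    - by apply: eq_Rintegral => x _; rewrite cReB [in LHS]cReM [in RHS]cReM; congr (_ - _); rewrite cReM cReC cImC; ring.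
    - exact: cmeas_Re.
    - exact: cmeas_Re.
    - by move=> x; case: (dx s x).
    - by move=> x; case: (dd x) => b [] /is_derive_continuous.
    - by move=> x; rewrite (le_trans (Re_cabs _)).
    - by move=> x; rewrite (le_trans (Re_cabs _)).
  rewrite -[RHS](@gauss_stein R (fun x => cIm (e s x)) (fun x => cIm ((- 'i * s%:C) * e s x)) (1 + `|s|)).
  - by apply: eq_Rintegral => x _; rewrite cImB; congr (_ - _); rewrite cImM cReC cImC; ring.
  - exact: cmeas_Im.
  - exact: cmeas_Im.
  - by move=> x; case: (dx s x).
  - by move=> x; case: (dd x) => b [_ /is_derive_continuous].
  - by move=> x; rewrite (le_trans (Im_cabs _)).
  - by move=> x; rewrite (le_trans (Im_cabs _)).
have dc (s : R) : is_cderive (fun s => cint gau (e s)) s (- s%:C * cint gau (e s)).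
  have -> : - s%:C * cint gau (e s) = cint gau (fun x => (x%:C * - 'i) * e s x).
    transitivity (cint gau (fun x => - 'i * (x%:C * e s x))).
      rewrite cintZl// stein !mulrA -!mulrA [X in _ = X]mulrA.
      by rewrite -[- 'i * - 'i]/((- 'i) ^+ 2) sqrrN sqr_i mulN1r mulNr.
    by apply: eq_cint => x; ring.
  apply: (@cderive_cint _ _ _ gau e (fun s x => (x%:C * - 'i) * e s x) (fun x => `|x|) s (s - 1) (s + 1)).
  - by apply/andP; split; lra.
  - by move=> r _; exact: ie.
  - move=> r x _.
    have h : (fun s : R => e s x) =1 (fun s => expC (s%:C * (x%:C * - 'i))).
      by move=> q; rewrite /e; congr expC; ring.
    by rewrite h; apply: (eq_cderive (fsym h)); exact: cderive_expi.
  - have := cintegrable_cabs (ixe 0); apply: eq_integrable => // x _.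
    by rewrite cabsM cabs_expim mulr1 cabsC.
  - by move=> r x _; rewrite cabsM cabs_expim cabsM cabsN cabsi cabsC !mulr1.
pose Z s := cint gau (e s) - (expR (- (s ^+ 2 / 2)))%:C.
suff : Z t = 0 by move/eqP; rewrite subr_eq0 => /eqP.
apply: (@dissipative_eq0 _ Z (fun s => - s%:C)) => //.
- move=> s _.
  have d2 : is_derive s 1 (fun s : R => expR (- (s ^+ 2 / 2))) (- s * expR (- (s ^+ 2 / 2))).
    have -> : (fun s : R => expR (- (s ^+ 2 / 2))) = fun s => expR (- (2^-1 * s ^+ 2)).
      by apply/funext => r; rewrite mulrC.
    apply: (rderive_eq (rderive_comp (is_derive_expR _) (rderiveN (rderiveZ 2^-1 (rderive_sqr (rderive_id s)))))).
    by rewrite [s ^+ 2 / 2]mulrC; field.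
  apply: (cderive_eq (cderiveB (dc s) (cderiveC d2))).
  by rewrite /Z CM CN; ring.
- by move=> s /andP[s0 _]; rewrite cReN cReC oppr_le0.
- rewrite /Z expr0n/= mul0r oppr0 expR0.
  have -> : e 0 = fun=> 1 by apply/funext => x; rewrite /e !mulr0 expC0.
  by rewrite cint1 ?subrr//; exact: gau_setT.
Qed.

(** ** The complex gamma integral *)

(** This is [Gamma k * c ^ - k] for the principal branch of the power; working with the
    integral and its differential equation avoids complex powers. *)
Definition Lap (k : R) (c : R[i]) : R[i] :=
  cint hl (fun x => (x `^ (k - 1))%:C * expC (x%:C * - c)).

Lemma cabs_expCN (x : R) (c : R[i]) : cabs (expC (x%:C * - c)) = expR (- (cRe c * x)).
Proof. by rewrite cabs_expC !cE; congr expR; ring. Qed.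

Lemma cmeas_powexp (k : R) (c : R[i]) : cmeas (fun x : R => (x `^ k)%:C * expC (x%:C * - c)).
Proof. by apply: cmeasM; [apply: cmeasC; exact: measurable_powRl|exact: cmeas_expi]. Qed.

Lemma cabs_powexp (k x : R) (c : R[i]) :
  cabs ((x `^ k)%:C * expC (x%:C * - c)) = x `^ k * expR (- (cRe c * x)).
Proof. by rewrite cabsM cabs_expCN cabsC ger0_norm ?powR_ge0. Qed.

Lemma cintegrable_powexp (k : R) (c : R[i]) : 0 < k -> 0 < cRe c ->
  cintegrable hl (fun x : R => (x `^ (k - 1))%:C * expC (x%:C * - c)).
Proof.
move=> k0 c0; split; first exact: cmeas_powexp.
have := integrable_powexp k0 c0; apply: eq_integrable => // x _.
by rewrite cabs_powexp.
Qed.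

Lemma cderive_powexp (k x : R) (c : R[i]) : 0 < x ->
  is_cderive (fun x : R => (x `^ k)%:C * expC (x%:C * - c)) x
    (k%:C * ((x `^ (k - 1))%:C * expC (x%:C * - c)) - c * ((x `^ k)%:C * expC (x%:C * - c))).
Proof.
move=> x0.
apply: (cderive_eq (cderiveM (cderiveC (is_derive1_powR k x0)) (cderive_expi (- c) x))).
by rewrite CM; ring.
Qed.

Lemma Lap_parts (k : R) (c : R[i]) : 0 < k -> 0 < cRe c ->
  c * Lap (k + 1) c = k%:C * Lap k c.
Proof.
move=> k0 c0; have k1 : 0 < k + 1 by rewrite addr_gt0.
have i0 := cintegrable_powexp k0 c0.
have := cintegrable_powexp k1 c0; rewrite /Lap addrK => i1.
apply/eqP; rewrite eq_sym -subr_eq0; apply/eqP.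
rewrite -!cintZl// -cintB; [|exact: cintegrableZl..].
rewrite -[RHS](subrr 0).
apply: (@cFTC0y _ _ (fun x : R => (x `^ k)%:C * expC (x%:C * - c))).
- by apply: cintegrableB; exact: cintegrableZl.
- by move=> x x0; exact: cderive_powexp.
- move=> x x0; eexists.
  by apply: cderiveB; apply: cderiveZ; exact: cderive_powexp.
- apply: (@cvg0_le _ _ _ _ _ (fun x => x `^ k)); last exact: powR_cvg0.
  near=> x; rewrite subr0 ger0_norm ?cabs_ge0// cabs_powexp ler_piMr ?powR_ge0//.
  rewrite -[leRHS]expR0 ler_expR oppr_le0 mulr_ge0// ltW//.
- have c2 : 0 < cRe c / 2 by rewrite divr_gt0.
  have [C C0 hC] := powR_le_expR (ltW k0) c2.
  apply: (@cvg0_le _ _ _ _ _ (fun x => C * expR (- (cRe c / 2 * x)))); last first.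
    by apply: cvgM0; exact: cvg_expRN.
  near=> x; rewrite subr0 ger0_norm ?cabs_ge0// cabs_powexp.
  have x0 : 0 < x by near: x; exact: nbhs_pinfty_gt.
  have -> : expR (- (cRe c / 2 * x)) = expR (cRe c / 2 * x) * expR (- (cRe c * x)).
    by rewrite -expRD; congr expR; field.
  by rewrite mulrA ler_wpM2r ?expR_ge0// hC.
Unshelve. all: by end_near. Qed.

Lemma cderive_Lap (k : R) (c0 c1 : R[i]) (t : R) : 0 < k -> 0 < cRe (c0 + t%:C * c1) ->
  is_cderive (fun s => Lap k (c0 + s%:C * c1)) t
    (- (k%:C * c1 / (c0 + t%:C * c1)) * Lap k (c0 + t%:C * c1)).
Proof.
move=> k0 h0; have k1 : 0 < k + 1 by rewrite addr_gt0.
set c := c0 + _ in h0 *.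
have cn0 : c != 0 by apply: contraTneq h0 => ->; rewrite ltxx.
have ipc (r : R) : 0 < cRe (c0 + r%:C * c1) -> cintegrable hl
    (fun x : R => (x `^ k)%:C * expC (x%:C * - (c0 + r%:C * c1))).
  by move=> rc; have := cintegrable_powexp k1 rc; rewrite addrK.
have -> : - (k%:C * c1 / c) * Lap k c =
    cint hl (fun x => - c1 * ((x `^ k)%:C * expC (x%:C * - c))).
  rewrite cintZl; last exact: ipc.
  have := Lap_parts k0 h0; rewrite [in Lap (k + 1) c]/Lap addrK => h.
  apply: (mulfI cn0); rewrite [RHS]mulrCA h; field => //.
pose dl := cRe c / (2 * (cabs c1 + 1)).
have c10 : 0 < cabs c1 + 1 by rewrite ltr_wpDl ?cabs_ge0.
have dl0 : 0 < dl by rewrite divr_gt0// mulr_gt0.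
have Rec r : t - dl < r < t + dl -> cRe c / 2 <= cRe (c0 + r%:C * c1).
  move=> /andP[r1 r2].
  have -> : c0 + r%:C * c1 = c + (r - t)%:C * c1 by rewrite /c CB; ring.
  rewrite cReD.
  have h : `|cRe ((r - t)%:C * c1)| <= dl * (cabs c1 + 1).
    rewrite (le_trans (Re_cabs _))// cabsM cabsC ler_pM ?cabs_ge0//.
      by rewrite ler_norml; apply/andP; split; lra.
    by rewrite lerDl.
  have e : dl * (cabs c1 + 1) = cRe c / 2 by rewrite /dl; field; rewrite gt_eqF.
  move: h; rewrite e ler_norml => /andP[h _]; lra.
have c2 : 0 < cRe c / 2 by rewrite divr_gt0.
have Rec0 r : t - dl < r < t + dl -> 0 < cRe (c0 + r%:C * c1).
  by move=> /Rec; exact: lt_le_trans.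
have mono (r x : R) : t - dl < r < t + dl -> 0 < x ->
    expR (- (cRe (c0 + r%:C * c1) * x)) <= expR (- (cRe c / 2 * x)).
  by move=> rt x0; rewrite ler_expR lerN2 ler_wpM2r ?Rec// ltW.
apply: (@cderive_cint_hl _ (fun s x => (x `^ (k - 1))%:C * expC (x%:C * - (c0 + s%:C * c1)))
  (fun s x => - c1 * ((x `^ k)%:C * expC (x%:C * - (c0 + s%:C * c1))))
  (fun x => cabs c1 * (x `^ k * expR (- (cRe c / 2 * x)))) t (t - dl) (t + dl)).
- by apply/andP; split; lra.
- by move=> r rt; exact: cintegrable_powexp k0 (Rec0 r rt).
- by apply: cmeasM; [exact: cmeas_cst|exact: cmeas_powexp].
- move=> r x rt x0.
  apply: (@eq_cderive _ (fun s : R => ((x `^ (k - 1))%:C * expC (x%:C * - c0)) * expC (s%:C * (- x%:C * c1)))).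
    move=> q; rewrite -mulrA -expCD; congr (_ * expC _); ring.
  apply: (cderive_eq (cderiveZ _ (cderive_expi _ _))).
  rewrite (powR_predM k x0) CM.
  have -> : x%:C * - (c0 + r%:C * c1) = x%:C * - c0 + r%:C * (- x%:C * c1) by ring.
  by rewrite expCD; ring.
- have := integrable_powexp k1 c2; rewrite addrK => h.
  by have := integrableZl measurableT (cabs c1) h.
- move=> r x rt x0; rewrite cabsM cabsN cabs_powexp ler_wpM2l ?cabs_ge0//.
  by rewrite ler_wpM2l ?powR_ge0// mono.
Qed.

Lemma Lap1 (k : R) : Lap k 1 = (gamma_fun k)%:C.
Proof.
rewrite gamma_funE -cintC; apply: eq_cint => x.
rewrite /powexp CM; congr (_ * _); rewrite /expC mulrN1 cReN cImN/= oppr0 cos0 sin0.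
by rewrite mulr1.
Qed.

Lemma cReNiM (w : R[i]) : cRe (- 'i * w) = cIm w.
Proof. by rewrite mulNr cReN cReM cRei cImi; ring. Qed.

(** Both sides, as functions of [t], solve the same linear equation: the
    logarithmic derivative of [Lap k] at [c] is [- k / c]. *)
Lemma Lap_scale (k : R) (w : R[i]) (t : R) : 0 < k -> 0 < cIm w -> 0 <= t ->
  Lap k (- 'i * w) * Lap k (1 + t%:C * ('i / w)) =
  (gamma_fun k)%:C * Lap k (- 'i * w + t%:C).
Proof.
move=> k0 w0 t0; have wn0 := Im_neq0 w0.
have n0 : 0 < cabs w ^+ 2 by rewrite exprn_gt0// cabs_gt0.
have Re1 (s : R) : 0 <= s -> 0 < cRe (1 + s%:C * ('i / w)).
  move=> s0; rewrite !cE cReV cImV /= .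
  have h : 0 <= s * (cIm w / cabs w ^+ 2) by rewrite mulr_ge0// divr_ge0// ltW.
  have -> : 1 + (s * (0 * (cRe w / cabs w ^+ 2) - 1 * (- cIm w / cabs w ^+ 2)) -
    0 * (0 * (- cIm w / cabs w ^+ 2) + 1 * (cRe w / cabs w ^+ 2))) = 1 + s * (cIm w / cabs w ^+ 2).
    by ring.
  lra.
have Re2 (s : R) : 0 <= s -> 0 < cRe (- 'i * w + s%:C * 1).
  by move=> s0; rewrite mulr1 cReD cReC cReNiM; lra.
pose Z (s : R) := Lap k (- 'i * w) * Lap k (1 + s%:C * ('i / w)) -
  (gamma_fun k)%:C * Lap k (- 'i * w + s%:C * 1).
suff : Z t = 0 by move/eqP; rewrite subr_eq0 mulr1 => /eqP.
pose q (s : R) : R[i] := - (k%:C / (- 'i * w + s%:C * 1)).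
apply: (@dissipative_eq0 _ Z q) => //.
- move=> s /andP[s0 _].
  apply: (cderive_eq (cderiveB (cderiveZ _ (cderive_Lap k0 (Re1 s s0)))
    (cderiveZ _ (cderive_Lap k0 (Re2 s s0))))).
  have i2 : 'i * 'i = -1 :> R[i] by rewrite -expr2 sqr_i.
  have e : 'i / w / (1 + s%:C * ('i / w)) = (- 'i * w + s%:C * 1)^-1.
    have := Re1 s s0; have := Re2 s s0.
    set x := 1 + _; set y := - 'i * w + _ => y0 x0.
    have xn : x != 0 by apply: contraTneq x0 => ->; rewrite ltxx.
    have yn : y != 0 by apply: contraTneq y0 => ->; rewrite ltxx.
    have yx : y * ('i / w) = x.
      rewrite /y /x mulr1 mulrDl; congr (_ + _).
      by rewrite mulNr mulNr mulrACA mulfV// mulr1 i2 opprK.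
    by apply: (mulfI yn); rewrite mulfV// mulrA yx divff.
  rewrite /q /Z -[k%:C * ('i / w) / _]mulrA e !mulr1; ring.
- move=> s /andP[s0 _]; rewrite /q cReN cReM cReC cImC mul0r subr0 cReV oppr_le0.
  apply: mulr_ge0; [exact: ltW|apply: divr_ge0; [apply: ltW; exact: Re2|exact: sqr_ge0]].
- rewrite /Z !mul0r !addr0 mulrC.
  by rewrite Lap1 subrr.
Qed.

End characteristic_functions.

(** * Quadratic functionals *)

Section quadratic.
Context {R : realType}.
Local Notation leb := (@lebesgue_measure R).
Local Notation hl := (@hl R).

(** The ring and the field of complex numbers carry two convertible conjugations. *)
Lemma conjcE (z : R[i]) : Num.conj z = conjc z. Proof. by []. Qed.

Lemma cabs_expCB (a b : R[i]) : cRe a <= 0 -> cRe b <= 0 ->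
  cabs (expC a - expC b) <= cabs (a - b).
Proof.
move=> a0 b0; pose l := (expC a - expC b)^*.
pose f (t : R) : R[i] := l * expC (b + t%:C * (a - b)).
have df (t : R) : is_cderive f t (l * ((a - b) * expC (b + t%:C * (a - b)))).
  by apply: cderiveZ; apply: cderive_expC; exact: cderive_lin.
have dRf (t : R) : is_derive t 1 (fun t => cRe (f t)) (cRe (l * ((a - b) * expC (b + t%:C * (a - b))))).
  by case: (df t).
have hc : {within `[0, 1], continuous (fun t => cRe (f t))}.
  by apply: continuous_in_subspaceT => t _; exact: is_derive_continuous (dRf t).
have [t t01 e] := MVT ltr01 (fun t _ => dRf t) hc.
have {e} : cabs (expC a - expC b) ^+ 2 = cRe (l * ((a - b) * expC (b + t%:C * (a - b)))).
  rewrite subr0 mulr1 in e; rewrite -e /f mul1r mul0r addr0 [b + _]addrC subrK.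
  by rewrite -cReB -mulrBr /l mulrC mulJ cReC.
have /andP[t0 t1] : 0 < t < 1 by move: t01; rewrite in_itv.
move=> e; have : cabs (expC a - expC b) ^+ 2 <= cabs (expC a - expC b) * cabs (a - b).
  rewrite e; apply: le_trans (le_trans (ler_norm _) (Re_cabs _)) _.
  rewrite cabsM [cabs ((a - b) * _)]cabsM cabs_expC /l cabsJ.
  apply: ler_wpM2l; [exact: cabs_ge0|apply: ler_piMr; first exact: cabs_ge0].
  rewrite -[leRHS]expR0 ler_expR.
  rewrite cReD cReM cReC cImC mul0r subr0 cReB.
  have -> : cRe b + t * (cRe a - cRe b) = t * cRe a + (1 - t) * cRe b by ring.
  have h1 : t * cRe a <= 0 by rewrite mulr_ge0_le0// ltW.
  have h2 : (1 - t) * cRe b <= 0 by rewrite mulr_ge0_le0// subr_ge0 ltW.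
  lra.
have := cabs_ge0 (expC a - expC b); have := cabs_ge0 (a - b).
set x := cabs (expC a - expC b); set y := cabs (a - b) => y0 x0 h.
by rewrite leNgt; apply/negP => yx; nra.
Qed.

Lemma jensen_sqr d (T : measurableType d) (mu : {measure set T -> \bar R}) (f : T -> R[i]) :
  mu setT = 1%E -> cintegrable mu f ->
  mu.-integrable setT (fun x => (cabs (f x) ^+ 2)%:E) ->
  cabs (cint mu f) ^+ 2 <= \int[mu]_x cabs (f x) ^+ 2.
Proof.
move=> mu1 fi f2i; set A := cabs (cint mu f).
have A0 : 0 <= A by exact: cabs_ge0.
have Ai : mu.-integrable setT (fun x => (A ^+ 2)%:E).
  apply/integrableP; split; first exact/measurable_EFinP/measurable_cst.
  by rewrite integral_cst//= mu1 mule1 ltry.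
have h1 : A <= \int[mu]_x cabs (f x) by exact: cabs_cint.
have fci := cintegrable_cabs fi.
have h2 : \int[mu]_x (2 * A * cabs (f x)) <= \int[mu]_x (A ^+ 2 + cabs (f x) ^+ 2).
  apply: le_Rintegral => //.
  - by have := integrableZl measurableT (2 * A) fci.
  - by have := integrableD measurableT Ai f2i.
  - by move=> x _; have := sqr_ge0 (A - cabs (f x)); lra.
move: h2; rewrite RintegralZl// RintegralD//.
have -> : \int[mu]_x A ^+ 2 = A ^+ 2.
  by rewrite /Rintegral integral_cst//= mu1 mule1.
have : 2 * A * A <= 2 * A * \int[mu]_x cabs (f x) by rewrite ler_wpM2l// mulr_ge0.
move=> h2 h3; have h4 := le_trans h2 h3.
have : A ^+ 2 + A ^+ 2 <= A ^+ 2 + \int[mu]_x cabs (f x) ^+ 2.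
  by apply: le_trans h4; rewrite le_eqVlt; apply/orP; left; apply/eqP; ring.
by rewrite lerD2l.
Qed.

(** The Cauchy-Schwarz inequality for the integral of [M] over [0, q]. *)
Lemma cderive_sqr_le (N M : R -> R[i]) (q : R) : 0 < q ->
  (forall s : R, 0 <= s -> is_cderive N s (M s)) ->
  (forall s : R, 0 <= s -> exists b, is_cderive M s b) ->
  cmeas M -> hl.-integrable setT (fun s => (cabs (M s) ^+ 2)%:E) ->
  cabs (N q - N 0) ^+ 2 <= q * \int[hl]_s cabs (M s) ^+ 2.
Proof.
move=> q0 dN dM mM iM; set A := N q - N 0.
pose f s := cRe (A^* * M s).
have df (s : R) : 0 <= s -> is_derive s 1 (fun s => cRe (A^* * N s)) (f s).
  by move=> s0; have [] := cderiveZ A^* (dN s s0).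
have cf (s : R) : 0 <= s -> {for s, continuous f}.
  by move=> /dM[b /(cderiveZ A^*)[] /is_derive_continuous].
have mf : measurable_fun setT f.
  by apply: cmeas_Re; apply: cmeasM => //; exact: cmeas_cst.
have cw : {within `[0, q], continuous f}.
  apply: continuous_in_subspaceT => s; rewrite inE/= in_itv/= => /andP[s0 _].
  exact: cf.
have D1 : measurable (`]0, q]%classic : set R) by exact: measurable_itv.
have D0 : measurable (`[0, q]%classic : set R) by exact: measurable_itv.
have fi : leb.-integrable `[0, q] (fun s => (f s)%:E).
  by apply: continuous_compact_integrable => //; exact: segment_compact.
have e : \int[leb]_(s in `[0, q]) f s = cabs A ^+ 2.
  transitivity (cRe (A^* * N q) - cRe (A^* * N 0)).
    2: by rewrite -cReB -mulrBr mulrC mulJ cReC.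
  apply: (@improper_FTC _ _ _ (fun s => cRe (A^* * N s)) (fun=> 0) (fun=> q)) => //.
  - by move=> s /=; rewrite in_itv/= => ?; apply: nearW.
  - by move=> s /=; rewrite in_itv/= => /andP[s0 _]; exact: df.
  - by move=> s /=; rewrite in_itv/= => /andP[s0 _]; exact: cf.
  - exact: cvg_cst.
  - exact: cvg_cst.
have m2 := measurable_cabs2 mM.
have i2' : leb.-integrable `]0, q] (fun s => (cabs (M s) ^+ 2)%:E).
  move/(integrable_hl m2): (iM); apply: integrableS => //.
  by move=> s /=; rewrite !in_itv/= => /andP[-> _].
have i3 : leb.-integrable `]0, q] (fun s => (q / 2 * cabs (M s) ^+ 2)%:E).
  have -> : (fun s => (q / 2 * cabs (M s) ^+ 2)%:E) =
    (fun s => (q / 2)%:E * (cabs (M s) ^+ 2)%:E)%E by [].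
  exact: integrableZl.
pose g s := cabs A ^+ 2 / (2 * q) + q / 2 * cabs (M s) ^+ 2.
have h1 : \int[leb]_(s in `[0, q]) f s = \int[leb]_(s in `]0, q]) f s.
  rewrite /Rintegral -integral_itv_obnd_cbnd//; exact/measurable_EFinP/measurable_funTS.
have ci : leb.-integrable `]0, q] (fun s => (cabs A ^+ 2 / (2 * q))%:E).
  apply/integrableP; split; first exact/measurable_EFinP/measurable_cst.
  by rewrite integral_cst//= lebesgue_measure_itv/= lte_fin q0 -EFinB -EFinM ltry.
have h2 : \int[leb]_(s in `]0, q]) f s <= \int[leb]_(s in `]0, q]) g s.
  apply: le_Rintegral => //.
  - by apply: integrableS fi => // s /=; rewrite !in_itv/= => /andP[/ltW -> ->].
  - have ii : leb.-integrable `]0, q] (fun s => (q / 2 * cabs (M s) ^+ 2)%:E).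
      exact: i3.
    have -> : EFin \o g = fun s => ((cabs A ^+ 2 / (2 * q))%:E + (q / 2 * cabs (M s) ^+ 2)%:E)%E by [].
    exact: integrableD.
  - move=> s _; rewrite /f /g (le_trans (le_trans (ler_norm _) (Re_cabs _)))// cabsM cabsJ.
    have := sqr_ge0 (cabs A - q * cabs (M s)) => h.
    have e2 : (cabs A - q * cabs (M s)) ^+ 2 / (2 * q) =
      cabs A ^+ 2 / (2 * q) + q / 2 * cabs (M s) ^+ 2 - cabs A * cabs (M s).
      by field; rewrite gt_eqF.
    by rewrite -subr_ge0 -e2 divr_ge0// mulr_ge0// ltW.
have h3 : \int[leb]_(s in `]0, q]) g s = cabs A ^+ 2 / 2 + q / 2 * \int[leb]_(s in `]0, q]) cabs (M s) ^+ 2.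
  transitivity (\int[leb]_(s in `]0, q]) (cabs A ^+ 2 / (2 * q)) +
      \int[leb]_(s in `]0, q]) (q / 2 * cabs (M s) ^+ 2)).
    exact: RintegralD.
  congr (_ + _); last exact: RintegralZl.
  rewrite /Rintegral integral_cst//= lebesgue_measure_itv/= lte_fin q0 -EFinB -EFinM/= subr0.
  by field; rewrite gt_eqF.
have h4 : \int[leb]_(s in `]0, q]) cabs (M s) ^+ 2 <= \int[hl]_s cabs (M s) ^+ 2.
  rewrite Rintegral_hl// /Rintegral.
  have le : (\int[leb]_(s in `]0%R, q]) (cabs (M s) ^+ 2)%:E <=
      \int[leb]_(s in `]0%R, +oo[) (cabs (M s) ^+ 2)%:E)%E.
    apply: ge0_subset_integral => //.
    - exact/measurable_EFinP/measurable_funTS.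
    - by move=> s _; rewrite lee_fin sqr_ge0.
    - by move=> s /=; rewrite !in_itv/= => /andP[-> _].
  apply: fine_le => //; apply: integrable_fin_num => //.
  exact/integrable_hl.
have : cabs A ^+ 2 <= cabs A ^+ 2 / 2 + q / 2 * \int[hl]_s cabs (M s) ^+ 2.
  rewrite -{1}e h1 (le_trans h2)// h3 lerD2l ler_wpM2l// divr_ge0// ltW//.
lra.
Qed.

(** Square-integrable on the half-line, and a common bound for the integrands to which
    Fubini's theorem is applied. *)
Definition env (s : R) : R := (1 + s)^-1.

Lemma measurable_env : measurable_fun setT env.
Proof.
have := @cmeas_Re _ _ _ _ (cmeasV (cmeasC (measurable_funD (measurable_cst (1 : R)) (@measurable_id _ (measurableTypeR R) setT)))).
by congr measurable_fun; apply/funext => s; rewrite -CV.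
Qed.

Lemma integrable_env2 : hl.-integrable setT (fun s => (env s ^+ 2)%:E).
Proof.
have n0 (x : R) : 0 <= x -> 1 + x != 0 by move=> x0; rewrite gt_eqF// ltr_pwDl.
have d1 (x : R) : 0 <= x -> is_derive x 1 (fun x => 1 + x) 1.
  by move=> _; apply: (rderive_eq (rderiveD (rderive_cst x 1) (rderive_id x))); rewrite add0r.
have dE (x : R) : 0 <= x -> is_derive x 1 (fun x => - env x) (env x ^+ 2).
  move=> x0; apply: (rderive_eq (rderiveN (rderiveV (n0 x x0) (d1 x x0)))).
  by rewrite /env; field; exact: n0.
have [//] : hl.-integrable setT (fun s => (env s ^+ 2)%:E) /\
  \int[hl]_x (env x ^+ 2) = 0 - - env 0.
apply: (@ge0_FTC0y R (fun s => env s ^+ 2) (fun x => - env x) (- env 0) 0).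
- by apply: measurable_funX; exact: measurable_env.
- by move=> x x0; apply: dE; exact: ltW.
- move=> x x0.
  have h := rderive_sqr (rderiveV (n0 x (ltW x0)) (d1 x (ltW x0))).
  exact: is_derive_continuous h.
- by move=> x _; exact: sqr_ge0.
- by apply: cvg_at_right_filter; exact: is_derive_continuous (dE 0 (lexx _)).
- apply: (@cvg0_le _ _ _ _ _ (fun x => x^-1)).
    near=> x; have x0 : 0 < x by near: x; exact: nbhs_pinfty_gt.
    rewrite normrN ger0_norm /env; last by rewrite invr_ge0 addr_ge0// ltW.
    by rewrite lef_pV2 ?posrE// ?addr_gt0// lerDr.
  apply/gtr0_cvgV0; last exact: cvg_id.
  by near=> x; near: x; exact: nbhs_pinfty_gt.
Unshelve. all: by end_near. Qed.

End quadratic.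

Section kernels.
Context {R : realType} {d1 d2 : measure_display} {S : measurableType d1} {X : measurableType d2}.
Variables (s1 : {sigma_finite_measure set S -> \bar R}) (m : {sigma_finite_measure set X -> \bar R}).

(** Fubini's theorem for the square of an integral: it depends on [F] only through the
    kernel formed by integrating over [s1]. *)
Lemma kernel_sqr (F : S * X -> R[i]) (e : S -> R) (q : X -> R) :
  cmeas F -> (forall s, 0 <= e s) -> (forall x, 0 <= q x) ->
  s1.-integrable setT (fun s => (e s ^+ 2)%:E) -> m.-integrable setT (fun x => (q x)%:E) ->
  (forall s x, cabs (F (s, x)) <= e s * q x) ->
  s1.-integrable setT (fun s => (cabs (cint m (fun x => F (s, x))) ^+ 2)%:E) /\
  (\int[s1]_s (cabs (cint m (fun x => F (s, x))) ^+ 2))%:C =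
  cint m (fun x => cint m (fun y => cint s1 (fun s => F (s, x) * (F (s, y))^*))).
Proof.
move=> mF e0 q0 ie iq Feq.
have mq : measurable_fun setT q by move/measurable_int: (iq) => /measurable_EFinP.
have mp (h : S * X -> R[i]) s : cmeas h -> cmeas (fun x => h (s, x)).
  by move=> mh; apply: (cmeas_comp mh); exact: pair1_measurable.
have iF s : cintegrable m (fun x => F (s, x)).
  apply: (@le_cintegrable _ _ _ _ _ (fun x => e s * q x)) => //; first exact: mp.
  by have := integrableZl measurableT (e s) iq.
pose Q := \int[m]_x q x.
have Q0 : 0 <= Q by apply: Rintegral_ge0.
have nuQ s : cabs (cint m (fun x => F (s, x))) <= e s * Q.
  rewrite (le_trans (cabs_cint (iF s)))// /Q -RintegralZl//.
  apply: le_Rintegral => //; first exact: cintegrable_cabs.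
  by have := integrableZl measurableT (e s) iq.
have mnu : cmeas (fun s => cint m (fun x => F (s, x))) by exact: cmeas_cint1.
have i2 : s1.-integrable setT (fun s => (cabs (cint m (fun x => F (s, x))) ^+ 2)%:E).
  have := integrableZl measurableT (Q ^+ 2) ie; apply: le_integrable => //.
    by apply/measurable_EFinP; exact: measurable_cabs2.
  move=> s _; rewrite /= lee_fin !ger0_norm ?sqr_ge0 ?mulr_ge0 ?sqr_ge0//.
  by rewrite -exprMn lerXn2r ?nnegrE ?cabs_ge0 ?mulr_ge0// mulrC.
split=> //; rewrite -cintC.
have mFJ (s : S) : cintegrable m (fun y => (F (s, y))^*) by exact: cintegrableJ.
transitivity (cint s1 (fun s => cint m (fun x => F (s, x) * cint m (fun y => (F (s, y))^*)))).
  by apply: eq_cint => s; rewrite cintZr// cintJ mulJ.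
have mG : cmeas (fun z : S * X => F z * (cint m (fun y => F (z.1, y)))^*).
  apply: cmeasM => //; apply: cmeasJ.
  by apply: (cmeas_comp (f := fun s => cint m (fun x => F (s, x)))) => //; exact: measurable_fst.
have iG : cintegrable (s1 \x m)%E (fun z : S * X => F z * (cint m (fun y => F (z.1, y)))^*).
  apply: (@cintegrable_prod _ _ _ _ _ _ _ _ (fun s => e s ^+ 2) (fun x => Q * q x)) => //.
  - by move=> s; exact: sqr_ge0.
  - by move=> x; exact: mulr_ge0.
  - by have := integrableZl measurableT Q iq.
  - move=> s x; rewrite cabsM cabsJ/=.
    apply: (@le_trans _ _ ((e s * q x) * (e s * Q))).
      by rewrite ler_pM ?cabs_ge0.
    by rewrite le_eqVlt; apply/orP; left; apply/eqP; ring.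
have := cint_fubini iG => /= h.
transitivity (cint s1 (fun s => cint m (fun x => F (s, x) * (cint m (fun y => F (s, y)))^*))).
  by apply: eq_cint => s; apply: eq_cint => x; rewrite cintJ.
rewrite h; apply: eq_cint => x.
have iH : cintegrable (s1 \x m)%E (fun z : S * X => F (z.1, x) * (F z)^*).
  apply: (@cintegrable_prod _ _ _ _ _ _ _ _ (fun s => e s ^+ 2) (fun y => q x * q y)) => //.
  - apply: cmeasM; last exact: cmeasJ.
    apply: (cmeas_comp (f := F) (u := fun z : S * X => (z.1, x))) => //.
    by apply: measurable_fun_pair => //; exact: measurable_fst.
  - by move=> s; exact: sqr_ge0.
  - by move=> y; exact: mulr_ge0.
  - by have := integrableZl measurableT (q x) iq.
  - move=> s y; rewrite cabsM cabsJ/=.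
    apply: (@le_trans _ _ ((e s * q x) * (e s * q y))).
      by rewrite ler_pM ?cabs_ge0.
    by rewrite le_eqVlt; apply/orP; left; apply/eqP; ring.
have h2 := cint_fubini iH; apply: etrans h2; apply: eq_cint => s.
by rewrite conjcE -cintJ -cintZl.
Qed.

End kernels.

(** * The wave kernels *)

HB.lock Definition wave {R : realType} (s : R) (w : R[i]) : R[i] := expC (s%:C * ('i * w)).

Section waves.
Context {R : realType}.
Implicit Types (s : R) (w : R[i]).
Local Notation hl := (@hl R).

Lemma waveE s w : wave s w = expC (s%:C * ('i * w)). Proof. by rewrite unlock. Qed.

Lemma cabs_wave s w : cabs (wave s w) = expR (- (cIm w * s)).
Proof. by rewrite waveE; exact: cabs_expi. Qed.

Lemma cabs_wave_le1 s w : 0 <= s -> 0 <= cIm w -> cabs (wave s w) <= 1.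
Proof. by move=> s0 w0; rewrite cabs_wave -[leRHS]expR0 ler_expR oppr_le0 mulr_ge0. Qed.

Lemma conjcB (z w : R[i]) : conjc (z - w) = conjc z - conjc w.
Proof. by apply: complexP; rewrite !(cReJ, cImJ, cReB, cImB)//; ring. Qed.

Lemma cReiM (w : R[i]) : cRe ('i * w) = - cIm w.
Proof. by rewrite cReM cRei cImi; ring. Qed.

Lemma cImiM (w : R[i]) : cIm ('i * w) = cRe w.
Proof. by rewrite cImM cRei cImi; ring. Qed.

Lemma cint0 d (T : measurableType d) (mu : {measure set T -> \bar R}) : cint mu (fun=> 0) = 0.
Proof. by apply: complexP; rewrite ?Re_cint ?Im_cint /= /Rintegral integral0. Qed.

Lemma waveJ s w : (wave s w)^* = wave s (- w^*).
Proof.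
rewrite !waveE expCJ; congr expC; apply: complexP; rewrite !(cReJ, cImJ, cReM, cImM, cRei, cImi, cReN, cImN, cReC, cImC).
  by ring.
by ring.
Qed.

Lemma wave0 w : wave 0 w = 1. Proof. by rewrite waveE mul0r expC0. Qed.

Lemma cmeas_wave (w : R[i]) : cmeas (fun s : R => wave s w).
Proof. by rewrite unlock; exact: cmeas_expi. Qed.

Lemma cderive_wave s w : is_cderive (fun s => wave s w) s ('i * w * wave s w).
Proof. by rewrite unlock; exact: cderive_expi. Qed.

Lemma cderive_wave_arg (p : R -> R[i]) (r s : R) p' : is_cderive p r p' ->
  is_cderive (fun r => wave s (p r)) r (s%:C * ('i * p') * wave s (p r)).
Proof. by move=> dp; rewrite unlock; apply: cderive_expC; do 2 apply: cderiveZ. Qed.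

Lemma subJ_neq0 (w w' : R[i]) : 0 < cIm w -> 0 < cIm w' -> w - w'^* != 0.
Proof. by move=> w0 w0'; apply: Im_neq0; rewrite cImB conjcE cImJ opprK addr_gt0. Qed.

Lemma wave_mulJ s (w w' : R[i]) : wave s w * (wave s w')^* = expC (s%:C * ('i * (w - w'^*))).
Proof. by rewrite conjcE waveJ !waveE -expCD; congr expC; rewrite conjcE; ring. Qed.

(** Up to a constant, the Szego kernel of the upper half-plane. *)
Lemma cint_wave2 (w w' : R[i]) : 0 < cIm w -> 0 < cIm w' ->
  cintegrable hl (fun s => wave s w * (wave s w')^*) /\
  cint hl (fun s => wave s w * (wave s w')^*) = 'i / (w - w'^*).
Proof.
move=> w0 w0'; have h : 0 < cIm (w - w'^*) by rewrite cImB conjcE cImJ opprK addr_gt0.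
have [i1 e1] := cint_expi h.
have -> : (fun s : R => wave s w * (wave s w')^*) = fun s => expC (s%:C * ('i * (w - w'^*))).
  by apply/funext => s; exact: wave_mulJ.
by [].
Qed.

Lemma cabs_waveB s (w w' : R[i]) dl : 0 <= s -> dl <= cIm w -> dl <= cIm w' ->
  cabs (wave s w - wave s w') <= s * cabs (w - w') * expR (- (dl * s)).
Proof.
move=> s0 w0 w0'.
have e v : wave s v = (expR (- (dl * s)))%:C * expC (s%:C * ('i * (v - 'i * dl%:C))).
  have i2 : 'i * 'i = -1 :> R[i] by rewrite -expr2 sqr_i.
  have -> : (expR (- (dl * s)))%:C = expC (- (dl * s))%:C.
    by rewrite /expC cReC cImC cos0 sin0 mulr1.
  rewrite waveE -expCD; congr expC; rewrite CN CM.
  have -> : 'i * (v - 'i * dl%:C) = 'i * v + dl%:C by rewrite mulrBr mulrA i2; ring.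
  by ring.
rewrite !e -mulrBr cabsM cabsC ger0_norm ?expR_ge0// mulrC ler_wpM2r ?expR_ge0//.
have Rle v : dl <= cIm v -> cRe (s%:C * ('i * (v - 'i * dl%:C))) <= 0.
  move=> h; rewrite cReM cReC cImC cReiM cImB cImiM cReC.
  have := mulr_ge0 s0 (_ : 0 <= cIm v - dl); rewrite subr_ge0 h => /(_ isT).
  lra.
apply: le_trans (cabs_expCB (Rle _ w0) (Rle _ w0')) _.
have -> : s%:C * ('i * (w - 'i * dl%:C)) - s%:C * ('i * (w' - 'i * dl%:C)) = s%:C * ('i * (w - w')).
  by ring.
by rewrite !cabsM cabsC cabsi mul1r ger0_norm.
Qed.

(** Differentiating a Frullani integral removes its singular weight. *)
Lemma cderive_frullani (p p' : R -> R[i]) (v w1 w2 : R[i]) (a lo hi C : R) :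
  lo < a < hi -> (forall r : R, lo < r < hi -> is_cderive p r (p' r)) ->
  (forall r : R, lo < r < hi -> 0 < cIm (p r)) -> (forall r : R, lo < r < hi -> cabs (p' r) <= C) ->
  0 < cIm v -> 0 < cIm w1 -> 0 < cIm w2 ->
  is_cderive (fun r => cint hl (fun s =>
      (wave s (p r) - wave s v) * ((wave s w1 - wave s w2)^* * (s^-1)%:C))) a
    ('i * p' a * ('i / (p a - w1^*) - 'i / (p a - w2^*))).
Proof.
move=> aI dp pI p'C v0 w10 w20.
pose H s : R[i] := (wave s w1 - wave s w2)^*.
have mH : cmeas H by apply: cmeasJ; apply: cmeasB; exact: cmeas_wave.
have [i1 e1] := cint_wave2 (pI a aI) w10; have [i2 e2] := cint_wave2 (pI a aI) w20.
have mV : cmeas (fun s : R => (s^-1)%:C).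
  have := cmeasV (@cmeas_id R); congr cmeas; by apply/funext => s; rewrite CV.
have -> : 'i * p' a * ('i / (p a - w1^*) - 'i / (p a - w2^*)) =
    cint hl (fun s => 'i * p' a * (wave s (p a) * H s)).
  rewrite -e1 -e2 -cintB// -cintZl; last exact: cintegrableB.
  by apply: eq_cint => s; congr (_ * _); rewrite /H conjcB mulrBr.
pose dl := Num.min (cIm w1) (cIm w2).
have dl0 : 0 < dl by rewrite lt_min w10.
have [ie _] := integrable_expRN dl0.
apply: (@cderive_cint_hl _ (fun r s => (wave s (p r) - wave s v) * (H s * (s^-1)%:C))
  (fun r s => 'i * p' r * (wave s (p r) * H s)) (fun s => C * (2 * expR (- (dl * s)))) a lo hi) => //.
- move=> r rI.
  apply: (@le_cintegrable_hl _ _ (fun s => 2 * cabs (w1 - w2) * expR (- (dl * s)))).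
  + apply: cmeasM; last exact: cmeasM.
    by apply: cmeasB; exact: cmeas_wave.
  + by have := integrableZl measurableT (2 * cabs (w1 - w2)) ie.
  + move=> s s0; rewrite !cabsM cabsJ cabsC ger0_norm; last by rewrite invr_ge0 ltW.
    have h1 : cabs (wave s (p r) - wave s v) <= 2.
      rewrite (le_trans (cabsB _ _))// -[leRHS]/(1 + 1) lerD// cabs_wave_le1 ?ltW//.
      exact: pI.
    have h2 : cabs (wave s w1 - wave s w2) / s <= cabs (w1 - w2) * expR (- (dl * s)).
      rewrite ler_pdivrMr// mulrC mulrA; apply: cabs_waveB; first exact: ltW.
      * by rewrite ge_min lexx.
      * by rewrite ge_min lexx orbT.
    rewrite -mulrA; apply: ler_pM => //; first exact: cabs_ge0.
    by rewrite mulr_ge0 ?cabs_ge0// invr_ge0 ltW.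
- apply: cmeasM; first exact: cmeas_cst.
  by apply: cmeasM => //; exact: cmeas_wave.
- move=> r s rI s0.
  apply: (cderive_eq (cderiveM (cderiveB (cderive_wave_arg s (dp r rI)) (cderive_cst r _)) (cderive_cst r (H s * (s^-1)%:C)))).
  have h : s%:C * (s^-1)%:C = 1 by rewrite -CM mulfV ?gt_eqF.
  rewrite subr0 mulr0 addr0.
  transitivity ('i * p' r * (wave s (p r) * H s) * (s%:C * (s^-1)%:C)); first by ring.
  by rewrite h mulr1.
- have := integrableZl measurableT (C * 2) ie.
  by apply: eq_integrable => // s _; rewrite /= -EFinM mulrA.
- move=> r s rI s0; rewrite !cabsM cabsi mul1r cabsJ.
  apply: ler_pM; rewrite ?cabs_ge0 ?mulr_ge0 ?cabs_ge0 ?p'C//.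
  have s0' := ltW s0.
  rewrite -[leRHS]mul1r; apply: ler_pM; rewrite ?cabs_ge0//.
    by apply: cabs_wave_le1 => //; apply: ltW; exact: pI.
  rewrite (le_trans (cabsB _ _))// !cabs_wave mulr_natl mulr2n lerD// ler_expR lerN2 ler_wpM2r//.
  + by rewrite ge_min lexx.
  + by rewrite ge_min lexx orbT.
Qed.

Lemma Im_gdiv (g : R) (u : R[i]) : 0 < g -> 0 < cIm u -> 0 < cIm (- (g%:C / u)).
Proof.
move=> g0 u0; rewrite cImN cImM cReC cImC cImV mul0r addr0 -mulrN mulNr opprK.
by rewrite mulr_gt0// divr_gt0// exprn_gt0// cabs_gt0 Im_neq0.
Qed.

(** The inversion [u |-> - g / u] preserves the singular kernel: along a path
    both integrals have the same derivative. *)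
Lemma frullani_inv (g : R) (u v u' v' : R[i]) : 0 < g ->
  0 < cIm u -> 0 < cIm v -> 0 < cIm u' -> 0 < cIm v' ->
  cint hl (fun s => (wave s (- (g%:C / u)) - wave s (- (g%:C / v))) *
    ((wave s (- (g%:C / u')) - wave s (- (g%:C / v')))^* * (s^-1)%:C)) =
  cint hl (fun s => (wave s u - wave s v) * ((wave s u' - wave s v')^* * (s^-1)%:C)).
Proof.
move=> g0 u0 v0 u0' v0'.
pose p (r : R) : R[i] := v + r%:C * (u - v).
pose y := Num.min (cIm u) (cIm v).
have y0 : 0 < y by rewrite lt_min u0.
pose de := y / (2 * (cabs (u - v) + 1)).
have uv0 : 0 < cabs (u - v) + 1 by rewrite ltr_wpDl ?cabs_ge0.
have de0 : 0 < de by rewrite divr_gt0// mulr_gt0.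
have pI (r r' : R) : 0 <= r <= 1 -> r - de < r' < r + de -> y / 2 <= cIm (p r').
  move=> /andP[r0 r1] /andP[h1 h2].
  have h3 : y <= cIm (p r).
    have hu : y <= cIm u by rewrite ge_min lexx.
    have hv : y <= cIm v by rewrite ge_min lexx orbT.
    rewrite /p cImD cImM cReC cImC mul0r addr0 cImB.
    have : 0 <= r * (cIm u - y) by rewrite mulr_ge0// subr_ge0.
    have : 0 <= (1 - r) * (cIm v - y) by rewrite mulr_ge0// subr_ge0.
    nra.
  have h4 : `|cIm ((r' - r)%:C * (u - v))| <= de * (cabs (u - v) + 1).
    rewrite (le_trans (Im_cabs _))// cabsM cabsC ler_pM ?cabs_ge0//.
      by rewrite ler_norml; apply/andP; split; lra.
    by rewrite lerDl.
  have e : de * (cabs (u - v) + 1) = y / 2 by rewrite /de; field; rewrite gt_eqF.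
  have -> : p r' = p r + (r' - r)%:C * (u - v) by rewrite /p CB; ring.
  rewrite cImD; move: h4; rewrite e ler_norml => /andP[h4 _]; lra.
pose A r := cint hl (fun s => (wave s (- (g%:C / p r)) - wave s (- (g%:C / v))) *
    ((wave s (- (g%:C / u')) - wave s (- (g%:C / v')))^* * (s^-1)%:C)).
pose B r := cint hl (fun s => (wave s (p r) - wave s v) * ((wave s u' - wave s v')^* * (s^-1)%:C)).
pose Z r := A r - B r.
suff : Z 1 = 0.
  by move/eqP; rewrite subr_eq0 /A /B /p mul1r [v + _]addrC subrK => /eqP.
apply: (@dissipative_eq0 _ Z (fun=> 0)) => //; last 1 first.
- have z0 (f h : R -> R[i]) : cint hl (fun s => (f s - f s) * h s) = 0.
    by rewrite -[RHS](cint0 hl); apply: eq_cint => s; rewrite subrr mul0r.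
  by rewrite /Z /A /B /p mul0r addr0 !z0 subrr.
- move=> r r01; rewrite mul0r.
  have rI : r - de < r < r + de by apply/andP; split; lra.
  have p0 r' : r - de < r' < r + de -> 0 < cIm (p r').
    by move=> /(pI r r' r01); apply: lt_le_trans; rewrite divr_gt0.
  have pn0 r' : r - de < r' < r + de -> p r' != 0 by move=> /p0; exact: Im_neq0.
  have dp (r' : R) : is_cderive p r' (u - v) by exact: cderive_lin.
  pose p' r' : R[i] := g%:C * (u - v) / p r' ^+ 2.
  have dq (r' : R) : r - de < r' < r + de -> is_cderive (fun r => - (g%:C / p r)) r' (p' r').
    move=> h; apply: (cderive_eq (cderiveN (cderiveZ g%:C (cderiveV (pn0 r' h) (dp r'))))).
    by rewrite /p'; field; exact: pn0.
  have y2 : 0 < y / 2 by rewrite divr_gt0.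
  have p'C r' : r - de < r' < r + de -> cabs (p' r') <= g * cabs (u - v) / (y / 2) ^+ 2.
    move=> h; rewrite /p' cabsM cabsM cabsC (ger0_norm (ltW g0)) cabsV expr2 cabsM.
    apply: ler_wpM2l; first by rewrite mulr_ge0 ?cabs_ge0// ltW.
    have c0 : 0 < cabs (p r') by rewrite cabs_gt0 pn0.
    rewrite -expr2 lef_pV2 ?posrE ?exprn_gt0// lerXn2r ?nnegrE ?cabs_ge0//; first exact: ltW.
    by rewrite (le_trans (pI r r' r01 h))// Im_le_cabs.
  have dA := cderive_frullani rI dq (fun r' h => Im_gdiv g0 (p0 r' h)) p'C (Im_gdiv g0 v0) (Im_gdiv g0 u0') (Im_gdiv g0 v0').
  have dB := cderive_frullani rI (fun r' _ => dp r') p0 (fun r' _ => lexx (cabs (u - v))) v0 u0' v0'.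
  apply: (cderive_eq (cderiveB dA dB)); apply/eqP; rewrite subr_eq0; apply/eqP.
  have P0 := pn0 r rI; have G0 : g%:C != 0 :> R[i] by rewrite C_eq0 gt_eqF.
  have J0 w : 0 < cIm w -> Num.conj w != 0 :> R[i] by move=> w0; rewrite -cabs_eq0 cabsJ cabs_eq0 Im_neq0.
  have N0 w : 0 < cIm w -> p r - w^* != 0 by move=> w0; exact: subJ_neq0 (p0 r rI) w0.
  have cg : Num.conj g%:C = g%:C :> R[i].
    by rewrite conjcE; apply: complexP; rewrite ?cReJ ?cImJ ?cImC ?oppr0.
  have EJ w : Num.conj (- (g%:C / w)) = - (g%:C / Num.conj w) :> R[i].
    by rewrite rmorphN; congr (- _); rewrite rmorphM fmorphV; congr (_ * _); exact: cg.
  have E w : 0 < cIm w -> 'i / (- (g%:C / p r) - (- (g%:C / w))^*) = 'i * (p r * w^*) / (g%:C * (p r - w^*)).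
    move=> w0; rewrite EJ.
    have -> : - (g%:C / p r) - - (g%:C / w^*) = g%:C * (p r - w^*) / (p r * w^*).
      by field; rewrite P0 J0.
    by rewrite invf_div mulrA.
  rewrite !E// /p'; have := N0 u' u0'; have := N0 v' v0'; have := J0 u' u0'; have := J0 v' v0'.
  move: (Num.conj u') (Num.conj v') (p r) P0 => a b q q0 b0 a0 qb qa.
  by field; rewrite q0 G0 qa qb.
Qed.

End waves.

(** * Transforms under inversion *)

Section wave_transforms.
Context {R : realType}.
Local Notation hl := (@hl R).

Lemma cmeas_wave2 d (T : measurableType d) (f : T -> R) (w : T -> R[i]) :
  measurable_fun setT f -> cmeas w -> cmeas (fun x => wave (f x) (w x)).
Proof.
move=> mf mw; rewrite unlock; apply: cmeas_expC; apply: cmeasM; first exact: cmeasC.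
by apply: cmeasM => //; exact: cmeas_cst.
Qed.

Lemma env_ge0 (s : R) : 0 < s -> 0 <= env s.
Proof. by move=> s0; rewrite invr_ge0 addr_ge0// ltW. Qed.

(** By [kernel_sqr] both square-integrals are the same double integral. *)
Lemma parseval_hl d (X : measurableType d) (m : {sigma_finite_measure set X -> \bar R})
    (F1 F2 : measurableTypeR R * X -> R[i]) (q : X -> R) :
  cmeas F1 -> cmeas F2 -> (forall x, 0 <= q x) -> m.-integrable setT (fun x => (q x)%:E) ->
  (forall (s : R) x, 0 < s -> cabs (F1 (s, x)) <= env s * q x) ->
  (forall (s : R) x, 0 < s -> cabs (F2 (s, x)) <= env s * q x) ->
  (forall x x', cint hl (fun s => F1 (s, x) * (F1 (s, x'))^*) =
                cint hl (fun s => F2 (s, x) * (F2 (s, x'))^*)) ->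
  [/\ hl.-integrable setT (fun s => (cabs (cint m (fun x => F1 (s, x))) ^+ 2)%:E),
      hl.-integrable setT (fun s => (cabs (cint m (fun x => F2 (s, x))) ^+ 2)%:E) &
      \int[hl]_s cabs (cint m (fun x => F1 (s, x))) ^+ 2 =
      \int[hl]_s cabs (cint m (fun x => F2 (s, x))) ^+ 2].
Proof.
move=> mF1 mF2 q0 iq b1 b2 kk.
pose e (s : R) := posind s * env s.
have e0 s : 0 <= e s.
  by rewrite /e /posind; case: ltP => s0; rewrite ?mul0r// mul1r env_ge0.
have me : measurable_fun setT e.
  by apply: measurable_funM; [exact: measurable_posind|exact: measurable_env].
have ie : hl.-integrable setT (fun s => (e s ^+ 2)%:E).
  apply: le_integrable_hl (@integrable_env2 R) _; first exact: measurable_funX.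
  by move=> s s0; rewrite /e /posind s0 mul1r ger0_norm ?sqr_ge0.
have mp : cmeas (fun z : measurableTypeR R * X => (posind z.1)%:C).
  apply: cmeasC; apply: measurableT_comp => //; exact: measurable_posind.
have main (F : measurableTypeR R * X -> R[i]) : cmeas F ->
    (forall (s : R) x, 0 < s -> cabs (F (s, x)) <= env s * q x) ->
    hl.-integrable setT (fun s => (cabs (cint m (fun x => F (s, x))) ^+ 2)%:E) /\
    (\int[hl]_s cabs (cint m (fun x => F (s, x))) ^+ 2)%:C =
    cint m (fun x => cint m (fun x' => cint hl (fun s => F (s, x) * (F (s, x'))^*))).
  move=> mF bF; pose G z := (posind z.1)%:C * F z.
  have mG : cmeas G by exact: cmeasM.
  have bG (s : R) x : cabs (G (s, x)) <= e s * q x.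
    rewrite /G cabsM cabsC/= ger0_norm ?posind_ge0// /e /posind.
    by case: ltP => s0; rewrite ?mul0r// !mul1r bF.
  have [i1 e1] := @kernel_sqr R _ _ _ X hl m G e q mG e0 q0 ie iq bG.
  have mc (H : measurableTypeR R * X -> R[i]) : cmeas H ->
      measurable_fun setT (fun s => cabs (cint m (fun x => H (s, x))) ^+ 2).
    by move=> mH; apply: measurable_cabs2; exact: cmeas_cint1.
  have EG (s : R) : 0 < s -> cint m (fun x => G (s, x)) = cint m (fun x => F (s, x)).
    by move=> s0; apply: eq_cint => x; rewrite /G /posind /= s0 mul1r.
  split.
    apply: le_integrable_hl i1 _; first exact: mc.
    by move=> s s0; rewrite EG// ger0_norm ?sqr_ge0.
  transitivity ((\int[hl]_s cabs (cint m (fun x => G (s, x))) ^+ 2)%:C : R[i]).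
    congr (_ %:C); apply: eq_Rintegral_hl; [exact: mc|exact: mc|].
    by move=> s s0; rewrite EG.
  rewrite e1; apply: eq_cint => x; apply: eq_cint => x'.
  have mx (H : measurableTypeR R * X -> R[i]) z : cmeas H -> cmeas (fun s => H (s, z)).
    move=> mH; apply: (cmeas_comp mH).
    by apply: measurable_fun_pair => //; exact: measurable_cst.
  apply: eq_cint_hl.
  - by apply: cmeasM; [exact: mx|apply: cmeasJ; exact: mx].
  - by apply: cmeasM; [exact: mx|apply: cmeasJ; exact: mx].
  - by move=> s s0; rewrite /G /posind /= s0 !mul1r.
have [i1 e1] := main F1 mF1 b1; have [i2 e2] := main F2 mF2 b2.
split=> //; apply: (@complexI R); rewrite e1 e2.
by apply: eq_cint => x; apply: eq_cint => x'.
Qed.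

Lemma expRN_le (x : R) : 0 < x -> expR (- x) <= x^-1.
Proof.
move=> x0; rewrite expRN lef_pV2 ?posrE ?expR_gt0//.
by apply: le_trans (expR_ge1Dx _); rewrite lerDr.
Qed.

Lemma expRN_le_sqrt (x : R) : 0 < x -> expR (- x) <= (Num.sqrt x)^-1.
Proof.
move=> x0; rewrite expRN lef_pV2 ?posrE ?expR_gt0 ?sqrtr_gt0//.
have h1 : 1 + x <= expR x by exact: expR_ge1Dx.
have h2 : Num.sqrt x ^+ 2 = x by rewrite sqr_sqrtr// ltW.
have := sqr_ge0 (Num.sqrt x - 1); have := sqrtr_ge0 x; nra.
Qed.

Lemma expRN_env (y s : R) : 0 < y -> 0 < s -> expR (- (y * s)) <= env s * (1 + y^-1).
Proof.
move=> y0 s0; rewrite /env ler_pdivlMl; last by rewrite addr_gt0.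
have ys0 : 0 < y * s by rewrite mulr_gt0.
have h1 : expR (- (y * s)) <= 1 by rewrite -[leRHS]expR0 ler_expR oppr_le0 ltW.
have h2 : s * expR (- (y * s)) <= y^-1.
  apply: (@le_trans _ _ (s * (y * s)^-1)); first by rewrite ler_wpM2l ?expRN_le// ltW.
  by rewrite invfM mulrCA mulfV ?mulr1// gt_eqF.
lra.
Qed.

Lemma cint_kernel2 (A B A' B' : R -> R[i]) (b : R) (k l : R[i]) :
  cintegrable hl (fun s => A s * (A' s)^*) -> cintegrable hl (fun s => B s * (A' s)^*) ->
  cintegrable hl (fun s => A s * (B' s)^*) -> cintegrable hl (fun s => B s * (B' s)^*) ->
  cint hl (fun s => (k * (A s - b%:C * B s)) * (l * (A' s - b%:C * B' s))^*) =
  k * l^* * ((cint hl (fun s => A s * (A' s)^*) - b%:C * cint hl (fun s => B s * (A' s)^*)) -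
     b%:C * (cint hl (fun s => A s * (B' s)^*) - b%:C * cint hl (fun s => B s * (B' s)^*))).
Proof.
move=> i1 i2 i3 i4.
rewrite -(cintZl b%:C i2) -(cintZl b%:C i4).
rewrite -cintB//; last exact: cintegrableZl.
rewrite -[X in _ - _ * X]cintB//; last exact: cintegrableZl.
have i12 : cintegrable hl (fun s => A s * (A' s)^* - b%:C * (B s * (A' s)^*)).
  by apply: cintegrableB => //; exact: cintegrableZl.
have i34 : cintegrable hl (fun s => A s * (B' s)^* - b%:C * (B s * (B' s)^*)).
  by apply: cintegrableB => //; exact: cintegrableZl.
rewrite -(cintZl b%:C i34) -cintB//; last exact: cintegrableZl.
rewrite -cintZl; last by apply: cintegrableB => //; exact: cintegrableZl.
have cb : Num.conj b%:C = b%:C :> R[i].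
  by rewrite conjcE; apply: complexP; rewrite ?cReJ ?cImJ ?cImC ?oppr0.
apply: eq_cint => s.
have -> : Num.conj (l * (A' s - b%:C * B' s)) =
  Num.conj l * (Num.conj (A' s) - b%:C * Num.conj (B' s)).
  by rewrite rmorphM; congr (_ * _); rewrite rmorphB; congr (_ - _); rewrite rmorphM; congr (_ * _).
by move: (Num.conj l) (Num.conj (A' s)) (Num.conj (B' s)) => l' a' b'; ring.
Qed.

Section transforms.
Context {d : measure_display} {X : measurableType d}.
Variables (m : {sigma_finite_measure set X -> \bar R}) (c u v : X -> R[i]) (y : R).
Hypothesis y0 : 0 < y.
Hypotheses (mc : cmeas c) (mu : cmeas u) (mv : cmeas v).
Hypotheses (uy : forall x, y <= cIm (u x)) (vy : forall x, y <= cIm (v x)).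
Hypothesis iq : m.-integrable setT (fun x => (cabs (c x) * (1 + cabs (u x) + cabs (v x)))%:E).

Let q x := cabs (c x) * (1 + cabs (u x) + cabs (v x)).

Let q0 x : 0 <= q x.
Proof. by rewrite mulr_ge0 ?addr_ge0 ?cabs_ge0. Qed.

Let u0 x : 0 < cIm (u x). Proof. exact: lt_le_trans (uy x). Qed.
Let v0 x : 0 < cIm (v x). Proof. exact: lt_le_trans (vy x). Qed.

(** The Fourier transform of the measure that puts mass [c] at [u] and mass [- b c] at [v];
    [itr] is that of its image under [w |-> - g / w]. For [b = 1] the total mass is zero,
    which makes the weight [1 / s] integrable; for [b = 0] only [u] remains. *)
Definition wtr (b s : R) : R[i] :=
  cint m (fun x => c x * (wave s (u x) - b%:C * wave s (v x))).

Definition itr (b g s : R) : R[i] :=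
  cint m (fun x => c x * (wave s (- (g%:C / u x)) - b%:C * wave s (- (g%:C / v x)))).

Let dtr (b s : R) : R[i] := cint m (fun x => c x *
  ((u x)^-1 * wave s (- (1 / u x)) - b%:C * ((v x)^-1 * wave s (- (1 / v x))))).

Let mz1 : measurable_fun setT (fun z : measurableTypeR R * X => z.1).
Proof. exact: measurable_fst. Qed.

Let mz2 (f : X -> R[i]) : cmeas f -> cmeas (fun z : measurableTypeR R * X => f z.2).
Proof. by move=> mf; apply: (cmeas_comp mf); exact: measurable_snd. Qed.

Let mginv (g : R) (f : X -> R[i]) : cmeas f -> cmeas (fun x => - (g%:C / f x)).
Proof. by move=> mf; apply: cmeasN; apply: cmeasM; [exact: cmeas_cst|exact: cmeasV]. Qed.

Let F1 b (z : measurableTypeR R * X) :=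
  c z.2 * (wave z.1 (u z.2) - b%:C * wave z.1 (v z.2)).

Let F2 b (z : measurableTypeR R * X) := c z.2 *
  ((u z.2)^-1 * wave z.1 (- (1 / u z.2)) - b%:C * ((v z.2)^-1 * wave z.1 (- (1 / v z.2)))).

Let mF1 b : cmeas (F1 b).
Proof.
apply: cmeasM; first exact: mz2.
apply: cmeasB; first by apply: cmeas_wave2 => //; exact: mz2.
by apply: cmeasM; [exact: cmeas_cst|apply: cmeas_wave2 => //; exact: mz2].
Qed.

Let mF2 b : cmeas (F2 b).
Proof.
apply: cmeasM; first exact: mz2.
apply: cmeasB.
  apply: cmeasM; first by apply: (mz2 (f := fun x => (u x)^-1)); exact: cmeasV.
  apply: cmeas_wave2 => //; apply: (mz2 (f := fun x => - (1 / u x))).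
  exact: (mginv 1).
apply: cmeasM; [exact: cmeas_cst|apply: cmeasM; first by apply: (mz2 (f := fun x => (v x)^-1)); exact: cmeasV].
apply: cmeas_wave2 => //; apply: (mz2 (f := fun x => - (1 / v x))).
exact: (mginv 1).
Qed.

Let bw1 (s : R) w : 0 < s -> y <= cIm w -> cabs (wave s w) <= env s * (1 + y^-1).
Proof.
move=> s0 yw; rewrite cabs_wave; apply: le_trans (expRN_env y0 s0).
by rewrite ler_expR lerN2 ler_wpM2r// ltW.
Qed.

Let Im_inv (w : R[i]) : cIm (- (1 / w)) = cIm w / cabs w ^+ 2.
Proof. by rewrite cImN mul1r cImV mulNr opprK. Qed.

Let cabs_y w : y <= cIm w -> y <= cabs w.
Proof. by move=> yw; apply: le_trans yw _; exact: Im_le_cabs. Qed.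

Let cabsV_y w : y <= cIm w -> cabs w^-1 <= y^-1.
Proof.
move=> yw; rewrite cabsV lef_pV2 ?posrE//; first exact: cabs_y.
exact: lt_le_trans (cabs_y yw).
Qed.

Let bw2 (s : R) w : 0 < s -> y <= cIm w ->
  cabs (w^-1 * wave s (- (1 / w))) <= env s * (y^-1 * (1 + cabs w)).
Proof.
move=> s0 yw; have w0 : 0 < cabs w by exact: lt_le_trans (cabs_y yw).
rewrite /env ler_pdivlMl; last by rewrite addr_gt0.
rewrite cabsM cabs_wave Im_inv.
have h1 := cabsV_y yw.
have e1 : expR (- (cIm w / cabs w ^+ 2 * s)) <= 1.
  by rewrite -[leRHS]expR0 ler_expR oppr_le0 !mulr_ge0 ?invr_ge0 ?sqr_ge0// ltW// (lt_le_trans y0).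
have e2 : expR (- (cIm w / cabs w ^+ 2 * s)) <= cabs w ^+ 2 / (y * s).
  apply: (@le_trans _ _ (expR (- (y / cabs w ^+ 2 * s)))).
    by rewrite ler_expR lerN2 ler_wpM2r ?ler_wpM2r ?invr_ge0 ?sqr_ge0// ltW.
  rewrite (le_trans (expRN_le _))//; first by rewrite mulr_gt0// divr_gt0// exprn_gt0.
  by rewrite le_eqVlt; apply/orP; left; apply/eqP; field; rewrite !gt_eqF.
have h2 : s * (cabs w^-1 * expR (- (cIm w / cabs w ^+ 2 * s))) <= y^-1 * cabs w.
  apply: (@le_trans _ _ (s * (cabs w^-1 * (cabs w ^+ 2 / (y * s))))).
    by rewrite ler_wpM2l ?ler_wpM2l ?cabs_ge0// ltW.
  by rewrite cabsV le_eqVlt; apply/orP; left; apply/eqP; field; rewrite !gt_eqF.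
have h3 : cabs w^-1 * expR (- (cIm w / cabs w ^+ 2 * s)) <= y^-1.
  by rewrite -[leRHS]mulr1 ler_pM ?cabs_ge0 ?expR_ge0.
lra.
Qed.

Let bcomb (b B1 B2 : R) (k w1 w2 : R[i]) : 0 <= b <= 1 -> cabs w1 <= B1 -> cabs w2 <= B2 ->
  cabs (k * (w1 - b%:C * w2)) <= cabs k * (B1 + B2).
Proof.
move=> /andP[b0 b1] h1 h2; rewrite cabsM ler_wpM2l ?cabs_ge0// (le_trans (cabsB _ _))// lerD//.
by rewrite cabsM cabsC ger0_norm// (le_trans _ h2)// ler_piMl ?cabs_ge0.
Qed.

(** The map [u |-> - 1 / u] is an isometry after division by [u]: both kernels are
    [i / (u - conj u')]. *)
Let parseval_inv (b : R) : 0 <= b <= 1 ->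
  [/\ hl.-integrable setT (fun s => (cabs (wtr b s) ^+ 2)%:E),
      hl.-integrable setT (fun s => (cabs (dtr b s) ^+ 2)%:E) &
      \int[hl]_s cabs (wtr b s) ^+ 2 = \int[hl]_s cabs (dtr b s) ^+ 2].
Proof.
move=> b01; pose C := 2 * (1 + y^-1).
have C0 : 0 <= C by rewrite mulr_ge0// addr_ge0// invr_ge0 ltW.
have iC : m.-integrable setT (fun x => (C * q x)%:E).
  by have := integrableZl measurableT C iq.
apply: (parseval_hl (F1 := F1 b) (F2 := F2 b) (mF1 b) (mF2 b) _ iC).
- by move=> x; exact: mulr_ge0.
- move=> s x s0; apply: (le_trans (bcomb (c x) b01 (bw1 s0 (uy x)) (bw1 s0 (vy x)))).
  rewrite /q /C; have := mulr_ge0 (env_ge0 s0) (cabs_ge0 (c x)).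
  have := cabs_ge0 (u x); have := cabs_ge0 (v x).
  move: (cabs (u x)) (cabs (v x)) (cabs (c x)) (env s) => U V k e V0 U0 ek0.
  rewrite -subr_ge0.
  have -> : e * (2 * (1 + y^-1) * (k * (1 + U + V))) - k * (e * (1 + y^-1) + e * (1 + y^-1)) =
    (e * k) * C * (U + V) by rewrite /C; ring.
  by apply: mulr_ge0; [exact: mulr_ge0|exact: addr_ge0].
- move=> s x s0; apply: (le_trans (bcomb (c x) b01 (bw2 s0 (uy x)) (bw2 s0 (vy x)))).
  rewrite /q /C; have := mulr_ge0 (env_ge0 s0) (cabs_ge0 (c x)).
  have := cabs_ge0 (u x); have := cabs_ge0 (v x).
  have : 0 <= y^-1 by rewrite invr_ge0 ltW.
  move: (y^-1) (cabs (u x)) (cabs (v x)) (cabs (c x)) (env s) => z U V k e z0 V0 U0 ek0.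
  rewrite -subr_ge0.
  have -> : e * (2 * (1 + z) * (k * (1 + U + V))) - k * (e * (z * (1 + U)) + e * (z * (1 + V))) =
    (e * k) * (2 * (1 + U + V) + z * (U + V)) by ring.
  by apply: mulr_ge0 => //; have := mulr_ge0 z0 (addr_ge0 U0 V0); lra.
- move=> x x'; rewrite /F1 /F2 /=.
  have K w w' : 0 < cIm w -> 0 < cIm w' ->
      cintegrable hl (fun s => (w^-1 * wave s (- (1 / w))) * (w'^-1 * wave s (- (1 / w')))^*) /\
      cint hl (fun s => (w^-1 * wave s (- (1 / w))) * (w'^-1 * wave s (- (1 / w')))^*) =
      cint hl (fun s => wave s w * (wave s w')^*).
    move=> w0 w0'.
    have [i1 e1] := cint_wave2 w0 w0'.
    have [i2 e2] := cint_wave2 (Im_gdiv ltr01 w0) (Im_gdiv ltr01 w0').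
    have -> : (fun s : R => (w^-1 * wave s (- (1 / w))) * (w'^-1 * wave s (- (1 / w')))^*) =
        fun s => w^-1 * (Num.conj w')^-1 * (wave s (- (1 / w)) * (wave s (- (1 / w')))^*).
      apply/funext => s.
      have -> : Num.conj (w'^-1 * wave s (- (1 / w'))) = (Num.conj w')^-1 * Num.conj (wave s (- (1 / w'))).
        by rewrite rmorphM fmorphV.
      by ring.
    split; first exact: cintegrableZl.
    rewrite cintZl// e1 e2.
    have J0 : Num.conj w' != 0 by rewrite -cabs_eq0 cabsJ cabs_eq0 Im_neq0.
    have -> : Num.conj (- (1 / w')) = - (1 / Num.conj w') :> R[i].
      by rewrite !mul1r rmorphN; congr (- _); rewrite fmorphV.
    have := subJ_neq0 w0 w0'; have := Im_neq0 w0; move: J0.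
    move: (Num.conj w') => a a0 w00 wa; field; rewrite a0 w00/=.
    by apply/andP; split => //; rewrite addrC.
  have [i1 e1] := K _ _ (u0 x) (u0 x'); have [i2 e2] := K _ _ (v0 x) (u0 x').
  have [i3 e3] := K _ _ (u0 x) (v0 x'); have [i4 e4] := K _ _ (v0 x) (v0 x').
  rewrite (cint_kernel2 b _ _ i1 i2 i3 i4) e1 e2 e3 e4.
  have [j1 _] := cint_wave2 (u0 x) (u0 x'); have [j2 _] := cint_wave2 (v0 x) (u0 x').
  have [j3 _] := cint_wave2 (u0 x) (v0 x'); have [j4 _] := cint_wave2 (v0 x) (v0 x').
  by rewrite (cint_kernel2 b _ _ j1 j2 j3 j4).
Qed.

Lemma integrable_wtr (b : R) : 0 <= b <= 1 -> hl.-integrable setT (fun s => (cabs (wtr b s) ^+ 2)%:E).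
Proof. by move=> b01; case: (parseval_inv b01). Qed.

Let iq1 : m.-integrable setT (fun x => (cabs (c x))%:E).
Proof.
apply: le_integrable iq => //; first by apply/measurable_EFinP; exact: measurable_cabs.
move=> x _; rewrite /= lee_fin (ger0_norm (cabs_ge0 _)) ger0_norm; last exact: q0.
by rewrite ler_peMr ?cabs_ge0// -addrA lerDl addr_ge0 ?cabs_ge0.
Qed.

Let bexp (s : R) w : -1 <= s -> y <= cIm w -> cabs (wave s (- (1 / w))) <= expR y^-1.
Proof.
move=> s1 yw; rewrite cabs_wave Im_inv ler_expR.
have w0 : 0 < cabs w by exact: lt_le_trans (cabs_y yw).
have h1 : cIm w / cabs w ^+ 2 <= y^-1.
  apply: (@le_trans _ _ (cabs w^-1)); last exact: cabsV_y.
  rewrite cabsV ler_pdivrMr ?exprn_gt0// expr2 mulKf ?gt_eqF//; exact: Im_le_cabs.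
have h2 : 0 <= cIm w / cabs w ^+ 2 by rewrite divr_ge0 ?sqr_ge0// (le_trans (ltW y0)).
have h3 : 0 <= (cIm w / cabs w ^+ 2) * (s + 1) by rewrite mulr_ge0//; lra.
lra.
Qed.

(** The derivative of [itr b 1] is, up to a constant phase, the transform [dtr b] to
    which [parseval_inv] applies; the rest is [cderive_sqr_le]. *)
Lemma itr_sqr_le (b t : R) : 0 <= b <= 1 -> 0 < t ->
  cabs (itr b 1 t - itr b 1 0) ^+ 2 <= t * \int[hl]_s cabs (wtr b s) ^+ 2.
Proof.
move=> b01 t0; have [_ i2 ->] := parseval_inv b01.
have md : cmeas (dtr b) by exact: (@cmeas_cint1 _ _ _ _ _ m _ (mF2 b)).
have yV : 0 <= y^-1 by rewrite invr_ge0 ltW.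
pose fA (s : R) x := c x * (wave s (- (1 / u x)) - b%:C * wave s (- (1 / v x))).
pose fD (s : R) x := - 'i * (c x * ((u x)^-1 * wave s (- (1 / u x)) - b%:C * ((v x)^-1 * wave s (- (1 / v x))))).
pose fE (s : R) x := - 'i * (c x * ((u x)^-1 * (- 'i * ((u x)^-1 * wave s (- (1 / u x)))) -
    b%:C * ((v x)^-1 * (- 'i * ((v x)^-1 * wave s (- (1 / v x))))))).
have dw (s : R) w : is_cderive (fun s => wave s (- (1 / w))) s (- 'i * (w^-1 * wave s (- (1 / w)))).
  by apply: (cderive_eq (cderive_wave s (- (1 / w)))); rewrite mul1r; ring.
have dA (s : R) x : is_cderive (fun s => fA s x) s (fD s x).
  apply: (cderive_eq (cderiveZ (c x) (cderiveB (dw s (u x)) (cderiveZ b%:C (dw s (v x)))))).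
  by rewrite /fD; ring.
have dD (s : R) x : is_cderive (fun s => fD s x) s (fE s x).
  apply: (cderive_eq (cderiveZ (- 'i) (cderiveZ (c x) (cderiveB (cderiveZ (u x)^-1 (dw s (u x)))
    (cderiveZ b%:C (cderiveZ (v x)^-1 (dw s (v x)))))))).
  by [].
pose K := 2 * expR y^-1.
have bA (s : R) x : -1 <= s -> cabs (fA s x) <= cabs (c x) * (expR y^-1 + expR y^-1).
  by move=> s1; apply: bcomb => //; exact: bexp.
have bV (s : R) w : -1 <= s -> y <= cIm w -> cabs (w^-1 * wave s (- (1 / w))) <= y^-1 * expR y^-1.
  by move=> s1 yw; rewrite cabsM ler_pM ?cabs_ge0 ?cabsV_y ?bexp.
have bD (s : R) x : -1 <= s -> cabs (fD s x) <= cabs (c x) * (y^-1 * expR y^-1 + y^-1 * expR y^-1).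
  by move=> s1; rewrite cabsM cabsN cabsi mul1r; apply: bcomb => //; exact: bV.
have bE (s : R) x : -1 <= s -> cabs (fE s x) <= cabs (c x) *
    (y^-1 * (y^-1 * expR y^-1) + y^-1 * (y^-1 * expR y^-1)).
  move=> s1; rewrite cabsM cabsN cabsi mul1r; apply: bcomb => //.
    by rewrite cabsM cabsM cabsN cabsi mul1r ler_pM ?cabs_ge0 ?cabsV_y ?bV.
  by rewrite cabsM cabsM cabsN cabsi mul1r ler_pM ?cabs_ge0 ?cabsV_y ?bV.
have ic (k : R) : m.-integrable setT (fun x => (cabs (c x) * k)%:E).
  have := integrableZl measurableT k iq1; apply: eq_integrable => // x _.
  by rewrite -EFinM mulrC.
have mw (s : R) (f : X -> R[i]) : cmeas f -> cmeas (fun x => wave s (- (1 / f x))).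
  by move=> mf; apply: cmeas_wave2; [exact: measurable_cst|exact: (mginv 1)].
have mA (s : R) : cmeas (fA s).
  apply: cmeasM => //; apply: cmeasB; first exact: mw.
  by apply: cmeasM; [exact: cmeas_cst|exact: mw].
have mD (s : R) : cmeas (fD s).
  apply: cmeasM; [exact: cmeas_cst|apply: cmeasM => //; apply: cmeasB].
    by apply: cmeasM; [exact: cmeasV|exact: mw].
  by apply: cmeasM; [exact: cmeas_cst|apply: cmeasM; [exact: cmeasV|exact: mw]].
have dN (s : R) : 0 <= s -> is_cderive (itr b 1) s (cint m (fD s)).
  move=> s0; apply: (@cderive_cint _ _ _ m fA fD _ s (s - 1) (s + 1) _ _ _ (ic (y^-1 * expR y^-1 + y^-1 * expR y^-1))).
  - by apply/andP; split; lra.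
  - move=> r /andP[r1 _]; apply: le_cintegrable (ic (expR y^-1 + expR y^-1)) _ => // x.
    by apply: bA; lra.
  - by move=> r x _; exact: dA.
  - by move=> r x /andP[r1 _]; apply: bD; lra.
have EM (s : R) : 0 <= s -> cint m (fD s) = - 'i * dtr b s.
  move=> s0; rewrite /fD cintZl// /dtr.
  apply: le_cintegrable (ic (y^-1 * expR y^-1 + y^-1 * expR y^-1)) _.
    by have := (cmeas_comp (mF2 b) (pair1_measurable s)).
  by move=> x; apply: bcomb => //; apply: bV => //; lra.
have mM : cmeas (fun s => cint m (fD s)).
  apply: (@cmeas_cint1 _ _ _ _ _ m (fun z => - 'i * F2 b z)).
  by apply: cmeasM; [exact: cmeas_cst|exact: mF2].
have m2 : measurable_fun setT (fun s => cabs (cint m (fD s)) ^+ 2) by exact: measurable_cabs2.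
have absE (s : R) : 0 < s -> cabs (cint m (fD s)) ^+ 2 = cabs (dtr b s) ^+ 2.
  by move=> s0; rewrite EM ?ltW// cabsM cabsN cabsi mul1r.
have iM : hl.-integrable setT (fun s => (cabs (cint m (fD s)) ^+ 2)%:E).
  apply: le_integrable_hl i2 _ => // s s0.
  by rewrite absE// ger0_norm ?sqr_ge0.
have -> : \int[hl]_s cabs (dtr b s) ^+ 2 = \int[hl]_s cabs (cint m (fD s)) ^+ 2.
  apply: eq_Rintegral_hl => //; first exact: measurable_cabs2.
  by move=> s s0; rewrite absE.
apply: cderive_sqr_le => //.
move=> s s0; eexists.
apply: (@cderive_cint _ _ _ m fD fE _ s (s - 1) (s + 1) _ _ _
  (ic (y^-1 * (y^-1 * expR y^-1) + y^-1 * (y^-1 * expR y^-1)))).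
- by apply/andP; split; lra.
- move=> r /andP[r1 _]; apply: le_cintegrable (ic (y^-1 * expR y^-1 + y^-1 * expR y^-1)) _ => // x.
  by apply: bD; lra.
- by move=> r x _; exact: dD.
- by move=> r x /andP[r1 _]; apply: bE; lra.
Qed.

(** Each of the two factors of the kernel takes one square root of the weight [1 / s]. *)
Let rs (s : R) : R := (Num.sqrt s)^-1.

Let rs_gt0 (s : R) : 0 < s -> 0 < rs s. Proof. by move=> s0; rewrite invr_gt0 sqrtr_gt0. Qed.

Let rs_sqr (s : R) : 0 < s -> rs s * rs s = s^-1.
Proof. by move=> s0; rewrite -invfM -expr2 sqr_sqrtr// ltW. Qed.

Let mrs : measurable_fun setT rs.
Proof.
apply: measurable_ge0V; first by move=> s; exact: sqrtr_ge0.
by apply: continuous_measurable_fun; exact: sqrt_continuous.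
Qed.

Let rs_small (s D B : R) : 0 < s -> 0 <= B -> (s <= 1 -> D <= s * B) -> (1 < s -> D <= s^-1 * B \/ D <= rs s * B) ->
  D * rs s <= env s * (2 * B).
Proof.
move=> s0 B0 h1 h2; rewrite /env ler_pdivlMl; last by rewrite addr_gt0.
have r0 := rs_gt0 s0; have rr := rs_sqr s0.
have sr : s * (rs s * rs s) = 1 by rewrite rr mulfV// gt_eqF.
have key (k : R) : D <= k * B -> (1 + s) * (k * rs s) <= 2 -> (1 + s) * (D * rs s) <= 2 * B.
  move=> Dk k2.
  have e1 : (1 + s) * (D * rs s) <= (1 + s) * (k * B * rs s).
    by rewrite ler_wpM2l ?addr_ge0 ?ler_wpM2r// ltW.
  rewrite (le_trans e1)//.
  have -> : (1 + s) * (k * B * rs s) = (1 + s) * (k * rs s) * B by ring.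
  by rewrite ler_wpM2r.
have [s1|s1] := leP s 1.
  apply: (key s (h1 s1)).
  have : (s * rs s) ^+ 2 <= 1.
    by rewrite exprMn [rs s ^+ 2]expr2 rr expr2 mulfK// gt_eqF.
  have : 0 <= s * rs s by rewrite mulr_ge0 ?ltW.
  move: (s * rs s) => z z0 z1; have z2 : z <= 1 by rewrite -(@ler_pXn2r _ 2)// ?nnegrE// expr1n.
  nra.
have rs1 : rs s <= 1.
  rewrite -(@ler_pXn2r _ 2)// ?nnegrE ?(ltW r0)// expr1n expr2 rr invf_le1//.
  exact: ltW.
have i1 : s^-1 <= 1 by rewrite invf_le1// ltW.
have si : s * s^-1 = 1 by rewrite mulfV// gt_eqF.
have i0 : 0 < s^-1 by rewrite invr_gt0.
case: (h2 s1) => /key; apply.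
  have h : s^-1 * rs s <= s^-1 by rewrite ler_piMr// ltW.
  have h' : s * (s^-1 * rs s) <= 1 by rewrite mulrA si mul1r.
  rewrite mulrDl mul1r; lra.
by rewrite rr mulrDl mul1r si; lra.
Qed.

Let bw4 (s : R) w w' : 0 < s -> y <= cIm w -> y <= cIm w' ->
  cabs (wave s w - wave s w') * rs s <= env s * (2 * ((1 + 2 * y^-1) * (1 + cabs w + cabs w'))).
Proof.
move=> s0 yw yw'; have yV : 0 <= y^-1 by rewrite invr_ge0 ltW.
have c1 := cabs_ge0 w; have c2 := cabs_ge0 w'.
have B0 : 0 <= (1 + 2 * y^-1) * (1 + cabs w + cabs w').
  by apply: mulr_ge0; lra.
have p1 : 0 <= y^-1 * (cabs w + cabs w') by rewrite mulr_ge0// addr_ge0.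
apply: rs_small => // s1.
  have h0 : 0 <= cIm w by rewrite (le_trans (ltW y0)).
  have h0' : 0 <= cIm w' by rewrite (le_trans (ltW y0)).
  apply: (le_trans (cabs_waveB (ltW s0) h0 h0')).
  rewrite mul0r oppr0 expR0 mulr1 ler_wpM2l ?(ltW s0)// (le_trans (cabsB _ _))//; lra.
left; rewrite (le_trans (cabsB _ _))// !cabs_wave.
have hw w1 : y <= cIm w1 -> expR (- (cIm w1 * s)) <= y^-1 * s^-1.
  move=> yv; rewrite -invfM (le_trans _ (expRN_le _)) ?mulr_gt0//.
  by rewrite ler_expR lerN2 ler_wpM2r// ltW.
have := hw _ yw; have := hw _ yw'.
have s10 : 0 <= s^-1 by rewrite invr_ge0 ltW.
have := mulr_ge0 s10 p1; have : 0 <= s^-1 * (1 + cabs w + cabs w') by rewrite mulr_ge0// !addr_ge0.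
nra.
Qed.

Let bw5 (g s : R) w w' : 0 < g -> 0 < s -> y <= cIm w -> y <= cIm w' ->
  cabs (wave s (- (g%:C / w)) - wave s (- (g%:C / w'))) * rs s <=
  env s * (2 * ((2 * (g * y^-1) + (Num.sqrt (g * y))^-1) * (1 + cabs w + cabs w'))).
Proof.
move=> g0 s0 yw yw'; have yV : 0 <= y^-1 by rewrite invr_ge0 ltW.
have gy : 0 < g * y by rewrite mulr_gt0.
have c1 := cabs_ge0 w; have c2 := cabs_ge0 w'.
have q1 : 0 <= (Num.sqrt (g * y))^-1 by rewrite invr_ge0 sqrtr_ge0.
have q2 : 0 <= g * y^-1 by rewrite mulr_ge0// ltW.
have B0 : 0 <= (2 * (g * y^-1) + (Num.sqrt (g * y))^-1) * (1 + cabs w + cabs w').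
  by apply: mulr_ge0; lra.
have w0 : 0 < cIm w by exact: lt_le_trans yw.
have w0' : 0 < cIm w' by exact: lt_le_trans yw'.
have p1 : 0 <= (g * y^-1) * (cabs w + cabs w') by rewrite mulr_ge0// addr_ge0.
have p2 : 0 <= (Num.sqrt (g * y))^-1 * (1 + cabs w + cabs w') by rewrite mulr_ge0// !addr_ge0.
apply: rs_small => // s1.
  apply: (le_trans (cabs_waveB (ltW s0) (ltW (Im_gdiv g0 w0)) (ltW (Im_gdiv g0 w0')))).
  rewrite mul0r oppr0 expR0 mulr1 ler_wpM2l ?(ltW s0)// (le_trans (cabsB _ _))//.
  rewrite !cabsN !cabsM cabsC (ger0_norm (ltW g0)).
  have h1 : g * cabs w^-1 <= g * y^-1 by rewrite ler_wpM2l ?cabsV_y// ltW.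
  have h2 : g * cabs w'^-1 <= g * y^-1 by rewrite ler_wpM2l ?cabsV_y// ltW.
  lra.
right; rewrite (le_trans (cabsB _ _))// !cabs_wave.
have hw w1 : y <= cIm w1 -> expR (- (cIm (- (g%:C / w1)) * s)) <= rs s * ((Num.sqrt (g * y))^-1 * cabs w1).
  move=> yv; have v00 : 0 < cabs w1 by exact: lt_le_trans (cabs_y yv).
  have e : cIm (- (g%:C / w1)) = g * cIm w1 / cabs w1 ^+ 2.
    by rewrite cImN cImM cReC cImC cImV; ring.
  rewrite e; apply: (@le_trans _ _ (expR (- (s * (g * y) / cabs w1 ^+ 2)))).
    rewrite ler_expR lerN2.
    have -> : g * cIm w1 / cabs w1 ^+ 2 * s = (s * g / cabs w1 ^+ 2) * cIm w1 by ring.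
    have -> : s * (g * y) / cabs w1 ^+ 2 = (s * g / cabs w1 ^+ 2) * y by ring.
    by rewrite ler_wpM2l// divr_ge0 ?sqr_ge0// mulr_ge0// ltW.
  rewrite (le_trans (expRN_le_sqrt _)) ?divr_gt0 ?mulr_gt0 ?exprn_gt0//.
  have sy : 0 <= s * (g * y) by apply: mulr_ge0; exact: ltW.
  rewrite (sqrtrM _ sy) (sqrtrM _ (ltW s0)).
  rewrite -exprVn sqrtr_sqr ger0_norm; last by rewrite invr_ge0 ltW.
  by rewrite !invfM invrK /rs mulrA.
have := hw _ yw; have := hw _ yw'.
have r0 := rs_gt0 s0.
have : 0 <= rs s * (g * y^-1) by rewrite mulr_ge0// ltW.
have := mulr_ge0 (ltW r0) p1; have := mulr_ge0 (ltW r0) q1.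
nra.
Qed.

(** By [frullani_inv] the two kernels for the weight [1 / s] agree. *)
Lemma itr_frullani (g : R) : 0 < g ->
  [/\ hl.-integrable setT (fun s => (cabs (itr 1 g s) ^+ 2 / s)%:E),
      hl.-integrable setT (fun s => (cabs (wtr 1 s) ^+ 2 / s)%:E) &
      \int[hl]_s (cabs (itr 1 g s) ^+ 2 / s) = \int[hl]_s (cabs (wtr 1 s) ^+ 2 / s)].
Proof.
move=> g0.
pose A (s : R) x : R[i] := wave s (- (g%:C / u x)) - wave s (- (g%:C / v x)).
pose B (s : R) x : R[i] := wave s (u x) - wave s (v x).
pose G1 (z : measurableTypeR R * X) := c z.2 * (A z.1 z.2 * (rs z.1)%:C).
pose G2 (z : measurableTypeR R * X) := c z.2 * (B z.1 z.2 * (rs z.1)%:C).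
have mrz : cmeas (fun z : measurableTypeR R * X => (rs z.1)%:C).
  by apply: cmeasC; exact: (measurableT_comp mrs mz1).
have mA : cmeas (fun z : measurableTypeR R * X => A z.1 z.2).
  apply: cmeasB; (apply: cmeas_wave2; first exact: mz1).
    by apply: (mz2 (f := fun x => - (g%:C / u x))); exact: mginv.
  by apply: (mz2 (f := fun x => - (g%:C / v x))); exact: mginv.
have mB : cmeas (fun z : measurableTypeR R * X => B z.1 z.2).
  by apply: cmeasB; (apply: cmeas_wave2; first exact: mz1); exact: mz2.
have mG1 : cmeas G1 by apply: cmeasM; [exact: mz2|exact: (cmeasM mA mrz)].
have mG2 : cmeas G2 by apply: cmeasM; [exact: mz2|exact: (cmeasM mB mrz)].
pose C1 := 2 * (2 * (g * y^-1) + (Num.sqrt (g * y))^-1).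
pose C2 := 2 * (1 + 2 * y^-1).
have yV : 0 <= y^-1 by rewrite invr_ge0 ltW.
have gyV : 0 <= g * y^-1 by rewrite mulr_ge0// ltW.
have q1 : 0 <= (Num.sqrt (g * y))^-1 by rewrite invr_ge0 sqrtr_ge0.
have C10 : 0 <= C1 by rewrite /C1; lra.
have C20 : 0 <= C2 by rewrite /C2; lra.
pose w x := 1 + cabs (u x) + cabs (v x).
have w0 x : 0 <= w x by rewrite /w !addr_ge0 ?cabs_ge0.
have bA (s : R) x : 0 < s -> cabs (A s x * (rs s)%:C) <= env s * ((C1 + C2) * w x).
  move=> s0; rewrite cabsM cabsC ger0_norm ?(ltW (rs_gt0 s0))//.
  rewrite (le_trans (bw5 g0 s0 (uy x) (vy x)))// ler_wpM2l ?env_ge0// mulrA -/C1.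
  by apply: ler_wpM2r; [exact: w0|rewrite lerDl].
have bB (s : R) x : 0 < s -> cabs (B s x * (rs s)%:C) <= env s * ((C1 + C2) * w x).
  move=> s0; rewrite cabsM cabsC ger0_norm ?(ltW (rs_gt0 s0))//.
  rewrite (le_trans (bw4 s0 (uy x) (vy x)))// ler_wpM2l ?env_ge0// mulrA -/C2.
  by apply: ler_wpM2r; [exact: w0|rewrite lerDr].
have iC : m.-integrable setT (fun x => ((C1 + C2) * q x)%:E).
  by have := integrableZl measurableT (C1 + C2) iq.
have bc (s : R) x (z : R[i]) : 0 < s -> cabs z <= env s * ((C1 + C2) * w x) ->
    cabs (c x * z) <= env s * ((C1 + C2) * q x).
  move=> s0 h; rewrite cabsM; apply: (le_trans (ler_wpM2l (cabs_ge0 (c x)) h)).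
  by rewrite le_eqVlt; apply/orP; left; apply/eqP; rewrite /q -/(w x); ring.
have mx (H : measurableTypeR R * X -> R[i]) z : cmeas H -> cmeas (fun s => H (s, z)).
  move=> mH; apply: (cmeas_comp mH).
  by apply: measurable_fun_pair => //; exact: measurable_cst.
have mV : cmeas (fun s : R => (s^-1)%:C).
  have := cmeasV (@cmeas_id R); congr cmeas; by apply/funext => s; rewrite CV.
have Kf (H : R -> X -> R[i]) x x' : cmeas (fun z : measurableTypeR R * X => H z.1 z.2) ->
    (forall (s : R) x, 0 < s -> cabs (H s x * (rs s)%:C) <= env s * ((C1 + C2) * w x)) ->
    cint hl (fun s => (c x * (H s x * (rs s)%:C)) * (c x' * (H s x' * (rs s)%:C))^*) =
    c x * (c x')^* * cint hl (fun s => H s x * ((H s x')^* * (s^-1)%:C)).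
  move=> mH bH.
  have mHx z : cmeas (fun s : measurableTypeR R => H s z) by exact: (mx (fun z => H z.1 z.2)).
  have mr : cmeas (fun s : measurableTypeR R => (rs s)%:C) by exact: cmeasC.
  have e (s : R) : 0 < s -> (c x * (H s x * (rs s)%:C)) * (c x' * (H s x' * (rs s)%:C))^* =
      c x * (c x')^* * (H s x * ((H s x')^* * (s^-1)%:C)).
    move=> s0; rewrite -(rs_sqr s0) CM.
    have cr : Num.conj (rs s)%:C = (rs s)%:C :> R[i].
      by rewrite conjcE; apply: complexP; rewrite ?cReJ ?cImJ ?cImC ?oppr0.
    have -> : Num.conj (c x' * (H s x' * (rs s)%:C)) = Num.conj (c x') * (Num.conj (H s x') * (rs s)%:C).
      by rewrite rmorphM; congr (_ * _); rewrite rmorphM; congr (_ * _).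
    by ring.
  rewrite -cintZl.
    apply: eq_cint_hl => //.
      apply: cmeasM; last apply: cmeasJ.
        by apply: cmeasM; [exact: cmeas_cst|apply: cmeasM; [exact: mHx|exact: mr]].
      by apply: cmeasM; [exact: cmeas_cst|apply: cmeasM; [exact: mHx|exact: mr]].
    apply: cmeasM; first exact: cmeas_cst.
    exact: (cmeasM (mHx x) (cmeasM (cmeasJ (mHx x')) mV)).
  apply: (@le_cintegrable_hl _ _ (fun s => ((C1 + C2) * w x) * ((C1 + C2) * w x') * env s ^+ 2)).
  - exact: (cmeasM (mHx x) (cmeasM (cmeasJ (mHx x')) mV)).
  - by have := integrableZl measurableT ((C1 + C2) * w x * ((C1 + C2) * w x')) (@integrable_env2 R).
  - move=> s s0; have := ler_pM (cabs_ge0 _) (cabs_ge0 _) (bH s x s0) (bH s x' s0).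
    rewrite !cabsM cabsJ !cabsC -(rs_sqr s0) (ger0_norm (ltW (rs_gt0 s0))) ger0_norm; last first.
      by rewrite mulr_ge0 ?(ltW (rs_gt0 s0)).
    move=> h; apply: le_trans (le_trans _ h) _; rewrite le_eqVlt; apply/orP; left; apply/eqP; ring.
have Cq0 x : 0 <= (C1 + C2) * q x by apply: mulr_ge0 => //; exact: addr_ge0.
have b1 (s : R) x : 0 < s -> cabs (G1 (s, x)) <= env s * ((C1 + C2) * q x).
  by move=> s0; apply: bc => //; exact: bA.
have b2 (s : R) x : 0 < s -> cabs (G2 (s, x)) <= env s * ((C1 + C2) * q x).
  by move=> s0; apply: bc => //; exact: bB.
have kk x x' : cint hl (fun s => G1 (s, x) * (G1 (s, x'))^*) =
    cint hl (fun s => G2 (s, x) * (G2 (s, x'))^*).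
  by rewrite /G1 /G2 /= (Kf A x x' mA bA) (Kf B x x' mB bB) /A /B frullani_inv.
have [i1 i2 e12] := parseval_hl mG1 mG2 Cq0 iC b1 b2 kk.
have absE (H : R -> X -> R[i]) (s : R) : 0 < s -> cintegrable m (fun x => c x * H s x) ->
    cabs (cint m (fun x => c x * (H s x * (rs s)%:C))) ^+ 2 = cabs (cint m (fun x => c x * H s x)) ^+ 2 / s.
  move=> s0 iH; have -> : cint m (fun x => c x * (H s x * (rs s)%:C)) = cint m (fun x => c x * H s x) * (rs s)%:C.
    by rewrite -cintZr//; apply: eq_cint => x; rewrite mulrA.
  by rewrite cabsM exprMn cabsC [X in _ * X]expr2 -normrM rs_sqr// ger0_norm// invr_ge0 ltW.
have iH (H : R -> X -> R[i]) (s : R) : 0 < s -> cmeas (fun z : measurableTypeR R * X => H z.1 z.2) ->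
    (forall x, cabs (H s x) <= 2) -> cintegrable m (fun x => c x * H s x).
  move=> s0 mH H2; have i3 := integrableZl measurableT 2 iq1.
  apply: le_cintegrable i3 _.
    by apply: cmeasM => //; exact: (cmeas_comp mH (pair1_measurable s)).
  by move=> x; rewrite cabsM mulrC ler_wpM2r ?cabs_ge0.
have H2 (s : R) w1 w2 : 0 < s -> 0 < cIm w1 -> 0 < cIm w2 -> cabs (wave s w1 - wave s w2) <= 2.
  move=> s0 w10 w20; rewrite (le_trans (cabsB _ _))// -[leRHS]/(1 + 1).
  by rewrite lerD// cabs_wave_le1// ltW.
have itrE (s : R) : itr 1 g s = cint m (fun x => c x * A s x).
  by apply: eq_cint => x; rewrite mul1r.
have wtrE (s : R) : wtr 1 s = cint m (fun x => c x * B s x).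
  by apply: eq_cint => x; rewrite mul1r.
have eA (s : R) : 0 < s -> cabs (cint m (fun x => G1 (s, x))) ^+ 2 = cabs (itr 1 g s) ^+ 2 / s.
  move=> s0; rewrite itrE -absE//; apply: iH => // x.
  by apply: H2 => //; exact: Im_gdiv.
have eB (s : R) : 0 < s -> cabs (cint m (fun x => G2 (s, x))) ^+ 2 = cabs (wtr 1 s) ^+ 2 / s.
  by move=> s0; rewrite wtrE -absE//; apply: iH => // x; exact: H2.
have mI : measurable_fun setT (fun s : R => s^-1).
  by have [h _] := mV; move: h; congr measurable_fun; apply/funext.
have m1 : measurable_fun setT (fun s => cabs (itr 1 g s) ^+ 2 / s).
  apply: measurable_funM => //; apply: measurable_cabs2.
  have -> : itr 1 g = fun s => cint m (fun x => c x * A s x) by apply/funext.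
  apply: (@cmeas_cint1 _ _ _ _ _ m (fun z => c z.2 * A z.1 z.2)).
  by apply: cmeasM => //; exact: mz2.
have m2 : measurable_fun setT (fun s => cabs (wtr 1 s) ^+ 2 / s).
  apply: measurable_funM => //; apply: measurable_cabs2.
  have -> : wtr 1 = fun s => cint m (fun x => c x * B s x) by apply/funext.
  apply: (@cmeas_cint1 _ _ _ _ _ m (fun z => c z.2 * B z.1 z.2)).
  by apply: cmeasM => //; exact: mz2.
have n1 : measurable_fun setT (fun s => cabs (cint m (fun x => G1 (s, x))) ^+ 2).
  by apply: measurable_cabs2; exact: cmeas_cint1.
have n2 : measurable_fun setT (fun s => cabs (cint m (fun x => G2 (s, x))) ^+ 2).
  by apply: measurable_cabs2; exact: cmeas_cint1.
split.
- apply: le_integrable_hl i1 _ => // s s0.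
  by rewrite eA// ger0_norm// divr_ge0 ?sqr_ge0// ltW.
- apply: le_integrable_hl i2 _ => // s s0.
  by rewrite eB// ger0_norm// divr_ge0 ?sqr_ge0// ltW.
- transitivity (\int[hl]_s cabs (cint m (fun x => G1 (s, x))) ^+ 2).
    by apply: eq_Rintegral_hl => // s s0; rewrite eA.
  by rewrite e12; apply: eq_Rintegral_hl => // s s0; rewrite eB.
Qed.

Lemma itrE (b g s : R) : itr b g s = itr b 1 (g * s).
Proof.
apply: eq_cint => x; congr (_ * (_ - _ * _)); rewrite !waveE; congr expC; rewrite CM; ring.
Qed.

End transforms.

End wave_transforms.

(** * The contraction *)

Section contraction.
Context {R : realType}.
Local Notation hl := (@hl R).
Local Notation gam := (@gam R).

Lemma measurable_inv : measurable_fun setT (fun s : R => s^-1).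
Proof.
have [h _] := cmeasV (@cmeas_id R); move: h; congr measurable_fun.
by apply/funext => s; rewrite -CV.
Qed.

Lemma le_Rintegral_gam (k : R) (f h : R -> R) : 0 < k ->
  (gam k).-integrable setT (fun x => (f x)%:E) -> (gam k).-integrable setT (fun x => (h x)%:E) ->
  (forall x : R, 0 < x -> f x <= h x) -> \int[gam k]_x f x <= \int[gam k]_x h x.
Proof.
move=> k0 fi hi fh.
have mf : measurable_fun setT f by move/measurable_int: (fi) => /measurable_EFinP.
have mh : measurable_fun setT h by move/measurable_int: (hi) => /measurable_EFinP.
rewrite !Rintegral_gam// ler_wpM2r ?invr_ge0 ?gamma_fun_ge0//.
apply: le_Rintegral_hl; [exact/integrable_gamP|exact/integrable_gamP|].
by move=> x x0; rewrite ler_wpM2r ?powexp_ge0 ?fh.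
Qed.

Lemma cintegrable_gam (k : R) (f : R -> R[i]) (C : R) : 0 < k -> cmeas f ->
  (forall x : R, 0 < x -> cabs (f x) <= C) -> cintegrable (gam k) f.
Proof.
move=> k0 mf fC; split => //; apply: (@integrable_gam_linear _ _ _ C) => //.
  exact: measurable_cabs.
move=> x x0; rewrite ger0_norm ?cabs_ge0// (le_trans (fC x x0))//.
rewrite ler_peMr ?lerDl ?(ltW x0)//.
exact: le_trans (cabs_ge0 _) (fC x x0).
Qed.

Lemma ge0_le_integral_gam (k : R) (f : R -> \bar R) (C : R) : 0 < k -> measurable_fun setT f ->
  (forall x, 0 <= f x)%E -> (forall x : R, 0 < x -> (f x <= C%:E)%E) ->
  (\int[gam k]_x f x <= C%:E)%E.
Proof.
move=> k0 mf f0 fC.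
have C0 : 0 <= C by rewrite -lee_fin (le_trans (f0 1))// fC.
have mg : measurable_fun setT (fun x : R => (gamma_pdf k x)%:E).
  by apply/measurable_EFinP; exact: measurable_gamma_pdf.
have -> : C%:E = (\int[gam k]_x C%:E)%E.
  by rewrite integral_cst//= gam_setT// mule1.
rewrite !ge0_integral_dens//; apply: ge0_le_integral => //.
- by move=> x _; rewrite mule_ge0 ?lee_fin ?gamma_pdf_ge0.
- exact: emeasurable_funM.
- exact: emeasurable_funM.
- move=> x _; have [x0|x0] := ltP 0 x.
    by rewrite lee_wpmul2r ?lee_fin ?gamma_pdf_ge0// fC.
  by rewrite gamma_pdfE /posind ltNge x0/= mulr0 !mule0.
Qed.

(** For [ep <= t] the Gaussian is at most [1 - ep ^+ 2 / 2]; for [t <= ep] the last term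
    is at least [ep ^+ 2]. *)
Lemma gauss_weight (ep t : R) : 0 < ep -> ep <= 1 -> 0 < t ->
  expR (- t ^+ 2) <= 1 - ep ^+ 2 / 2 + ep ^+ 2 * (expR 1 * expR (- (ep^-1 * t))).
Proof.
move=> e0 e1 t0; have e2 : 0 < ep ^+ 2 by rewrite exprn_gt0.
have ee : ep ^+ 2 <= 1 by rewrite expr_le1// ltW.
have [te|te] := ltP t ep.
  have h : 1 <= expR 1 * expR (- (ep^-1 * t)).
    rewrite -expRD -[leLHS]expR0 ler_expR subr_ge0 mulrC ler_pdivrMr// mul1r.
    exact: ltW.
  have h1 : expR (- t ^+ 2) <= 1 by rewrite -[leRHS]expR0 ler_expR oppr_le0 sqr_ge0.
  have h2 : ep ^+ 2 * 1 <= ep ^+ 2 * (expR 1 * expR (- (ep^-1 * t))).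
    by rewrite ler_wpM2l// ltW.
  lra.
have h0 : 0 <= ep ^+ 2 * (expR 1 * expR (- (ep^-1 * t))).
  by apply: mulr_ge0; [exact: ltW|rewrite mulr_ge0 ?expR_ge0].
suff : expR (- t ^+ 2) <= 1 - ep ^+ 2 / 2 by lra.
have h1 : expR (- t ^+ 2) <= (1 + ep ^+ 2)^-1.
  rewrite expRN lef_pV2 ?posrE ?expR_gt0 ?addr_gt0//.
  apply: le_trans (expR_ge1Dx _); rewrite lerD2l lerXn2r ?nnegrE// ltW//.
rewrite (le_trans h1)// -[leLHS]mul1r ler_pdivrMr ?addr_gt0//.
nra.
Qed.

Lemma gauss_weight2 (t : R) : 0 < t -> expR (- t ^+ 2) <= 2^-1 / t.
Proof.
move=> t0; rewrite ler_pdivlMr//.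
have h1 : expR (- t ^+ 2) <= (1 + t ^+ 2)^-1.
  rewrite expRN lef_pV2 ?posrE ?expR_gt0 ?addr_gt0 ?exprn_gt0//; exact: expR_ge1Dx.
have t2 : 0 < 1 + t ^+ 2 by rewrite addr_gt0 ?exprn_gt0.
rewrite (le_trans (ler_wpM2r (ltW t0) h1))// mulrC ler_pdivrMr//.
have := sqr_ge0 (t - 1); nra.
Qed.

Section gamma_transform.
Context {d : measure_display} {X : measurableType d}.
Variables (m : {sigma_finite_measure set X -> \bar R}) (c u v : X -> R[i]) (y : R).
Hypothesis y0 : 0 < y.
Hypotheses (mc : cmeas c) (mu : cmeas u) (mv : cmeas v).
Hypotheses (uy : forall x, y <= cIm (u x)) (vy : forall x, y <= cIm (v x)).
Hypothesis iq : m.-integrable setT (fun x => (cabs (c x) * (1 + cabs (u x) + cabs (v x)))%:E).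
Variable k : R.
Hypothesis k0 : 0 < k.

Local Notation wtr := (wtr m c u v).
Local Notation itr := (itr m c u v).

Definition gtr (b t : R) : R[i] := cint (gam k) (fun g => itr b g t).

Let iq1 : m.-integrable setT (fun x => (cabs (c x))%:E).
Proof.
apply: le_integrable iq => //; first by apply/measurable_EFinP; exact: measurable_cabs.
move=> x _; rewrite /= lee_fin (ger0_norm (cabs_ge0 _)) ger0_norm; last first.
  by rewrite mulr_ge0 ?addr_ge0 ?cabs_ge0.
by rewrite ler_peMr ?cabs_ge0// -addrA lerDl addr_ge0 ?cabs_ge0.
Qed.

Let M := \int[m]_x (2 * cabs (c x)).

Let M0 : 0 <= M.
Proof. by apply: Rintegral_ge0 => x _; rewrite mulr_ge0 ?cabs_ge0. Qed.

Lemma cmeas_inv_arg (f : X -> R[i]) : cmeas f ->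
  cmeas (fun z : measurableTypeR R * measurableTypeR R * X => - (z.1.1%:C / f z.2)).
Proof.
move=> mf; apply: cmeasN; apply: cmeasM.
  by apply: cmeasC; exact: (measurableT_comp measurable_fst measurable_fst).
by apply: cmeasV; apply: (cmeas_comp mf); exact: measurable_snd.
Qed.

Lemma cmeas_itr2 (b : R) : cmeas (fun z : measurableTypeR R * measurableTypeR R => itr b z.1 z.2).
Proof.
apply: (@cmeas_cint1 _ _ _ _ _ m (fun z : measurableTypeR R * measurableTypeR R * X =>
  c z.2 * (wave z.1.2 (- (z.1.1%:C / u z.2)) - b%:C * wave z.1.2 (- (z.1.1%:C / v z.2))))).
have m12 : measurable_fun setT (fun z : measurableTypeR R * measurableTypeR R * X => z.1.2).
  exact: (measurableT_comp measurable_snd measurable_fst).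
apply: cmeasM; first by apply: (cmeas_comp mc); exact: measurable_snd.
apply: cmeasB; first by apply: cmeas_wave2 => //; exact: cmeas_inv_arg.
apply: cmeasM; first exact: cmeas_cst.
by apply: cmeas_wave2 => //; exact: cmeas_inv_arg.
Qed.

Let mitr (b t : R) : cmeas (fun g : R => itr b g t).
Proof.
by apply: (cmeas_comp (cmeas_itr2 b) (u := fun g => (g, t))); exact: measurable_fun_pair.
Qed.

Lemma cmeas_gtr (b : R) : cmeas (gtr b).
Proof. exact: (cmeas_cint2 (gam k) (cmeas_itr2 b)). Qed.

Lemma cintegrable_itr (b g s : R) : 0 <= b <= 1 -> 0 < g -> 0 <= s ->
  cintegrable m (fun x => c x * (wave s (- (g%:C / u x)) - b%:C * wave s (- (g%:C / v x)))) /\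
  forall x, cabs (c x * (wave s (- (g%:C / u x)) - b%:C * wave s (- (g%:C / v x)))) <= 2 * cabs (c x).
Proof.
move=> /andP[b0 b1] g0 s0.
have bd x : cabs (c x * (wave s (- (g%:C / u x)) - b%:C * wave s (- (g%:C / v x)))) <= 2 * cabs (c x).
  rewrite cabsM mulrC ler_wpM2r ?cabs_ge0// (le_trans (cabsB _ _))// -[leRHS]/(1 + 1).
  have ux : 0 < cIm (u x) by exact: lt_le_trans (uy x).
  have vx : 0 < cIm (v x) by exact: lt_le_trans (vy x).
  rewrite lerD ?cabs_wave_le1 ?(ltW (Im_gdiv g0 ux))// cabsM cabsC ger0_norm//.
  by rewrite -[leRHS]mulr1 ler_pM ?cabs_ge0 ?cabs_wave_le1 ?(ltW (Im_gdiv g0 vx)).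
split=> //; have i2 := integrableZl measurableT 2 iq1.
apply: le_cintegrable i2 bd.
have mg f : cmeas f -> cmeas (fun x : X => wave s (- (g%:C / f x))).
  move=> mf; apply: cmeas_wave2; first exact: measurable_cst.
  by apply: cmeasN; apply: cmeasM; [exact: cmeas_cst|exact: cmeasV].
apply: cmeasM => //; apply: cmeasB; first exact: mg.
by apply: cmeasM; [exact: cmeas_cst|exact: mg].
Qed.

Lemma cabs_itr (b g s : R) : 0 <= b <= 1 -> 0 < g -> 0 <= s -> cabs (itr b g s) <= M.
Proof.
move=> b01 g0 s0; have [i1 b1] := cintegrable_itr b01 g0 s0.
rewrite (le_trans (cabs_cint i1))//; apply: le_Rintegral => //; first exact: cintegrable_cabs.
by have := integrableZl measurableT 2 iq1.
Qed.

(** Jensen's inequality for the gamma law of [g], applied to [itr_sqr_le] at time [g t];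
    the factor [k] is the mean of [g]. *)
Lemma gtr_sqr_le (b t : R) : 0 <= b <= 1 -> 0 < t ->
  cabs (gtr b t - itr b 1 0) ^+ 2 <= k * t * \int[hl]_s cabs (wtr b s) ^+ 2.
Proof.
move=> b01 t0; set Z := \int[hl]_s _.
have Z0 : 0 <= Z by apply: Rintegral_ge0 => s _; exact: sqr_ge0.
pose f (g : R) := itr b g t - itr b 1 0.
have mf : cmeas f by apply: cmeasB => //; exact: cmeas_cst.
have fM (g : R) : 0 < g -> cabs (f g) <= 2 * M.
  move=> g0; rewrite (le_trans (cabsB _ _))// mulr_natl mulr2n lerD// cabs_itr//.
  exact: ltW.
have fZ (g : R) : 0 < g -> cabs (f g) ^+ 2 <= t * Z * g.
  move=> g0; rewrite /f itrE; have gt : 0 < g * t by rewrite mulr_gt0.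
  rewrite (le_trans (itr_sqr_le y0 mc mu mv uy vy iq b01 gt))// -/Z.
  by rewrite le_eqVlt; apply/orP; left; apply/eqP; ring.
have fi : cintegrable (gam k) f by exact: cintegrable_gam fM.
have ig : (gam k).-integrable setT (fun g => (t * Z * g)%:E).
  apply: (@integrable_gam_linear _ _ _ (t * Z)) => //.
  move=> g g0; rewrite ger0_norm ?mulr_ge0 ?(ltW t0) ?(ltW g0)//.
  by rewrite ler_wpM2l ?mulr_ge0 ?(ltW t0)// lerDr.
have f2i : (gam k).-integrable setT (fun g => (cabs (f g) ^+ 2)%:E).
  apply: (@integrable_gam_linear _ _ _ (t * Z)) => //; first exact: measurable_cabs2.
  move=> g g0; rewrite ger0_norm ?sqr_ge0// (le_trans (fZ g g0))//.
  by rewrite ler_wpM2l ?mulr_ge0 ?(ltW t0)// lerDr.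
have -> : gtr b t - itr b 1 0 = cint (gam k) f.
  have h1 : cintegrable (gam k) (fun g => itr b g t).
    by apply: (cintegrable_gam (C := M)) => // g g0; apply: cabs_itr => //; exact: ltW.
  have h2 : cintegrable (gam k) (fun g : R => itr b 1 0).
    by apply: (cintegrable_gam (C := cabs (itr b 1 0))) => //; exact: cmeas_cst.
  rewrite cintB//; congr (_ - _).
  have h3 : cintegrable (gam k) (fun=> 1).
    by apply: (cintegrable_gam (C := 1)) => //; first [exact: cmeas_cst|move=> g _; rewrite cabs1].
  rewrite -[LHS]mulr1 -(cint1 (gam_setT k0)) -cintZl//.
  by apply: eq_cint => g; rewrite mulr1.
rewrite (le_trans (jensen_sqr (gam_setT k0) fi f2i))//.
have -> : k * t * Z = \int[gam k]_g (t * Z * g).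
  have igl : (gam k).-integrable setT (fun g : R => g%:E).
    apply: (@integrable_gam_linear _ _ _ 1) => // g g0.
    by rewrite mul1r ger0_norm ?(ltW g0)// lerDr.
  by rewrite (RintegralZl _ measurableT igl) gam_mean// -mulrA mulrC.
exact: le_Rintegral_gam.
Qed.

(** Jensen's inequality again: for each [g] the inversion is an isometry, so that the
    average does not increase the norm. *)
Lemma gtr_div_le :
  hl.-integrable setT (fun t => (cabs (gtr 1 t) ^+ 2 / t)%:E) /\
  \int[hl]_t (cabs (gtr 1 t) ^+ 2 / t) <= \int[hl]_t (cabs (wtr 1 t) ^+ 2 / t).
Proof.
set XX := (X in _ /\ _ <= X).
have b01 : 0 <= (1 : R) <= 1 by rewrite ler01 lexx.
have mg : measurable_fun setT (fun t => cabs (gtr 1 t) ^+ 2 / t).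
  apply: measurable_funM; last exact: measurable_inv.
  by apply: measurable_cabs2; exact: cmeas_gtr.
pose f (z : measurableTypeR R * measurableTypeR R) : R :=
  posind z.1 * (cabs (itr 1 z.2 z.1) ^+ 2 / z.1).
have f0 z : 0 <= f z.
  rewrite /f /posind; case: ltP => z0; rewrite ?mul0r// mul1r.
  by rewrite divr_ge0 ?sqr_ge0// ltW.
have mf : measurable_fun setT f.
  apply: measurable_funM; first exact: (measurableT_comp measurable_posind measurable_fst).
  apply: measurable_funM; last exact: (measurableT_comp measurable_inv measurable_fst).
  apply: measurable_cabs2.
  apply: (cmeas_comp (cmeas_itr2 1) (u := fun z => (z.2, z.1))).
  by apply: measurable_fun_pair; [exact: measurable_snd|exact: measurable_fst].
have mfE : measurable_fun setT (fun z => (f z)%:E) by exact/measurable_EFinP.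
have fE0 z : (0 <= (f z)%:E)%E by rewrite lee_fin.
have i1 (t : R) : 0 < t -> cintegrable (gam k) (fun g => itr 1 g t).
  move=> t0; apply: (cintegrable_gam (C := M)) => // g g0.
  by apply: cabs_itr => //; exact: ltW.
have i2 (t : R) : 0 < t -> (gam k).-integrable setT (fun g => (cabs (itr 1 g t) ^+ 2)%:E).
  move=> t0; apply: (@integrable_gam_linear _ _ _ (M ^+ 2)) => //; first exact: measurable_cabs2.
  move=> g g0; rewrite ger0_norm ?sqr_ge0//.
  rewrite (@le_trans _ _ (M ^+ 2))//; first by rewrite lerXn2r ?nnegrE ?cabs_ge0 ?cabs_itr// ltW.
  by rewrite ler_peMr ?sqr_ge0// lerDl ltW.
have main : (\int[hl]_t `|(cabs (gtr 1 t) ^+ 2 / t)%:E| <= XX%:E)%E.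
  apply: (@le_trans _ _ (\int[hl]_t \int[gam k]_g (f (t, g))%:E)%E).
    apply: le_integral_hl => //.
    - by apply: measurableT_comp => //; exact/measurable_EFinP.
    - exact: (@measurable_fun_fubini_tonelli_F _ _ _ _ R (gam k) (fun z => (f z)%:E) mfE fE0).
    - by move=> t; apply: integral_ge0 => g _; rewrite lee_fin.
    - move=> t t0.
      have j := jensen_sqr (gam_setT k0) (i1 t t0) (i2 t t0).
      have i3 : (gam k).-integrable setT (fun g => (t^-1 * cabs (itr 1 g t) ^+ 2)%:E).
        by have := integrableZl measurableT t^-1 (i2 t t0).
      have -> : (\int[gam k]_g (f (t, g))%:E = \int[gam k]_g (t^-1 * cabs (itr 1 g t) ^+ 2)%:E)%E.
        by apply: eq_integral => g _; rewrite /f /posind /= t0 mul1r mulrC.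
      rewrite -Rintegral_EFin// RintegralZl//; last exact: i2.
      rewrite /= lee_fin ger0_norm; last by rewrite divr_ge0 ?sqr_ge0// ltW.
      by rewrite [leRHS]mulrC ler_wpM2r// invr_ge0 ltW.
  rewrite (@fubini_tonelli _ _ _ _ R hl (gam k) (fun z => (f z)%:E) mfE fE0).
  apply: ge0_le_integral_gam => //.
  - exact: (@measurable_fun_fubini_tonelli_G _ _ _ _ R hl (fun z => (f z)%:E) mfE fE0).
  - by move=> g; apply: integral_ge0 => t _; rewrite lee_fin.
  - move=> g g0; have [h1 h2 h3] := itr_frullani y0 mc mu mv uy vy iq g0.
    have m1 : measurable_fun setT (fun t => f (t, g)).
      exact: (measurableT_comp mf (pair2_measurable g)).
    have m2 : measurable_fun setT (fun t => cabs (itr 1 g t) ^+ 2 / t).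
      by move/measurable_int: (h1) => /measurable_EFinP.
    have i3 : hl.-integrable setT (fun t => (f (t, g))%:E).
      apply: le_integrable_hl h1 _ => // t t0.
      by rewrite ger0_norm ?f0// /f /posind /= t0 mul1r.
    rewrite /XX -h3 -(Rintegral_EFin i3) lee_fin le_eqVlt; apply/orP; left; apply/eqP.
    by apply: eq_Rintegral_hl => // t t0; rewrite /f /posind /= t0 mul1r.
have ig : hl.-integrable setT (fun t => (cabs (gtr 1 t) ^+ 2 / t)%:E).
  apply/integrableP; split; first exact/measurable_EFinP.
  by apply: (le_lt_trans main); rewrite ltry.
split=> //; rewrite -lee_fin Rintegral_EFin//; apply: le_trans main.
by apply: le_integral => //; [exact: integrable_abse|move=> t _; rewrite lee_fin ler_norm].
Qed.

(** The factor [e^(- t ^ 2)] is a gain only away from [t = 0]. Near [0], [gtr_sqr_le] bounds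
    the square by the unweighted norm [Z], at the price of [k Z]; on the scale [ep] this costs
    [ep * e * k * ep ^ 2 Z], and [ep] is small enough for this to be less than half of the part
    [ep ^ 2 / 2 * Z] of the norm on the right. *)
Lemma gtr_contraction (K ep : R) : k <= K -> ep = (4 * expR 1 * (K + 1))^-1 ->
  let w t := t^-1 + ep ^+ 2 / 2 in
  [/\ hl.-integrable setT (fun t => (expR (- t ^+ 2) * cabs (gtr 1 t) ^+ 2 * w t)%:E),
      hl.-integrable setT (fun t => (cabs (wtr 1 t) ^+ 2 * w t)%:E) &
      \int[hl]_t (expR (- t ^+ 2) * cabs (gtr 1 t) ^+ 2 * w t) <=
      (1 - ep ^+ 2 / 4) * \int[hl]_t (cabs (wtr 1 t) ^+ 2 * w t)].
Proof.
move=> kK epE w; have b01 : 0 <= (1 : R) <= 1 by rewrite ler01 lexx.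
have K0 : 0 < K by exact: lt_le_trans kK.
have ex1 : 1 <= expR 1 :> R by rewrite -[leLHS]expR0 ler_expR.
have eK : 0 < 4 * expR 1 * (K + 1) by rewrite !mulr_gt0 ?expR_gt0// addr_gt0.
have e0 : 0 < ep by rewrite epE invr_gt0.
have e1 : ep <= 1.
  rewrite epE invf_le1//.
  have : 0 <= (expR 1 - 1) * (K + 1) by rewrite mulr_ge0 ?subr_ge0// addr_ge0// ltW.
  lra.
have ek : ep * expR 1 * k <= 4^-1.
  have h : ep * (4 * expR 1 * (K + 1)) = 1 by rewrite epE mulVf// gt_eqF.
  have : 0 <= ep * expR 1 * (K + 1 - k).
    by rewrite !mulr_ge0 ?expR_ge0 ?(ltW e0)// subr_ge0 (le_trans kK)// lerDl.
  lra.
have e2 : 0 < ep ^+ 2 by rewrite exprn_gt0.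
have [g1 g2] := gtr_div_le.
have [_ x1 _] := itr_frullani y0 mc mu mv uy vy iq (ltr01 : 0 < 1 :> R).
have z1 := integrable_wtr y0 mc mu mv uy vy iq b01.
set XX := \int[hl]_t (cabs (wtr 1 t) ^+ 2 / t) in g2.
pose Z := \int[hl]_t cabs (wtr 1 t) ^+ 2.
have Z0 : 0 <= Z by apply: Rintegral_ge0 => s _; exact: sqr_ge0.
have cz : hl.-integrable setT (fun t => (ep ^+ 2 / 2 * cabs (wtr 1 t) ^+ 2)%:E).
  by have := integrableZl measurableT (ep ^+ 2 / 2) z1.
have wE (t : R) : cabs (wtr 1 t) ^+ 2 * w t =
    cabs (wtr 1 t) ^+ 2 / t + ep ^+ 2 / 2 * cabs (wtr 1 t) ^+ 2.
  by rewrite /w mulrDr [_ * (ep ^+ 2 / 2)]mulrC.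
have iw : hl.-integrable setT (fun t => (cabs (wtr 1 t) ^+ 2 * w t)%:E).
  have := integrableD measurableT x1 cz; apply: eq_integrable => // t _.
  by rewrite wE.
have ew : \int[hl]_t (cabs (wtr 1 t) ^+ 2 * w t) = XX + ep ^+ 2 / 2 * Z.
  have -> : \int[hl]_t (cabs (wtr 1 t) ^+ 2 * w t) =
    \int[hl]_t (cabs (wtr 1 t) ^+ 2 / t + ep ^+ 2 / 2 * cabs (wtr 1 t) ^+ 2).
    by apply: eq_Rintegral => t _; exact: wE.
  by rewrite RintegralD// RintegralZl.
have eV : 0 < ep^-1 by rewrite invr_gt0.
have [ie Ie] := integrable_expRN eV; rewrite invrK in Ie.
pose A := 1 - ep ^+ 2 / 2 + ep ^+ 2 / 4.
pose B := ep ^+ 2 * expR 1 * (k * Z).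
pose rhs (t : R) := A * (cabs (gtr 1 t) ^+ 2 / t) + B * expR (- (ep^-1 * t)).
have ia : hl.-integrable setT (fun t => (A * (cabs (gtr 1 t) ^+ 2 / t))%:E).
  by have := integrableZl measurableT A g1.
have ib : hl.-integrable setT (fun t => (B * expR (- (ep^-1 * t)))%:E).
  by have := integrableZl measurableT B ie.
have ir : hl.-integrable setT (fun t => (rhs t)%:E).
  by have := integrableD measurableT ia ib.
have it0 : itr 1 1 0 = 0.
  rewrite -[RHS](cint0 m); apply: eq_cint => x; rewrite !wave0 !mul1r subrr mulr0//.
have P1 (t : R) : 0 < t -> cabs (gtr 1 t) ^+ 2 <= k * t * Z.
  by move=> t0; have := gtr_sqr_le b01 t0; rewrite it0 subr0.
have lr (t : R) : 0 < t -> `|expR (- t ^+ 2) * cabs (gtr 1 t) ^+ 2 * w t| <= rhs t.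
  move=> t0; have t1 : 0 < t^-1 by rewrite invr_gt0.
  have w0 : 0 <= w t by rewrite /w addr_ge0 ?divr_ge0 ?(ltW t1) ?(ltW e2).
  rewrite ger0_norm; last by apply: mulr_ge0 => //; rewrite mulr_ge0 ?expR_ge0 ?sqr_ge0.
  have p0 : 0 <= cabs (gtr 1 t) ^+ 2 by exact: sqr_ge0.
  have h1 := gauss_weight e0 e1 t0; have h2 := gauss_weight2 t0.
  have h3 := P1 t t0; rewrite /rhs /w.
  move: (cabs (gtr 1 t) ^+ 2) (expR (- t ^+ 2)) (expR (- (ep^-1 * t))) (expR_ge0 (- (ep^-1 * t))) (expR_ge0 (- t ^+ 2)) p0 h1 h2 h3 => P E F F0 E0 P0 h1 h2 h3.
  have Pt : 0 <= P / t by rewrite mulr_ge0// ltW.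
  have a1 : E * (P / t) <= (1 - ep ^+ 2 / 2 + ep ^+ 2 * (expR 1 * F)) * (P / t) by rewrite ler_wpM2r.
  have a2 : E * P <= 2^-1 / t * P by rewrite ler_wpM2r.
  have a3 : P / t <= k * Z by rewrite ler_pdivrMr// (le_trans h3)// mulrAC.
  have a4 : ep ^+ 2 * (expR 1 * F) * (P / t) <= ep ^+ 2 * (expR 1 * F) * (k * Z).
    have q0 : 0 <= ep ^+ 2 * (expR 1 * F).
      by apply: mulr_ge0; [exact: ltW|apply: mulr_ge0; rewrite ?expR_ge0].
    by rewrite ler_wpM2l.
  have a5 : ep ^+ 2 / 2 * (E * P) <= ep ^+ 2 / 2 * (2^-1 / t * P).
    by rewrite ler_wpM2l// divr_ge0// ltW.
  have -> : E * P * (t^-1 + ep ^+ 2 / 2) = E * (P / t) + ep ^+ 2 / 2 * (E * P) by ring.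
  rewrite (le_trans (lerD a1 a5))// /A /B.
  have -> : (1 - ep ^+ 2 / 2 + ep ^+ 2 * (expR 1 * F)) * (P / t) + ep ^+ 2 / 2 * (2^-1 / t * P) =
    (1 - ep ^+ 2 / 2 + ep ^+ 2 / 4) * (P / t) + ep ^+ 2 * (expR 1 * F) * (P / t) by field; rewrite gt_eqF.
  rewrite lerD2l (le_trans a4)// le_eqVlt; apply/orP; left; apply/eqP; ring.
have mgw : measurable_fun setT (fun t : R => expR (- t ^+ 2) * cabs (gtr 1 t) ^+ 2 * w t).
  apply: measurable_funM; last first.
    by apply: measurable_funD; [exact: measurable_inv|exact: measurable_cst].
  apply: measurable_funM; last by apply: measurable_cabs2; exact: cmeas_gtr.
  by apply: measurableT_comp => //; apply: measurableT_comp.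
have ig : hl.-integrable setT (fun t => (expR (- t ^+ 2) * cabs (gtr 1 t) ^+ 2 * w t)%:E).
  exact: le_integrable_hl ir lr.
split=> //; apply: (@le_trans _ _ (\int[hl]_t rhs t)).
  by apply: le_Rintegral_hl => // t t0; apply: le_trans (lr t t0); exact: ler_norm.
have -> : \int[hl]_t rhs t = A * \int[hl]_t (cabs (gtr 1 t) ^+ 2 / t) + B * ep.
  by rewrite RintegralD// !RintegralZl// Ie.
rewrite ew.
have A0 : 0 <= A.
  by have := exprn_ile1 2 (ltW e0) e1; rewrite /A; lra.
have h1 : A * \int[hl]_t (cabs (gtr 1 t) ^+ 2 / t) <= A * XX by rewrite ler_wpM2l.
have h2 : B * ep <= ep ^+ 2 / 4 * Z.
  have -> : B * ep = ep ^+ 2 * (ep * expR 1 * k) * Z by rewrite /B; ring.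
  by rewrite ler_wpM2r// ler_wpM2l// ltW.
have ee : ep ^+ 2 <= 1 by exact: exprn_ile1 (ltW e0) e1.
have h3 : 0 <= (1 - ep ^+ 2) * (ep ^+ 2 * Z).
  by rewrite !mulr_ge0 ?subr_ge0// ltW.
have h4 : 0 <= ep ^+ 2 * Z by rewrite mulr_ge0// ltW.
have -> : (1 - ep ^+ 2 / 4) * (XX + ep ^+ 2 / 2 * Z) = A * XX + (1 - ep ^+ 2 / 4) * (ep ^+ 2 / 2 * Z).
  by rewrite /A; field.
nra.
Qed.

End gamma_transform.

End contraction.

(** * Independence *)

Section independence.
Context {R : realType} {d : measure_display} {T : measurableType d} (P : probability T R).
Context (I : finType) (X : I -> T -> measurableTypeR R).
Hypothesis mX : forall j, measurable_fun setT (X j).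
Hypothesis indX : forall (J : {set I}) (A : I -> set (measurableTypeR R)),
  (forall j, j \in J -> measurable (A j)) ->
  P (\bigcap_(j in [set` J]) (X j @^-1` A j)) = (\prod_(j in J) P (X j @^-1` A j))%E.
Variable i : I.

Let mpre j (A : set (measurableTypeR R)) : measurable A -> measurable (X j @^-1` A).
Proof. by move=> mA; rewrite -[X in measurable X]setTI; exact: mX. Qed.

Definition cylinders : set (set T) :=
  [set B | exists2 A : I -> set (measurableTypeR R), (forall j, measurable (A j)) &
    B = \bigcap_(j in [set` [set~ i]%SET]) (X j @^-1` A j)].

(** The sample space with the sigma-algebra of the variables of index different from [i]. *)
Definition others := g_sigma_algebraType cylinders.

Let cyl_setT : cylinders setT.
Proof.
exists (fun=> setT) => [j|]; first exact: measurableT.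
by apply/esym/seteqP; split => // x _ j.
Qed.

Let cyl_setI : setI_closed cylinders.
Proof.
move=> _ _ [A mA ->] [B mB ->]; exists (fun j => A j `&` B j) => [j|].
  exact: measurableI.
by rewrite -bigcapI.
Qed.

Let cyl_measurable : cylinders `<=` @measurable d T.
Proof.
move=> _ [A mA ->]; apply: fin_bigcap_measurable => // j _.
exact: mpre.
Qed.

Lemma measurable_others (j : I) : j != i ->
  measurable_fun setT (X j : others -> measurableTypeR R).
Proof.
move=> ji _ A mA; rewrite setTI; apply: sub_sigma_algebra.
exists (fun l => if l == j then A else setT) => [l|]; first by case: ifP.
apply/seteqP; split => [x Ax l _ /=|x /(_ j)]; last by rewrite /= in_setC1 eqxx; exact.
by case: eqP => [->|].
Qed.

Lemma measurable_id_others : measurable_fun setT (id : T -> others).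
Proof.
move=> _ A mA; rewrite setTI.
exact: (smallest_sub (@sigma_algebra_measurable _ T) cyl_measurable).
Qed.

Let indep_cyl (A : set (measurableTypeR R)) B : measurable A -> cylinders B ->
  P (X i @^-1` A `&` B) = (P (X i @^-1` A) * P B)%E.
Proof.
move=> mA [C mC ->]; pose D j := if j == i then A else C j.
have mD j : measurable (D j) by rewrite /D; case: ifP.
have := indX (J := [set: I]%SET) (fun j _ => mD j).
rewrite (bigD1 i)//= {2}/D eqxx => h.
have e1 : \bigcap_(j in [set` [set: I]%SET]) (X j @^-1` D j) =
    X i @^-1` A `&` \bigcap_(j in [set` [set~ i]%SET]) (X j @^-1` C j).
  apply/seteqP; split => [x Dx|x [Ax Cx] j _].
    split; first by have := Dx i; rewrite /= inE /D eqxx; exact.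
    move=> j; rewrite /= in_setC1 => ji; have := Dx j.
    by rewrite /= inE /D (negbTE ji); exact.
  by rewrite /= /D; case: eqP => [->//|/eqP ji]; apply: Cx; rewrite /= in_setC1.
rewrite -e1 h; congr (_ * _)%E.
rewrite (indX (J := [set~ i]%SET))//; apply: eq_big => j; first by rewrite !inE.
by case/andP=> _ ji; rewrite /D (negbTE ji).
Qed.

Lemma indep_others (A : set (measurableTypeR R)) (B : set others) :
  measurable A -> measurable B -> P (X i @^-1` A `&` B) = (P (X i @^-1` A) * P B)%E.
Proof.
move=> mA mB.
have mXA := mpre i mA.
have p0 : 0 <= fine (P (X i @^-1` A)) by rewrite fine_ge0.
pose m1 : {measure set T -> \bar R} := mrestr P mXA.
pose m2 : {measure set T -> \bar R} := mscale (NngNum p0) P.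
have pE : (fine (P (X i @^-1` A)))%:E = P (X i @^-1` A).
  by rewrite fineK// fin_num_measure.
have m2E C : m2 C = (P (X i @^-1` A) * P C)%E by rewrite -pE.
have m1E C : m1 C = P (X i @^-1` A `&` C) by rewrite /m1 /mrestr /= setIC.
rewrite -m1E -m2E.
apply: (@g_sigma_algebra_measure_unique _ _ _ cylinders cyl_measurable (fun=> setT)) => //.
- by rewrite bigcup_const//; exists 0%N.
- by move=> C cC; rewrite m1E m2E indep_cyl.
- by move=> k; rewrite m1E setIT -pE ltry.
Qed.

(** By [indep_others] the law of the pair is a product, so that Fubini's theorem applies. The
    law of [X i] is given through [theta] because chi laws arise from gamma laws by a square root. *)
Lemma indep_Rintegral (mu : {sigma_finite_measure set (measurableTypeR R) -> \bar R})
    (theta : R -> R) (F : measurableTypeR R * others -> R) :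
  measurable_fun setT theta ->
  (forall A : set (measurableTypeR R), measurable A -> P (X i @^-1` A) = mu (theta @^-1` A)) ->
  measurable_fun setT F ->
  (forall w, mu.-integrable setT (fun x => (F (theta x, w))%:E)) ->
  P.-integrable setT (fun w => (F (X i w, w))%:E) ->
  \int[P]_w F (X i w, w) = \int[P]_w \int[mu]_x F (theta x, w).
Proof.
move=> mth law mF iF iP.
pose id' : {mfun T >-> others} := HB.pack (id : T -> others) (isMeasurableFun.Build _ _ _ _ _ measurable_id_others).
pose P' : probability others R := distribution P id'.
pose Xi : {mfun T >-> measurableTypeR R} := HB.pack (X i) (isMeasurableFun.Build _ _ _ _ _ (mX i)).
pose Q : probability (measurableTypeR R) R := distribution P Xi.
have mpsi : measurable_fun setT (fun w : T => (X i w, w : others)).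
  by apply: measurable_fun_pair; [exact: mX|exact: measurable_id_others].
pose psi : {mfun T >-> (measurableTypeR R * others)%type} := HB.pack (fun w : T => (X i w, w : others)) (isMeasurableFun.Build _ _ _ _ _ mpsi).
pose PP : probability _ R := distribution P psi.
have QP : forall A, measurable A -> (Q \x P')%E A = PP A.
  apply: product_measure_unique => A B mA mB.
  exact: indep_others.
have mFE : measurable_fun setT (fun z => (F z)%:E) by exact/measurable_EFinP.
have iPP : PP.-integrable setT (fun z => (F z)%:E).
  exact: integrable_pushforward.
have iQP : (Q \x P')%E.-integrable setT (fun z => (F z)%:E).
  move/integrableP: iPP => [_ h]; apply/integrableP; split=> //.
  by rewrite (eq_measure_integral PP)// => A mA _; exact: QP.
have e1 : \int[P]_w F (X i w, w) = \int[(Q \x P')%E]_z F z.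
  rewrite /Rintegral (eq_measure_integral PP); last by move=> A mA _; exact: QP.
  by rewrite integral_pushforward.
rewrite e1 Rintegral_prod//.
have mth' : measurable_fun setT (theta : measurableTypeR R -> measurableTypeR R) by exact: mth.
pose th : {mfun measurableTypeR R >-> measurableTypeR R} :=
  HB.pack theta (isMeasurableFun.Build _ _ _ _ _ mth').
have iQ w : \int[Q]_x F (x, w) = \int[mu]_x F (theta x, w).
  have mFw : measurable_fun setT (fun x => (F (x, w))%:E).
    exact: (measurableT_comp mFE (pair2_measurable w)).
  rewrite /Rintegral [in LHS](eq_measure_integral (pushforward mu th)); last first.
    by move=> A mA _; exact: law.
  by rewrite integral_pushforward//; exact (iF w).
have mI : measurable_fun setT (fun w : others => \int[Q]_x F (x, w)).
  apply: (@measurable_Rintegral1 _ _ _ others (measurableTypeR R) Q (fun z => F (z.2, z.1))).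
  apply: (measurableT_comp mF); apply: measurable_fun_pair.
    exact: measurable_snd.
  exact: measurable_fst.
transitivity (\int[P]_w \int[Q]_x F (x, w)); last by apply: eq_Rintegral => w _.
have mIE : measurable_fun setT (fun w : others => (\int[Q]_x F (x, w))%:E).
  exact/measurable_EFinP.
rewrite /Rintegral; congr fine; rewrite [LHS]integralE [RHS]integralE.
congr (_ - _)%E.
  apply: (ge0_integral_pushforward measurable_id_others) => //.
  exact: measurable_funepos.
apply: (ge0_integral_pushforward measurable_id_others) => //.
exact: measurable_funeneg.
Qed.

End independence.

(** * Resolvents of real symmetric matrices *)

Section resolvent.
Context {R : realType}.

Definition shifted n (T : 'M[R]_n) (z : R[i]) : 'M[R[i]]_n :=
  map_mx (real_complex R) T - z%:M.

Definition res n (T : 'M[R]_n) (z : R[i]) : 'M[R[i]]_n := invmx (shifted T z).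

Lemma Im_quadratic_form n (T : 'M[R]_n) (z : R[i]) (v : 'rV[R[i]]_n) : T^T = T ->
  cIm ((v *m shifted T z *m (map_mx conjc v)^T) 0 0) = - cIm z * \sum_k cabs (v 0 k) ^+ 2.
Proof.
move=> sT; rewrite mxE.
pose q i j : R := T i j * cIm (v 0 i * conjc (v 0 j)).
have qa : \sum_j \sum_i q i j = 0.
  have qN i j : q j i = - q i j.
    rewrite /q -[in LHS]sT mxE -mulrN; congr (_ * _).
    by rewrite !cImM !cReJ !cImJ; ring.
  have h : \sum_j \sum_i q i j = - \sum_j \sum_i q i j.
    rewrite {1}exchange_big/= -sumrN; apply: eq_bigr => i _.
    by rewrite -sumrN; apply: eq_bigr => j _; rewrite qN.
  by move: h; set s := \sum_j _; lra.
have -> : \sum_j (v *m shifted T z) 0 j * (map_mx conjc v)^T j 0 =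
    \sum_j \sum_i (T i j)%:C * (v 0 i * conjc (v 0 j)) - z * \sum_k (cabs (v 0 k) ^+ 2)%:C.
  rewrite mulr_sumr -sumrB; apply: eq_bigr => j _.
  have -> : (v *m shifted T z) 0 j = (v *m map_mx (real_complex R) T) 0 j - z * v 0 j.
    by rewrite mulmxBr mul_mx_scalar !mxE.
  rewrite !mxE mulrBl; congr (_ - _); last by rewrite -mulrA; congr (_ * _); exact: mulJ.
  by rewrite mulr_suml; apply: eq_bigr => i _; rewrite !mxE; ring.
rewrite cImB mulNr; transitivity (\sum_j \sum_i q i j - cIm z * \sum_k cabs (v 0 k) ^+ 2).
  2: by rewrite qa sub0r.
congr (_ - _).
  rewrite cIm_sum; apply: eq_bigr => j _; rewrite cIm_sum; apply: eq_bigr => i _.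
  by rewrite cImM cImC cReC mul0r addr0.
rewrite cImM cIm_sum big1 ?mulr0 ?add0r//.
by rewrite cRe_sum; congr (_ * _); apply: eq_bigr.
Qed.

(** A null vector would be a zero of the quadratic form, whose imaginary part is definite. *)
Lemma shifted_unit n (T : 'M[R]_n) (z : R[i]) : T^T = T -> 0 < cIm z -> shifted T z \in unitmx.
Proof.
move=> sT z0; rewrite -row_free_unit -kermx_eq0; apply/rowV0P => v /sub_kermxP vA.
have := Im_quadratic_form z v sT; rewrite vA mul0mx mxE => /esym/eqP.
rewrite mulf_eq0 oppr_eq0 gt_eqF//= psumr_eq0; last by move=> i _; exact: sqr_ge0.
move=> /allP h; apply/rowP => k; rewrite mxE.
have := h k (mem_index_enum k); rewrite /= sqrf_eq0 cabs_eq0 => /eqP; exact.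
Qed.

Lemma res_mulV n (T : 'M[R]_n) (z : R[i]) : T^T = T -> 0 < cIm z ->
  res T z *m shifted T z = 1%:M.
Proof. by move=> sT z0; rewrite mulVmx// shifted_unit. Qed.

Lemma res_mulmx n (T : 'M[R]_n) (z : R[i]) : T^T = T -> 0 < cIm z ->
  shifted T z *m res T z = 1%:M.
Proof. by move=> sT z0; rewrite mulmxV// shifted_unit. Qed.

Lemma shifted_sym n (T : 'M[R]_n) (z : R[i]) : T^T = T -> (shifted T z)^T = shifted T z.
Proof. by move=> sT; rewrite /shifted linearB/= tr_scalar_mx map_trmx sT. Qed.

Lemma res_sym n (T : 'M[R]_n) (z : R[i]) : T^T = T -> (res T z)^T = res T z.
Proof. by move=> sT; rewrite /res trmx_inv shifted_sym. Qed.

Lemma res_symE n (T : 'M[R]_n) (z : R[i]) j k : T^T = T -> res T z j k = res T z k j.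
Proof. by move=> sT; rewrite -{1}(res_sym z sT) mxE. Qed.

(** The Ward identity: the quadratic form at the row [j] of the resolvent. *)
Lemma Im_res n (T : 'M[R]_n) (z : R[i]) j : T^T = T -> 0 < cIm z ->
  cIm (res T z j j) = cIm z * \sum_k cabs (res T z j k) ^+ 2.
Proof.
move=> sT z0; have := Im_quadratic_form z (row j (res T z)) sT.
rewrite -row_mul res_mulV// => h.
have : cIm (conjc (res T z j j)) = - cIm z * \sum_k cabs (res T z j k) ^+ 2.
  have -> : \sum_k cabs (res T z j k) ^+ 2 = \sum_k cabs (row j (res T z) 0 k) ^+ 2.
    by apply: eq_bigr => k _; rewrite mxE.
  rewrite -h; congr cIm; rewrite mxE (bigD1 j)//= big1 => [|k kj].
    by rewrite !mxE eqxx mul1r addr0.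
  by rewrite !mxE eq_sym (negbTE kj) mul0r.
rewrite cImJ => /eqP; rewrite mulNr eqr_opp => /eqP.
exact.
Qed.

Lemma cabs_res n (T : 'M[R]_n) (z : R[i]) j k : T^T = T -> 0 < cIm z ->
  cabs (res T z j k) <= (cIm z)^-1.
Proof.
move=> sT z0; have W l : cIm z * cabs (res T z j l) ^+ 2 <= cIm (res T z j j).
  rewrite (Im_res j sT z0) ler_wpM2l ?(ltW z0)// (bigD1 l)//= lerDl.
  by apply: sumr_ge0 => i _; exact: sqr_ge0.
have d1 : cabs (res T z j j) <= (cIm z)^-1.
  have := le_trans (W j) (Im_le_cabs _); have := cabs_ge0 (res T z j j).
  set x := cabs _ => x0 h; rewrite -[leRHS]mul1r ler_pdivlMr// mulrC.
  rewrite leNgt; apply/negP => x1; have xp : 0 < x by nra.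
  have : cIm z * x ^+ 2 > x by rewrite expr2 mulrA ltr_pMl.
  by rewrite ltNge h.
have h1 := le_trans (le_trans (W k) (Im_le_cabs _)) d1.
have h2 : cabs (res T z j k) ^+ 2 <= (cIm z)^-1 ^+ 2.
  by rewrite expr2 ler_pdivlMl.
by rewrite -(@ler_pXn2r _ 2)// nnegrE ?cabs_ge0// invr_ge0 ltW.
Qed.

Lemma res_comm n (T : 'M[R]_n) (z : R[i]) : T^T = T -> 0 < cIm z ->
  map_mx (real_complex R) T *m res T z = res T z *m map_mx (real_complex R) T.
Proof.
move=> sT z0; have := res_mulV sT z0; have := res_mulmx sT z0.
rewrite /shifted mulmxBl mulmxBr mul_scalar_mx mul_mx_scalar => h1 h2.
have e1 : map_mx (real_complex R) T *m res T z = 1%:M + z *: res T z by rewrite -h1 subrK.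
by rewrite e1 -h2 subrK.
Qed.

Lemma res_sub n (T T' : 'M[R]_n) (z : R[i]) : T^T = T -> T'^T = T' -> 0 < cIm z ->
  res T' z - res T z = - (res T' z *m map_mx (real_complex R) (T' - T) *m res T z).
Proof.
move=> sT sT' z0.
have -> : map_mx (real_complex R) (T' - T) = shifted T' z - shifted T z.
  by rewrite /shifted map_mxB opprB addrA subrK.
rewrite mulmxBr mulmxBl res_mulV// mul1mx -mulmxA res_mulmx// mulmx1.
by rewrite opprB.
Qed.

(** ** Derivatives *)

Lemma cderive_quotient (f h : R -> R[i]) (s : R) (C : R) :
  (forall r, f r - f s = (r - s)%:C * h r) ->
  (forall r, cabs (h r - h s) <= C * `|r - s|) -> is_cderive f s (h s).
Proof.
move=> fh hC.
have C0 : 0 <= C.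
  have := hC (s + 1); rewrite addrAC subrr add0r normr1 mulr1.
  by apply: le_trans; exact: cabs_ge0.
have key (p : R[i] -> R) : (forall (x : R) w, p (x%:C * w) = x * p w) ->
    (forall u v, p (u - v) = p u - p v) -> (forall w, `|p w| <= cabs w) ->
    is_derive s 1 (fun r => p (f r)) (p (h s)).
  move=> pM pB pa.
  have cv : (fun t => t^-1 *: ((fun r => p (f r)) (t *: (1 : R) + s) - p (f s))) @ 0^' --> p (h s).
    apply/cvgrPdist_le => e e0; near=> t.
    have t0 : t != 0 by near: t; exact: nbhs_dnbhs_neq.
    rewrite -pB fh pM /= [t *: 1]mulr1 addrK [_ *: _]mulrA mulVf// mul1r distrC -pB.
    rewrite (le_trans (pa _))// (le_trans (hC _))// addrK.
    have : `|t| <= e / (C + 1).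
      near: t; apply: dnbhs0_le; rewrite divr_gt0// ltr_wpDl//.
    rewrite ler_pdivlMr ?ltr_wpDl// => h1; rewrite (le_trans _ h1)// mulrC ler_wpM2l//.
    by rewrite lerDl.
  have dv : derivable (fun r => p (f r)) s 1 by apply/cvg_ex; exists (p (h s)).
  by apply: DeriveDef => //; exact: cvg_lim.
split; apply: key.
- by move=> x w; rewrite cReM cReC cImC mul0r subr0.
- exact: cReB.
- exact: Re_cabs.
- by move=> x w; rewrite cImM cReC cImC mul0r addr0.
- exact: cImB.
- exact: Im_cabs.
Unshelve. all: by end_near. Qed.

Lemma cabs_sum (I : Type) (u : seq I) (Q : pred I) (F : I -> R[i]) :
  cabs (\sum_(i <- u | Q i) F i) <= \sum_(i <- u | Q i) cabs (F i).
Proof.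
elim/big_rec2: _ => [|i y x _ yx]; first by rewrite cabs0.
by rewrite (le_trans (cabsD _ _))// lerD2l.
Qed.

Lemma cabs_mulmx3 n (A B C : 'M[R[i]]_n) (a c : R) j k :
  (forall j k, cabs (A j k) <= a) -> (forall j k, cabs (C j k) <= c) ->
  cabs ((A *m B *m C) j k) <= \sum_l \sum_m (a * cabs (B m l) * c).
Proof.
move=> Aa Cc; rewrite mxE (le_trans (cabs_sum _ _ _))//; apply: ler_sum => l _.
rewrite mxE mulr_suml (le_trans (cabs_sum _ _ _))//; apply: ler_sum => m _.
by rewrite !cabsM !ler_pM ?mulr_ge0 ?cabs_ge0.
Qed.

(** The second resolvent identity gives the difference quotient, and the bound on the
    entries its convergence. *)
Lemma cderive_res n (T E : 'M[R]_n) (z : R[i]) (s : R) j k :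
  T^T = T -> E^T = E -> 0 < cIm z ->
  is_cderive (fun r => res (T + r *: E) z j k) s
    (- (res (T + s *: E) z *m map_mx (real_complex R) E *m res (T + s *: E) z) j k).
Proof.
move=> sT sE z0; have sTE r : (T + r *: E)^T = T + r *: E.
  by rewrite linearD/= linearZ/= sT sE.
set G := fun r => res (T + r *: E) z.
set E' := map_mx (real_complex R) E.
have dG r r' : G r' - G r = - ((r' - r)%:C *: (G r' *m E' *m G r)).
  rewrite /G res_sub//; congr (- _).
  have -> : T + r' *: E - (T + r *: E) = (r' - r) *: E by rewrite opprD addrACA subrr add0r -scalerBl.
  by rewrite map_mxZ -scalemxAr -scalemxAl.
pose y := (cIm z)^-1; have y0 : 0 <= y by rewrite invr_ge0 ltW.
pose D := \sum_l \sum_m (y * cabs (E' m l) * y).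
have D0 : 0 <= D.
  by apply: sumr_ge0 => l _; apply: sumr_ge0 => m _; rewrite !mulr_ge0 ?cabs_ge0.
have bG r j' k' : cabs (G r j' k') <= y by exact: cabs_res.
have bGE r r' j' k' : cabs ((G r' *m E' *m G r) j' k') <= D by exact: cabs_mulmx3.
pose h r := - (G r *m E' *m G s) j k.
apply: (@cderive_quotient _ h s (\sum_l \sum_m (D * cabs (E' m l) * y))).
- move=> r; have := congr1 (fun M : 'M[R[i]]_n => M j k) (dG s r).
  by rewrite /h !mxE => ->; rewrite mulrN.
- move=> r; rewrite /h -opprB opprK cabsN addrC.
  have -> : (G r *m E' *m G s) j k - (G s *m E' *m G s) j k = ((G r - G s) *m E' *m G s) j k.
    by rewrite !mulmxBl !mxE.
  have e c (M : 'M[R[i]]_n) : (- (c *: M)) j k = - (c * M j k) by rewrite !mxE.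
  rewrite dG !mulNmx -!scalemxAl e cabsN cabsM cabsC mulrC.
  by rewrite ler_wpM2r// cabs_mulmx3.
Qed.

End resolvent.

(** * Tridiagonal matrices *)

Section tridiagonal_algebra.
Context {R : realType}.
Local Notation rc := (real_complex R).

Lemma tridiag_sym n (a : 'I_n.+1 -> R) (b : 'I_n -> R) :
  (tridiag_mx a b)^T = tridiag_mx a b.
Proof.
by rewrite /tridiag_mx !linearD/= tr_diag_mx trmxK -!addrA [X in _ + X]addrC.
Qed.

Let up n (k : 'I_n) : 'I_n.+1 := lift ord0 k.
Let lo n (k : 'I_n) : 'I_n.+1 := widen_ord (leqnSn n) k.

Let up_inj n : injective (@up n).
Proof. exact: lift_inj. Qed.

Let lo_inj n : injective (@lo n).
Proof. by move=> i j /(congr1 val)/= h; apply: val_inj. Qed.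

Lemma mxtrace_delta n (i j : 'I_n) (M : 'M[R[i]]_n) : \tr (delta_mx i j *m M) = M j i.
Proof.
rewrite /mxtrace (bigD1 i)//= mxE (bigD1 j)//= mxE !eqxx mul1r.
rewrite big1 => [|k kj]; last by rewrite mxE (negbTE kj) andbF mul0r.
rewrite big1 ?addr0// => k ki; rewrite mxE big1// => l _.
by rewrite mxE (negbTE ki) mul0r.
Qed.

Lemma mxtrace_scale_delta n (c : R[i]) (i j : 'I_n) (M : 'M[R[i]]_n) :
  \tr ((c *: delta_mx i j) *m M) = c * M j i.
Proof. by rewrite -scalemxAl mxtraceZ mxtrace_delta. Qed.

Lemma mxE_delta n p (i j k : 'I_n) (l : 'I_p) (M : 'M[R[i]]_(n, p)) :
  (delta_mx i j *m M) k l = (k == i)%:R * M j l.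
Proof.
rewrite mxE (bigD1 j)//= mxE eqxx andbT big1 ?addr0// => m mj.
by rewrite mxE (negbTE mj) andbF mul0r.
Qed.

Definition csub n (b : 'I_n -> R) : 'M[R[i]]_n.+1 := map_mx rc (subdiag_mx b).

Lemma csubE n (b : 'I_n -> R) : csub b = \sum_k (b k)%:C *: delta_mx (up k) (lo k).
Proof.
rewrite /csub /subdiag_mx map_mx_sum; apply: eq_bigr => k _.
by rewrite map_mxZ map_delta_mx.
Qed.

Lemma csubTE n (b : 'I_n -> R) : (csub b)^T = \sum_k (b k)%:C *: delta_mx (lo k) (up k).
Proof.
rewrite csubE linear_sum; apply: eq_bigr => k _.
by rewrite linearZ/= trmx_delta.
Qed.

Lemma csub_mulT n (b : 'I_n -> R) :
  csub b *m (csub b)^T = \sum_k ((b k)%:C ^+ 2) *: delta_mx (up k) (up k).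
Proof.
rewrite csubTE csubE mulmx_suml; apply: eq_bigr => k _.
rewrite mulmx_sumr (bigD1 k)//= big1 => [|l lk].
  by rewrite addr0 -scalemxAl -scalemxAr mul_delta_mx scalerA.
rewrite -scalemxAl -scalemxAr mul_delta_mx_0 ?scaler0//.
by apply: contra lk => /eqP /lo_inj ->.
Qed.

Lemma csubT_mul n (b : 'I_n -> R) :
  (csub b)^T *m csub b = \sum_k ((b k)%:C ^+ 2) *: delta_mx (lo k) (lo k).
Proof.
rewrite csubTE csubE mulmx_suml; apply: eq_bigr => k _.
rewrite mulmx_sumr (bigD1 k)//= big1 => [|l lk].
  by rewrite addr0 -scalemxAl -scalemxAr mul_delta_mx scalerA.
rewrite -scalemxAl -scalemxAr mul_delta_mx_0 ?scaler0//.
by apply: contra lk => /eqP /up_inj ->.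
Qed.

Lemma map_tridiag n (a : 'I_n.+1 -> R) (b : 'I_n -> R) :
  map_mx rc (tridiag_mx a b) = diag_mx (\row_i (a i)%:C) + csub b + (csub b)^T.
Proof.
rewrite /tridiag_mx !map_mxD /csub map_trmx map_diag_mx; congr (diag_mx _ + _ + _).
by apply/rowP => i; rewrite !mxE.
Qed.

Lemma mxtrace_mul_sym n (D S G : 'M[R[i]]_n) : D^T = D -> G^T = G ->
  \tr (S *m D *m G) = \tr (D *m S^T *m G).
Proof. by move=> sD sG; rewrite -[LHS]mxtrace_tr !trmx_mul sD sG mxtrace_mulC. Qed.

Lemma trace_commutator n (D S S' G : 'M[R[i]]_n) :
  \tr ((D + S + S') *m S *m G) = \tr (S *m (D + S + S') *m G) ->
  \tr (S *m D *m G) = \tr (D *m S' *m G) ->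
  \tr (D *m (S' - S) *m G) + \tr ((S *m S' - S' *m S) *m G) = 0.
Proof.
have trD (A B : 'M[R[i]]_n) : \tr (A + B) = \tr A + \tr B by exact: raddfD.
have trB (A B : 'M[R[i]]_n) : \tr (A - B) = \tr A - \tr B by exact: raddfB.
have -> : \tr ((D + S + S') *m S *m G) = \tr (D *m S *m G) + \tr (S *m S *m G) + \tr (S' *m S *m G).
  by rewrite !mulmxDl !trD.
have -> : \tr (S *m (D + S + S') *m G) = \tr (S *m D *m G) + \tr (S *m S *m G) + \tr (S *m S' *m G).
  by rewrite !mulmxDr !mulmxDl !trD.
have -> : \tr (D *m (S' - S) *m G) = \tr (D *m S' *m G) - \tr (D *m S *m G).
  by rewrite mulmxBr mulmxBl trB.
have -> : \tr ((S *m S' - S' *m S) *m G) = \tr (S *m S' *m G) - \tr (S' *m S *m G).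
  by rewrite mulmxBl trB.
move: (\tr _) (\tr _) (\tr _) (\tr _) (\tr _) (\tr _) => x1 x2 x3 x4 x5 x6 h hD.
rewrite -hD; move/eqP: h; rewrite -subr_eq0 => /eqP h; rewrite -[RHS]oppr0 -[in RHS]h; ring.
Qed.

Lemma res_unique n (T : 'M[R]_n) (z : R[i]) (X : 'M[R[i]]_n) : T^T = T -> 0 < cIm z ->
  X *m shifted T z = 1%:M -> res T z = X.
Proof.
by move=> sT z0 h; rewrite -[LHS]mul1mx -h -mulmxA (res_mulmx sT z0) mulmx1.
Qed.

Section identities.
Context (n : nat) (a : 'I_n.+1 -> R) (b : 'I_n -> R) (z : R[i]).
Hypothesis z0 : 0 < cIm z.
Let G := res (tridiag_mx a b) z.
Let S := csub b.

(** The test functions of the Gaussian integrations by parts. The skew matrix is the one of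
    the Lax pair of the Toda lattice. *)
Definition toda_flow i := ((S^T - S) *m G) i i.

(** Only neighbouring entries of [G] occur since [S] is bidiagonal, and the two that a bond
    contributes are equal since [G] is symmetric. *)
Lemma sum_toda_flow (g : 'I_n.+1 -> R[i]) :
  \sum_i g i * toda_flow i =
  \sum_k (b k)%:C * G (up k) (lo k) * (g (lo k) - g (up k)).
Proof.
have -> : \sum_i g i * toda_flow i = \tr (diag_mx (\row_i g i) *m ((S^T - S) *m G)).
  by apply: eq_bigr => i _; rewrite /toda_flow mul_diag_mx !mxE.
rewrite mxtrace_mulC -mulmxA mulmxBl linearB/= /S csubTE csubE !mulmx_suml.
have trs (F : 'I_n -> 'M[R[i]]_n.+1) : \tr (\sum_k F k) = \sum_k \tr (F k) by exact: raddf_sum.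
rewrite !trs -sumrB; apply: eq_bigr => k _ /=.
rewrite !mxtrace_scale_delta.
have GD i j : (G *m diag_mx (\row_i g i)) i j = G i j * g j.
  by rewrite mul_mx_diag !mxE.
transitivity ((b k)%:C * (G *m diag_mx (\row_i g i)) (up k) (lo k) -
  (b k)%:C * (G *m diag_mx (\row_i g i)) (lo k) (up k)); first by rewrite -mulrN.
rewrite !GD.
have -> : G (lo k) (up k) = G (up k) (lo k) by exact: res_symE (tridiag_sym a b).
ring.
Qed.

(** The trace of [[T, S] G] vanishes because [G] commutes with [T]; the symmetry of [G] turns
    its terms of the diagonal part into the first sum ([trace_commutator]). *)
Lemma trace_flow :
  \sum_i (a i)%:C * toda_flow i +
  \sum_k (b k)%:C ^+ 2 * (G (up k) (up k) - G (lo k) (lo k)) = 0.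
Proof.
pose D := diag_mx (\row_i (a i)%:C).
have sT := tridiag_sym a b.
have comm : map_mx rc (tridiag_mx a b) *m G = G *m map_mx rc (tridiag_mx a b).
  exact: res_comm.
have e1 : \sum_i (a i)%:C * toda_flow i = \tr (D *m (S^T - S) *m G).
  by rewrite -mulmxA; apply: eq_bigr => i _; rewrite /toda_flow mul_diag_mx !mxE.
have e2 : \sum_k (b k)%:C ^+ 2 * (G (up k) (up k) - G (lo k) (lo k)) =
    \tr ((S *m S^T - S^T *m S) *m G).
  rewrite csub_mulT csubT_mul -sumrB mulmx_suml linear_sum; apply: eq_bigr => k _ /=.
  by rewrite -scalerBr -scalemxAl linearZ/= mulmxBl linearB/= !mxtrace_delta.
have h : \tr (map_mx rc (tridiag_mx a b) *m S *m G) = \tr (S *m map_mx rc (tridiag_mx a b) *m G).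
  by rewrite -!mulmxA comm mxtrace_mulC !mulmxA.
have hD : \tr (S *m D *m G) = \tr (D *m S^T *m G).
  by apply: mxtrace_mul_sym; [exact: tr_diag_mx|exact: res_sym].
rewrite e1 e2; move: h hD; rewrite map_tridiag -/S -/D.
exact: trace_commutator.
Qed.

End identities.

(** Summation by parts. *)
Lemma abel_trace n (f : 'I_n.+1 -> R[i]) :
  \sum_(k < n) (n - k)%:R * (f (up k) - f (lo k)) = \sum_i f i - n.+1%:R * f ord0.
Proof.
have h1 : \sum_(i < n.+1) (n.+1 - i)%:R * f i =
    n.+1%:R * f ord0 + \sum_(k < n) (n - k)%:R * f (up k).
  by rewrite big_ord_recl subn0; congr (_ + _); apply: eq_bigr => k _; rewrite lift0 subSS.
have h2 : \sum_(i < n.+1) (n - i)%:R * f i = \sum_(k < n) (n - k)%:R * f (lo k).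
  by rewrite big_ord_recr/= subnn mul0r addr0.
under eq_bigr do rewrite mulrBr.
rewrite sumrB -h2; apply/eqP; rewrite subr_eq -(inj_eq (addrI (n.+1%:R * f ord0))).
rewrite -h1 addrA addrCA subrr addr0 -big_split/=; apply/eqP; apply: eq_bigr => i _.
by rewrite subSn ?leq_ord// mulrS mulrDl mul1r.
Qed.

(** ** The spectral theorem *)

Lemma char_poly_similar (C : fieldType) n (P D : 'M[C]_n) : P \in unitmx ->
  char_poly (invmx P *m D *m P) = char_poly D.
Proof.
move=> uP; pose Q := map_mx polyC P; pose Q' := map_mx polyC (invmx P).
have QQ : Q' *m Q = 1%:M by rewrite -map_mxM mulVmx// map_mx1.
have -> : char_poly (invmx P *m D *m P) = \det (Q' *m char_poly_mx D *m Q).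
  congr (\det _); rewrite /char_poly_mx !map_mxM -/Q -/Q' mulmxBr mulmxBl.
  by rewrite mul_mx_scalar -scalemxAl QQ scalemx1.
by rewrite !det_mulmx mulrAC -det_mulmx QQ det1 mul1r.
Qed.

(** The spectral theorem over the complex numbers diagonalizes [T]; its eigenvalues are
    identified with [s] by comparing characteristic polynomials. *)
Lemma trace_res n (T : 'M[R]_n) (z : R[i]) (s : n.-tuple R) : T^T = T -> 0 < cIm z ->
  eigenvalues_of T s -> \tr (res T z) = \sum_(x <- s) (x%:C - z)^-1.
Proof.
move=> sT z0 sE; set A := map_mx rc T.
have An : A \is normalmx.
  apply: symmetric_normalmx.
    by apply/is_hermitianmxP; rewrite expr0 scale1r map_mx_id// map_trmx sT.
  by apply/mxOverP => i j; rewrite mxE; apply/CrealP; rewrite conjcE; apply: complexP;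
    rewrite ?cReJ ?cImJ ?cImC ?oppr0.
have uP := spectral_unit A; have AE := orthomx_spectralP An.
set P := spectralmx A in uP AE; set d := spectral_diag A in AE.
have cA : \prod_(x <- [seq rc x | x <- s]) ('X - x%:P) = \prod_(x <- [seq d 0 i | i <- enum 'I_n]) ('X - x%:P).
  have -> : \prod_(x <- [seq rc x | x <- s]) ('X - x%:P) = char_poly A.
    rewrite -map_char_poly sE rmorph_prod big_map; apply: eq_bigr => x _.
    by rewrite rmorphB/= map_polyX map_polyC.
  rewrite AE char_poly_similar// char_poly_trig ?diag_mx_is_trig//.
  rewrite big_map big_enum/=; apply: eq_bigr => i _.
  by rewrite mxE eqxx mulr1n.
have pE := prod_XsubC_eq cA.
have dz i : d 0 i - z != 0.
  have : d 0 i \in [seq rc x | x <- s].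
    by rewrite (perm_mem pE) map_f// mem_enum.
  move=> /mapP[x _ ->]; apply/eqP => /(congr1 (@complex.Im R)).
  by rewrite cImB cImC sub0r => /eqP; rewrite oppr_eq0 gt_eqF.
have rE : res T z = invmx P *m diag_mx (\row_i (d 0 i - z)^-1) *m P.
  have sh : shifted T z = invmx P *m diag_mx (\row_i (d 0 i - z)) *m P.
    have e3 : diag_mx d - z%:M = diag_mx (\row_i (d 0 i - z)).
      by apply/matrixP => i j; rewrite !mxE; case: eqP; rewrite ?mulr1n ?mulr0n ?subrr.
    have e4 : invmx P *m z%:M *m P = z%:M :> 'M[R[i]]_n.
      by rewrite mul_mx_scalar -scalemxAl mulVmx// scalemx1.
    have e5 (B1 B2 : 'M[R[i]]_n) : invmx P *m (B1 - B2) *m P = invmx P *m B1 *m P - invmx P *m B2 *m P.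
      by rewrite mulmxBr mulmxBl.
    by rewrite -e3 e5 e4 /shifted -/A [in LHS]AE.
  have h : invmx P *m diag_mx (\row_i (d 0 i - z)^-1) *m P *m shifted T z = 1%:M.
    have e (A1 B1 B2 : 'M[R[i]]_n) : P *m A1 = 1%:M -> A1 *m B1 *m P *m (A1 *m B2 *m P) = A1 *m (B1 *m B2) *m P.
      by move=> PA; rewrite -!mulmxA [P *m (A1 *m _)]mulmxA PA mul1mx.
    rewrite sh (e _ _ _ (mulmxV uP)) mulmx_diag.
    rewrite (_ : diag_mx _ = 1%:M); first by rewrite mulmx1 mulVmx.
    apply/matrixP => i j; rewrite !mxE; case: eqP => [->|_]; rewrite ?mulr0n//.
    by rewrite mulVf ?dz// mulr1n.
  exact: (res_unique sT z0 h).
rewrite rE mxtrace_mulC mulmxA mulmxV// mul1mx mxtrace_diag.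
have : \sum_(x <- [seq rc x | x <- s]) (x - z)^-1 =
    \sum_(x <- [seq d 0 i | i <- enum 'I_n]) (x - z)^-1 by exact: perm_big.
rewrite big_map [in X in _ = X -> _]big_map => ->.
rewrite big_enum /=.
by apply: eq_bigr => i _; rewrite mxE.
Qed.

End tridiagonal_algebra.

(** * Measurability of the resolvent *)

Lemma mxE_skew (V : zmodType) n (M : 'M[V]_n) i j : (M^T - M) i j = M j i - M i j.
Proof. by rewrite !mxE. Qed.

Section resolvent_measurable.
Context {R : realType} {d : measure_display} {S : measurableType d}.

Lemma cmeas_det n (M : S -> 'M[R[i]]_n) : (forall i j, cmeas (fun s => M s i j)) ->
  cmeas (fun s => \det (M s)).
Proof.
move=> mM; apply: cmeas_sum => p.
apply: cmeasM; first exact: cmeas_cst.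
by apply: cmeas_prod => i; exact: mM.
Qed.

Lemma cmeas_res n (T : S -> 'M[R]_n) (z : R[i]) i j : (forall s, (T s)^T = T s) -> 0 < cIm z ->
  (forall i j, measurable_fun setT (fun s => T s i j)) -> cmeas (fun s => res (T s) z i j).
Proof.
move=> sT z0 mT; have mM k l : cmeas (fun s => shifted (T s) z k l).
  have -> : (fun s => shifted (T s) z k l) = fun s => (T s k l)%:C - z *+ (k == l).
    by apply/funext => s; rewrite !mxE.
  by apply: cmeasB; [exact: cmeasC|exact: cmeas_cst].
have -> : (fun s => res (T s) z i j) =
    fun s => (\det (shifted (T s) z))^-1 * cofactor (shifted (T s) z) j i.
  by apply/funext => s; rewrite /res /invmx shifted_unit// !mxE.
apply: cmeasM; first by apply: cmeasV; exact: cmeas_det.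
apply: cmeasM; first exact: cmeas_cst.
apply: cmeas_det => k l; have -> : (fun s => row' j (col' i (shifted (T s) z)) k l) =
    fun s => shifted (T s) z (lift j k) (lift i l) by apply/funext => s; rewrite 2!mxE.
exact: mM.
Qed.

Lemma measurable_tridiag n (a : S -> 'I_n.+1 -> R) (b : S -> 'I_n -> R) i j :
  (forall i, measurable_fun setT (fun s => a s i)) ->
  (forall i, measurable_fun setT (fun s => b s i)) ->
  measurable_fun setT (fun s => tridiag_mx (a s) (b s) i j).
Proof.
move=> ma mb; have msub k l : measurable_fun setT (fun s => subdiag_mx (b s) k l).
  under eq_fun do rewrite summxE.
  apply: measurable_sum => m; under eq_fun do rewrite mxE.
  by apply: measurable_funM => //; exact: mb.
under eq_fun do rewrite !mxE.
apply: measurable_funD; last exact: msub.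
apply: measurable_funD; last exact: msub.
by case: (i == j); [exact: ma|exact: measurable_cst].
Qed.

Lemma cmeas_toda n (a : S -> 'I_n.+1 -> R) (b : S -> 'I_n -> R) z i : 0 < cIm z ->
  (forall i, measurable_fun setT (fun s => a s i)) ->
  (forall i, measurable_fun setT (fun s => b s i)) ->
  cmeas (fun s => toda_flow (a s) (b s) z i).
Proof.
move=> z0 ma mb; rewrite /toda_flow; under eq_fun do rewrite mxE.
apply: cmeas_sum => l; apply: cmeasM; last first.
  apply: cmeas_res => // [s|k m]; first exact: tridiag_sym.
  exact: measurable_tridiag.
have mc k m : cmeas (fun s => csub (b s) k m).
  under eq_fun do rewrite csubE summxE.
  apply: cmeas_sum => p; under eq_fun do rewrite !mxE.
  by apply: cmeasM; [exact: cmeasC|exact: cmeas_cst].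
by under eq_fun do rewrite mxE_skew; apply: cmeasB; exact: mc.
Qed.

End resolvent_measurable.

(** * Stein's identities for the tridiagonal model *)

Section updates.
Context {R : realType}.

Definition upd (I : eqType) (a : I -> R) i x : I -> R := fun j => if j == i then x else a j.

Lemma upd_id (I : eqType) (a : I -> R) i : upd a i (a i) = a.
Proof. by apply/funext => j; rewrite /upd; case: eqP => [->|]. Qed.

Context (n : nat) (a : 'I_n.+1 -> R) (b : 'I_n -> R) (z : R[i]).
Hypothesis z0 : 0 < cIm z.
Let up (k : 'I_n) : 'I_n.+1 := lift ord0 k.
Let lo (k : 'I_n) : 'I_n.+1 := widen_ord (leqnSn n) k.

Lemma tridiag_upd_diag i x : tridiag_mx (upd a i x) b = tridiag_mx (upd a i 0) b + x *: delta_mx i i.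
Proof.
rewrite /tridiag_mx -!addrA addrC [RHS]addrC -!addrA; congr (_ + (_ + _)).
apply/matrixP => j k; rewrite !mxE /upd; case: (j =P i) => [->|ji].
  rewrite /= [k == i]eq_sym; by case: (i == k); rewrite ?mulr1n ?mulr0n ?mulr1 ?mulr0 ?addr0.
by rewrite mulr0 add0r.
Qed.

Definition bond k : 'M[R]_n.+1 := delta_mx (up k) (lo k) + delta_mx (lo k) (up k).

Lemma tridiag_upd_sub k x : tridiag_mx a (upd b k x) = tridiag_mx a (upd b k 0) + x *: bond k.
Proof.
have sE : subdiag_mx (upd b k x) = subdiag_mx (upd b k 0) + x *: delta_mx (up k) (lo k).
  rewrite /subdiag_mx (bigD1 k)//= [X in _ = X + _](bigD1 k)//= /upd eqxx scale0r add0r addrC.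
  by congr (_ + _); apply: eq_bigr => j /negbTE ->.
rewrite /tridiag_mx sE linearD/= linearZ/= trmx_delta /bond scalerDr.
by rewrite -!addrA; congr (_ + (_ + _)); rewrite addrCA.
Qed.

Lemma bond_sym k : (bond k)^T = bond k.
Proof. by rewrite /bond linearD/= !trmx_delta addrC. Qed.

Let Ga i x := res (tridiag_mx (upd a i x) b) z.
Let Fa i x := toda_flow (upd a i x) b z i.

Lemma cderive_diag i x j k : is_cderive (fun x => Ga i x j k) x (- (Ga i x j i * Ga i x i k)).
Proof.
have sd : (delta_mx i i : 'M[R]_n.+1)^T = delta_mx i i by rewrite trmx_delta.
have h := cderive_res x j k (tridiag_sym (upd a i 0) b) sd z0.
have -> : (fun x => Ga i x j k) = fun x => res (tridiag_mx (upd a i 0) b + x *: delta_mx i i) z j k.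
  by apply/funext => r; rewrite /Ga tridiag_upd_diag.
apply: (cderive_eq h); rewrite -tridiag_upd_diag -/(Ga i x); congr (- _).
rewrite map_delta_mx -mulmxA mxE (bigD1 i)//= big1 ?addr0 => [|l li].
  by rewrite mxE_delta eqxx mul1r.
by rewrite mxE_delta (negbTE li) mul0r mulr0.
Qed.

Lemma cderive_sum (I : Type) (u : seq I) (f : I -> R -> R[i]) x l :
  (forall i, is_cderive (f i) x (l i)) ->
  is_cderive (fun x => \sum_(i <- u) f i x) x (\sum_(i <- u) l i).
Proof.
move=> h; elim: u => [|i u IH].
  by under eq_fun do rewrite big_nil; rewrite big_nil; exact: cderive_cst.
by under eq_fun do rewrite big_cons; rewrite big_cons; exact: cderiveD.
Qed.

Lemma cderive_toda i x : is_cderive (Fa i) x (- (Fa i x * Ga i x i i)).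
Proof.
have -> : Fa i = fun x => \sum_l ((csub b)^T - csub b) i l * Ga i x l i.
  by apply/funext => r; rewrite /Fa /toda_flow mxE.
apply: cderive_eq; first by apply: cderive_sum => l; apply: cderiveZ; exact: cderive_diag.
rewrite mulr_suml -sumrN; apply: eq_bigr => l _; ring.
Qed.

Let Gb k x := res (tridiag_mx a (upd b k x)) z.
Let Hb k x := Gb k x (up k) (up k) - Gb k x (lo k) (lo k).

Lemma cderive_bond k x i j :
  is_cderive (fun x => Gb k x i j) x
    (- (Gb k x i (up k) * Gb k x (lo k) j + Gb k x i (lo k) * Gb k x (up k) j)).
Proof.
have h := cderive_res x i j (tridiag_sym a (upd b k 0)) (bond_sym k) z0.
have -> : (fun x => Gb k x i j) = fun x => res (tridiag_mx a (upd b k 0) + x *: bond k) z i j.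
  by apply/funext => r; rewrite /Gb tridiag_upd_sub.
apply: (cderive_eq h); rewrite -tridiag_upd_sub -/(Gb k x); congr (- _).
have e (M : 'M[R[i]]_n.+1) p q : (M *m delta_mx p q *m M) i j = M i p * M q j.
  rewrite -mulmxA mxE (bigD1 p)//= big1 ?addr0 => [|l lp].
    by rewrite mxE_delta eqxx mul1r.
  by rewrite mxE_delta (negbTE lp) mul0r mulr0.
by rewrite /bond map_mxD !map_delta_mx mulmxDr mulmxDl mxE !e.
Qed.

Lemma cderive_gap k x : is_cderive (Hb k) x (- (2 * (Gb k x (up k) (lo k) * Hb k x))).
Proof.
apply: cderive_eq; first by apply: cderiveB; exact: cderive_bond.
rewrite /Hb; have -> : Gb k x (lo k) (up k) = Gb k x (up k) (lo k).
  exact: res_symE (tridiag_sym _ _).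
ring.
Qed.

Lemma cabs_csub i j : cabs (csub b i j) <= \sum_k `|b k|.
Proof.
rewrite csubE summxE (le_trans (cabs_sum _ _ _))//; apply: ler_sum => k _.
rewrite !mxE cabsM cabsC ler_piMr//.
by case: (_ && _); rewrite ?cabs0 ?cabs1.
Qed.

Lemma cabs_toda i : cabs (toda_flow a b z i) <= n.+1%:R * (2 * (\sum_k `|b k|) * (cIm z)^-1).
Proof.
rewrite /toda_flow mxE (le_trans (cabs_sum _ _ _))//.
have -> : n.+1%:R * (2 * (\sum_k `|b k|) * (cIm z)^-1) = \sum_(l < n.+1) (2 * (\sum_k `|b k|) * (cIm z)^-1).
  by rewrite sumr_const card_ord mulr_natl.
apply: ler_sum => l _; rewrite cabsM ler_pM ?cabs_ge0 ?cabs_res ?tridiag_sym//.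
rewrite mxE_skew (le_trans (cabsB _ _))// mulrDl mul1r lerD// cabs_csub//.
Qed.

End updates.

(** * The expected trace of the resolvent *)

Lemma measurable_sqrt_fun {R : realType} : measurable_fun [set: R] (@Num.sqrt R).
Proof. by apply: continuous_measurable_fun; exact: sqrt_continuous. Qed.

Lemma integrable_law {R : realType} d (T : measurableType d) (P : probability T R)
    (X : T -> measurableTypeR R) (mu : {sigma_finite_measure set (measurableTypeR R) -> \bar R})
    (theta g : R -> R) :
  measurable_fun setT X -> measurable_fun setT theta ->
  (forall A : set (measurableTypeR R), measurable A -> P (X @^-1` A) = mu (theta @^-1` A)) ->
  measurable_fun setT g -> mu.-integrable setT (fun x => (g (theta x))%:E) ->
  P.-integrable setT (fun w => (g (X w))%:E).
Proof.
move=> mX mth law mg /integrableP[_ ig].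
have mgE : measurable_fun setT (fun x : measurableTypeR R => (g x)%:E) by exact/measurable_EFinP.
have mga : measurable_fun setT (fun x : measurableTypeR R => (`|(g x)%:E|)%E).
  exact: measurableT_comp.
apply/integrableP; split; first exact: (measurableT_comp mgE mX).
have mth' : measurable_fun setT (theta : measurableTypeR R -> measurableTypeR R) by exact: mth.
pose th : {mfun measurableTypeR R >-> measurableTypeR R} :=
  HB.pack theta (isMeasurableFun.Build _ _ _ _ _ mth').
pose X' : {mfun T >-> measurableTypeR R} := HB.pack X (isMeasurableFun.Build _ _ _ _ _ mX).
have e1 : (\int[P]_w `|(g (X w))%:E| = \int[pushforward P X']_x `|(g x)%:E|)%E.
  by rewrite (ge0_integral_pushforward mX).
have e2 : (\int[mu]_x `|(g (theta x))%:E| = \int[pushforward mu th]_x `|(g x)%:E|)%E.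
  by rewrite (ge0_integral_pushforward mth').
rewrite e1 (eq_measure_integral (pushforward mu th)) -?e2// => A mA _.
exact: law.
Qed.

Lemma cabsC1 {R : realType} : cabs (1%:R + 1 : R[i]) = 1 + 1.
Proof. by rewrite -CD cabsC ger0_norm. Qed.

Lemma ler_split {R : realType} (x t A B m : R) : x <= A * m -> t <= B * m -> x + t <= (A + B) * m.
Proof. by move=> xA tB; rewrite mulrDl lerD. Qed.

Lemma ler_mul1D {R : realType} (c x : R) : 0 <= c -> 0 <= x -> c <= c * (1 + x).
Proof. by move=> c0 x0; rewrite ler_peMr// lerDl. Qed.

Lemma Rintegral_eq0 {R : realType} d (T : measurableType d)
    (mu : {measure set T -> \bar R}) (f : T -> R) : (forall x, f x = 0) -> \int[mu]_x f x = 0.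
Proof.
move=> f0; have -> : f = fun=> 0 by apply/funext.
by rewrite /Rintegral integral0.
Qed.

Lemma eq_Rintegral_gam {R : realType} (k : R) (f g : R -> R) : 0 < k ->
  measurable_fun setT f -> measurable_fun setT g ->
  (gam k).-integrable setT (fun x => (f x)%:E) -> (gam k).-integrable setT (fun x => (g x)%:E) ->
  (forall x : R, 0 < x -> f x = g x) -> \int[gam k]_x f x = \int[gam k]_x g x.
Proof.
move=> k0 mf mg fi gi e; rewrite !Rintegral_gam//; congr (_ / _).
apply: eq_Rintegral_hl; [| |by move=> x x0; rewrite e].
- by apply: measurable_funM => //; exact: measurable_powexp.
- by apply: measurable_funM => //; exact: measurable_powexp.
Qed.

Section trace_identity.
Context {R : realType} {d : measure_display} {Om : measurableType d} (P : probability Om R).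
Context (n : nat) (av : 'I_n.+1 -> Om -> R) (bv : 'I_n -> Om -> R) (z : R[i]) (kap : 'I_n -> R).

Definition entry (i : 'I_n.+1 + 'I_n) : Om -> measurableTypeR R :=
  match i with inl i => av i | inr k => bv k end.

Hypothesis z0 : 0 < cIm z.
Hypothesis mX : forall i, measurable_fun setT (entry i).
Hypothesis indX : forall (J : {set 'I_n.+1 + 'I_n}) (A : 'I_n.+1 + 'I_n -> set (measurableTypeR R)),
  (forall j, j \in J -> measurable (A j)) ->
  P (\bigcap_(j in [set` J]) (entry j @^-1` A j)) = (\prod_(j in J) P (entry j @^-1` A j))%E.
Hypothesis kap0 : forall k, 0 < kap k.
Hypothesis lawa : forall i (A : set (measurableTypeR R)), measurable A ->
  P (entry (inl i) @^-1` A) = gau A.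
Hypothesis lawb : forall k (A : set (measurableTypeR R)), measurable A ->
  P (entry (inr k) @^-1` A) = gam (kap k) (Num.sqrt @^-1` A).

Let up (k : 'I_n) : 'I_n.+1 := lift ord0 k.
Let lo (k : 'I_n) : 'I_n.+1 := widen_ord (leqnSn n) k.
Let a w i := av i w.
Let b w k := bv k w.
Let G w := res (tridiag_mx (a w) (b w)) z.
Let F w i := toda_flow (a w) (b w) z i.
Let h w k := G w (up k) (up k) - G w (lo k) (lo k).
Let y := (cIm z)^-1.

Let ma i : measurable_fun setT (fun w => a w i).
Proof. exact: (mX (inl i)). Qed.

Let mb i : measurable_fun setT (fun w => b w i).
Proof. exact: (mX (inr i)). Qed.

Let y_ge0 : 0 <= y.
Proof. by rewrite invr_ge0 ltW. Qed.

Let mG j k : cmeas (fun w => G w j k).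
Proof.
apply: cmeas_res => // [w|i l]; first exact: tridiag_sym.
exact: measurable_tridiag.
Qed.

Let mF i : cmeas (fun w => F w i).
Proof. exact: cmeas_toda. Qed.

Let G_le w j k : cabs (G w j k) <= y.
Proof. by rewrite cabs_res// tridiag_sym. Qed.

Let h_le w k : cabs (h w k) <= 2 * y.
Proof. by rewrite (le_trans (cabsB _ _))// mulrDl mul1r lerD. Qed.

(** Every integrand below is at most quadratic in the entries, hence dominated by [M]. *)
Let M w := 1 + \sum_i a w i ^+ 2 + \sum_k b w k ^+ 2.

Let integrable_M : P.-integrable setT (fun w => (M w)%:E).
Proof.
have msq : measurable_fun setT (fun x : R => x ^+ 2) by exact: measurable_funX.
have iD (f g : Om -> R) : P.-integrable setT (fun w => (f w)%:E) ->
    P.-integrable setT (fun w => (g w)%:E) -> P.-integrable setT (fun w => (f w + g w)%:E).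
  by move=> fi gi; under eq_fun do rewrite EFinD; exact: integrableD.
have isum (I : Type) (u : seq I) (f : I -> Om -> R) :
    (forall i, P.-integrable setT (fun w => (f i w)%:E)) ->
    P.-integrable setT (fun w => (\sum_(i <- u) f i w)%:E).
  move=> fi; elim: u => [|i u IH].
    by under eq_fun do rewrite big_nil; exact: integrable0.
  by under eq_fun do rewrite big_cons; exact: iD.
apply: (iD); [apply: iD|]; last 2 first.
- apply: isum => i; apply: (@integrable_law _ _ _ P (entry (inl i)) gau id (fun x => x ^+ 2)) => //.
    by move=> A mA; exact: lawa.
  apply: (@integrable_gau _ _ 4) => // x; rewrite ger0_norm ?sqr_ge0//.
  have := expR_ge1Dx (x ^+ 2 / 4); lra.
- apply: isum => k.
  apply: (@integrable_law _ _ _ P (entry (inr k)) (gam (kap k)) Num.sqrt (fun x => x ^+ 2)) => //.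
  - exact: measurable_sqrt_fun.
  - by move=> A mA; exact: lawb.
  apply: (@integrable_gam_linear _ _ _ 1) => // [|x x0].
    by apply: measurable_funX; exact: measurable_sqrt_fun.
  by rewrite sqr_sqrtr ?(ltW x0)// ger0_norm ?(ltW x0)//; lra.
- exact: (@finite_measure_integrable_cst _ _ _ P setT 1).
Qed.

Let a2_le w i : a w i ^+ 2 <= M w.
Proof.
rewrite /M (bigD1 i)//=; have h1 : 0 <= \sum_(j | j != i) a w j ^+ 2.
  by apply: sumr_ge0 => j _; exact: sqr_ge0.
have h2 : 0 <= \sum_k b w k ^+ 2 by apply: sumr_ge0 => j _; exact: sqr_ge0.
lra.
Qed.

Let b2_le w i : b w i ^+ 2 <= M w.
Proof.
rewrite /M (bigD1 i)//=; have h1 : 0 <= \sum_(j | j != i) b w j ^+ 2.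
  by apply: sumr_ge0 => j _; exact: sqr_ge0.
have h2 : 0 <= \sum_k a w k ^+ 2 by apply: sumr_ge0 => j _; exact: sqr_ge0.
lra.
Qed.

Let M_ge1 w : 1 <= M w.
Proof.
have h1 : 0 <= \sum_k b w k ^+ 2 by apply: sumr_ge0 => j _; exact: sqr_ge0.
have h2 : 0 <= \sum_k a w k ^+ 2 by apply: sumr_ge0 => j _; exact: sqr_ge0.
by rewrite /M; lra.
Qed.

Let prod_le (x t m : R) : x ^+ 2 <= m -> t ^+ 2 <= m -> `|x| * `|t| <= m.
Proof.
rewrite -[x ^+ 2]real_normK ?num_real// -[t ^+ 2]real_normK ?num_real// => h1 h2; have := sqr_ge0 (`|x| - `|t|).
rewrite sqrrB; nra.
Qed.

Let sum_b_le w (x : R) : x ^+ 2 <= M w -> `|x| * \sum_k `|b w k| <= n%:R * M w.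
Proof.
move=> xM; rewrite mulr_sumr (le_trans (_ : _ <= \sum_(k < n) M w))//.
  by apply: ler_sum => k _; exact: prod_le.
by rewrite sumr_const card_ord mulr_natl.
Qed.

Let intM (f : Om -> R) (C : R) : measurable_fun setT f -> (forall w, `|f w| <= C * M w) ->
  P.-integrable setT (fun w => (f w)%:E).
Proof.
move=> mf fC; have := integrableZl measurableT C integrable_M.
apply: le_integrable => //; first exact/measurable_EFinP.
move=> w _; rewrite -EFinM /= lee_fin (le_trans (fC w))// ler_norm//.
Qed.

Let aF_le w i (x : R) : x ^+ 2 <= M w ->
  `|x| * cabs (F w i) <= n.+1%:R * (2 * (n%:R * y)) * M w.
Proof.
move=> xM; have h1 := cabs_toda (a w) (b w) z0 i.
have h2 := sum_b_le xM.
rewrite (le_trans (ler_wpM2l (normr_ge0 x) h1))//.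
have -> : `|x| * (n.+1%:R * (2 * (\sum_k `|b w k|) / cIm z)) =
   n.+1%:R * (2 * y) * (`|x| * \sum_k `|b w k|) by rewrite /y; ring.
rewrite (le_trans (ler_wpM2l _ h2))//; first by rewrite !mulr_ge0.
by rewrite le_eqVlt; apply/orP; left; apply/eqP; ring.
Qed.

Let int_diag i : P.-integrable setT
  (fun w => (cIm (- (F w i * G w i i)) - a w i * cIm (F w i))%:E).
Proof.
apply: (@intM _ (n.+1%:R * (2 * (n%:R * y)) * y + n.+1%:R * (2 * (n%:R * y)))).
  apply: measurable_funB; first by apply: cmeas_Im; apply: cmeasN; exact: cmeasM.
  by apply: measurable_funM => //; exact: cmeas_Im.
move=> w; apply: le_trans (ler_normB _ _) _; apply: ler_split; last first.
  by rewrite normrM (le_trans _ (aF_le i (a2_le w i)))// ler_wpM2l// Im_cabs.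
rewrite (le_trans (Im_cabs _))// cabsN cabsM mulrAC ler_pM ?cabs_ge0//.
have h1 : (1 : R) ^+ 2 <= M w by rewrite expr1n M_ge1.
by have := aF_le i h1; rewrite normr1 mul1r.
Qed.

(** [gauss_stein] in the entry [a i], conditionally on the others; by [cderive_toda] the
    derivative of [F i] is [- F i * G i i]. *)
Lemma stein_diag i :
  \int[P]_w (cIm (- (F w i * G w i i)) - a w i * cIm (F w i)) = 0.
Proof.
pose a' (p : measurableTypeR R * others entry (inl i)) := upd (a p.2) i p.1.
pose Fp (p : measurableTypeR R * others entry (inl i)) : R :=
  cIm (- (toda_flow (a' p) (b p.2) z i * res (tridiag_mx (a' p) (b p.2)) z i i))
  - p.1 * cIm (toda_flow (a' p) (b p.2) z i).
have m1 : measurable_fun setT (fun p : measurableTypeR R * others entry (inl i) => p.1).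
  exact: measurable_fst.
have mo j : j != inl i ->
    measurable_fun setT (fun p : measurableTypeR R * others entry (inl i) => entry j p.2).
  move=> ji; have hj := @measurable_others R d Om _ entry (inl i) j ji.
  exact (measurableT_comp hj measurable_snd).
have ma' j : measurable_fun setT (fun p => a' p j).
  rewrite /a' /upd; case: eqP => [_|ji]; first exact: m1.
  by apply: (mo (inl j)); apply/eqP => -[].
have mb' j : measurable_fun setT (fun p : measurableTypeR R * others entry (inl i) => b p.2 j).
  exact: (mo (inr j)).
have mtd : cmeas (fun p => toda_flow (a' p) (b p.2) z i) by exact: cmeas_toda.
have mrs : cmeas (fun p => res (tridiag_mx (a' p) (b p.2)) z i i).
  apply: cmeas_res => // [s|k m]; first exact: tridiag_sym.
  exact: measurable_tridiag.
have mFp : measurable_fun setT Fp.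
  apply: measurable_funB; first by apply: cmeas_Im; apply: cmeasN; exact: cmeasM.
  by apply: measurable_funM => //; exact: cmeas_Im.
have FpE w : Fp (entry (inl i) w, w) = cIm (- (F w i * G w i i)) - a w i * cIm (F w i).
  rewrite /Fp /a' /=; have -> : upd (a w) i (av i w) = a w by exact: upd_id.
  by [].
transitivity (\int[P]_w \int[gau]_x Fp (x, w)).
  transitivity (\int[P]_w Fp (entry (inl i) w, w)).
    by apply: eq_Rintegral => w _; rewrite FpE.
  apply: (@indep_Rintegral _ _ _ P _ entry mX indX (inl i) gau id Fp) => //.
  - by move=> A mA; exact: lawa.
  - move=> w.
    have mw : measurable_fun setT (fun x => Fp (x, w)) by exact: (measurableT_comp mFp (pair2_measurable w)).
    pose C := n.+1%:R * (2 * (\sum_k `|b w k|) * y).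
    have C0 : 0 <= C by rewrite !mulr_ge0// sumr_ge0.
    apply: (@integrable_gau_linear _ _ (C * y + C)) => // x.
    have t1 : cabs (toda_flow (a' (x, w)) (b w) z i) <= C by exact: cabs_toda.
    have t2 : cabs (res (tridiag_mx (a' (x, w)) (b w)) z i i) <= y.
      by rewrite cabs_res// tridiag_sym.
    rewrite /Fp /=; apply: le_trans (ler_normB _ _) _; apply: ler_split.
      rewrite (le_trans (Im_cabs _))// cabsN cabsM (le_trans (ler_pM _ _ t1 t2)) ?cabs_ge0//.
      by apply: ler_mul1D => //; exact: mulr_ge0.
    rewrite normrM mulrC ler_pM// ?(le_trans (Im_cabs _))//.
    by rewrite lerDr.
  - by under eq_fun do rewrite FpE; exact: int_diag.
apply: Rintegral_eq0 => w.
have mp : measurable_fun setT (fun x : measurableTypeR R => (x, w : others entry (inl i))).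
  exact: pair2_measurable.
pose f x := cIm (toda_flow (a' (x, w)) (b w) z i).
pose f' x := cIm (- (toda_flow (a' (x, w)) (b w) z i * res (tridiag_mx (a' (x, w)) (b w)) z i i)).
pose C := n.+1%:R * (2 * (\sum_k `|b w k|) * y).
have C0 : 0 <= C by rewrite !mulr_ge0// sumr_ge0.
have t1 x : cabs (toda_flow (a' (x, w)) (b w) z i) <= C by exact: cabs_toda.
have t2 x : cabs (res (tridiag_mx (a' (x, w)) (b w)) z i i) <= y.
  by rewrite cabs_res// tridiag_sym.
have dF x : is_cderive (fun x => toda_flow (a' (x, w)) (b w) z i) x
    (- (toda_flow (a' (x, w)) (b w) z i * res (tridiag_mx (a' (x, w)) (b w)) z i i)).
  exact: (@cderive_toda R n (a w) (b w) z z0 i x).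
apply: (@gauss_stein _ f f' (C + C * y)).
- exact: (measurableT_comp (cmeas_Im mtd) mp).
- exact: (measurableT_comp (cmeas_Im (cmeasN (cmeasM mtd mrs))) mp).
- by move=> x; have [] := dF x.
- move=> x; have dR := cderiveN (cderiveM (dF x) (@cderive_diag R n (a w) (b w) z z0 i x i i)).
  by have [_ dI] := dR; exact: (is_derive_continuous dI).
- by move=> x; rewrite (le_trans (Im_cabs _))// (le_trans (t1 x))// lerDl mulr_ge0.
- move=> x; rewrite (le_trans (Im_cabs _))// cabsN cabsM.
  by rewrite (le_trans (ler_pM _ _ (t1 x) (t2 x))) ?cabs_ge0// lerDr.
Qed.

Let int_sub k : P.-integrable setT
  (fun w => (b w k * cIm (- (2 * (G w (up k) (lo k) * h w k))) +
    (2 * kap k - 2 * b w k ^+ 2) * cIm (h w k))%:E).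
Proof.
have mh : cmeas (fun w => h w k) by apply: cmeasB; exact: mG.
apply: (@intM _ (2 * (y * (2 * y)) + (2 * kap k + 2) * (2 * y))).
  apply: measurable_funD; apply: measurable_funM => //.
    by apply: cmeas_Im; apply: cmeasN; apply: cmeasM; [exact: cmeas_cst|exact: cmeasM].
    by apply: measurable_funB => //; apply: measurable_funM => //; exact: measurable_funX.
  exact: cmeas_Im.
move=> w; apply: le_trans (ler_normD _ _) _; apply: ler_split.
  have b1 : `|b w k| <= M w.
    have h1 : (1 : R) ^+ 2 <= M w by rewrite expr1n M_ge1.
    by have := prod_le h1 (b2_le w k); rewrite normr1 mul1r.
  rewrite normrM mulrC ler_pM// (le_trans (Im_cabs _))// cabsN !cabsM.
  have -> : cabs 2 = 2 :> R by rewrite -(natr1 1) cabsC1.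
  by rewrite ler_wpM2l// ler_pM ?cabs_ge0.
rewrite normrM mulrAC ler_pM//; last by rewrite (le_trans (Im_cabs _)).
have k0 := kap0 k; have := M_ge1 w; have := b2_le w k; have := sqr_ge0 (b w k).
by move=> t1 t2 t3; rewrite ler_norml; apply/andP; split; nra.
Qed.

(** [gamma_stein] in [x = b k ^+ 2], conditionally on the other entries; the derivative of
    [h k] in [b k] is given by [cderive_gap]. *)
Lemma stein_sub k :
  \int[P]_w (b w k * cIm (- (2 * (G w (up k) (lo k) * h w k))) +
    (2 * kap k - 2 * b w k ^+ 2) * cIm (h w k)) = 0.
Proof.
pose b' (p : measurableTypeR R * others entry (inr k)) := upd (b p.2) k p.1.
pose G' (p : measurableTypeR R * others entry (inr k)) := res (tridiag_mx (a p.2) (b' p)) z.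
pose h' p := G' p (up k) (up k) - G' p (lo k) (lo k).
pose dh p := - (2 * (G' p (up k) (lo k) * h' p)).
pose Fp (p : measurableTypeR R * others entry (inr k)) : R :=
  p.1 * cIm (dh p) + (2 * kap k - 2 * p.1 ^+ 2) * cIm (h' p).
have m1 : measurable_fun setT (fun p : measurableTypeR R * others entry (inr k) => p.1).
  exact: measurable_fst.
have mo j : j != inr k ->
    measurable_fun setT (fun p : measurableTypeR R * others entry (inr k) => entry j p.2).
  move=> ji; have hj := @measurable_others R d Om _ entry (inr k) j ji.
  exact (measurableT_comp hj measurable_snd).
have mb' j : measurable_fun setT (fun p => b' p j).
  rewrite /b' /upd; case: eqP => [_|ji]; first exact: m1.
  by apply: (mo (inr j)); apply/eqP => -[].
have ma' j : measurable_fun setT (fun p : measurableTypeR R * others entry (inr k) => a p.2 j).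
  exact: (mo (inl j)).
have mrs i j : cmeas (fun p => G' p i j).
  apply: cmeas_res => // [s|l m]; first exact: tridiag_sym.
  exact: measurable_tridiag.
have mh' : cmeas h' by exact: cmeasB.
have mdh : cmeas dh.
  by apply: cmeasN; apply: cmeasM; [exact: cmeas_cst|exact: cmeasM].
have mFp : measurable_fun setT Fp.
  apply: measurable_funD; apply: measurable_funM.
  - exact: m1.
  - exact: cmeas_Im.
  - by apply: measurable_funB => //; apply: measurable_funM => //; exact: measurable_funX.
  - exact: cmeas_Im.
have FpE w : Fp (entry (inr k) w, w) = b w k * cIm (- (2 * (G w (up k) (lo k) * h w k))) +
    (2 * kap k - 2 * b w k ^+ 2) * cIm (h w k).
  rewrite /Fp /dh /h' /G' /b' /=; have -> : upd (b w) k (bv k w) = b w by exact: upd_id.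
  by [].
have h'_le p : cabs (h' p) <= 2 * y.
  by rewrite (le_trans (cabsB _ _))// mulrDl mul1r lerD// cabs_res// tridiag_sym.
have dh_le p : cabs (dh p) <= 2 * (y * (2 * y)).
  rewrite cabsN !cabsM; have -> : cabs 2 = 2 :> R by rewrite -(natr1 1) cabsC1.
  by rewrite ler_wpM2l// ler_pM ?cabs_ge0// cabs_res// tridiag_sym.
pose C := 2 * y + 2 * (y * (2 * y)).
have C0 : 0 <= C by rewrite addr_ge0 ?mulr_ge0.
have sq x : 0 < x -> Num.sqrt x <= 1 + x :> R.
  move=> x0; have := sqr_sqrtr (ltW x0); have := sqrtr_ge0 x; nra.
have k0 := kap0 k.
have gm w : measurable_fun setT (fun x : R => Fp (Num.sqrt x, w)).
  have mw : measurable_fun setT (fun x => Fp (x, w)) by exact: (measurableT_comp mFp (pair2_measurable w)).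
  exact: (measurableT_comp mw measurable_sqrt_fun).
have gi w : (gam (kap k)).-integrable setT (fun x => (Fp (Num.sqrt x, w))%:E).
  apply: (@integrable_gam_linear _ _ _ (C + (2 * kap k + 2) * C)) => // x x0.
  rewrite /Fp /= sqr_sqrtr ?(ltW x0)//; apply: le_trans (ler_normD _ _) _; apply: ler_split.
    rewrite normrM ger0_norm ?sqrtr_ge0// mulrC ler_pM ?sqrtr_ge0 ?sq//.
    by rewrite (le_trans (Im_cabs _))// (le_trans (dh_le _))// lerDr mulr_ge0.
  rewrite normrM mulrAC ler_pM//; last first.
    by rewrite (le_trans (Im_cabs _))// (le_trans (h'_le _))// lerDl !mulr_ge0.
  by rewrite ler_norml; apply/andP; split; nra.
transitivity (\int[P]_w \int[gam (kap k)]_x Fp (Num.sqrt x, w)).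
  transitivity (\int[P]_w Fp (entry (inr k) w, w)).
    by apply: eq_Rintegral => w _; rewrite FpE.
  apply: (@indep_Rintegral _ _ _ P _ entry mX indX (inr k) (gam (kap k)) Num.sqrt Fp) => //.
  - exact: measurable_sqrt_fun.
  - by move=> A mA; exact: lawb.
  - by under eq_fun do rewrite FpE; exact: int_sub.
apply: Rintegral_eq0 => w.
have mp : measurable_fun setT (fun x : measurableTypeR R => (x, w : others entry (inr k))).
  exact: pair2_measurable.
pose hh x := cIm (h' (Num.sqrt x, w)).
pose hh' x := cIm (dh (Num.sqrt x, w)) * (2 * Num.sqrt x)^-1.
have dH x : is_cderive (fun x => h' (x, w)) x (dh (x, w)).
  exact: (@cderive_gap R n (a w) (b w) z z0 k x).
have mhh : measurable_fun setT hh.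
  exact: (measurableT_comp (measurableT_comp (cmeas_Im mh') mp) measurable_sqrt_fun).
have mdhs : measurable_fun setT (fun x : R => cIm (dh (Num.sqrt x, w))).
  exact: (measurableT_comp (measurableT_comp (cmeas_Im mdh) mp) measurable_sqrt_fun).
have ms : measurable_fun setT (fun x : R => (2 * Num.sqrt x)^-1).
  apply: measurable_ge0V => [x|]; first by rewrite mulr_ge0 ?sqrtr_ge0.
  by apply: measurable_funM => //; exact: measurable_sqrt_fun.
have mhh' : measurable_fun setT hh' by exact: measurable_funM.
have e x : 0 < x -> Fp (Num.sqrt x, w) = 2 * (x * hh' x + (kap k - x) * hh x).
  move=> x0; rewrite /Fp /= sqr_sqrtr ?(ltW x0)// /hh' /hh.
  have s0 : 0 < Num.sqrt x by rewrite sqrtr_gt0.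
  set s := Num.sqrt x in s0 *; have -> : x = s ^+ 2 by rewrite sqr_sqrtr ?(ltW x0).
  by field; rewrite gt_eqF.
have hhC x : 0 < x -> `|hh x| <= C.
  by move=> x0; rewrite (le_trans (Im_cabs _))// (le_trans (h'_le _))// lerDl !mulr_ge0.
have hh'C x : 0 < x -> `|x * hh' x| <= C * (1 + x).
  move=> x0; have s0 : 0 < Num.sqrt x by rewrite sqrtr_gt0.
  have -> : x * hh' x = cIm (dh (Num.sqrt x, w)) * (Num.sqrt x / 2).
    rewrite /hh'; set c := cIm _; set s := Num.sqrt x in s0 *.
    have -> : x = s ^+ 2 by rewrite sqr_sqrtr ?(ltW x0).
    by field; rewrite gt_eqF.
  rewrite normrM ler_pM//; first by rewrite (le_trans (Im_cabs _))// (le_trans (dh_le _))// lerDr mulr_ge0.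
  have := sq x x0; rewrite ger0_norm ?divr_ge0 ?(ltW s0)//; lra.
have st := @gamma_stein _ (kap k) hh hh' C k0 mhh mhh'.
have st0 : \int[gam (kap k)]_x (x * hh' x + (kap k - x) * hh x) = 0.
  apply: st.
  - move=> x x0; have [_ dI] := dH (Num.sqrt x).
    have ds := is_derive1_sqrt x0; apply: rderive_eq; first exact: (rderive_comp dI ds).
    by [].
  - move=> x x0; have s0 : 0 < Num.sqrt x by rewrite sqrtr_gt0.
    have cs : {for x, continuous (@Num.sqrt R)} by exact: sqrt_continuous.
    apply: continuousM.
      have dG i j := @cderive_bond R n (a w) (b w) z z0 k (Num.sqrt x) i j.
      have ddh := cderiveN (cderiveZ 2 (cderiveM (dG (up k) (lo k)) (dH (Num.sqrt x)))).
      have [_ dI] := ddh.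
      by apply: (@continuous_comp _ _ _ _ (fun x => cIm (dh (x, w)))); [exact: cs|exact: (is_derive_continuous dI)].
    apply: continuousV; first by rewrite mulf_neq0// gt_eqF.
    by apply: continuousM => //; exact: cst_continuous.
  - exact: hhC.
  - exact: hh'C.
have gi' : (gam (kap k)).-integrable setT (fun x => (x * hh' x + (kap k - x) * hh x)%:E).
  apply: (@integrable_gam_linear _ _ _ (C + (kap k + 1) * C)) => // [|x x0].
    apply: measurable_funD; first exact: measurable_funM.
    by apply: measurable_funM => //; exact: measurable_funB.
  apply: le_trans (ler_normD _ _) _; apply: ler_split; first exact: hh'C.
  rewrite normrM mulrAC ler_pM//; last exact: hhC.
  by rewrite ler_norml; apply/andP; split; nra.
transitivity (2 * \int[gam (kap k)]_x (x * hh' x + (kap k - x) * hh x)); last by rewrite st0 mulr0.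
rewrite -RintegralZl//; apply: eq_Rintegral_gam => //.
  apply: measurable_funM => //; apply: measurable_funD; first exact: measurable_funM.
  by apply: measurable_funM => //; exact: measurable_funB.
by under eq_fun do rewrite EFinM; exact: integrableZl.
Qed.

Lemma cImCM (x : R) (w : R[i]) : cIm (x%:C * w) = x * cIm w.
Proof. by rewrite cImM cReC cImC mul0r addr0. Qed.

(** The quadratic terms cancel by [sum_toda_flow] with [g i = G i i], the entries
    disappear by [trace_flow], and [abel_trace] sums what remains. *)
Lemma Im_stein_sum (beta : R) w : (forall k : 'I_n, 2 * kap k = (n - k)%:R * beta) ->
  \sum_i 2 * (cIm (- (F w i * G w i i)) - a w i * cIm (F w i)) +
  \sum_k (b w k * cIm (- (2 * (G w (up k) (lo k) * h w k))) +
    (2 * kap k - 2 * b w k ^+ 2) * cIm (h w k)) =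
  beta * (cIm (\tr (G w)) - n.+1%:R * cIm (G w ord0 ord0)).
Proof.
move=> kE.
have e1 : \sum_i G w i i * F w i = - \sum_k (b w k)%:C * (G w (up k) (lo k) * h w k).
  rewrite sum_toda_flow -sumrN; apply: eq_bigr => k _; rewrite /h; ring.
have e2 := trace_flow (a w) (b w) z0.
have e3 := abel_trace (fun i => G w i i).
transitivity (cIm (- 2 * (\sum_i G w i i * F w i) - 2 * (\sum_i (a w i)%:C * F w i) +
    (- 2 * (\sum_k (b w k)%:C * (G w (up k) (lo k) * h w k)) +
    \sum_k (2 * kap k)%:C * h w k - 2 * \sum_k (b w k)%:C ^+ 2 * h w k))).
  rewrite !mulr_sumr -sumrB -big_split/= -sumrB cImD !cIm_sum.
  congr (_ + _); apply: eq_bigr => i _.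
    rewrite -cImCM -cImB -(cImCM 2); congr cIm.
    have -> : (2%:C : R[i]) = 2 by rewrite (CD 1 1).
    ring.
  rewrite -!cImCM -cImD; congr cIm; rewrite CB [(2 * b w i ^+ 2)%:C]CM CX.
  have -> : (2%:C : R[i]) = 2 by rewrite (CD 1 1).
  ring.
have -> : \sum_k (2 * kap k)%:C * h w k = beta%:C * (\tr (G w) - n.+1%:R * G w ord0 ord0).
  rewrite /mxtrace -e3 mulr_sumr; apply: eq_bigr => k _; rewrite kE CM.
  have -> : ((n - k)%:R)%:C = (n - k)%:R :> R[i] by exact: rmorph_nat.
  rewrite /h; ring.
have -> : n.+1%:R = (n.+1%:R)%:C :> R[i] by rewrite rmorph_nat.
rewrite -cImCM -cImB -cImCM; congr cIm; rewrite e1.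
move/eqP: e2; rewrite addr_eq0 => /eqP ->; ring.
Qed.

Lemma expected_trace (beta : R) : 0 < beta -> (forall k : 'I_n, 2 * kap k = (n - k)%:R * beta) ->
  \int[P]_w cIm (\tr (G w)) = n.+1%:R * \int[P]_w cIm (G w ord0 ord0).
Proof.
move=> b0 kE.
have iD (f g : Om -> R) : P.-integrable setT (fun w => (f w)%:E) ->
    P.-integrable setT (fun w => (g w)%:E) -> P.-integrable setT (fun w => (f w + g w)%:E).
  by move=> fi gi; under eq_fun do rewrite EFinD; exact: integrableD.
have isum (I : Type) (u : seq I) (f : I -> Om -> R) :
    (forall i, P.-integrable setT (fun w => (f i w)%:E)) -> (forall i, \int[P]_w f i w = 0) ->
    P.-integrable setT (fun w => (\sum_(i <- u) f i w)%:E) /\ \int[P]_w \sum_(i <- u) f i w = 0.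
  move=> fi f0; elim: u => [|i u [IH1 IH2]].
    split; first by under eq_fun do rewrite big_nil; exact: integrable0.
    by apply: Rintegral_eq0 => w; rewrite big_nil.
  split; first by under eq_fun do rewrite big_cons; exact: iD.
  transitivity (\int[P]_w (f i w + \sum_(j <- u) f j w)).
    by apply: eq_Rintegral => w _; rewrite big_cons.
  transitivity (\int[P]_w f i w + \int[P]_w \sum_(j <- u) f j w); first exact: (RintegralD measurableT (fi i) IH1).
  by rewrite IH2 addr0; exact: (f0 i).
pose fa i w := 2 * (cIm (- (F w i * G w i i)) - a w i * cIm (F w i)).
have ia i : P.-integrable setT (fun w => (fa i w)%:E).
  by rewrite /fa; under eq_fun do rewrite EFinM; exact: integrableZl.
have i0 i : \int[P]_w fa i w = 0.
  have hi := int_diag i; rewrite /fa RintegralZl//; have hs := stein_diag i.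
  by transitivity (2 * (0 : R)); [congr (_ * _)|rewrite mulr0].
have [s1 s2] := isum _ (index_enum 'I_n.+1) fa ia i0.
have [s3 s4] := isum _ (index_enum 'I_n) _ int_sub stein_sub.
have iIm (f : Om -> R[i]) C : cmeas f -> (forall w, cabs (f w) <= C) ->
    P.-integrable setT (fun w => (cIm (f w))%:E).
  move=> mf fC; apply: (@intM _ C); first exact: cmeas_Im.
  move=> w; have C0 : 0 <= C by exact: le_trans (cabs_ge0 _) (fC w).
  by rewrite (le_trans (Im_cabs _))// (le_trans (fC w))// ler_peMr.
have i1 : P.-integrable setT (fun w => (cIm (\tr (G w)))%:E).
  apply: (@iIm _ (\sum_(i < n.+1) y)); first by apply: cmeas_sum => i; exact: mG.
  by move=> w; rewrite (le_trans (cabs_sum _ _ _))//; apply: ler_sum => i _.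
have i2 : P.-integrable setT (fun w => (cIm (G w ord0 ord0))%:E).
  by apply: (@iIm _ y).
have i2' : P.-integrable setT (fun w => (n.+1%:R * cIm (G w ord0 ord0))%:E).
  by under eq_fun do rewrite EFinM; exact: integrableZl.
have iB : P.-integrable setT (fun w => (cIm (\tr (G w)) - n.+1%:R * cIm (G w ord0 ord0))%:E).
  by under eq_fun do rewrite EFinB; exact: integrableB.
have : \int[P]_w (beta * (cIm (\tr (G w)) - n.+1%:R * cIm (G w ord0 ord0))) = 0.
  transitivity (\int[P]_w (\sum_(i <- index_enum 'I_n.+1) fa i w +
    \sum_(k <- index_enum 'I_n) (b w k * cIm (- (2 * (G w (up k) (lo k) * h w k))) +
    (2 * kap k - 2 * b w k ^+ 2) * cIm (h w k)))).
    by apply: eq_Rintegral => w _; rewrite (Im_stein_sum w kE).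
  by rewrite RintegralD// s2 s4 addr0.
rewrite RintegralZl// RintegralB// RintegralZl//.
by move/eqP; rewrite mulf_eq0 gt_eqF//= subr_eq0 => /eqP.
Qed.

End trace_identity.

(** * Limits of complex sequences *)

Section complex_limits.
Context {R : realType}.
Implicit Types (f g : nat -> R[i]) (l m : R[i]).

Definition ccvg f l := cabs (f n - l) @[n --> \oo] --> (0 : R).

Lemma ccvgP f l : ccvg f l <->
  cRe (f n) @[n --> \oo] --> cRe l /\ cIm (f n) @[n --> \oo] --> cIm l.
Proof.
split=> [h|[/cvgrPdist_le c1 /cvgrPdist_le c2]].
  by split; [exact: cabs_cvg0_Re|exact: cabs_cvg0_Im].
apply/cvgrPdist_le => e e0; have e2 : 0 < e / 2 by rewrite divr_gt0.
near=> n; rewrite sub0r normrN ger0_norm ?cabs_ge0//.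
rewrite (le_trans (cabs_le_ReIm _))// cReB cImB [e]splitr lerD//.
  by rewrite distrC; near: n; exact: c1.
by rewrite distrC; near: n; exact: c2.
Unshelve. all: by end_near. Qed.

Lemma ccvg_cst l : ccvg (fun=> l) l.
Proof. by apply/ccvgP; split; exact: cvg_cst. Qed.

Lemma ccvgC (h : nat -> R) (x : R) : h n @[n --> \oo] --> x -> ccvg (fun n => (h n)%:C) x%:C.
Proof. by move=> hx; apply/ccvgP; split => //; exact: cvg_cst. Qed.

Lemma ccvgD f g l m : ccvg f l -> ccvg g m -> ccvg (fun n => f n + g n) (l + m).
Proof.
move=> /ccvgP[f1 f2] /ccvgP[g1 g2]; apply/ccvgP; rewrite cReD cImD; split.
  by under eq_fun do rewrite cReD; exact: cvgD.
by under eq_fun do rewrite cImD; exact: cvgD.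
Qed.

Lemma ccvgM f g l m : ccvg f l -> ccvg g m -> ccvg (fun n => f n * g n) (l * m).
Proof.
move=> /ccvgP[f1 f2] /ccvgP[g1 g2]; apply/ccvgP; rewrite cReM cImM; split.
  by under eq_fun do rewrite cReM; apply: cvgB; exact: cvgM.
by under eq_fun do rewrite cImM; apply: cvgD; exact: cvgM.
Qed.

Lemma ccvgV f l : l != 0 -> ccvg f l -> ccvg (fun n => (f n)^-1) l^-1.
Proof.
move=> l0 /ccvgP[f1 f2].
have c2 : cabs (f n) ^+ 2 @[n --> \oo] --> cabs l ^+ 2.
  rewrite cabs_sqr !expr2; under eq_fun do rewrite cabs_sqr !expr2.
  by apply: cvgD; exact: cvgM.
have cV : (cabs (f n) ^+ 2)^-1 @[n --> \oo] --> (cabs l ^+ 2)^-1.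
  by apply: cvgV => //; rewrite sqrf_eq0 cabs_eq0.
apply/ccvgP; rewrite cReV cImV; split.
  by under eq_fun do rewrite cReV; exact: cvgM.
by under eq_fun do rewrite cImV; apply: cvgM => //; exact: cvgN.
Qed.

Lemma ccvg_expC f l : ccvg f l -> ccvg (fun n => expC (f n)) (expC l).
Proof.
move=> /ccvgP[f1 f2]; apply/ccvgP; rewrite Re_expC Im_expC.
have e1 : expR (cRe (f n)) @[n --> \oo] --> expR (cRe l).
  exact: (cvg_comp _ _ f1 (@continuous_expR R _)).
have e2 : cos (cIm (f n)) @[n --> \oo] --> cos (cIm l).
  exact: (cvg_comp _ _ f2 (@continuous_cos R _)).
have e3 : sin (cIm (f n)) @[n --> \oo] --> sin (cIm l).
  exact: (cvg_comp _ _ f2 (@continuous_sin R _)).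
by split; [under eq_fun do rewrite Re_expC|under eq_fun do rewrite Im_expC]; exact: cvgM.
Qed.

Lemma cdct_hl (f_ : nat -> R -> R[i]) (f : R -> R[i]) (g : R -> R) :
  (forall n, cmeas (f_ n)) -> cmeas f ->
  (forall x : R, 0 < x -> ccvg (fun n => f_ n x) (f x)) ->
  hl.-integrable setT (fun x => (g x)%:E) ->
  (\forall n \near \oo, forall x : R, 0 < x -> cabs (f_ n x) <= g x) ->
  (forall x : R, 0 < x -> cabs (f x) <= g x) ->
  ccvg (fun n => cint hl (f_ n)) (cint hl f).
Proof.
move=> mf_ mf cf ig [N _ hN] fg.
pose pp (x : R) : R[i] := (posind x)%:C.
have mpp : cmeas pp by apply: cmeasC; exact: measurable_posind.
have E (q : R -> R[i]) : cmeas q -> cint hl q = cint hl (fun x => pp x * q x).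
  move=> mq; apply: eq_cint_hl => //; first exact: cmeasM.
  by move=> x x0; rewrite /pp /posind x0 mul1r.
have mg : measurable_fun setT g by move/measurable_int: (ig) => /measurable_EFinP.
rewrite /ccvg -(cvg_shiftn N).
have -> : (fun n => cabs (cint hl (f_ (n + N)%N) - cint hl f)) =
    fun n => cabs (cint hl (fun x => pp x * f_ (n + N)%N x) - cint hl (fun x => pp x * f x)).
  by apply/funext => n; rewrite -!E.
have bd (q : R -> R[i]) : (forall x, 0 < x -> cabs (q x) <= g x) ->
    forall x, cabs (pp x * q x) <= posind x * g x.
  move=> qg x; rewrite cabsM cabsC ger0_norm ?posind_ge0// /posind.
  by case: (ltP 0 x) => x0; rewrite ?mul1r ?mul0r// qg.
apply: (@cdct _ _ _ hl (fun n x => pp x * f_ (n + N)%N x) _ (fun x => posind x * g x)).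
- by move=> n; apply: cmeasM => //; exact: mf_.
- exact: cmeasM.
- move=> x; rewrite /pp /posind; case: (ltP 0 x) => x0.
    have := cf x x0; rewrite /ccvg -(cvg_shiftn N) => h.
    by under eq_fun do rewrite !mul1r.
  by under eq_fun do rewrite !mul0r subrr cabs0; exact: cvg_cst.
- apply: le_integrable_hl ig _; first by apply: measurable_funM => //; exact: measurable_posind.
  move=> x x0; rewrite /posind x0 mul1r ger0_norm//.
  by rewrite (le_trans (cabs_ge0 (f x)))// fg.
- by move=> n; apply: bd; apply: hN => /=; rewrite leq_addl.
- exact: bd.
Qed.

End complex_limits.

(** * Parabolic cylinder functions *)

Section cylinder_functions.
Context {R : realType}.
Local Notation hl := (@hl R).

(** The characteristic function of [z - a], with [a] a standard Gaussian variable. *)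
Definition gwave (w : R[i]) (s : R) : R[i] := expC ((- (s ^+ 2 / 2))%:C + s%:C * ('i * w)).

Definition cylf (k : R) (w : R[i]) (s : R) : R[i] := (s `^ (k - 1))%:C * gwave w s.

(** In the usual notation, [Gamma k * e^(- w ^ 2 / 4) * D_(- k) (- i w)] with [D] the parabolic
    cylinder function. *)
Definition cyl (k : R) (w : R[i]) : R[i] := cint hl (cylf k w).

Lemma cabs_gwave w s : cabs (gwave w s) = expR (- (s ^+ 2 / 2) - cIm w * s).
Proof. by rewrite cabs_expC cReD cReC cReM cReC cImC cReiM; congr expR; ring. Qed.

Lemma cabs_gwave_le (M : R) w s : 0 < s -> - M <= cIm w ->
  cabs (gwave w s) <= expR ((M + 1) ^+ 2 / 2) * expR (- (1 * s)).
Proof.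
move=> s0 Mw; rewrite cabs_gwave -expRD ler_expR.
have h1 : - (cIm w * s) <= M * s by rewrite -mulNr ler_wpM2r ?(ltW s0)// lerNl.
have h2 := sqr_ge0 (s - (M + 1)); nra.
Qed.

Lemma cmeas_gwave w : cmeas (gwave w).
Proof.
apply: cmeas_expC; apply: cmeasD; last by apply: cmeasM; [exact: cmeas_id|exact: cmeas_cst].
by apply: cmeasC; apply: measurableT_comp => //; apply: measurable_funM => //; exact: measurable_funX.
Qed.

Lemma cmeas_cylf k w : cmeas (cylf k w).
Proof. by apply: cmeasM; [apply: cmeasC; exact: measurable_powRl|exact: cmeas_gwave]. Qed.

Lemma powR_le2 (s x lo hi : R) : 0 < s -> lo <= x <= hi -> s `^ x <= s `^ lo + s `^ hi.
Proof.
move=> s0 /andP[h1 h2]; rewrite /powR gt_eqF//.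
have [l0|l0] := leP 0 (ln s).
  rewrite (@le_trans _ _ (expR (hi * ln s)))// ?lerDr ?expR_ge0//.
  by rewrite ler_expR ler_wpM2r.
rewrite (@le_trans _ _ (expR (lo * ln s)))// ?lerDl ?expR_ge0//.
by rewrite ler_expR ler_wnM2r// ltW.
Qed.

Definition cyl_dom (lo hi M s : R) : R :=
  expR ((M + 1) ^+ 2 / 2) * (s `^ (lo - 1) * expR (- (1 * s)) + s `^ (hi - 1) * expR (- (1 * s))).

Lemma integrable_cyl_dom (lo hi M : R) : 0 < lo -> 0 < hi ->
  hl.-integrable setT (fun s => (cyl_dom lo hi M s)%:E).
Proof.
move=> lo0 hi0; rewrite /cyl_dom; under eq_fun do rewrite EFinM EFinD.
by apply: integrableZl => //; apply: integrableD => //; exact: integrable_powexp.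
Qed.

Lemma cabs_cylf_le (lo hi M k s : R) w : 0 < s -> lo <= k <= hi -> - M <= cIm w ->
  cabs (cylf k w s) <= cyl_dom lo hi M s.
Proof.
move=> s0 /andP[k1 k2] Mw; rewrite /cylf cabsM cabsC ger0_norm ?powR_ge0//.
rewrite /cyl_dom -mulrDl mulrCA ler_pM ?powR_ge0 ?cabs_ge0 ?cabs_gwave_le//.
by apply: powR_le2 => //; rewrite !lerD2r k1.
Qed.

Lemma cintegrable_cylf k w : 0 < k -> cintegrable hl (cylf k w).
Proof.
move=> k0; apply: (@le_cintegrable_hl _ _ (cyl_dom k k (- cIm w))).
- exact: cmeas_cylf.
- exact: integrable_cyl_dom.
- by move=> s s0; apply: cabs_cylf_le; rewrite ?lexx// opprK.
Qed.

Lemma ccvg_powR (s x : R) (x_ : nat -> R) : 0 < s -> x_ n @[n --> \oo] --> x ->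
  s `^ (x_ n) @[n --> \oo] --> s `^ x.
Proof.
move=> s0 h; rewrite /powR gt_eqF//.
apply: (@cvg_comp _ _ _ (fun n => x_ n * ln s) expR _ _ _ _ (@continuous_expR R _)).
exact: (cvgM h (cvg_cst (ln s))).
Qed.

Lemma ccvg_cyl (k : R) w (k_ : nat -> R) (w_ : nat -> R[i]) : 0 < k ->
  k_ n @[n --> \oo] --> k -> ccvg w_ w -> ccvg (fun n => cyl (k_ n) (w_ n)) (cyl k w).
Proof.
move=> k0 ck cw; have [_ cI] := (ccvgP _ _).1 cw.
pose M := 1 - cIm w.
apply: (@cdct_hl _ (fun n => cylf (k_ n) (w_ n)) (cylf k w) (cyl_dom (k / 2) (2 * k) M)).
- by move=> n; exact: cmeas_cylf.
- exact: cmeas_cylf.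
- move=> s s0; apply: ccvgM.
    by apply: ccvgC; apply: ccvg_powR => //; apply: cvgB => //; exact: cvg_cst.
  apply: ccvg_expC; apply: ccvgD; first exact: ccvg_cst.
  by apply: ccvgM; [exact: ccvg_cst|apply: ccvgM => //; exact: ccvg_cst].
- by apply: integrable_cyl_dom; rewrite ?mulr_gt0.
- have k1 : \forall n \near \oo, k / 2 <= k_ n by apply: (cvgr_ge k) => //; lra.
  have k2 : \forall n \near \oo, k_ n <= 2 * k by apply: (cvgr_le k) => //; lra.
  have w1 : \forall n \near \oo, - M <= cIm (w_ n).
    by apply: (cvgr_ge (cIm w)) => //; rewrite /M; lra.
  near=> n => s s0; apply: cabs_cylf_le => //; last by near: n.
  by apply/andP; split; near: n.
- move=> s s0; apply: cabs_cylf_le => //; last by rewrite /M; lra.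
  by apply/andP; split; lra.
Unshelve. all: by end_near. Qed.

Lemma cderive_gwave w s : is_cderive (gwave w) s (('i * w - s%:C) * gwave w s).
Proof.
have d2 : is_derive s 1 (fun s : R => - (s ^+ 2 / 2)) (- s).
  have -> : (fun s : R => - (s ^+ 2 / 2)) = fun s => - (2^-1 * s ^+ 2).
    by apply/funext => r; rewrite mulrC.
  by apply: (rderive_eq (rderiveN (rderiveZ 2^-1 (rderive_sqr (rderive_id s))))); field.
apply: (cderive_eq (cderive_expC (cderiveD (cderiveC d2) (cderiveM (cderive_id s) (cderive_cst s ('i * w)))))).
by rewrite -/(gwave w s) CN; ring.
Qed.

Lemma cderive_cylF k w s : 0 < s ->
  is_cderive (fun s : R => (s `^ k)%:C * gwave w s) s
    (k%:C * cylf k w s + ('i * w * cylf (k + 1) w s - cylf (k + 2) w s)).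
Proof.
move=> s0; apply: (cderive_eq (cderiveM (cderiveC (is_derive1_powR k s0)) (cderive_gwave w s))).
have e1 : k + 1 - 1 = k by ring.
have e2 : s `^ (k + 2 - 1) = s * s `^ k.
  have -> : k + 2 - 1 = k + 1 by ring.
  by have := powR_predM (k + 1) s0; rewrite addrK.
by rewrite /cylf e1 e2 !CM; ring.
Qed.

Lemma cyl_parts k w : 0 < k ->
  k%:C * cyl k w + ('i * w * cyl (k + 1) w - cyl (k + 2) w) = 0.
Proof.
move=> k0; have k1 : 0 < k + 1 by rewrite addr_gt0.
have k2 : 0 < k + 2 by rewrite addr_gt0.
have i0 := cintegrable_cylf w k0; have i1 := cintegrable_cylf w k1.
have i2 := cintegrable_cylf w k2.
have j0 := cintegrableZl k%:C i0; have j1 := cintegrableZl ('i * w) i1.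
have j12 := cintegrableB j1 i2.
transitivity (cint hl (fun s => k%:C * cylf k w s + ('i * w * cylf (k + 1) w s - cylf (k + 2) w s))).
  by rewrite cintD// cintB// !cintZl.
rewrite -[RHS](subrr 0).
pose M := - cIm w.
have Fle s : 0 < s -> cabs ((s `^ k)%:C * gwave w s) <= expR ((M + 1) ^+ 2 / 2) * (s `^ k * expR (- (1 * s))).
  move=> s0; rewrite cabsM cabsC ger0_norm ?powR_ge0// mulrCA ler_wpM2l ?powR_ge0//.
  by apply: cabs_gwave_le => //; rewrite opprK.
apply: (@cFTC0y _ _ (fun s : R => (s `^ k)%:C * gwave w s)).
- exact: cintegrableD.
- by move=> s s0; exact: cderive_cylF.
- move=> s s0.
  have dcyl j := cderive_cylF (j - 1) w s0.
  eexists; apply: cderiveD; first by apply: cderiveZ; exact: dcyl.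
  by apply: cderiveB; [apply: cderiveZ|]; exact: dcyl.
- apply: (@cvg0_le _ _ _ _ _ (fun s => expR ((M + 1) ^+ 2 / 2) * s `^ k)); last first.
    by apply: cvgM0; exact: powR_cvg0.
  near=> s; have s0 : 0 < s by near: s; exact: nbhs_right_gt.
  rewrite subr0 ger0_norm ?cabs_ge0// (le_trans (Fle s s0))// ler_wpM2l ?expR_ge0//.
  by rewrite ler_piMr ?powR_ge0// -[leRHS]expR0 ler_expR oppr_le0 mul1r ltW.
- have c2 : 0 < 2^-1 :> R by [].
  have [C C0 hC] := powR_le_expR (ltW k0) c2.
  apply: (@cvg0_le _ _ _ _ _ (fun s => expR ((M + 1) ^+ 2 / 2) * (C * expR (- (2^-1 * s))))); last first.
    by apply: cvgM0; apply: cvgM0; exact: cvg_expRN.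
  near=> s; have s0 : 0 < s by near: s; exact: nbhs_pinfty_gt.
  rewrite subr0 ger0_norm ?cabs_ge0// (le_trans (Fle s s0))// ler_wpM2l ?expR_ge0//.
  have -> : expR (- (2^-1 * s)) = expR (2^-1 * s) * expR (- (1 * s)).
    by rewrite -expRD; congr expR; field.
  by rewrite mulrA ler_wpM2r ?expR_ge0// hC.
Unshelve. all: by end_near. Qed.

Lemma cderive_cyl k w v (t : R) : 0 < k ->
  is_cderive (fun r => cyl k (w + r%:C * v)) t ('i * v * cyl (k + 1) (w + t%:C * v)).
Proof.
move=> k0; have k1 : 0 < k + 1 by rewrite addr_gt0.
rewrite -cintZl; last exact: cintegrable_cylf.
pose M := `|cIm w| + (`|t| + 1) * cabs v.
have Mw r : t - 1 < r < t + 1 -> - M <= cIm (w + r%:C * v).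
  move=> rt; rewrite cImD opprD lerD//; first by rewrite lerNl -normrN ler_norm.
  rewrite cImM cReC cImC mul0r addr0 lerNl.
  rewrite (le_trans (ler_norm _))// normrN normrM ler_pM// ?Im_cabs//.
  have h1 : `|r - t| <= 1 by rewrite ler_norml; move: rt => /andP[]; lra.
  by have := ler_normD (r - t) t; rewrite subrK; lra.
apply: (@cderive_cint_hl _ (fun r s => cylf k (w + r%:C * v) s)
  (fun r s => 'i * v * cylf (k + 1) (w + r%:C * v) s)
  (fun s => cabs v * cyl_dom (k + 1) (k + 1) M s) t (t - 1) (t + 1)).
- by apply/andP; split; lra.
- by move=> r _; exact: cintegrable_cylf.
- by apply: cmeasM; [exact: cmeas_cst|exact: cmeas_cylf].
- move=> r s rt s0.
  apply: (@eq_cderive _ (fun r : R => cylf k w s * expC (r%:C * (s%:C * ('i * v))))).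
    move=> q; rewrite /cylf -mulrA -expCD; congr (_ * expC _); ring.
  apply: (cderive_eq (cderiveZ _ (cderive_expi _ _))).
  have -> : cylf (k + 1) (w + r%:C * v) s = s%:C * cylf k w s * expC (r%:C * (s%:C * ('i * v))).
    have eA : gwave (w + r%:C * v) s = gwave w s * expC (r%:C * (s%:C * ('i * v))).
      by rewrite /gwave -expCD; congr expC; ring.
    by rewrite /cylf addrK (powR_predM k s0) CM eA; ring.
  ring.
- by under eq_fun do rewrite EFinM; apply: integrableZl => //; exact: integrable_cyl_dom.
- move=> r s rt s0; rewrite cabsM [cabs ('i * v)]cabsM cabsi mul1r ler_wpM2l ?cabs_ge0//.
  by apply: cabs_cylf_le; rewrite ?lexx ?Mw.
Qed.

End cylinder_functions.

(** * The duplication constant *)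

Section duplication.
Context {R : realType}.
Local Notation hl := (@hl R).

Lemma powRD_gt0 (x r s : R) : 0 < x -> x `^ (r + s) = x `^ r * x `^ s.
Proof. by move=> x0; rewrite powRD// (gt_eqF x0) implybT. Qed.

Lemma powR_ge_half (k x : R) : 0 < k -> 1 <= x -> x <= 2 -> 2^-1 <= x `^ (k - 1).
Proof.
move=> k0 x1 x2; have x0 : 0 < x by rewrite (lt_le_trans ltr01).
have -> : x `^ (k - 1) = x `^ k * x^-1.
  by rewrite (powR_predM k x0); field; rewrite gt_eqF.
apply: (@le_trans _ _ x^-1); first by rewrite lef_pV2 ?posrE.
have h1 : (1 : R) `^ k = 1 by rewrite powR1.
rewrite ler_peMl ?invr_ge0 ?(ltW x0)// -h1.
by apply: (ge0_ler_powR (ltW k0)); rewrite ?nnegrE ?(ltW x0).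
Qed.

Lemma powR_young (t m s : R) : 0 < t -> 0 < m -> 0 <= s <= 1 ->
  t `^ s <= m `^ s * ((1 - s) + s * (t / m)).
Proof.
move=> t0 m0 /andP[s0 s1].
have -> : t `^ s = m `^ s * (t / m) `^ s.
  by rewrite -powRM ?divr_ge0 ?(ltW t0) ?(ltW m0)//; congr (_ `^ _); field; rewrite gt_eqF.
rewrite ler_wpM2l ?powR_ge0//; set u := t / m.
have u0 : 0 < u by rewrite divr_gt0.
rewrite /powR gt_eqF// -{2}(lnK (u0 : u \is Num.pos)); set L := ln u.
have h1 := expR_ge1Dx ((1 - s) * L); have h2 := expR_ge1Dx (- s * L).
have e1 : expR L = expR (s * L) * expR ((1 - s) * L) by rewrite -expRD; congr expR; ring.
have e2 : 1 = expR (s * L) * expR (- s * L) by rewrite -expRD -{1}(expR0 R); congr expR; ring.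
have E0 := expR_ge0 (s * L); set e := expR (s * L) in e1 e2 E0 *.
have h3 : e * (1 + (1 - s) * L) <= expR L by rewrite e1 ler_wpM2l.
have h4 : e * (1 + - s * L) <= 1 by rewrite [leRHS]e2 ler_wpM2l.
have h5 : s * (e * (1 + (1 - s) * L)) <= s * expR L by rewrite ler_wpM2l.
have h6 : (1 - s) * (e * (1 + - s * L)) <= (1 - s) * 1 by rewrite ler_wpM2l ?subr_ge0.
lra.
Qed.

(** The Bohr-Mollerup theorem. The ratio [p / g] has period one, and the inequalities let it
    grow at most by the factor [1 + s / y] from [y] to [y + s]; along [y = n] this tends to one. *)
Lemma log_convex_le (p g : R -> R) : (forall x, 0 < x -> 0 < p x) -> (forall x, 0 < x -> 0 < g x) ->
  (forall x, 0 < x -> p (x + 1) = x * p x) -> (forall x, 0 < x -> g (x + 1) = x * g x) ->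
  (forall x s, 0 < x -> 0 <= s <= 1 -> p (x + s) <= x `^ s * p x) ->
  (forall x s, 0 < x -> 0 <= s <= 1 -> g (x + s) <= x `^ s * g x) ->
  p 1 = g 1 -> forall x, 0 < x -> p x <= g x.
Proof.
move=> p0 g0 pS gS ple gle pg1 x x0.
pose r x := p x / g x.
have r0 y : 0 < y -> 0 < r y by move=> y0; rewrite divr_gt0 ?p0 ?g0.
have rS y : 0 < y -> r (y + 1) = r y.
  by move=> y0; rewrite /r pS// gS//; field; rewrite !gt_eqF ?g0.
have rn (n : nat) y : 0 < y -> r (y + n%:R) = r y.
  move=> y0; elim: n => [|n IH]; first by rewrite addr0.
  by rewrite -natr1 addrA rS// ltr_wpDr.
have step y s : 0 < y -> 0 <= s <= 1 -> r (y + s) <= r y * (1 + s / y).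
  move=> y0 s01; have /andP[s0 s1] := s01; have ys : 0 < y + s by rewrite ltr_wpDr.
  have s'01 : 0 <= 1 - s <= 1 by rewrite subr_ge0 s1 lerBlDr lerDl.
  have h1 := ple y s y0 s01; have h2 := gle (y + s) (1 - s) ys s'01.
  have e : y + s + (1 - s) = y + 1 by ring.
  rewrite e gS// in h2.
  have h3 : y `^ s * (y + s) `^ (1 - s) <= y + s.
    rewrite (@le_trans _ _ ((y + s) `^ s * (y + s) `^ (1 - s)))//.
      rewrite ler_wpM2r ?powR_ge0//; apply: ge0_ler_powR => //.
      - by rewrite nnegrE ltW.
      - by rewrite nnegrE ltW.
      by rewrite lerDl.
    rewrite -powRD_gt0// (_ : s + (1 - s) = 1); last by ring.
    by rewrite powRr1 ?(ltW ys).
  rewrite /r ler_pdivrMr ?g0// (le_trans h1)//.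
  have gy := g0 y y0; have py := p0 y y0; have gys := g0 _ ys.
  have -> : p y / g y * (1 + s / y) * g (y + s) = (y + s) * g (y + s) * p y / (y * g y).
    by field; rewrite !gt_eqF.
  rewrite ler_pdivlMr ?mulr_gt0//.
  rewrite (@le_trans _ _ (y `^ s * p y * ((y + s) `^ (1 - s) * g (y + s))))//.
    by rewrite ler_wpM2l ?mulr_ge0 ?powR_ge0 ?(ltW py).
  have -> : y `^ s * p y * ((y + s) `^ (1 - s) * g (y + s)) =
    (y `^ s * (y + s) `^ (1 - s)) * (p y * g (y + s)) by ring.
  rewrite (le_trans (ler_wpM2r _ h3))//; first by rewrite mulr_ge0 ?ltW.
  by rewrite le_eqVlt; apply/orP; left; apply/eqP; ring.
have r1 : r 1 = 1 by rewrite /r pg1 divff// gt_eqF// g0.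
have small s : 0 < s -> s <= 1 -> r s <= 1.
  move=> s0 s1; apply/ler_addgt0Pr => e e0.
  have [n hn] : exists n : nat, s / e < n%:R.
    by exists (Num.truncn (s / e)).+1; rewrite truncnS_gt.
  have n0 : 0 < n%:R :> R by rewrite (lt_trans _ hn)// divr_gt0.
  have := @step n%:R s n0; rewrite (ltW s0) s1 => /(_ isT).
  rewrite addrC rn//.
  have -> : r n%:R = 1.
    case: n n0 {hn} => [|n _]; first by rewrite ltxx.
    by rewrite -natr1 addrC rn.
  rewrite mul1r => h; rewrite (le_trans h)// lerD2l ler_pdivrMr//.
  by rewrite ltW// -ltr_pdivrMl// mulrC.
have all (m : nat) y : 0 < y -> y <= m.+1%:R -> r y <= 1.
  elim: m y => [|m IH] y y0 ym; first exact: small.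
  have [y1|y1] := leP y 1; first exact: small.
  have y1' : 0 < y - 1 by rewrite subr_gt0.
  have := rS _ y1'; rewrite subrK => ->; apply: IH => //.
  by rewrite lerBlDr natr1.
have := all (Num.truncn x) x x0; rewrite ltW ?truncnS_gt// => /(_ isT).
by rewrite ler_pdivrMr ?g0// mul1r.
Qed.

Lemma log_convex_eq (p g : R -> R) : (forall x, 0 < x -> 0 < p x) -> (forall x, 0 < x -> 0 < g x) ->
  (forall x, 0 < x -> p (x + 1) = x * p x) -> (forall x, 0 < x -> g (x + 1) = x * g x) ->
  (forall x s, 0 < x -> 0 <= s <= 1 -> p (x + s) <= x `^ s * p x) ->
  (forall x s, 0 < x -> 0 <= s <= 1 -> g (x + s) <= x `^ s * g x) ->
  p 1 = g 1 -> forall x, 0 < x -> p x = g x.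
Proof.
move=> p0 g0 pS gS ple gle pg1 x x0; apply/eqP; rewrite eq_le.
by rewrite !log_convex_le.
Qed.

(** Young's inequality under the integral. The free parameter [m] is to be the quotient of
    the two moments on the right. *)
Lemma moment_le (v : R -> R) (k s m : R) : measurable_fun setT v -> (forall x, 0 <= v x) ->
  (forall k : R, 0 < k -> hl.-integrable setT (fun x => (x `^ (k - 1) * v x)%:E)) ->
  0 < k -> 0 <= s <= 1 -> 0 < m ->
  \int[hl]_x (x `^ (k + s - 1) * v x) <=
  m `^ s * ((1 - s) * \int[hl]_x (x `^ (k - 1) * v x) + s / m * \int[hl]_x (x `^ (k + 1 - 1) * v x)).
Proof.
move=> mv v0 iv k0 s01 m0; have /andP[s0 s1] := s01.
have k1 : 0 < k + 1 by rewrite addr_gt0.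
have ks : 0 < k + s by rewrite ltr_wpDr.
have i1 := iv k k0; have i2 := iv _ k1; have i3 := iv _ ks.
have j1 := integrableZl measurableT (1 - s) i1.
have j2 := integrableZl measurableT (s / m) i2.
have j12 : hl.-integrable setT (fun x => ((1 - s) * (x `^ (k - 1) * v x) + s / m * (x `^ (k + 1 - 1) * v x))%:E).
  by under eq_fun do rewrite EFinD; exact: integrableD.
have j := integrableZl measurableT (m `^ s) j12.
rewrite -!RintegralZl// -RintegralD// -RintegralZl//.
apply: le_Rintegral_hl => // x x0.
have e1 : x `^ (k + s - 1) = x `^ (k - 1) * x `^ s.
  by rewrite -powRD_gt0//; congr (_ `^ _); ring.
have e2 : x `^ (k + 1 - 1) = x `^ (k - 1) * x by rewrite addrK (powR_predM k x0) mulrC.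
rewrite e1 e2.
have h := powR_young x0 m0 s01.
have -> : m `^ s * ((1 - s) * (x `^ (k - 1) * v x) + s / m * (x `^ (k - 1) * x * v x)) =
  (x `^ (k - 1) * v x) * (m `^ s * (1 - s + s * (x / m))) by ring.
have -> : x `^ (k - 1) * x `^ s * v x = (x `^ (k - 1) * v x) * x `^ s by ring.
by rewrite ler_wpM2l// mulr_ge0 ?powR_ge0.
Qed.

Definition gmom (k : R) : R := \int[hl]_x (x `^ (k - 1) * expR (- (x ^+ 2 / 2))).

Let mv : measurable_fun setT (fun x : R => expR (- (x ^+ 2 / 2))).
Proof.
apply: measurableT_comp => //; apply: measurableT_comp => //.
by apply: measurable_funM => //; exact: measurable_funX.
Qed.

Let cylf0E k x : cylf k (0 : R[i]) x = (x `^ (k - 1) * expR (- (x ^+ 2 / 2)))%:C.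
Proof.
rewrite /cylf /gwave !mulr0 addr0 CM; congr (_ * _).
by apply: complexP; rewrite !(Re_expC, Im_expC) !(cReC, cImC) ?cos0 ?sin0 ?mulr1 ?mulr0.
Qed.

Lemma cyl0E k : cyl k (0 : R[i]) = (gmom k)%:C.
Proof. by rewrite /gmom -cintC; apply: eq_cint => x; exact: cylf0E. Qed.

Let iv (k : R) : 0 < k -> hl.-integrable setT (fun x => (x `^ (k - 1) * expR (- (x ^+ 2 / 2)))%:E).
Proof.
move=> k0; have := cintegrable_Re (cintegrable_cylf (0 : R[i]) k0).
by apply: eq_integrable => // x _; rewrite cylf0E.
Qed.

Lemma gmomS k : 0 < k -> gmom (k + 2) = k * gmom k.
Proof.
move=> k0; have := cyl_parts (0 : R[i]) k0; rewrite mulr0 mul0r sub0r !cyl0E -CM.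
by move=> /eqP; rewrite subr_eq0 => /eqP /(congr1 (@complex.Re R)).
Qed.

Lemma gmom_gt0 k : 0 < k -> 0 < gmom k.
Proof.
move=> k0; apply: (@Rintegral_hl_gt0 R _ (2^-1 * expR (- 2)) (iv k0)).
- by rewrite mulr_gt0 ?expR_gt0.
- by move=> x x0; rewrite mulr_ge0 ?powR_ge0 ?expR_ge0.
move=> x x1 x2; rewrite ler_pM ?expR_ge0 ?powR_ge_half// ler_expR lerN2.
nra.
Qed.

Let sqrt2pi : Num.sqrt (2 * pi) = 2 * Num.sqrt (pi / 2) :> R.
Proof.
have -> : 2 * pi = 2 ^+ 2 * (pi / 2) :> R by field.
by rewrite sqrtrM ?sqr_ge0// sqrtr_sqr ger0_norm.
Qed.

Lemma gmom1 : gmom 1 = Num.sqrt (pi / 2).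
Proof.
have c0 : 0 < Num.sqrt (2 * pi) :> R by rewrite sqrtr_gt0 mulr_gt0 ?pi_gt0.
have gE : gmom 1 = \int[hl]_x (Num.sqrt (2 * pi) * gpdf x).
  apply: eq_Rintegral => x _; rewrite subrr powRr0 mul1r gpdfE; field.
  by rewrite gt_eqF.
have gi : hl.-integrable setT (fun x => (gpdf x : R)%:E).
  have := integrableZl measurableT (Num.sqrt (2 * pi))^-1 (iv ltr01).
  apply: eq_integrable => // x _; rewrite -EFinM gpdfE; congr (_ * _)%:E.
  by rewrite subrr powRr0 mul1r.
rewrite gE RintegralZl// sqrt2pi.
suff h : \int[hl]_x gpdf x = 2^-1 :> R by rewrite h; field.
have m0 : measurable_fun setT (@gpdf R) by exact: measurable_gpdf.
have cg : continuous (@gpdf R) by move=> x; exact: is_derive_continuous (rderive_gpdf x).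
have eg : @gpdf R =1 @gpdf R \o -%R by move=> x; rewrite /= !gpdfE sqrrN.
have := ge0_symfun_integralT gpdf_ge0 cg eg.
rewrite integral_normal_pdf -set_itvcy -integral_itv_obnd_cbnd; last first.
  by apply/measurable_EFinP; exact: measurable_funTS.
move=> h; rewrite Rintegral_hl// /Rintegral.
move: h; case: (integral _ _ _) => [r| |] //=; last first.
- by rewrite mulrNy gtr0_sg// mul1e.
- by rewrite mulry gtr0_sg// mul1e.
by rewrite -EFinM => -[h]; lra.
Qed.

Lemma gmom2 : gmom 2 = 1.
Proof.
rewrite /gmom; have [_ ->] : hl.-integrable setT (fun x : R => (x `^ (2 - 1) * expR (- (x ^+ 2 / 2)))%:E) /\
    \int[hl]_x (x `^ (2 - 1) * expR (- (x ^+ 2 / 2))) = 0 - (- 1); last by ring.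
have d2 (x : R) : is_derive x 1 (fun x : R => - expR (- (x ^+ 2 / 2))) (x * expR (- (x ^+ 2 / 2))).
  have -> : (fun x : R => - expR (- (x ^+ 2 / 2))) = fun s => - expR (- (2^-1 * s ^+ 2)).
    by apply/funext => r; rewrite mulrC.
  apply: (rderive_eq (rderiveN (rderive_comp (is_derive_expR _) (rderiveN (rderiveZ 2^-1 (rderive_sqr (rderive_id x))))))).
  by rewrite [x ^+ 2 / 2]mulrC; field.
have e (x : R) : 0 < x -> x `^ (2 - 1) = x.
  by move=> x0; rewrite (_ : 2 - 1 = 1) ?powRr1 ?ltW//; ring.
apply: (@ge0_FTC0y _ _ (fun x : R => - expR (- (x ^+ 2 / 2)))).
- by apply: measurable_funM => //; exact: measurable_powRl.
- by move=> x x0; rewrite e.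
- move=> x x0; have := rderiveM (is_derive1_powR (2 - 1) x0) (rderiveN (d2 x)).
  move=> /is_derive_continuous; under [X in {for _, continuous X} -> _]eq_fun do rewrite opprK; exact.
- by move=> x x0; rewrite mulr_ge0 ?powR_ge0 ?expR_ge0.
- apply: cvg_at_right_filter; have h := is_derive_continuous (d2 0).
  have e0 : - expR (- ((0 : R) ^+ 2 / 2)) = - 1 by rewrite expr0n/= mul0r oppr0 expR0.
  by rewrite -e0; exact: h.
- rewrite -[X in _ --> X]oppr0; apply: cvgN.
  apply: (@cvg0_le _ _ _ _ _ (fun x => expR (2^-1) * expR (- (1 * x)))); last first.
    by apply: cvgM0; exact: cvg_expRN.
  near=> x; rewrite ger0_norm ?expR_ge0// -expRD ler_expR.
  have := sqr_ge0 (x - 1); nra.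
Unshelve. all: by end_near. Qed.

(** Divided by [Num.sqrt (pi / 2)], the left-hand side satisfies the functional equation and the
    interpolation inequality that characterize the gamma function. *)
Lemma duplication k : 0 < k -> gmom k * gmom (k + 1) = Num.sqrt (pi / 2) * gamma_fun k.
Proof.
move=> k0; have c0 : 0 < Num.sqrt (pi / 2) :> R by rewrite sqrtr_gt0 divr_gt0 ?pi_gt0.
pose p k := gmom k * gmom (k + 1) / Num.sqrt (pi / 2).
suff h : p k = gamma_fun k by rewrite -h /p [RHS]mulrC divfK// gt_eqF.
have g0 x : 0 < x -> 0 < gmom x := @gmom_gt0 x.
have ss (x : R) : x + 1 + 1 = x + 2 by ring.
have x1 (x : R) : 0 < x -> 0 < x + 1 by move=> x0; rewrite addr_gt0.
have GE (x : R) : gamma_fun x = \int[hl]_t (t `^ (x - 1) * expR (- t)) by rewrite gamma_funE.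
have GS (x : R) : 0 < x -> gamma_fun (x + 1) = x * gamma_fun x.
  move=> x0; have c1 : 0 < cRe (1 : R[i]) by [].
  by have := Lap_parts x0 c1; rewrite mul1r !Lap1 -CM => /(congr1 (@complex.Re R)).
apply: log_convex_eq => //.
- by move=> x x0; rewrite /p divr_gt0 ?mulr_gt0 ?g0 ?x1.
- by move=> x x0; exact: gamma_fun_gt0.
- by move=> x x0; rewrite /p ss gmomS//; move: (gmom x) (gmom (x + 1)) (Num.sqrt _)^-1 => u v w; ring.
- move=> x s x0 s01; rewrite /p.
  have step y : 0 < y -> gmom (y + s) <= (gmom (y + 1) / gmom y) `^ s * gmom y.
    move=> y0; have y1 := x1 _ y0.
    have m0 : 0 < gmom (y + 1) / gmom y by rewrite divr_gt0 ?g0.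
    have := moment_le mv (fun x => expR_ge0 _) iv y0 s01 m0.
    rewrite -/(gmom y) -/(gmom (y + s)) -/(gmom (y + 1)).
    have -> : (1 - s) * gmom y + s / (gmom (y + 1) / gmom y) * gmom (y + 1) = gmom y => //.
    move: (g0 _ y0) (g0 _ y1); move: (gmom y) (gmom (y + 1)) => u v u0 v0.
    by field; rewrite !gt_eqF.
  rewrite mulrA ler_pM2r ?invr_gt0// (_ : x + s + 1 = x + 1 + s); last by ring.
  have h1 := step x x0; have h2 := step _ (x1 _ x0).
  rewrite (le_trans (ler_pM _ _ h1 h2)) ?(ltW (g0 _ _))//.
  - by case/andP: s01 => s0 _; rewrite ltr_wpDr.
  - by case/andP: s01 => s0 _; rewrite ltr_wpDr// x1.
  rewrite mulrACA -powRM ?divr_ge0 ?(ltW (g0 _ _)) ?x1// ?ss ?gmomS ?addr_gt0//.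
  rewrite le_eqVlt; apply/orP; left; apply/eqP; congr (_ `^ _ * _).
  move: (g0 _ x0) (g0 _ (x1 _ x0)); move: (gmom x) (gmom (x + 1)) => u v u0 v0.
  by field; rewrite !gt_eqF.
- move=> x s x0 s01.
  have mw : measurable_fun setT (fun x : R => expR (- x)) by apply: measurableT_comp.
  have iw (y : R) : 0 < y -> hl.-integrable setT (fun x => (x `^ (y - 1) * expR (- x))%:E).
    by move=> y0; exact: integrable_powexp1.
  have := moment_le mw (fun x => expR_ge0 _) iw x0 s01 x0.
  rewrite -!GE GS// => h; rewrite (le_trans h)// le_eqVlt; apply/orP; left; apply/eqP.
  by field; rewrite gt_eqF.
- rewrite /p gmom1 (_ : 1 + 1 = 2 :> R)// gmom2 mulr1 divff ?gt_eqF// GE.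
  under eq_Rintegral do rewrite subrr powRr0 mul1r.
  have [_] := @integrable_expRN R 1 ltr01.
  by under eq_Rintegral do rewrite mul1r; move=> ->; rewrite ?invr1.
Qed.

End duplication.

(** * The stationary solution *)

Section stationary.
Context {R : realType}.
Local Notation hl := (@hl R).
Local Notation gau := (@gau R).

(** As functions of [E] both sides solve [f' = - E f]; at [E = 0] this is [duplication]. *)
Lemma wronskian (k E : R) : 0 < k ->
  cRe (cyl (k + 1) E%:C * conjc (cyl k E%:C)) = Num.sqrt (pi / 2) * gamma_fun k * expR (- (E ^+ 2 / 2)).
Proof.
move=> k0; have k1 : 0 < k + 1 by rewrite addr_gt0.
pose Y (r : R) := cyl k r%:C; pose A (r : R) := cyl (k + 1) r%:C.
have dcy j r : 0 < j -> is_cderive (fun r : R => cyl j r%:C) r ('i * cyl (j + 1) r%:C).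
  move=> j0; have := cderive_cyl 0 1 r j0; rewrite mulr1 add0r mulr1.
  by apply: eq_cderive => q; rewrite add0r mulr1.
have dY r := dcy k r k0; have dA := fun r => dcy (k + 1) r k1.
have AA r : cyl (k + 1 + 1) r%:C = k%:C * Y r + 'i * r%:C * A r.
  have := cyl_parts r%:C k0; rewrite addrA => /eqP; rewrite subr_eq0 => /eqP ->.
  by congr (cyl _ _); ring.
pose f (r : R) := cRe (A r) * cRe (Y r) + cIm (A r) * cIm (Y r).
have df (r : R) : is_derive r 1 f (- r * f r).
  have [y1 y2] := dY r; have [a1 a2] := dA r.
  apply: (rderive_eq (rderiveD (rderiveM a1 y1) (rderiveM a2 y2))).
  rewrite AA -/(A r) -/(Y r) /f !(cReiM, cImiM) !(cReD, cImD).
  rewrite -mulrA !(cReiM, cImiM) !(cReM, cImM) !(cReC, cImC); ring.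
pose g (r : R) := f r * expR (r ^+ 2 / 2).
have dg (r : R) : is_derive r 1 g 0.
  have d2 : is_derive r 1 (fun s : R => expR (s ^+ 2 / 2)) (r * expR (r ^+ 2 / 2)).
    have -> : (fun s : R => expR (s ^+ 2 / 2)) = fun s => expR (2^-1 * s ^+ 2).
      by apply/funext => s; rewrite mulrC.
    apply: (rderive_eq (rderive_comp (is_derive_expR _) (rderiveZ 2^-1 (rderive_sqr (rderive_id r))))).
    by rewrite [r ^+ 2 / 2]mulrC; field.
  by apply: (rderive_eq (rderiveM (df r) d2)); ring.
have gE : g E = g 0 by apply: is_derive_0_is_cst.
have fE : f E = g 0 * expR (- (E ^+ 2 / 2)).
  by rewrite -gE /g -mulrA -expRD subrr expR0 mulr1.
transitivity (f E); first by rewrite cReM cReJ cImJ mulrN opprK.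
rewrite fE /g /f /A /Y !cyl0E !(cReC, cImC) mulr0 addr0 expr0n/= mul0r expR0 mulr1 mulrC.
by rewrite [gmom (k + 1) * _]mulrC duplication// mulrC.
Qed.

Lemma cyl_real_neq0 (k E : R) : 0 < k -> cyl k E%:C != 0.
Proof.
move=> k0; apply/eqP => Y0; have := wronskian E k0.
have c0 : cRe (0 : R[i]) = 0 by []; have c1 : cIm (0 : R[i]) = 0 by [].
rewrite Y0 cReM cReJ cImJ c0 c1 oppr0 !mulr0 subrr => /esym/eqP.
by rewrite gt_eqF// !mulr_gt0 ?expR_gt0 ?gamma_fun_gt0// sqrtr_gt0 divr_gt0 ?pi_gt0.
Qed.

Lemma fhatE (k E : R) : fhat k E = (Num.sqrt (k / gamma_fun k))%:C * cyl k E%:C.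
Proof.
rewrite /fhat; congr (_ * _).
have fE : (fun t : R => (t `^ (k - 1))%:C * expC ((- (t ^+ 2 / 2))%:C + 'i * (E * t)%:C)) = cylf k E%:C.
  by apply/funext => t; rewrite /cylf /gwave CM; congr (_ * expC (_ + _)); ring.
rewrite fE /Cintegral /cyl; have [m1 m2] := cmeas_cylf k E%:C.
by apply: complexP; rewrite ?(Re_cint, Im_cint) Rintegral_hl.
Qed.

(** Multiply numerator and denominator by the conjugate of [cyl k E]; the numerator is then
    given by [wronskian]. *)
Lemma pi_mubar (k E : R) : 0 < k ->
  pi * mubar k E = cIm ('i * (cyl (k + 1) E%:C / (k%:C * cyl k E%:C))).
Proof.
move=> k0; have Y0 := cyl_real_neq0 E k0; have G0 := gamma_fun_gt0 k0.
have aY : 0 < cabs (cyl k E%:C) by rewrite cabs_gt0.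
have -> : cyl (k + 1) E%:C / (k%:C * cyl k E%:C) =
    ((k * cabs (cyl k E%:C) ^+ 2)^-1)%:C * (cyl (k + 1) E%:C * conjc (cyl k E%:C)).
  rewrite CV CM -mulJ; field.
  have Yc0 : conjc (cyl k E%:C) != 0 by rewrite -cabs_eq0 cabsJ cabs_eq0.
  by apply/and3P; split => //; rewrite C_eq0 gt_eqF.
rewrite cImiM cReM cReC cImC mul0r subr0 wronskian// /mubar fhatE.
rewrite cabsM cabsC ger0_norm ?sqrtr_ge0// exprMn sqr_sqrtr ?divr_ge0 ?ltW//.
have c0 : 0 < Num.sqrt (pi / 2) :> R by rewrite sqrtr_gt0 divr_gt0 ?pi_gt0.
have e1 : Num.sqrt (2 * pi) = 2 * Num.sqrt (pi / 2) :> R.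
  have -> : 2 * pi = 2 ^+ 2 * (pi / 2) :> R by field.
  by rewrite sqrtrM ?sqr_ge0// sqrtr_sqr ger0_norm.
have e2 : pi = 2 * Num.sqrt (pi / 2) ^+ 2 :> R.
  by rewrite sqr_sqrtr ?divr_ge0 ?pi_ge0//; field.
rewrite e1 [X in X * _ = _]e2; field.
by rewrite !gt_eqF.
Qed.

Lemma cabs_cyl_le (lo hi M k : R) w : 0 < lo -> lo <= k <= hi -> - M <= cIm w ->
  cabs (cyl k w) <= \int[hl]_s cyl_dom lo hi M s.
Proof.
move=> lo0 kk Mw; have /andP[k1 k2] := kk.
have k0 : 0 < k := lt_le_trans lo0 k1.
have hi0 : 0 < hi := lt_le_trans k0 k2.
have ci := cintegrable_cylf w k0.
rewrite (le_trans (cabs_cint ci))//; apply: le_Rintegral_hl.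
- exact: cintegrable_cabs.
- exact: integrable_cyl_dom.
- by move=> s s0; exact: cabs_cylf_le.
Qed.

Lemma cabs_cylB_le (lo hi M k t : R) w : 0 < lo -> lo <= k <= hi -> - M <= cIm w -> 0 <= t ->
  cabs (cyl k (w + t%:C * 'i) - cyl k w) <= t * \int[hl]_s cyl_dom (lo + 1) (hi + 1) M s.
Proof.
move=> lo0 kk Mw t0; have /andP[k1 k2] := kk.
have k0 : 0 < k := lt_le_trans lo0 k1.
have hi0 : 0 < hi := lt_le_trans k0 k2.
have ci := cintegrableB (cintegrable_cylf (w + t%:C * 'i) k0) (cintegrable_cylf w k0).
have di : hl.-integrable setT (fun s => (cyl_dom (lo + 1) (hi + 1) M s)%:E).
  by apply: integrable_cyl_dom; rewrite addr_gt0.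
rewrite -cintB; [|exact: cintegrable_cylf..].
rewrite -RintegralZl// (le_trans (cabs_cint ci))//; apply: le_Rintegral_hl.
- exact: cintegrable_cabs.
- by under eq_fun do rewrite EFinM; exact: integrableZl.
move=> s s0.
have -> : cylf k (w + t%:C * 'i) s - cylf k w s = cylf k w s * (expC (- (s * t)%:C) - expC 0).
  have eA : gwave (w + t%:C * 'i) s = gwave w s * expC (- (s * t)%:C).
    rewrite /gwave -expCD; congr expC; rewrite CM.
    have ii : 'i * 'i = -1 :> R[i] by rewrite -expr2 sqr_i.
    by ring: ii.
  by rewrite /cylf eA expC0; ring.
have h1 : cabs (expC (- (s * t)%:C) - expC 0) <= s * t.
  rewrite (le_trans (cabs_expCB _ _)) ?cReN ?cReC ?oppr_le0 ?mulr_ge0 ?(ltW s0)//.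
  by rewrite subr0 cabsN cabsC ger0_norm// mulr_ge0 ?(ltW s0).
have h2 : s * cabs (cylf k w s) <= cyl_dom (lo + 1) (hi + 1) M s.
  have := @cabs_cylf_le R (lo + 1) (hi + 1) M (k + 1) s w s0; rewrite !lerD2r kk => /(_ isT Mw).
  have -> : cylf (k + 1) w s = s%:C * cylf k w s.
    by rewrite /cylf addrK (powR_predM k s0) CM; ring.
  by rewrite cabsM cabsC ger0_norm// ltW.
rewrite cabsM (le_trans (ler_wpM2l (cabs_ge0 _) h1))//.
have -> : cabs (cylf k w s) * (s * t) = t * (s * cabs (cylf k w s)) by ring.
by rewrite ler_wpM2l.
Qed.

(** By [cyl_parts] the integrand is, up to the factor [- k], the derivative of
    [gwave z t * cyl (k + 1) (z + t%:C * 'i)]. *)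
Lemma integral_stationary (k : R) z : 0 < k -> 0 <= cIm z ->
  cintegrable hl (fun t => gwave z t * cyl k (z + t%:C * 'i)) /\
  cint hl (fun t => gwave z t * cyl k (z + t%:C * 'i)) = cyl (k + 1) z / k%:C.
Proof.
move=> k0 z0; have k1 : 0 < k + 1 by rewrite addr_gt0.
have kC : k%:C != 0 :> R[i] by rewrite C_eq0 gt_eqF.
have dF j t : 0 < j -> is_cderive (fun t : R => gwave z t * cyl j (z + t%:C * 'i)) t
    (('i * z - t%:C) * gwave z t * cyl j (z + t%:C * 'i) -
     gwave z t * cyl (j + 1) (z + t%:C * 'i)).
  move=> j0; apply: (cderive_eq (cderiveM (cderive_gwave z t) (cderive_cyl z 'i t j0))).
  by rewrite -[in 'i * 'i * _]expr2 sqr_i; ring.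
have mcyl j : 0 < j -> cmeas (fun t : R => cyl j (z + t%:C * 'i)).
  move=> j0; have d t := cderive_cyl z 'i t j0.
  by split; apply: continuous_measurable_fun => t; have [d1 d2] := d t;
    [exact: (is_derive_continuous d1)|exact: (is_derive_continuous d2)].
have bd j (t : R) : 0 < j -> 0 < t -> cabs (gwave z t * cyl j (z + t%:C * 'i)) <=
    expR (2^-1) * \int[hl]_s cyl_dom j j 0 s * expR (- (1 * t)).
  move=> j0 t0; rewrite cabsM mulrAC ler_pM ?cabs_ge0//.
    rewrite (le_trans (@cabs_gwave_le _ 0 z t t0 _)) ?oppr0//.
    by rewrite add0r expr1n mul1r.
  apply: cabs_cyl_le => //; first by rewrite lexx.
  rewrite oppr0 cImD cImM cReC cImC cImi mulr1 mul0r addr0 addr_ge0 ?(ltW t0)//.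
have ci j : 0 < j -> cintegrable hl (fun t => gwave z t * cyl j (z + t%:C * 'i)).
  move=> j0; have [i1 _] := @integrable_expRN R 1 ltr01.
  apply: (@le_cintegrable_hl _ _ (fun t => expR (2^-1) * \int[hl]_s cyl_dom j j 0 s * expR (- (1 * t)))).
  - by apply: cmeasM; [exact: cmeas_gwave|exact: mcyl].
  - by under eq_fun do rewrite EFinM; exact: integrableZl.
  - by move=> t t0; exact: bd.
split; first exact: ci.
pose F (t : R) := - (k%:C)^-1 * (gwave z t * cyl (k + 1) (z + t%:C * 'i)).
have dF' t : is_cderive F t (gwave z t * cyl k (z + t%:C * 'i)).
  apply: (cderive_eq (cderiveZ _ (dF (k + 1) t k1))).
  have := cyl_parts (z + t%:C * 'i) k0; rewrite -addrA.
  have -> : k + 2 = k + (1 + 1) by ring.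
  set X := cyl k _; set Y := cyl (k + 1) _; set W := cyl _ _ => h.
  have -> : W = k%:C * X + 'i * (z + t%:C * 'i) * Y.
    by apply/esym/eqP; rewrite -subr_eq0 -[X in _ == X]h; apply/eqP; ring.
  have ii : 'i * 'i = -1 :> R[i] by rewrite -expr2 sqr_i.
  field: ii.
  done.
have F0 : F 0 = - (cyl (k + 1) z / k%:C).
  have g0 : gwave z 0 = 1 by rewrite /gwave expr0n/= mul0r oppr0 mul0r addr0 expC0.
  by rewrite /F g0 mul0r addr0 mul1r; ring.
rewrite (_ : cyl (k + 1) z / k%:C = 0 - F 0); last by rewrite F0 opprK add0r.
apply: (@cFTC0y _ _ F).
- exact: ci.
- by move=> t _; exact: dF'.
- by move=> t _; eexists; exact: dF.
- by apply: cvg_at_right_filter; exact: (cderive_continuous (dF' 0)).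
- apply: (@cvg0_le _ _ _ _ _ (fun t => cabs (k%:C)^-1 *
    (expR (2^-1) * \int[hl]_s cyl_dom (k + 1) (k + 1) 0 s) * expR (- (1 * t)))); last first.
    by apply: cvgM0; exact: cvg_expRN.
  near=> t; have t0 : 0 < t by near: t; exact: nbhs_pinfty_gt.
  rewrite subr0 ger0_norm ?cabs_ge0// /F cabsM cabsN -mulrA ler_wpM2l ?cabs_ge0//.
  exact: bd.
Unshelve. all: by end_near. Qed.

Lemma Lap_wave (k : R) (v : R[i]) (t : R) : Lap k (- 'i * v + t%:C) =
  cint hl (fun s => (s `^ (k - 1))%:C * (wave s v * (expR (- (t * s)))%:C)).
Proof.
apply: eq_cint => s; congr (_ * _); rewrite waveE.
have -> : (expR (- (t * s)))%:C = expC (- (t * s)%:C).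
  by apply: complexP; rewrite !(Re_expC, Im_expC) !(cReN, cImN, cReC, cImC) oppr0 ?cos0 ?sin0 ?mulr1 ?mulr0.
by rewrite -expCD CM; congr expC; ring.
Qed.

Lemma integrable_gau_cst (c : R) : gau.-integrable setT (fun=> c%:E).
Proof.
apply: (@integrable_gau_linear _ _ `|c|) => // x.
by rewrite ler_peMr// lerDl.
Qed.

Lemma eq_cintegrable d (T : measurableType d) (mu : {measure set T -> \bar R}) (f g : T -> R[i]) :
  (forall x, f x = g x) -> cintegrable mu f -> cintegrable mu g.
Proof. by move=> fg; have -> : f = g by exact/funext. Qed.

(** Exchanging the two integrals, the Gaussian average of a wave along the line through [z]
    is [gwave]. *)
Lemma gau_Lap (k t1 t2 : R) z : 0 < k -> 0 < cIm z -> 0 <= t1 -> 0 <= t2 ->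
  cint gau (fun x => Lap k (- 'i * (z - x%:C) + t1%:C) * wave t2 (z - x%:C)) =
  gwave z t2 * cyl k (z + (t1 + t2)%:C * 'i).
Proof.
move=> k0 z0 t10 t20; set y := cIm z in z0.
pose f (p : measurableTypeR R * measurableTypeR R) : R[i] :=
  (p.2 `^ (k - 1))%:C * (wave p.2 (z - p.1%:C) * (expR (- (t1 * p.2)))%:C) * wave t2 (z - p.1%:C).
have m1 : measurable_fun setT (fun p : measurableTypeR R * measurableTypeR R => p.1) by exact: measurable_fst.
have m2 : measurable_fun setT (fun p : measurableTypeR R * measurableTypeR R => p.2) by exact: measurable_snd.
have mz : cmeas (fun p : measurableTypeR R * measurableTypeR R => z - p.1%:C).
  by apply: cmeasB; [exact: cmeas_cst|exact: cmeasC].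
have mf : cmeas f.
  apply: cmeasM; last by apply: cmeas_wave2 => //; exact: measurable_cst.
  apply: cmeasM; first by apply: cmeasC; exact: (measurableT_comp (measurable_powRl (k - 1)) m2).
  apply: cmeasM; first exact: cmeas_wave2.
  by apply: cmeasC; exact: (measurableT_comp (measurable_expRN t1) m2).
have y1 : 0 < y + t1 by rewrite ltr_wpDr.
have fE p : cabs (f p) = expR (- (y * t2)) * (p.2 `^ (k - 1) * expR (- ((y + t1) * p.2))).
  have Iz : cIm (z - p.1%:C) = y by rewrite cImB cImC subr0.
  rewrite /f !cabsM !cabs_wave Iz !cabsC !ger0_norm ?powR_ge0 ?expR_ge0//.
  have -> : expR (- ((y + t1) * p.2)) = expR (- (y * p.2)) * expR (- (t1 * p.2)).
    by rewrite -expRD; congr expR; ring.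
  ring.
have fi : cintegrable (gau \x hl)%E f.
  apply: (@cintegrable_prod _ _ _ _ _ _ _ f (fun=> expR (- (y * t2))) (fun s => s `^ (k - 1) * expR (- ((y + t1) * s)))) => //.
  - by move=> s; rewrite mulr_ge0 ?powR_ge0 ?expR_ge0.
  - exact: integrable_gau_cst.
  - exact: integrable_powexp.
  - by move=> x s; rewrite fE.
transitivity (cint gau (fun x => cint hl (fun s => f (x, s)))).
  apply: eq_cint => x; rewrite Lap_wave -cintZr//.
  have c1 : 0 < cRe (- 'i * (z - x%:C) + t1%:C).
    by rewrite cReD cReC cReNiM cImB cImC subr0.
  have := cintegrable_powexp k0 c1; apply: eq_cintegrable => s; congr (_ * _).
  rewrite waveE; have -> : (expR (- (t1 * s)))%:C = expC (- (t1 * s)%:C).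
    by apply: complexP; rewrite !(Re_expC, Im_expC) !(cReN, cImN, cReC, cImC) oppr0 ?cos0 ?sin0 ?mulr1 ?mulr0.
  by rewrite -expCD CM; congr expC; ring.
rewrite cint_fubini// /cyl -cintZl; last exact: cintegrable_cylf.
apply: eq_cint_hl.
- exact: cmeas_cint2.
- by apply: cmeasM; [exact: cmeas_cst|exact: cmeas_cylf].
move=> s s0; have st0 : 0 <= s + t2 by rewrite addr_ge0 ?(ltW s0).
pose c : R[i] := (s `^ (k - 1))%:C * ((expR (- (t1 * s)))%:C * wave (s + t2) z).
transitivity (c * cint gau (fun x => expC (x%:C * (- 'i * (s + t2)%:C)))).
  rewrite -cintZl; last first.
    apply: (@cintegrable_gau _ _ 1); first exact: cmeas_expi.
    by move=> x; rewrite cabs_expim mul1r lerDl.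
  apply: eq_cint => x; rewrite /f /c /=.
  have eW : wave (s + t2) z * expC (x%:C * (- 'i * (s + t2)%:C)) = wave s (z - x%:C) * wave t2 (z - x%:C).
    by rewrite !waveE -!expCD CD; congr expC; ring.
  transitivity ((s `^ (k - 1))%:C * (expR (- (t1 * s)))%:C * (wave s (z - x%:C) * wave t2 (z - x%:C))).
    ring.
  by rewrite -eW; ring.
rewrite gau_char// /c /cylf.
have eR x : (expR x)%:C = expC x%:C :> R[i].
  by apply: complexP; rewrite !(Re_expC, Im_expC) !(cReC, cImC) ?cos0 ?sin0 ?mulr1 ?mulr0.
rewrite !eR waveE /gwave.
transitivity ((s `^ (k - 1))%:C * (expC (- (t1 * s))%:C * expC ((s + t2)%:C * ('i * z)) * expC (- ((s + t2) ^+ 2 / 2))%:C)).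
  ring.
rewrite -!expCD [RHS]mulrCA -expCD; congr (_ * expC _).
have ii : 'i * 'i = -1 :> R[i] by rewrite -expr2 sqr_i.
have -> : - ((s + t2) ^+ 2 / 2) = - (s ^+ 2 / 2) - s * t2 - t2 ^+ 2 / 2 by field.
rewrite !(CD, CN, CM).
ring: ii.
Qed.

End stationary.

(** * Distance to the stationary solution *)

Section gamma_integrals.
Context {R : realType}.
Local Notation hl := (@hl R).
Local Notation gam := (@gam R).

Lemma integrable_gam_bounded (k C : R) (f : R -> R) : 0 < k -> measurable_fun setT f ->
  (forall x : R, 0 < x -> `|f x| <= C) -> (gam k).-integrable setT (fun x => (f x)%:E).
Proof.
move=> k0 mf fC; apply: (@integrable_gam_linear _ _ _ C) => // x x0.
have C0 : 0 <= C := le_trans (normr_ge0 _) (fC x x0).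
by rewrite (le_trans (fC x x0))// ler_mul1D// ltW.
Qed.

Lemma eq_cint_gam (k C : R) (f g : R -> R[i]) : 0 < k -> cmeas f -> cmeas g ->
  (forall x : R, 0 < x -> cabs (f x) <= C) -> (forall x : R, 0 < x -> f x = g x) ->
  cint (gam k) f = cint (gam k) g.
Proof.
move=> k0 [f1 f2] [g1 g2] fC fg.
have gC x : 0 < x -> cabs (g x) <= C by move=> x0; rewrite -fg// fC.
apply: complexP; rewrite ?(Re_cint, Im_cint).
  apply: eq_Rintegral_gam => //; last by move=> x x0; rewrite fg.
    by apply: (@integrable_gam_bounded _ C) => // x x0; rewrite (le_trans (Re_cabs _))// fC.
  by apply: (@integrable_gam_bounded _ C) => // x x0; rewrite (le_trans (Re_cabs _))// gC.
apply: eq_Rintegral_gam => //; last by move=> x x0; rewrite fg.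
  by apply: (@integrable_gam_bounded _ C) => // x x0; rewrite (le_trans (Im_cabs _))// fC.
by apply: (@integrable_gam_bounded _ C) => // x x0; rewrite (le_trans (Im_cabs _))// gC.
Qed.

Lemma gam_fubini d (X : measurableType d) (m : {sigma_finite_measure set X -> \bar R})
    (k : R) (F : measurableTypeR R * X -> R[i]) (q : X -> R) : 0 < k -> cmeas F ->
  (forall x, 0 <= q x) -> m.-integrable setT (fun x => (q x)%:E) ->
  (forall (g : R) x, 0 < g -> cabs (F (g, x)) <= q x) ->
  cint (gam k) (fun g => cint m (fun x => F (g, x))) =
  cint m (fun x => cint (gam k) (fun g => F (g, x))).
Proof.
move=> k0 mF q0 iq Fq.
pose F' (p : measurableTypeR R * X) : R[i] := (posind p.1)%:C * F p.
have mF' : cmeas F'.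
  apply: cmeasM => //; apply: cmeasC.
  exact: (measurableT_comp (measurable_posind) measurable_fst).
have F'q g x : cabs (F' (g, x)) <= 1 * q x.
  rewrite /F' cabsM cabsC ger0_norm ?posind_ge0// /posind.
  by case: (ltP 0 g) => g0; rewrite ?mul1r ?mul0r ?Fq.
have F'E g x : 0 < g -> F' (g, x) = F (g, x) by move=> g0; rewrite /F' /posind g0 mul1r.
have iF' : cintegrable (gam k \x m)%E F'.
  apply: (@cintegrable_prod _ _ _ _ _ _ _ F' (fun=> 1) q) => //.
  by apply: (@integrable_gam_bounded _ 1) => // x _; rewrite normr1.
have mi (G : measurableTypeR R * X -> R[i]) : cmeas G -> cmeas (fun g => cint m (fun x => G (g, x))).
  exact: cmeas_cint1.
transitivity (cint (gam k) (fun g => cint m (fun x => F' (g, x)))).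
  apply: (@eq_cint_gam _ (\int[m]_x q x)) => //; [exact: mi|exact: mi| |].
    move=> g g0; have ci : cintegrable m (fun x => F (g, x)).
      apply: (le_cintegrable _ iq) => [|x]; last exact: Fq.
      exact: (cmeas_comp (u := fun x : X => (g : measurableTypeR R, x)) mF (pair1_measurable g)).
    rewrite (le_trans (cabs_cint ci))//; apply: le_Rintegral => //.
      exact: cintegrable_cabs.
    by move=> x _; exact: Fq.
  by move=> g g0; apply: eq_cint => x; rewrite F'E.
rewrite cint_fubini//; apply: eq_cint => x.
have ms (G : measurableTypeR R * X -> R[i]) : cmeas G -> cmeas (fun g => G (g, x)).
  by move=> mG; exact: (cmeas_comp (u := fun g : measurableTypeR R => (g, x)) mG (pair2_measurable x)).
apply: (@eq_cint_gam _ (q x)) => //; [exact: ms|exact: ms| |].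
  by move=> g g0; rewrite F'E// Fq.
by move=> g g0; rewrite F'E.
Qed.

Lemma Im_Ninv (g : R) (v : R[i]) : 0 <= g -> 0 < cIm v -> 0 <= cIm (- (g%:C / v)).
Proof.
move=> g0 v0; rewrite cImN cImM cReC cImC mul0r addr0 cImV mulNr mulrN opprK.
by rewrite !mulr_ge0 ?invr_ge0 ?sqr_ge0 ?(ltW v0).
Qed.

Lemma cint_gam_wave (k t : R) (v : R[i]) : 0 < k -> 0 < cIm v -> 0 <= t ->
  cint (gam k) (fun g => wave t (- (g%:C / v))) = Lap k (1 + t%:C * ('i / v)) / (gamma_fun k)%:C.
Proof.
move=> k0 v0 t0.
have mw : cmeas (fun g : R => wave t (- (g%:C / v))).
  apply: cmeas_wave2; first exact: measurable_cst.
  by apply: cmeasN; apply: cmeasM; [exact: cmeas_id|exact: cmeas_cst].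
have wb (g : R) : 0 < g -> cabs (wave t (- (g%:C / v))) <= 1.
  by move=> g0; rewrite cabs_wave_le1// Im_Ninv// ltW.
have [m1 m2] := mw.
have LE (x : R) : (x `^ (k - 1))%:C * expC (x%:C * - (1 + t%:C * ('i / v))) =
    wave t (- (x%:C / v)) * (powexp k x)%:C.
  rewrite waveE /powexp CM.
  have -> : (expR (- x))%:C = expC (- x%:C).
    by apply: complexP; rewrite !(Re_expC, Im_expC) !(cReN, cImN, cReC, cImC) oppr0 ?cos0 ?sin0 ?mulr1 ?mulr0.
  transitivity ((x `^ (k - 1))%:C * (expC (t%:C * ('i * - (x%:C / v))) * expC (- x%:C))); last ring.
  by rewrite -expCD; congr (_ * expC _); ring.
rewrite -CV; apply: complexP.
  rewrite Re_cint cReM cReC cImC mulr0 subr0 Rintegral_gam//; last first.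
    by apply: (@integrable_gam_bounded _ 1) => // x x0; rewrite (le_trans (Re_cabs _))// wb.
  congr (_ / _); rewrite /Lap Re_cint; apply: eq_Rintegral => x _.
  by rewrite LE cReM cReC cImC mulr0 subr0.
rewrite Im_cint cImM cReC cImC mulr0 add0r Rintegral_gam//; last first.
  by apply: (@integrable_gam_bounded _ 1) => // x x0; rewrite (le_trans (Im_cabs _))// wb.
congr (_ / _); rewrite /Lap Im_cint; apply: eq_Rintegral => x _.
by rewrite LE cImM cReC cImC mulr0 add0r.
Qed.

End gamma_integrals.

Section product_with_gaussian.
Context {R : realType} {d : measure_display} {T : measurableType d} (P : probability T R).

Let PT : P setT = 1%E := probability_setT P.

Lemma prod_gau_sigma_finite : sigma_finite setT (P \x @gau R)%E.
Proof.
exists (fun=> setT); first by rewrite bigcup_const//; exists 0%N.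
move=> _; split => //; rewrite -setXTT product_measure1E//.
rewrite (_ : (_ * _)%E = 1%E) ?ltry//.
by rewrite gau_setT mule1; exact: PT.
Qed.

Definition prod_gau : {sigma_finite_measure set (T * measurableTypeR R)%type -> \bar R} :=
  HB.pack (P \x @gau R)%E (Measure_isSigmaFinite.Build _ _ _ (P \x @gau R)%E prod_gau_sigma_finite).

Lemma cint_prod_gau (F : T * measurableTypeR R -> R[i]) : cintegrable prod_gau F ->
  cint prod_gau F = cint (@gau R) (fun x => cint P (fun w => F (w, x))).
Proof.
move=> Fi; apply: complexP; rewrite !(Re_cint, Im_cint).
  under [RHS]eq_Rintegral do rewrite Re_cint.
  exact: (Rintegral_prod (cintegrable_Re Fi)).
under [RHS]eq_Rintegral do rewrite Im_cint.
exact: (Rintegral_prod (cintegrable_Im Fi)).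
Qed.

End product_with_gaussian.

Lemma cintegrable_prob {R : realType} d (T : measurableType d) (P : probability T R)
    (f : T -> R[i]) (C : R) : cmeas f -> (forall w, cabs (f w) <= C) -> cintegrable P f.
Proof.
move=> mf fC; apply: (le_cintegrable mf _ fC).
exact: (@finite_measure_integrable_cst _ _ _ P setT C).
Qed.

Lemma cabs_cint_prob {R : realType} d (T : measurableType d) (P : probability T R)
    (f : T -> R[i]) (C : R) : cmeas f -> (forall w, cabs (f w) <= C) -> cabs (cint P f) <= C.
Proof.
move=> mf fC; have ci := cintegrable_prob P mf fC.
rewrite (le_trans (cabs_cint ci))//.
have iC : P.-integrable setT (fun=> C%:E) by exact: (@finite_measure_integrable_cst _ _ _ P setT C).
have -> : C = \int[P]_w C.
  have PT : P setT = 1%E by exact: probability_setT.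
  by rewrite /Rintegral integral_cst// (etrans (congr1 _ PT) (mule1 _)).
by apply: le_Rintegral => //; exact: cintegrable_cabs.
Qed.

Section one_step.
Context {R : realType} {d : measure_display} {Om : measurableType d} (P : probability Om R).
Variables (u : Om -> R[i]) (z : R[i]) (k : R).
Local Notation hl := (@hl R).
Local Notation gam := (@gam R).
Hypothesis z0 : 0 < cIm z.
Hypothesis mu : cmeas u.
Hypothesis uz : forall w, cIm z <= cIm (u w).
Hypothesis iu : P.-integrable setT (fun w => (cabs (u w))%:E).
Hypothesis k0 : 0 < k.
Hypothesis Y0 : cyl k z != 0.

Definition chf (t : R) : R[i] := cint P (fun w => wave t (u w)).
Definition ghf (t : R) : R[i] := cint (gam k) (fun g => cint P (fun w => wave t (- (g%:C / u w)))).
(** What [ghf] becomes when the law of [u] is replaced by the stationary complex measure,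
    of density [rho] on the line through [z]. *)
Definition stat (t : R) : R[i] := cyl k (z + t%:C * 'i) / cyl k z.

Let X : measurableType _ := (Om * measurableTypeR R)%type.
(** The density, with respect to the Gaussian law of [x], of the stationary complex measure
    at the point [z - x]. *)
Let rho (x : R) : R[i] := Lap k (- 'i * (z - x%:C)) / cyl k z.
Let c (p : Om * measurableTypeR R) : R[i] := rho p.2.
Let u' (p : Om * measurableTypeR R) : R[i] := u p.1.
Let v' (p : Om * measurableTypeR R) : R[i] := z - p.2%:C.

Let m1 : measurable_fun setT (fun p : Om * measurableTypeR R => p.1).
Proof. exact: measurable_fst. Qed.

Let m2 : measurable_fun setT (fun p : Om * measurableTypeR R => p.2).
Proof. exact: measurable_snd. Qed.

Let mLap (t : R) : cmeas (fun x : R => Lap k (- 'i * (z - x%:C) + t%:C)).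
Proof.
apply: (@cmeas_cint1 _ _ _ _ _ hl (fun p : measurableTypeR R * measurableTypeR R =>
  (p.2 `^ (k - 1))%:C * expC (p.2%:C * - (- 'i * (z - p.1%:C) + t%:C)))).
have n1 : measurable_fun setT (fun p : measurableTypeR R * measurableTypeR R => p.1) by exact: measurable_fst.
have n2 : measurable_fun setT (fun p : measurableTypeR R * measurableTypeR R => p.2) by exact: measurable_snd.
apply: cmeasM; first by apply: cmeasC; exact: (measurableT_comp (measurable_powRl (k - 1)) n2).
apply: cmeas_expC; apply: cmeasM; first exact: cmeasC.
apply: cmeasN; apply: cmeasD; last exact: cmeas_cst.
apply: cmeasM; first exact: cmeas_cst.
by apply: cmeasB; [exact: cmeas_cst|exact: cmeasC].
Qed.

Let mrho : cmeas rho.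
Proof.
apply: cmeasM; last exact: cmeas_cst.
by have := mLap 0; under eq_fun do rewrite addr0.
Qed.

Let Iv (x : R) : cIm (z - x%:C) = cIm z.
Proof. by rewrite cImB cImC subr0. Qed.

Let BL (t : R) := \int[hl]_s (s `^ (k - 1) * expR (- ((cIm z + t) * s))).

Let Lap_le (t x : R) : 0 <= t -> cabs (Lap k (- 'i * (z - x%:C) + t%:C)) <= BL t.
Proof.
move=> t0; have e : cRe (- 'i * (z - x%:C) + t%:C) = cIm z + t by rewrite cReD cReNiM Iv cReC.
have c1 : 0 < cRe (- 'i * (z - x%:C) + t%:C) by rewrite e ltr_wpDr.
rewrite (le_trans (cabs_cint (cintegrable_powexp k0 c1)))// le_eqVlt; apply/orP; left; apply/eqP.
by apply: eq_Rintegral => s _; rewrite cabs_powexp e.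
Qed.

Let B := BL 0 / cabs (cyl k z).

Let rho_le x : cabs (rho x) <= B.
Proof.
rewrite /rho cabsM cabsV ler_wpM2r ?invr_ge0 ?cabs_ge0//.
by have := @Lap_le 0 x (lexx _); rewrite addr0.
Qed.

Let B0 : 0 <= B. Proof. exact: le_trans (cabs_ge0 _) (rho_le 0). Qed.

Let mc : cmeas c.
Proof. exact: (cmeas_comp (u := fun p : Om * measurableTypeR R => p.2) mrho m2). Qed.

Let mu' : cmeas u'.
Proof. exact: (cmeas_comp (u := fun p : Om * measurableTypeR R => p.1) mu m1). Qed.

Let mv' : cmeas v'.
Proof. by apply: cmeasB; [exact: cmeas_cst|exact: cmeasC]. Qed.

Let uy' p : cIm z <= cIm (u' p). Proof. exact: uz. Qed.

Let vy' p : cIm z <= cIm (v' p). Proof. by rewrite /v' Iv. Qed.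

Let iq : (prod_gau P).-integrable setT
  (fun p => (cabs (c p) * (1 + cabs (u' p) + cabs (v' p)))%:E).
Proof.
have i1 : P.-integrable setT (fun w => (1 + cabs (u w))%:E).
  under eq_fun do rewrite EFinD; apply: integrableD => //.
  exact: (@finite_measure_integrable_cst _ _ _ P setT 1).
have h2 (x : R) : 0 <= B * (1 + cabs z + `|x|).
  by apply: mulr_ge0; [exact: B0|rewrite !addr_ge0 ?cabs_ge0].
have i2 : (@gau R).-integrable setT (fun x => (B * (1 + cabs z + `|x|))%:E).
  apply: (@integrable_gau_linear _ _ (B * (1 + cabs z))).
    by apply: measurable_funM => //; apply: measurable_funD => //; exact: measurableT_comp.
  move=> x; rewrite (ger0_norm (h2 x)) -[leRHS]mulrA; apply: ler_wpM2l; first exact: B0.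
  by rewrite mulrDr mulr1 lerD2l ler_peMl// lerDl cabs_ge0.
have := @integrable_prod _ _ _ _ _ P (@gau R) (fun w => 1 + cabs (u w)) (fun x => B * (1 + cabs z + `|x|)).
have h1 w : 0 <= 1 + cabs (u w) by rewrite addr_ge0 ?cabs_ge0.
move=> /(_ h1 h2 i1 i2); apply: le_integrable => //.
  apply/measurable_EFinP; apply: measurable_funM; first exact: measurable_cabs.
  apply: measurable_funD; last exact: measurable_cabs.
  by apply: measurable_funD => //; exact: measurable_cabs.
move=> [w x] _; rewrite /= lee_fin ger0_norm; last by rewrite mulr_ge0 ?addr_ge0 ?cabs_ge0.
rewrite [leRHS]ger0_norm; last by apply: mulr_ge0; [exact: h1|exact: h2].
rewrite [leRHS]mulrCA; apply: ler_pM; rewrite ?addr_ge0 ?cabs_ge0 ?rho_le//.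
have h3 : cabs (v' (w, x)) <= cabs z + `|x| by rewrite (le_trans (cabsB _ _))// cabsC.
have := cabs_ge0 (u w); have := cabs_ge0 z; have := normr_ge0 x.
rewrite /u' /=; nra.
Qed.

Let gau_Lap_div (t1 t2 : R) : 0 <= t1 -> 0 <= t2 ->
  cintegrable (@gau R) (fun x => Lap k (- 'i * (z - x%:C) + t1%:C) / cyl k z * wave t2 (z - x%:C)) /\
  cint (@gau R) (fun x => Lap k (- 'i * (z - x%:C) + t1%:C) / cyl k z * wave t2 (z - x%:C)) =
  gwave z t2 * stat (t1 + t2).
Proof.
move=> t10 t20.
have mw : cmeas (fun x : R => wave t2 (z - x%:C)).
  apply: cmeas_wave2; first exact: measurable_cst.
  by apply: cmeasB; [exact: cmeas_cst|exact: cmeas_id].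
have bL : 0 <= BL t1 := le_trans (cabs_ge0 _) (@Lap_le t1 0 t10).
have Li : cintegrable (@gau R) (fun x => Lap k (- 'i * (z - x%:C) + t1%:C) * wave t2 (z - x%:C)).
  apply: (@cintegrable_gau _ _ (BL t1)); first exact: cmeasM.
  move=> x; rewrite cabsM -[leLHS]mulr1 -mulrA ler_pM ?mulr_ge0 ?cabs_ge0 ?Lap_le//.
  rewrite mulr1 (le_trans (cabs_wave_le1 t20 _)) ?Iv ?(ltW z0)//.
  by rewrite lerDl.
have e x : Lap k (- 'i * (z - x%:C) + t1%:C) / cyl k z * wave t2 (z - x%:C) =
    (cyl k z)^-1 * (Lap k (- 'i * (z - x%:C) + t1%:C) * wave t2 (z - x%:C)) by ring.
split; first by apply: eq_cintegrable (cintegrableZl _ Li) => x; rewrite e.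
transitivity (cint (@gau R) (fun x => (cyl k z)^-1 * (Lap k (- 'i * (z - x%:C) + t1%:C) * wave t2 (z - x%:C)))).
  by apply: eq_cint => x; exact: e.
rewrite cintZl// gau_Lap// /stat; ring.
Qed.

Let rho_wave (s : R) : 0 <= s ->
  cintegrable (@gau R) (fun x => rho x * wave s (z - x%:C)) /\
  cint (@gau R) (fun x => rho x * wave s (z - x%:C)) = gwave z s * stat s.
Proof.
move=> s0; have [h1 h2] := gau_Lap_div (lexx 0) s0.
rewrite add0r in h2; rewrite -h2; have e x : rho x = Lap k (- 'i * (z - x%:C) + 0%:C) / cyl k z.
  by rewrite addr0.
split; last by apply: eq_cint => x; rewrite e.
by apply: eq_cintegrable h1 => x; rewrite e.
Qed.

Let gwave0 : gwave z 0 = 1.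
Proof. by rewrite /gwave expr0n/= mul0r oppr0 mul0r addr0 expC0. Qed.

Let stat0 : stat 0 = 1.
Proof. by rewrite /stat mul0r addr0 divff. Qed.

Let rho_total : cintegrable (@gau R) rho /\ cint (@gau R) rho = 1.
Proof.
have [h1 h2] := rho_wave (lexx 0); rewrite gwave0 stat0 mulr1 in h2.
split; first by apply: eq_cintegrable h1 => x; rewrite wave0 mulr1.
by rewrite -[RHS]h2; apply: eq_cint => x; rewrite wave0 mulr1.
Qed.

Let wave_int (f : Om -> R[i]) : cmeas f -> (forall w, cabs (f w) <= 1) -> cintegrable P f.
Proof. by move=> mf f1; exact: (@cintegrable_prob R d Om P f 1 mf f1). Qed.

(** Both factors of the product space integrate out. *)
Let cint_split (f : Om -> R[i]) (h : R -> R[i]) : cmeas f -> cmeas h ->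
  (forall w, cabs (f w) <= 1) -> (forall x, cabs (h x) <= 1) ->
  cint (prod_gau P) (fun p => c p * (f p.1 - 1%:C * h p.2)) =
  cint P f - cint (@gau R) (fun x => rho x * h x).
Proof.
move=> mf mh f1 h1; have [r1 r2] := rho_total.
have fi := wave_int mf f1.
have hi : cintegrable (@gau R) (fun x => rho x * h x).
  apply: (le_cintegrable _ (cintegrable_cabs r1)); first exact: cmeasM.
  by move=> x; rewrite cabsM ler_piMr ?cabs_ge0.
have mp : cmeas (fun p : Om * measurableTypeR R => c p * (f p.1 - 1%:C * h p.2)).
  apply: cmeasM => //; apply: cmeasB.
    exact: (cmeas_comp (u := fun p : Om * measurableTypeR R => p.1) mf m1).
  apply: cmeasM; first exact: cmeas_cst.
  exact: (cmeas_comp (u := fun p : Om * measurableTypeR R => p.2) mh m2).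
rewrite cint_prod_gau; last first.
  apply: (@cintegrable_prod _ _ _ _ _ P (@gau R) _ (fun=> 1) (fun x => 2 * cabs (rho x))) => //.
  - by move=> x; rewrite mulr_ge0 ?cabs_ge0.
  - exact: (@finite_measure_integrable_cst _ _ _ P setT 1).
  - by under eq_fun do rewrite EFinM; apply: integrableZl => //; exact: cintegrable_cabs.
  move=> w x; rewrite mul1r cabsM mulrC ler_wpM2r ?cabs_ge0// mul1r.
  by rewrite (le_trans (cabsB _ _))//=; have := f1 w; have := h1 x; lra.
transitivity (cint (@gau R) (fun x => cint P f * rho x - rho x * h x)).
  apply: eq_cint => x; rewrite /c /=.
  rewrite cintZl; last first.
    apply: (@cintegrable_prob _ _ _ _ _ 2) => [|w].
      by apply: cmeasB => //; exact: cmeas_cst.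
    by rewrite mul1r (le_trans (cabsB _ _))//; have := f1 w; have := h1 x; lra.
  rewrite cintB//; last by apply: (@cintegrable_prob _ _ _ _ _ 1) => [|w]; [exact: cmeas_cst|rewrite mul1r].
  have -> : cint P (fun=> 1%:C * h x) = h x.
    rewrite -[RHS]mulr1 -(cint1 (probability_setT P)) -cintZl.
      by apply: eq_cint => w; rewrite mul1r mulr1.
    by apply: (@cintegrable_prob _ _ _ _ _ 1) => [|w]; [exact: cmeas_cst|rewrite cabs1].
  ring.
by rewrite cintB ?cintZl// ?r2 ?mulr1//; exact: cintegrableZl.
Qed.

Let u0 w : 0 < cIm (u w). Proof. exact: lt_le_trans (uz w). Qed.

Lemma wtr_stat (s : R) : 0 < s ->
  wtr (prod_gau P) c u' v' 1 s = chf s - gwave z s * stat s.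
Proof.
move=> s0; have [_ h2] := rho_wave (ltW s0); rewrite -h2.
apply: (@cint_split (fun w => wave s (u w)) (fun x => wave s (z - x%:C))).
- by apply: cmeas_wave2 => //; exact: measurable_cst.
- apply: cmeas_wave2; first exact: measurable_cst.
  by apply: cmeasB; [exact: cmeas_cst|exact: cmeas_id].
- by move=> w; rewrite cabs_wave_le1 ?(ltW s0) ?(ltW (u0 w)).
- by move=> x; rewrite cabs_wave_le1 ?(ltW s0)// Iv ltW.
Qed.

(** The stationary measure reproduces itself because of [Lap_scale]: averaging its wave at
    [- g / (z - x)] over [g] only adds [t] to the argument of [Lap]. *)
Lemma gtr_stat (t : R) : 0 < t -> gtr (prod_gau P) c u' v' k 1 t = ghf t - stat t.
Proof.
move=> t0; rewrite /gtr; have [r1 r2] := rho_total.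
have mwu : cmeas (fun p : measurableTypeR R * Om => wave t (- (p.1%:C / u p.2))).
  apply: cmeas_wave2; first exact: measurable_cst.
  apply: cmeasN; apply: cmeasM; first by apply: cmeasC; exact: measurable_fst.
  by apply: cmeasV; exact: (cmeas_comp (u := fun p : measurableTypeR R * Om => p.2) mu measurable_snd).
have mwv : cmeas (fun p : measurableTypeR R * measurableTypeR R => rho p.2 * wave t (- (p.1%:C / (z - p.2%:C)))).
  have n1 : measurable_fun setT (fun p : measurableTypeR R * measurableTypeR R => p.1) by exact: measurable_fst.
  have n2 : measurable_fun setT (fun p : measurableTypeR R * measurableTypeR R => p.2) by exact: measurable_snd.
  apply: cmeasM; first exact: (cmeas_comp (u := fun p : measurableTypeR R * measurableTypeR R => p.2) mrho n2).
  apply: cmeas_wave2; first exact: measurable_cst.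
  apply: cmeasN; apply: cmeasM; first exact: cmeasC.
  by apply: cmeasV; apply: cmeasB; [exact: cmeas_cst|exact: cmeasC].
have sec1 (g : R) : cmeas (fun w => wave t (- (g%:C / u w))).
  exact: (cmeas_comp (u := fun w : Om => (g : measurableTypeR R, w)) mwu (pair1_measurable g)).
have b1 (g : R) w : 0 < g -> cabs (wave t (- (g%:C / u w))) <= 1.
  by move=> g0; rewrite cabs_wave_le1 ?(ltW t0)// Im_Ninv// ltW.
have b2 (g x : R) : 0 < g -> cabs (wave t (- (g%:C / (z - x%:C)))) <= 1.
  by move=> g0; rewrite cabs_wave_le1 ?(ltW t0)// Im_Ninv ?Iv// ltW.
have sec2 (g : R) : cmeas (fun x : R => wave t (- (g%:C / (z - x%:C)))).
  apply: cmeas_wave2; first exact: measurable_cst.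
  apply: cmeasN; apply: cmeasM; first exact: cmeas_cst.
  by apply: cmeasV; apply: cmeasB; [exact: cmeas_cst|exact: cmeas_id].
pose f1 (g : R) := cint P (fun w => wave t (- (g%:C / u w))).
pose f2 (g : R) := cint (@gau R) (fun x => rho x * wave t (- (g%:C / (z - x%:C)))).
have mf1 : cmeas f1 by exact: (@cmeas_cint1 _ _ _ _ _ P _ mwu).
have mf2 : cmeas f2 by exact: (@cmeas_cint1 _ _ _ _ _ (@gau R) _ mwv).
have f1_le (g : R) : 0 < g -> cabs (f1 g) <= 1.
  by move=> g0; apply: cabs_cint_prob => // w; exact: b1.
have f2_le (g : R) : 0 < g -> cabs (f2 g) <= \int[@gau R]_x cabs (rho x).
  move=> g0; have ci : cintegrable (@gau R) (fun x => rho x * wave t (- (g%:C / (z - x%:C)))).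
    apply: (le_cintegrable _ (cintegrable_cabs r1)); first by apply: cmeasM => //; exact: sec2.
    by move=> x; rewrite cabsM ler_piMr ?cabs_ge0 ?b2.
  rewrite (le_trans (cabs_cint ci))//; apply: le_Rintegral => //; try exact: cintegrable_cabs.
  by move=> x _; rewrite cabsM ler_piMr ?cabs_ge0 ?b2.
transitivity (cint (gam k) (fun g => f1 g - f2 g)).
  apply: (@eq_cint_gam _ _ (\int[prod_gau P]_p (2 * cabs (c p)))) => //.
  - have h := cmeas_itr2 (prod_gau P) mc mu' mv' 1.
    exact: (cmeas_comp (u := fun g : R => (g : measurableTypeR R, t : measurableTypeR R)) h (pair2_measurable t)).
  - exact: cmeasB.
  - move=> g g0; apply: (@cabs_itr R _ X (prod_gau P) c u' v' (cIm z) z0 mc mu' mv' uy' vy' iq) => //.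
      by rewrite ler01 lexx.
    exact: ltW.
  move=> g g0.
  apply: (@cint_split (fun w => wave t (- (g%:C / u w))) (fun x => wave t (- (g%:C / (z - x%:C))))) => //.
  - by move=> w; exact: b1.
  - by move=> x; exact: b2.
rewrite cintB; [|exact: (cintegrable_gam k0 mf1 f1_le)|exact: (cintegrable_gam k0 mf2 f2_le)].
congr (_ - _).
rewrite (@gam_fubini _ _ _ (@gau R) k (fun p : measurableTypeR R * measurableTypeR R => rho p.2 * wave t (- (p.1%:C / (z - p.2%:C)))) (fun x => cabs (rho x)))//.
- have [h1 h2] := gau_Lap_div (ltW t0) (lexx 0).
  rewrite gwave0 mul1r addr0 in h2; rewrite -h2; apply: eq_cint => x.
  have v0 : 0 < cIm (z - x%:C) by rewrite Iv.
  rewrite /= cintZl; last by apply: (@cintegrable_gam _ _ _ 1) => [//||g g0]; [|exact: b2]; apply: cmeas_wave2 => //; apply: cmeasN; apply: cmeasM; [exact: cmeas_id|exact: cmeas_cst].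
  rewrite cint_gam_wave ?(ltW t0)// wave0 mulr1 /rho.
  have := Lap_scale k0 v0 (ltW t0); have G0 := gamma_fun_gt0 k0.
  have GC : (gamma_fun k)%:C != 0 :> R[i] by rewrite C_eq0 gt_eqF.
  move=> h; transitivity (Lap k (- 'i * (z - x%:C)) * Lap k (1 + t%:C * ('i / (z - x%:C))) / cyl k z / (gamma_fun k)%:C).
    ring.
  by rewrite h; field; apply/andP.
- by move=> x; exact: cabs_ge0.
- exact: cintegrable_cabs.
- by move=> g x g0; rewrite /= cabsM ler_piMr ?cabs_ge0 ?b2.
Qed.

Lemma cmeas_chf : cmeas chf.
Proof.
have h : cmeas (fun p : measurableTypeR R * Om => wave p.1 (u p.2)).
  apply: cmeas_wave2; first exact: measurable_fst.
  exact: (cmeas_comp (u := fun p : measurableTypeR R * Om => p.2) mu measurable_snd).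
exact: (@cmeas_cint1 _ _ _ _ _ P _ h).
Qed.

Lemma cmeas_ghf : cmeas ghf.
Proof.
pose F (p : (measurableTypeR R * measurableTypeR R) * Om) : R[i] := wave p.1.1 (- (p.1.2%:C / u p.2)).
have n1 : measurable_fun setT (fun p : (measurableTypeR R * measurableTypeR R) * Om => p.1) by exact: measurable_fst.
have mF : cmeas F.
  apply: cmeas_wave2; first exact: (measurableT_comp measurable_fst n1).
  apply: cmeasN; apply: cmeasM; first by apply: cmeasC; exact: (measurableT_comp measurable_snd n1).
  by apply: cmeasV; exact: (cmeas_comp (u := fun p : (measurableTypeR R * measurableTypeR R) * Om => p.2) mu measurable_snd).
have h : cmeas (fun p : measurableTypeR R * measurableTypeR R => cint P (fun w => F (p, w))).
  exact: (@cmeas_cint1 _ _ _ _ _ P _ mF).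
exact: (@cmeas_cint1 _ _ _ _ _ (gam k) _ h).
Qed.

Lemma cmeas_stat : cmeas stat.
Proof.
apply: cmeasM; last exact: cmeas_cst.
have dt t := cderive_cyl z 'i t k0.
by split; apply: continuous_measurable_fun => t; have [d1 d2] := dt t;
  [exact: (is_derive_continuous d1)|exact: (is_derive_continuous d2)].
Qed.

Let integrable_eq (f g : R -> R) : measurable_fun setT g -> (forall x : R, 0 < x -> f x = g x) ->
  (forall x : R, 0 < x -> 0 <= f x) ->
  hl.-integrable setT (fun x => (f x)%:E) -> hl.-integrable setT (fun x => (g x)%:E).
Proof.
move=> mg fg f0 fi; apply: (le_integrable_hl mg fi) => x x0.
by rewrite -fg// ger0_norm// f0.
Qed.

Let mD : measurable_fun setT (fun t => cabs (ghf t - stat t) ^+ 2).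
Proof. by apply: measurable_cabs2; apply: cmeasB; [exact: cmeas_ghf|exact: cmeas_stat]. Qed.

Let mE : measurable_fun setT (fun t => cabs (chf t - gwave z t * stat t) ^+ 2).
Proof.
apply: measurable_cabs2; apply: cmeasB; first exact: cmeas_chf.
by apply: cmeasM; [exact: cmeas_gwave|exact: cmeas_stat].
Qed.

Let measurable_of_integrable (f : R -> R) : hl.-integrable setT (fun x => (f x)%:E) -> measurable_fun setT f.
Proof. by move/measurable_int => /measurable_EFinP. Qed.

Lemma stat_div_le :
  hl.-integrable setT (fun t => (cabs (ghf t - stat t) ^+ 2 / t)%:E) /\
  \int[hl]_t (cabs (ghf t - stat t) ^+ 2 / t) <=
  \int[hl]_t (cabs (chf t - gwave z t * stat t) ^+ 2 / t).
Proof.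
have [i1 le1] := @gtr_div_le R _ X (prod_gau P) c u' v' (cIm z) z0 mc mu' mv' uy' vy' iq k k0.
have mi : measurable_fun setT (fun t : R => t^-1) by exact: measurable_inv.
have e1 t : 0 < t -> cabs (gtr (prod_gau P) c u' v' k 1 t) ^+ 2 / t = cabs (ghf t - stat t) ^+ 2 / t.
  by move=> t0; rewrite gtr_stat.
have e2 t : 0 < t -> cabs (wtr (prod_gau P) c u' v' 1 t) ^+ 2 / t = cabs (chf t - gwave z t * stat t) ^+ 2 / t.
  by move=> t0; rewrite wtr_stat.
have m1' : measurable_fun setT (fun t => cabs (ghf t - stat t) ^+ 2 / t) by exact: measurable_funM.
have m2' : measurable_fun setT (fun t : R => cabs (chf t - gwave z t * stat t) ^+ 2 / t) by exact: measurable_funM.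
have [_ i2 _] := @itr_frullani R _ X (prod_gau P) c u' v' (cIm z) z0 mc mu' mv' uy' vy' iq 1 ltr01.
split; first by apply: (integrable_eq m1' e1) => // t t0; rewrite divr_ge0 ?sqr_ge0 ?ltW.
rewrite -(eq_Rintegral_hl (measurable_of_integrable i1) m1' e1).
by rewrite -(eq_Rintegral_hl (measurable_of_integrable i2) m2' e2).
Qed.

(** [gtr_contraction] for the difference of the law of [u] and of the stationary measure, both
    of mass one. *)
Lemma stat_contraction (K ep : R) : k <= K -> ep = (4 * expR 1 * (K + 1))^-1 ->
  let w t := t^-1 + ep ^+ 2 / 2 in
  [/\ hl.-integrable setT (fun t => (expR (- t ^+ 2) * cabs (ghf t - stat t) ^+ 2 * w t)%:E),
      hl.-integrable setT (fun t => (cabs (chf t - gwave z t * stat t) ^+ 2 * w t)%:E) &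
      \int[hl]_t (expR (- t ^+ 2) * cabs (ghf t - stat t) ^+ 2 * w t) <=
      (1 - ep ^+ 2 / 4) * \int[hl]_t (cabs (chf t - gwave z t * stat t) ^+ 2 * w t)].
Proof.
move=> kK epE w.
have [i1 i2 le1] := @gtr_contraction R _ X (prod_gau P) c u' v' (cIm z) z0 mc mu' mv' uy' vy' iq k k0 K ep kK epE.
have mi : measurable_fun setT (fun t : R => t^-1) by exact: measurable_inv.
have mw : measurable_fun setT w by apply: measurable_funD.
have me : measurable_fun setT (fun t : R => expR (- t ^+ 2)).
  by apply: measurableT_comp => //; apply: measurableT_comp => //; exact: measurable_funX.
have w0 t : 0 < t -> 0 <= w t.
  by move=> t0; rewrite addr_ge0 ?invr_ge0 ?(ltW t0)// divr_ge0 ?sqr_ge0.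
have e1 t : 0 < t -> expR (- t ^+ 2) * cabs (gtr (prod_gau P) c u' v' k 1 t) ^+ 2 * w t =
    expR (- t ^+ 2) * cabs (ghf t - stat t) ^+ 2 * w t.
  by move=> t0; rewrite gtr_stat.
have e2 t : 0 < t -> cabs (wtr (prod_gau P) c u' v' 1 t) ^+ 2 * w t = cabs (chf t - gwave z t * stat t) ^+ 2 * w t.
  by move=> t0; rewrite wtr_stat.
have m1' : measurable_fun setT (fun t : R => expR (- t ^+ 2) * cabs (ghf t - stat t) ^+ 2 * w t).
  by apply: measurable_funM => //; exact: measurable_funM.
have m2' : measurable_fun setT (fun t : R => cabs (chf t - gwave z t * stat t) ^+ 2 * w t) by exact: measurable_funM.
split.
- apply: (integrable_eq m1' e1) => // t t0.
  by apply: mulr_ge0; [apply: mulr_ge0; [exact: expR_ge0|exact: sqr_ge0]|exact: w0].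
- by apply: (integrable_eq m2' e2) => // t t0; apply: mulr_ge0; [exact: sqr_ge0|exact: w0].
rewrite -(eq_Rintegral_hl (measurable_of_integrable i1) m1' e1).
by rewrite -(eq_Rintegral_hl (measurable_of_integrable i2) m2' e2).
Qed.

(** [gtr_sqr_le] with [b = 0], that is without subtracting the stationary measure. *)
Lemma ghf_apriori (t : R) : (forall s : R, 0 < s -> cabs (chf s) <= expR (- (s ^+ 2 / 2))) ->
  0 < t -> cabs (ghf t - 1) ^+ 2 <= k * t * expR 1.
Proof.
move=> chf_le t0.
have m1c : cmeas (fun _ : Om => 1 : R[i]) by exact: cmeas_cst.
have iq1 : P.-integrable setT (fun w => (cabs (1 : R[i]) * (1 + cabs (u w) + cabs (u w)))%:E).
  under eq_fun do rewrite cabs1 mul1r !EFinD.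
  apply: integrableD => //; apply: integrableD => //.
  exact: (@finite_measure_integrable_cst _ _ _ P setT 1).
have b01 : (0 : R) <= (0 : R) <= (1 : R) by rewrite lexx /=.
have h := @gtr_sqr_le R _ Om P (fun=> 1) u u (cIm z) z0 m1c mu mu uz uz iq1 k k0 0 t b01 t0.
have iw := @integrable_wtr R _ Om P (fun=> 1) u u (cIm z) z0 m1c mu mu uz uz iq1 0 b01.
have e1 : gtr P (fun=> 1) u u k 0 t = ghf t.
  by apply: eq_cint => g; apply: eq_cint => w; rewrite mul1r mul0r subr0.
have e2 : itr P (fun=> 1) u u 0 1 0 = 1.
  rewrite -[RHS](cint1 (probability_setT P)); apply: eq_cint => w.
  by rewrite !wave0 mul1r mul0r subr0.
have e3 s : wtr P (fun=> 1) u u 0 s = chf s.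
  by apply: eq_cint => w; rewrite mul1r mul0r subr0.
rewrite e1 e2 in h; rewrite (le_trans h)// ler_wpM2l ?mulr_ge0 ?(ltW k0) ?(ltW t0)//.
have [j1 j2] := @integrable_expRN R 1 ltr01.
have -> : expR 1 = \int[hl]_s (expR 1 * expR (- (1 * s))) :> R.
  by rewrite RintegralZl// j2 invr1 mulr1.
apply: le_Rintegral_hl => //; first by under eq_fun do rewrite EFinM; exact: integrableZl.
move=> s s0; rewrite e3.
have h1 : cabs (chf s) ^+ 2 <= expR (- (s ^+ 2 / 2)) ^+ 2.
  by rewrite ler_pXn2r ?nnegrE ?cabs_ge0 ?expR_ge0// chf_le.
rewrite (le_trans h1)// -expRM_natl -expRD ler_expR.
have := sqr_ge0 (s - 1); rewrite -mulr_natl; nra.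
Qed.

End one_step.

(** * The continued fraction of the resolvent *)

Section continued_fraction.
Context {R : realType}.
Variable z : R[i].
Hypothesis z0 : 0 < cIm z.

(** [chain av bv n m] is the level of index [n - m]; counting from the last level makes the
    recursion structural. *)
Fixpoint chain (av bv : nat -> R) (n m : nat) : R[i] :=
  match m with
  | 0 => z - (av n)%:C
  | m'.+1 => z - (av (n - m)%N)%:C - (bv (n - m)%N ^+ 2)%:C / chain av bv n m'
  end.

Definition level (av bv : nat -> R) n j := chain av bv n (n - j).

Lemma levelE av bv n j : (j < n)%N ->
  level av bv n j = z - (av j)%:C - (bv j ^+ 2)%:C / level av bv n j.+1.
Proof.
move=> jn; rewrite /level -(subnSK jn) /=.
by rewrite (subnSK jn) subKn// ltnW.
Qed.

Lemma level_last av bv n : level av bv n n = z - (av n)%:C.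
Proof. by rewrite /level subnn. Qed.

Lemma Im_chain av bv n m : cIm z <= cIm (chain av bv n m).
Proof.
elim: m => [|m IH] /=; first by rewrite cImB cImC subr0.
rewrite cImD cImB cImC subr0 lerDl.
by apply: Im_Ninv; [exact: sqr_ge0|exact: lt_le_trans IH].
Qed.

Lemma Im_level av bv n j : cIm z <= cIm (level av bv n j).
Proof. exact: Im_chain. Qed.

Lemma Im_level_gt0 av bv n j : 0 < cIm (level av bv n j).
Proof. exact: lt_le_trans (Im_level _ _ _ _). Qed.

Lemma level_neq0 av bv n j : level av bv n j != 0.
Proof. exact: Im_neq0 (Im_level_gt0 _ _ _ _). Qed.

Lemma cabs_level_le av bv n j : (j < n)%N ->
  cabs (level av bv n j) <= cabs z + `|av j| + bv j ^+ 2 * (cIm z)^-1.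
Proof.
move=> jn; rewrite levelE// (le_trans (cabsB _ _))// lerD//.
  by rewrite (le_trans (cabsB _ _))// cabsC.
rewrite cabsM cabsC cabsV ger0_norm ?sqr_ge0// ler_wpM2l ?sqr_ge0//.
rewrite lef_pV2 ?posrE ?cabs_gt0 ?level_neq0//.
exact: le_trans (Im_level _ _ _ _) (Im_le_cabs _).
Qed.

Lemma cmeas_level d (S : measurableType d) (av bv : S -> nat -> R) n j : (j <= n)%N ->
  (forall i, (j <= i <= n)%N -> measurable_fun setT (fun s => av s i)) ->
  (forall i, (j <= i)%N -> measurable_fun setT (fun s => bv s i)) ->
  cmeas (fun s => level (av s) (bv s) n j).
Proof.
move=> jn ma mb; rewrite /level.
have : (j <= n - (n - j))%N by rewrite subKn.
elim: (n - j)%N => [|m IH] jm /=.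
  apply: cmeasB; first exact: cmeas_cst.
  by apply: cmeasC; apply: ma; rewrite jn leqnn.
apply: cmeasB.
  apply: cmeasB; first exact: cmeas_cst.
  by apply: cmeasC; apply: ma; rewrite jm leq_subr.
apply: cmeasM; first by apply: cmeasC; apply: measurable_funX; exact: mb.
by apply: cmeasV; apply: IH; rewrite (leq_trans jm)// leq_sub2l.
Qed.

(** The first column of the resolvent. *)
Fixpoint weyl (av bv : nat -> R) n j : R[i] :=
  match j with
  | 0 => - (level av bv n 0)^-1
  | j'.+1 => (bv j')%:C * weyl av bv n j' / level av bv n j
  end.

(** The column [weyl] solves the three-term recursion by [levelE]. *)
Lemma resolvent11_level n (av bv : nat -> R) :
  resolvent11 (tridiag_mx (fun i : 'I_n.+1 => av i) (fun k : 'I_n => bv k)) z =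
  - (level av bv n 0)^-1.
Proof.
set T := tridiag_mx _ _; have sT : T^T = T := tridiag_sym _ _.
pose U := level av bv n; pose xs := weyl av bv n.
have U0 j : U j != 0 by exact: level_neq0.
pose x : 'cV[R[i]]_n.+1 := \col_i xs i.
have subL i : (csub (fun k : 'I_n => bv k) *m x) i 0 =
    if (i : nat) is j.+1 then (bv j)%:C * xs j else 0.
  rewrite csubE mulmx_suml summxE.
  under eq_bigr => k _ do rewrite -scalemxAl mxE mxE_delta mxE /=.
  case: i => -[|j] jn /=.
    by rewrite big1// => k _; rewrite mul0r mulr0.
  have jn' : (j < n)%N by [].
  rewrite (bigD1 (Ordinal jn'))//= -val_eqE /= eqxx mul1r big1 ?addr0// => k kj.
  rewrite -val_eqE /= eqSS eq_sym (_ : (k == j :> nat) = false) ?mul0r ?mulr0//.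
  by apply/negbTE; move: kj; rewrite -val_eqE.
have subU (i : 'I_n.+1) : ((csub (fun k : 'I_n => bv k))^T *m x) i 0 =
    if (i < n)%N then (bv i)%:C * xs i.+1 else 0.
  rewrite csubTE mulmx_suml summxE.
  under eq_bigr => k _ do rewrite -scalemxAl mxE mxE_delta mxE /=.
  case: ltnP => iN.
    rewrite (bigD1 (Ordinal iN))//= -val_eqE /= eqxx mul1r big1 ?addr0// => k kj.
    rewrite -val_eqE /= eq_sym (_ : (k == i :> nat) = false) ?mul0r ?mulr0//.
    by apply/negbTE; move: kj; rewrite -val_eqE.
  rewrite big1// => k _; rewrite -val_eqE /= (_ : (i == k :> nat) = false) ?mul0r ?mulr0//.
  by rewrite gtn_eqF// (leq_trans (ltn_ord k)).
have Ax : shifted T z *m x = delta_mx 0 0.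
  apply/colP => i; rewrite /shifted map_tridiag mulmxBl !mulmxDl [LHS]mxE.
  rewrite [X in X + _ = _]mxE [X in X + _ + _ = _]mxE subL subU.
  rewrite mul_diag_mx [X in X + _ + _ + _ = _]mxE mul_scalar_mx [in X in _ + X = _]mxE.
  have -> : (\row_i0 (av i0)%:C) 0 i = (av i)%:C by rewrite mxE.
  have -> : x i 0 = xs i by rewrite mxE.
  have -> : (z *: x) i 0 = z * xs i by rewrite !mxE.
  have -> : ('e_0 : 'cV[R[i]]_n.+1) i 0 = (i == 0)%:R by rewrite mxE andbT.
  have step j : (j < n)%N -> (bv j)%:C * xs j.+1 = (z - (av j)%:C - U j) * xs j.
    move=> jn; have Ej : U j = z - (av j)%:C - (bv j ^+ 2)%:C / U j.+1 by exact: levelE.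
    rewrite Ej /xs /= -/xs -/U CX; field; exact: U0.
  have bot : n = i :> nat -> U i = z - (av i)%:C.
    by move=> ni; rewrite /U -ni level_last.
  have tot : (if (i < n)%N then (bv i)%:C * xs i.+1 else 0) = (z - (av i)%:C - U i) * xs i.
    case: ltnP => iN; first exact: step.
    rewrite bot ?subrr ?mul0r//; apply/eqP; rewrite eqn_leq iN /=.
    by rewrite -ltnS.
  rewrite tot -val_eqE /=; case: (i : nat) => [|j].
    rewrite eqxx addr0 /xs /= -/U; field; exact: U0.
  rewrite /xs /= -/xs -/U; field; exact: U0.
have -> : resolvent11 T z = res T z 0 0 by [].
have : res T z *m (shifted T z *m x) = x by rewrite mulmxA res_mulV// mul1mx.
rewrite Ax => /(congr1 (fun M : 'cV[R[i]]_n.+1 => M 0 0)).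
have -> : x 0 0 = xs 0 by rewrite mxE.
rewrite /xs /= => <-; rewrite mxE (bigD1 0)//= mxE eqxx mulr1 big1 ?addr0// => k k0.
by rewrite mxE (negbTE k0) mulr0.
Qed.

End continued_fraction.

Lemma cabs_cint_gam {R : realType} (k C : R) (f : R -> R[i]) : 0 < k -> cmeas f ->
  (forall x : R, 0 < x -> cabs (f x) <= C) -> cabs (cint (gam k) f) <= C.
Proof.
move=> k0 mf fC; have ci := cintegrable_gam k0 mf fC.
rewrite (le_trans (cabs_cint ci))//.
have iC : (gam k).-integrable setT (fun=> C%:E).
  by apply: (@integrable_gam_bounded _ _ `|C|).
have -> : C = \int[gam k]_x C.
  have GT : gam k setT = 1%E by exact: gam_setT.
  by rewrite /Rintegral integral_cst// (etrans (congr1 _ GT) (mule1 _)).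
by apply: le_Rintegral_gam => //; exact: cintegrable_cabs.
Qed.

(** * One step of the recursion *)

Section recursion.
Context {R : realType} {d : measure_display} {Om : measurableType d} (P : probability Om R).
Context (n : nat) (av : 'I_n.+1 -> Om -> R) (bv : 'I_n -> Om -> R) (z : R[i]) (kap : 'I_n -> R).
Local Notation gau := (@gau R).
Local Notation entry := (entry av bv).

Hypothesis z0 : 0 < cIm z.
Hypothesis mX : forall i, measurable_fun setT (entry i).
Hypothesis indX : forall (J : {set 'I_n.+1 + 'I_n}) (A : 'I_n.+1 + 'I_n -> set (measurableTypeR R)),
  (forall j, j \in J -> measurable (A j)) ->
  P (\bigcap_(j in [set` J]) (entry j @^-1` A j)) = (\prod_(j in J) P (entry j @^-1` A j))%E.
Hypothesis kap0 : forall k, 0 < kap k.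
Hypothesis lawa : forall i (A : set (measurableTypeR R)), measurable A ->
  P (entry (inl i) @^-1` A) = gau A.
Hypothesis lawb : forall k (A : set (measurableTypeR R)), measurable A ->
  P (entry (inr k) @^-1` A) = gam (kap k) (Num.sqrt @^-1` A).

(** The entries as sequences. Outside the range of the indices [inord] and [insub] return
    arbitrary values, which the levels up to [n] do not see. *)
Definition avN (w : Om) (j : nat) : R := av (inord j) w.
Definition bvN (w : Om) (j : nat) : R := if insub j is Some k then bv k w else 0.
Definition ulev (j : nat) (w : Om) : R[i] := level z (avN w) (bvN w) n j.

Lemma avN_ord w (i : 'I_n.+1) : avN w i = av i w.
Proof. by rewrite /avN inord_val. Qed.

Lemma bvN_ord w (k : 'I_n) : bvN w k = bv k w.
Proof. by rewrite /bvN valK. Qed.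

Lemma resolvent11_ulev w :
  resolvent11 (tridiag_mx (fun i => av i w) (fun k => bv k w)) z = - (ulev 0 w)^-1.
Proof.
have -> : (fun i => av i w) = (fun i : 'I_n.+1 => avN w i) by apply/funext => i; rewrite avN_ord.
have -> : (fun k => bv k w) = (fun k : 'I_n => bvN w k) by apply/funext => k; rewrite bvN_ord.
exact: resolvent11_level.
Qed.

Lemma cmeas_ulev_gen d' (S : measurableType d') (e : S -> Om) j : (j <= n)%N ->
  (forall i : 'I_n.+1, (j <= i)%N -> measurable_fun setT (fun s => av i (e s))) ->
  (forall i : 'I_n, (j <= i)%N -> measurable_fun setT (fun s => bv i (e s))) ->
  cmeas (fun s => ulev j (e s)).
Proof.
move=> jn ma mb; apply: (@cmeas_level _ _ _ _ (fun s => avN (e s)) (fun s => bvN (e s))) => // i.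
  by move=> /andP[ji iN]; apply: ma; rewrite inordK.
move=> ji; rewrite /bvN; case: insubP => [k kn kE|_]; last exact: measurable_cst.
by apply: mb; rewrite kE.
Qed.

Let ma i : measurable_fun setT (fun w => av i w).
Proof. exact: (mX (inl i)). Qed.

Let mb i : measurable_fun setT (fun w => bv i w).
Proof. exact: (mX (inr i)). Qed.

Lemma cmeas_ulev j : (j <= n)%N -> cmeas (ulev j).
Proof. by move=> jn; apply: (@cmeas_ulev_gen _ _ id). Qed.

Lemma Im_ulev j w : cIm z <= cIm (ulev j w).
Proof. exact: Im_level. Qed.

Lemma integrable_ulev j : (j < n)%N -> P.-integrable setT (fun w => (cabs (ulev j w))%:E).
Proof.
move=> jn; pose k := Ordinal jn.
have ia : P.-integrable setT (fun w => (`|av (inord j) w|)%:E).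
  apply: (@integrable_law _ _ _ P (entry (inl (inord j))) gau id Num.norm) => //.
    by move=> A mA; exact: lawa.
  apply: (@integrable_gau_linear _ _ 1) => // x; rewrite normr_id; lra.
have ib : P.-integrable setT (fun w => (bv k w ^+ 2)%:E).
  apply: (@integrable_law _ _ _ P (entry (inr k)) (gam (kap k)) Num.sqrt (fun x => x ^+ 2)) => //.
  - exact: measurable_sqrt_fun.
  - by move=> A mA; exact: lawb.
  apply: (@integrable_gam_linear _ _ _ 1) => // [|x x0].
    by apply: measurable_funX; exact: measurable_sqrt_fun.
  by rewrite sqr_sqrtr ?(ltW x0)// ger0_norm ?(ltW x0)//; lra.
have iz : P.-integrable setT (fun w => (cabs z)%:E) by exact: (@finite_measure_integrable_cst _ _ _ P setT (cabs z)).
have i2 : P.-integrable setT (fun w => (cabs z + `|av (inord j) w| + bv k w ^+ 2 * (cIm z)^-1)%:E).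
  under eq_fun do rewrite EFinD EFinD EFinM muleC.
  apply: integrableD => //; first exact: integrableD.
  exact: integrableZl.
apply: le_integrable i2 => //.
  by apply/measurable_EFinP; apply: measurable_cabs; apply: cmeas_ulev; exact: ltnW.
move=> w _; rewrite /= lee_fin ger0_norm ?cabs_ge0// (le_trans _ (ler_norm _))//.
have := cabs_level_le z0 (avN w) (bvN w) jn.
by rewrite -[bvN w j]/(bvN w k) bvN_ord.
Qed.

Lemma cindep (i : 'I_n.+1 + 'I_n) (nu : {sigma_finite_measure set (measurableTypeR R) -> \bar R})
    (theta : R -> R) (F : measurableTypeR R * others entry i -> R[i]) :
  measurable_fun setT theta ->
  (forall A : set (measurableTypeR R), measurable A -> P (entry i @^-1` A) = nu (theta @^-1` A)) ->
  nu.-integrable setT (fun=> (1 : R)%:E) -> cmeas F -> (forall p, cabs (F p) <= 1) ->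
  cint P (fun w => F (entry i w, w)) = cint P (fun w => cint nu (fun x => F (theta x, w))).
Proof.
move=> mth law i1 [m1 m2] F1.
have sec (f : measurableTypeR R * others entry i -> R) : measurable_fun setT f -> (forall p, `|f p| <= 1) ->
    \int[P]_w f (entry i w, w) = \int[P]_w \int[nu]_x f (theta x, w).
  move=> mf f1; apply: (@indep_Rintegral _ _ _ P _ entry mX indX i nu theta f) => //.
    move=> w; apply: le_integrable i1 => //.
      apply/measurable_EFinP.
      exact: (measurableT_comp (measurableT_comp mf (pair2_measurable w)) mth).
    by move=> x _; rewrite /= lee_fin normr1.
  have iP : P.-integrable setT (fun=> (1 : R)%:E) by exact: (@finite_measure_integrable_cst _ _ _ P setT 1).
  apply: le_integrable iP => //.
    apply/measurable_EFinP; apply: (measurableT_comp mf).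
    apply: measurable_fun_pair; first exact: mX.
    exact: (@measurable_id_others R d Om _ entry mX i).
  by move=> w _; rewrite /= lee_fin normr1.
apply: complexP; rewrite !(Re_cint, Im_cint).
  under [RHS]eq_Rintegral do rewrite Re_cint.
  by apply: (sec (fun p => cRe (F p))) => // p; rewrite (le_trans (Re_cabs _)).
under [RHS]eq_Rintegral do rewrite Im_cint.
by apply: (sec (fun p => cIm (F p))) => // p; rewrite (le_trans (Im_cabs _)).
Qed.

Let mo (i j : 'I_n.+1 + 'I_n) : j != i ->
  measurable_fun setT (fun p : measurableTypeR R * others entry i => entry j p.2).
Proof.
move=> ji; have hj := @measurable_others R d Om _ entry i j ji.
exact (measurableT_comp hj measurable_snd).
Qed.

Let mlev (i : 'I_n.+1 + 'I_n) j : (j <= n)%N ->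
  (forall l : 'I_n.+1, (j <= l)%N -> inl l != i) -> (forall l : 'I_n, (j <= l)%N -> inr l != i) ->
  cmeas (fun p : measurableTypeR R * others entry i => ulev j p.2).
Proof.
move=> jn hl hr; apply: (@cmeas_ulev_gen _ _ (fun p : measurableTypeR R * others entry i => p.2)) => // l jl.
  by apply: (mo (j := inl l)); exact: hl.
by apply: (mo (j := inr l)); exact: hr.
Qed.

(** Conditionally on the rest, the diagonal entry contributes the Gaussian factor, and the
    square of the subdiagonal entry the gamma average. *)
Lemma chf_step (k : 'I_n) (t : R) : 0 <= t ->
  chf P (ulev k) t = gwave z t * ghf P (ulev k.+1) (kap k) t.
Proof.
move=> t0; pose u := ulev k.+1.
have u0 w : 0 < cIm (u w) by exact: lt_le_trans (Im_ulev _ _).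
pose i : 'I_n.+1 := widen_ord (leqnSn n) k.
have uE w : ulev k w = z - (av i w)%:C - (bv k w ^+ 2)%:C / u w.
  rewrite /ulev levelE// bvN_ord; congr (_ - (_)%:C - _).
  by rewrite -(avN_ord w i).
have Iq (x : R) w : 0 <= cIm (- ((x ^+ 2)%:C / u w)) by apply: Im_Ninv => //; exact: sqr_ge0.
have mq (S : 'I_n.+1 + 'I_n) (f : measurableTypeR R * others entry S -> R) :
    measurable_fun setT f -> cmeas (fun p : measurableTypeR R * others entry S => u p.2) ->
    cmeas (fun p : measurableTypeR R * others entry S => - ((f p ^+ 2)%:C / u p.2)).
  move=> mf mu; apply: cmeasN; apply: cmeasM; last exact: cmeasV.
  by apply: cmeasC; exact: measurable_funX.
pose F1 (p : measurableTypeR R * others entry (inl i)) : R[i] :=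
  wave t (z - p.1%:C - (bv k p.2 ^+ 2)%:C / u p.2).
have mF1 : cmeas F1.
  apply: cmeas_wave2; first exact: measurable_cst.
  apply: cmeasD; last first.
    apply: mq; first exact: (mo (i := inl i) (j := inr k)).
    apply: mlev => // l kl; apply/eqP => -[lE].
    by move: kl; rewrite lE /= ltnn.
  by apply: cmeasB; [exact: cmeas_cst|apply: cmeasC; exact: measurable_fst].
have F1_le p : cabs (F1 p) <= 1.
  rewrite cabs_wave_le1// cImD cImB cImC subr0 addr_ge0 ?(ltW z0)//; exact: Iq.
have mid : measurable_fun setT (id : R -> R) by exact: measurable_id.
have s1 := @cindep (inl i) gau id F1 mid (fun A mA => lawa i mA) (integrable_gau_cst 1) mF1 F1_le.
transitivity (cint P (fun w => F1 (entry (inl i) w, w))).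
  by apply: eq_cint => w; rewrite /F1 uE.
rewrite s1.
pose F2 (p : measurableTypeR R * others entry (inr k)) : R[i] := wave t (- ((p.1 ^+ 2)%:C / u p.2)).
have mF2 : cmeas F2.
  apply: cmeas_wave2; first exact: measurable_cst.
  apply: mq; first exact: measurable_fst.
  apply: mlev => // l kl; apply/eqP => -[lE].
  by move: kl; rewrite lE ltnn.
have F2_le p : cabs (F2 p) <= 1 by rewrite cabs_wave_le1//; exact: Iq.
have ig1 : (gam (kap k)).-integrable setT (fun=> (1 : R)%:E).
  by apply: (@integrable_gam_bounded _ _ 1) => // x _; rewrite normr1.
have s2 := @cindep (inr k) (gam (kap k)) Num.sqrt F2 measurable_sqrt_fun (fun A mA => lawb k mA) ig1 mF2 F2_le.
have gz : wave t z * (expR (- (t ^+ 2 / 2)))%:C = gwave z t.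
  have -> : (expR (- (t ^+ 2 / 2)))%:C = expC (- (t ^+ 2 / 2))%:C.
    by apply: complexP; rewrite !(Re_expC, Im_expC) !(cReC, cImC) ?cos0 ?sin0 ?mulr1 ?mulr0.
  by rewrite waveE -expCD /gwave addrC.
transitivity (cint P (fun w => gwave z t * F2 (entry (inr k) w, w))).
  apply: eq_cint => w; rewrite -gz -gau_char// /F1 /F2 /=.
  rewrite mulrAC -cintZl; last first.
    apply: (@cintegrable_gau _ _ 1); first exact: cmeas_expi.
    by move=> x; rewrite cabs_expim mul1r lerDl.
  apply: eq_cint => x; rewrite !waveE -!expCD; congr expC; ring.
rewrite cintZl; last first.
  apply: (@cintegrable_prob _ _ _ P _ 1) => [|w]; last exact: F2_le.
  have mq2 : cmeas (fun w => - ((bv k w ^+ 2)%:C / u w)).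
    apply: cmeasN; apply: cmeasM; first by apply: cmeasC; exact: measurable_funX.
    by apply: cmeasV; exact: cmeas_ulev.
  by apply: cmeas_wave2 => //; exact: measurable_cst.
congr (_ * _); rewrite s2 /ghf.
have mG : cmeas (fun p : measurableTypeR R * Om => wave t (- (p.1%:C / u p.2))).
  apply: cmeas_wave2; first exact: measurable_cst.
  apply: cmeasN; apply: cmeasM; first by apply: cmeasC; exact: measurable_fst.
  apply: cmeasV; exact: (cmeas_comp (u := fun p : measurableTypeR R * Om => p.2) (cmeas_ulev (ltn_ord k)) measurable_snd).
rewrite (@gam_fubini _ _ _ P (kap k) (fun p => wave t (- (p.1%:C / u p.2))) (fun=> 1))//; last 2 first.
- exact: (@finite_measure_integrable_cst _ _ _ P setT 1).
- by move=> g w g0; rewrite /= cabs_wave_le1// Im_Ninv// ltW.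
apply: eq_cint => w.
have ms (f : R -> R) : measurable_fun setT f -> cmeas (fun g : R => wave t (- ((f g)%:C / u w))).
  move=> mf; apply: cmeas_wave2; first exact: measurable_cst.
  by apply: cmeasN; apply: cmeasM; [exact: cmeasC|exact: cmeas_cst].
apply: (@eq_cint_gam _ _ 1) => //.
- by apply: (ms (fun g => Num.sqrt g ^+ 2)); apply: measurable_funX; exact: measurable_sqrt_fun.
- exact: (ms id).
- by move=> g g0; rewrite /F2 /= sqr_sqrtr// ltW.
Qed.

Lemma cabs_chf_le (k : 'I_n) (s : R) : 0 < s -> cabs (chf P (ulev k) s) <= expR (- (s ^+ 2 / 2)).
Proof.
move=> s0; rewrite (chf_step k (ltW s0)) cabsM.
rewrite -[leRHS]mulr1 ler_pM ?cabs_ge0//.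
  rewrite cabs_gwave ler_expR lerBlDr lerDl mulr_ge0 ?(ltW s0)// ltW//.
apply: cabs_cint_gam => //.
  have mG : cmeas (fun p : measurableTypeR R * Om => wave s (- (p.1%:C / ulev k.+1 p.2))).
    apply: cmeas_wave2; first exact: measurable_cst.
    apply: cmeasN; apply: cmeasM; first by apply: cmeasC; exact: measurable_fst.
    apply: cmeasV; exact: (cmeas_comp (u := fun p : measurableTypeR R * Om => p.2) (cmeas_ulev (ltn_ord k)) measurable_snd).
  exact: (@cmeas_cint1 _ _ _ _ _ P _ mG).
move=> g g0; have mw : cmeas (fun w => - (g%:C / ulev k.+1 w)).
  apply: cmeasN; apply: cmeasM; first exact: cmeas_cst.
  by apply: cmeasV; exact: (cmeas_ulev (ltn_ord k)).
apply: cabs_cint_prob; first by apply: cmeas_wave2 => //; exact: measurable_cst.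
move=> w; rewrite cabs_wave_le1 ?(ltW s0)//; apply: Im_Ninv; first exact: ltW.
exact: lt_le_trans (Im_ulev _ _).
Qed.

End recursion.

(** * Estimates for one matrix *)

Section weight.
Context {R : realType}.
Local Notation hl := (@hl R).

Definition weight (ep t : R) : R := t^-1 + ep ^+ 2 / 2.

Lemma weight_ge0 ep t : 0 < t -> 0 <= weight ep t.
Proof. by move=> t0; rewrite addr_ge0 ?invr_ge0 ?(ltW t0)// divr_ge0 ?sqr_ge0. Qed.

Lemma measurable_weight ep : measurable_fun setT (weight ep).
Proof. by apply: measurable_funD => //; exact: measurable_inv. Qed.

Lemma measurable_gauss2 : measurable_fun setT (fun t : R => expR (- t ^+ 2)).
Proof. by apply: measurableT_comp => //; apply: measurableT_comp => //; exact: measurable_funX. Qed.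

(** Up to the crude constant, the integral of [A (t + t^2)] times the weight against [e^(- t^2)]. *)
Definition wbound (ep A : R) : R := A * (3 * (1 + ep ^+ 2 / 2) * expR (9 / 4)).

Lemma weighted_pointwise (ep A x t : R) : 0 <= A -> 0 < t -> 0 <= x -> x <= A * (t + t ^+ 2) ->
  expR (- t ^+ 2) * x * weight ep t <= wbound ep A * expR (- (1 * t)).
Proof.
move=> A0 t0 x0 xA; set c := ep ^+ 2 / 2.
have c0 : 0 <= c by rewrite divr_ge0 ?sqr_ge0.
have h1 : x * weight ep t <= A * (3 * (1 + c)) * expR (2 * t).
  rewrite (@le_trans _ _ (A * (t + t ^+ 2) * weight ep t))//.
    by rewrite ler_wpM2r ?weight_ge0.
  have -> : A * (t + t ^+ 2) * weight ep t = A * ((1 + t) * (1 + c * t)).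
    by rewrite /weight -/c; field; rewrite gt_eqF.
  rewrite -mulrA ler_wpM2l//.
  have e1 : expR (2 * t) = expR t ^+ 2 by rewrite expRM_natl.
  have h := expR_ge1Dx t; rewrite e1.
  have h2 : (1 + t) * (1 + c * t) <= 3 * (1 + c) * (1 + t) ^+ 2.
    have ct : 0 <= c * t by rewrite mulr_ge0 ?(ltW t0).
    nra.
  rewrite (le_trans h2)// ler_wpM2l ?mulr_ge0 ?addr_ge0//.
  by rewrite ler_pXn2r ?nnegrE ?expR_ge0// addr_ge0 ?(ltW t0).
(* Complete the square in [t ^ 2 - 3 t]. *)
have h3 : expR (- t ^+ 2) <= expR (9 / 4) * expR (- (3 * t)).
  by rewrite -expRD ler_expR; have := sqr_ge0 (t - 3 / 2); nra.
rewrite -mulrA (le_trans (ler_pM _ _ h3 h1)) ?expR_ge0 ?mulr_ge0 ?weight_ge0//.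
have e2 : expR (- (1 * t)) = expR (- (3 * t)) * expR (2 * t) by rewrite -expRD; congr expR; ring.
by rewrite e2 /wbound -/c le_eqVlt; apply/orP; left; apply/eqP; ring.
Qed.

Lemma weighted_le (ep A : R) (f : R -> R) : 0 <= A -> measurable_fun setT f ->
  (forall t : R, 0 < t -> 0 <= f t) -> (forall t : R, 0 < t -> f t <= A * (t + t ^+ 2)) ->
  hl.-integrable setT (fun t => (expR (- t ^+ 2) * f t * weight ep t)%:E) /\
  \int[hl]_t (expR (- t ^+ 2) * f t * weight ep t) <= wbound ep A.
Proof.
move=> A0 mf f0 fA.
have [j1 j2] := @integrable_expRN R 1 ltr01.
have mh : measurable_fun setT (fun t : R => expR (- t ^+ 2) * f t * weight ep t).
  apply: measurable_funM; last exact: measurable_weight.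
  by apply: measurable_funM => //; exact: measurable_gauss2.
have iB : hl.-integrable setT (fun t => (wbound ep A * expR (- (1 * t)))%:E).
  by under eq_fun do rewrite EFinM; exact: integrableZl.
have ih : hl.-integrable setT (fun t => (expR (- t ^+ 2) * f t * weight ep t)%:E).
  apply: (le_integrable_hl mh iB) => t t0; rewrite ger0_norm.
    by apply: weighted_pointwise => //; [exact: f0|exact: fA].
  apply: mulr_ge0; last exact: weight_ge0.
  by apply: mulr_ge0; [exact: expR_ge0|exact: f0].
split => //.
have -> : wbound ep A = \int[hl]_t (wbound ep A * expR (- (1 * t))).
  by rewrite RintegralZl// j2 invr1 mulr1.
apply: le_Rintegral_hl => // t t0; apply: weighted_pointwise => //; [exact: f0|exact: fA].
Qed.

Lemma cabs_sqrD_le (x : R) (a b : R[i]) : 0 < x ->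
  cabs (a + b) ^+ 2 <= (1 + x) * cabs a ^+ 2 + (1 + x^-1) * cabs b ^+ 2.
Proof.
move=> x0; have h := cabsD a b.
have h1 : cabs (a + b) ^+ 2 <= (cabs a + cabs b) ^+ 2.
  by rewrite ler_pXn2r ?nnegrE ?addr_ge0 ?cabs_ge0.
rewrite (le_trans h1)//; have h2 := sqr_ge0 (x * cabs a - cabs b).
have h3 : 2 * (cabs a * cabs b) <= x * cabs a ^+ 2 + x^-1 * cabs b ^+ 2.
  rewrite -(ler_pM2l x0) mulrDr [x * (x^-1 * _)]mulrA divff ?gt_eqF// mul1r; nra.
nra.
Qed.

Lemma le_Rintegral_hl2 (a b : R) (f g h : R -> R) : measurable_fun setT f ->
  hl.-integrable setT (fun t => (g t)%:E) -> hl.-integrable setT (fun t => (h t)%:E) ->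
  (forall t : R, 0 < t -> 0 <= f t <= a * g t + b * h t) ->
  \int[hl]_t f t <= a * \int[hl]_t g t + b * \int[hl]_t h t.
Proof.
move=> mf ig ih fgh; rewrite -!RintegralZl//.
have k1 := integrableZl measurableT a ig; have k2 := integrableZl measurableT b ih.
have k12 : hl.-integrable setT (fun t => (a * g t + b * h t)%:E).
  by under eq_fun do rewrite EFinD; exact: integrableD.
rewrite -RintegralD//; apply: le_Rintegral_hl => // [|t t0]; last by case/andP: (fgh t t0).
apply: (le_integrable_hl mf k12) => t t0.
by case/andP: (fgh t t0) => f0 fl; rewrite ger0_norm.
Qed.

End weight.

Section one_matrix.
Context {R : realType} {d : measure_display} {Om : measurableType d} (P : probability Om R).
Context (n : nat) (av : 'I_n.+1 -> Om -> R) (bv : 'I_n -> Om -> R) (z : R[i]) (kap : nat -> R).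
Local Notation hl := (@hl R).
Local Notation gau := (@gau R).
Local Notation entry := (entry av bv).

Hypothesis z0 : 0 < cIm z.
Hypothesis mX : forall i, measurable_fun setT (entry i).
Hypothesis indX : forall (J : {set 'I_n.+1 + 'I_n}) (A : 'I_n.+1 + 'I_n -> set (measurableTypeR R)),
  (forall j, j \in J -> measurable (A j)) ->
  P (\bigcap_(j in [set` J]) (entry j @^-1` A j)) = (\prod_(j in J) P (entry j @^-1` A j))%E.
Hypothesis lawa : forall i (A : set (measurableTypeR R)), measurable A ->
  P (entry (inl i) @^-1` A) = gau A.
Hypothesis lawb : forall (k : 'I_n) (A : set (measurableTypeR R)), measurable A ->
  P (entry (inr k) @^-1` A) = gam (kap k) (Num.sqrt @^-1` A).
Hypothesis kap0 : forall k : 'I_n, 0 < kap k.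

Let U j := ulev av bv z j.

Definition dev (j : nat) (t : R) : R[i] := ghf P (U j.+1) (kap j) t - stat z (kap j) t.

(** The error made when the stationary solution of one level is used at the next. *)
Definition jump (j : nat) (t : R) : R[i] := stat z (kap j.+1) t - stat z (kap j) t.

Definition energy (ep : R) (f : R -> R[i]) : R :=
  \int[hl]_t (expR (- t ^+ 2) * cabs (f t) ^+ 2 * weight ep t).

Let mU j : (j <= n)%N -> cmeas (U j).
Proof. exact: (cmeas_ulev z mX). Qed.

Let UZ j w : cIm z <= cIm (U j w).
Proof. exact: Im_ulev. Qed.

Let iU j : (j < n)%N -> P.-integrable setT (fun w => (cabs (U j w))%:E).
Proof. by move=> jn; exact: (@integrable_ulev _ _ _ P n av bv z (fun k => kap k)). Qed.

Let chfE j : (j.+1 < n)%N -> forall t : R, 0 < t -> chf P (U j.+1) t - gwave z t * stat z (kap j) t =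
  gwave z t * (dev j.+1 t + jump j t).
Proof.
move=> jn t t0; have := @chf_step _ _ _ P n av bv z (fun k => kap k) z0 mX indX kap0 lawa lawb (Ordinal jn) t (ltW t0).
rewrite /= -/(U j.+1) -/(U j.+2) => ->; rewrite /dev /jump; ring.
Qed.

Let gwave_sqr t : 0 < t -> cabs (gwave z t) ^+ 2 <= expR (- t ^+ 2).
Proof.
move=> t0; rewrite cabs_gwave -expRM_natl ler_expR -mulr_natl.
have : 0 <= cIm z * t by rewrite mulr_ge0 ?(ltW z0) ?(ltW t0).
by lra.
Qed.

Let mstat j : (j < n)%N -> cmeas (stat z (kap j)).
Proof. by move=> jn; exact: (cmeas_stat z (kap0 (Ordinal jn))). Qed.

Let mdev j : (j < n)%N -> cmeas (dev j).
Proof.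
by move=> jn; apply: cmeasB; [apply: cmeas_ghf; exact: mU|exact: mstat].
Qed.

(** The contraction, followed by the comparison of the stationary solutions at two
    consecutive levels. *)
Lemma energy_step (K ep : R) j : (j.+2 < n)%N -> kap j <= K -> kap j.+1 <= K ->
  ep = (4 * expR 1 * (K + 1))^-1 -> cyl (kap j) z != 0 -> cyl (kap j.+1) z != 0 ->
  hl.-integrable setT (fun t => (expR (- t ^+ 2) * cabs (jump j t) ^+ 2 * weight ep t)%:E) ->
  energy ep (dev j) <= (1 - ep ^+ 2 / 4) *
    ((1 + ep ^+ 2 / 4) * energy ep (dev j.+1) + (1 + (ep ^+ 2 / 4)^-1) * energy ep (jump j)).
Proof.
move=> jn kj kj1 epE Yj Yj1 ij.
have jn0 : (j < n)%N by rewrite (leq_trans _ jn)// ltnW.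
have jn1 : (j.+1 < n)%N by exact: ltnW.
have K1 : 0 < K + 1 by rewrite ltr_wpDl// (le_trans (ltW (kap0 (Ordinal jn0))) kj).
have ep0 : 0 < ep by rewrite epE invr_gt0 !mulr_gt0 ?expR_gt0.
have ep1 : ep <= 1.
  rewrite epE invf_le1 ?mulr_gt0 ?expR_gt0//.
  have h1 := expR_ge1Dx (1 : R); have : 0 <= K by rewrite (le_trans (ltW (kap0 (Ordinal jn0))) kj).
  by move=> Kp; nra.
have x0 : 0 < ep ^+ 2 / 4 by rewrite divr_gt0 ?exprn_gt0.
have [i1 i2 h1] := @stat_contraction _ _ _ P (U j.+1) z (kap j) z0 (mU jn0) (UZ j.+1) (iU jn1)
  (kap0 (Ordinal jn0)) Yj K ep kj epE.
have [i3 _ _] := @stat_contraction _ _ _ P (U j.+2) z (kap j.+1) z0 (mU jn1) (UZ j.+2) (iU jn)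
  (kap0 (Ordinal jn1)) Yj1 K ep kj1 epE.
apply: (le_trans h1); apply: ler_wpM2l.
  have : ep ^+ 2 <= 1 by rewrite expr_le1// ltW.
  lra.
apply: (le_Rintegral_hl2 _ i3 ij) => [|t t0].
  apply: measurable_funM; last exact: measurable_weight.
  apply: measurable_cabs2; apply: cmeasB; first by apply: cmeas_chf; exact: mU.
  by apply: cmeasM; [exact: cmeas_gwave|exact: mstat].
apply/andP; split; first by rewrite mulr_ge0 ?sqr_ge0 ?weight_ge0.
rewrite chfE// cabsM exprMn -/(weight ep t).

have w0 := weight_ge0 ep t0.
have h2 := cabs_sqrD_le (dev j.+1 t) (jump j t) x0.
rewrite (@le_trans _ _ (expR (- t ^+ 2) * ((1 + ep ^+ 2 / 4) * cabs (dev j.+1 t) ^+ 2 +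
  (1 + (ep ^+ 2 / 4)^-1) * cabs (jump j t) ^+ 2) * weight ep t))//.
  rewrite ler_wpM2r// ler_pM ?sqr_ge0//; exact: gwave_sqr.
by rewrite le_eqVlt; apply/orP; left; apply/eqP; rewrite /dev; ring.
Qed.

(** Independent of the levels below: this starts the induction. *)
Lemma energy_apriori (K ep C : R) j : (j.+1 < n)%N -> kap j <= K -> 0 <= C ->
  (forall t : R, 0 < t -> cabs (stat z (kap j) t - 1) <= C * t) ->
  hl.-integrable setT (fun t => (expR (- t ^+ 2) * cabs (dev j t) ^+ 2 * weight ep t)%:E) /\
  energy ep (dev j) <= wbound ep (2 * (K * expR 1) + 2 * C ^+ 2).
Proof.
move=> jn kj C0 statC.
have jn0 : (j < n)%N by exact: ltnW.
have K0 : 0 <= K by rewrite (le_trans (ltW (kap0 (Ordinal jn0))) kj).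
have A0 : 0 <= 2 * (K * expR 1) + 2 * C ^+ 2.
  by rewrite addr_ge0 ?mulr_ge0 ?expR_ge0 ?sqr_ge0.
apply: (@weighted_le _ ep _ (fun t => cabs (dev j t) ^+ 2) A0).
- by apply: measurable_cabs2; exact: mdev.
- by move=> t _; exact: sqr_ge0.
move=> t t0.
have chf_le s : 0 < s -> cabs (chf P (U j.+1) s) <= expR (- (s ^+ 2 / 2)).
  exact: (@cabs_chf_le _ _ _ P n av bv z (fun k => kap k) z0 mX indX kap0 lawa lawb (Ordinal jn)).
have h1 := @ghf_apriori _ _ _ P (U j.+1) z (kap j) z0 (mU jn0) (UZ j.+1) (iU jn) (kap0 (Ordinal jn0)) t chf_le t0.
have h2 := statC t t0.
have -> : dev j t = (ghf P (U j.+1) (kap j) t - 1) + (1 - stat z (kap j) t).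
  by rewrite /dev; ring.
have h3 := cabs_sqrD_le (ghf P (U j.+1) (kap j) t - 1) (1 - stat z (kap j) t) (@ltr01 R).
have h4 : cabs (1 - stat z (kap j) t) ^+ 2 <= (C * t) ^+ 2.
  by rewrite -cabsN opprB ler_pXn2r ?nnegrE ?cabs_ge0 ?mulr_ge0 ?(ltW t0).
rewrite (le_trans h3)// invr1.
have h5 : kap j * t * expR 1 <= K * t * expR 1 by rewrite ler_wpM2r ?expR_ge0// ler_wpM2r ?(ltW t0).
have E0 := expR_ge0 (1 : R); have C2 := sqr_ge0 C; have t2 := sqr_ge0 t.
have KE : 0 <= K * expR 1 by rewrite mulr_ge0.
rewrite exprMn in h4; nra.
Qed.

Lemma deviation_div_le (ep : R) : (1 < n)%N -> cyl (kap 0) z != 0 ->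
  hl.-integrable setT (fun t => (expR (- t ^+ 2) * cabs (dev 1 t) ^+ 2 * weight ep t)%:E) ->
  hl.-integrable setT (fun t => (expR (- t ^+ 2) * cabs (jump 0 t) ^+ 2 * weight ep t)%:E) ->
  hl.-integrable setT (fun t => (cabs (dev 0 t) ^+ 2 / t)%:E) /\
  \int[hl]_t (cabs (dev 0 t) ^+ 2 / t) <= 2 * energy ep (dev 1) + 2 * energy ep (jump 0).
Proof.
move=> n1 Y0 i1 i2; have n0 : (0 < n)%N by exact: ltnW.
have [i3 h1] := @stat_div_le _ _ _ P (U 1) z (kap 0) z0 (mU n0) (UZ 1) (iU n1) (kap0 (Ordinal n0)) Y0.
split; first exact: i3.
apply: (le_trans h1); apply: (le_Rintegral_hl2 _ i1 i2) => [|t t0].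
  apply: measurable_funM; last exact: measurable_inv.
  apply: measurable_cabs2; apply: cmeasB; first by apply: cmeas_chf; exact: mU.
  by apply: cmeasM; [exact: cmeas_gwave|exact: mstat].
apply/andP; split; first by rewrite divr_ge0 ?sqr_ge0 ?(ltW t0).
rewrite chfE// cabsM exprMn.
have tw : t^-1 <= weight ep t by rewrite lerDl divr_ge0 ?sqr_ge0.
have h2 := cabs_sqrD_le (dev 1 t) (jump 0 t) (@ltr01 R); rewrite invr1 in h2.
rewrite (le_trans (ler_pM _ _ (ler_pM _ _ (gwave_sqr t0) h2) tw))//; rewrite ?mulr_ge0 ?sqr_ge0 ?cabs_ge0 ?invr_ge0 ?(ltW t0)//.
by rewrite le_eqVlt; apply/orP; left; apply/eqP; ring.
Qed.

(** [- 1 / u] is [i] times the integral of [e^(i t u)] over the half-line. *)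
Lemma expected_resolvent11 : (0 < n)%N ->
  cint P (fun w => resolvent11 (tridiag_mx (fun i => av i w) (fun k => bv k w)) z) =
  'i * cint hl (fun t => gwave z t * ghf P (U 1) (kap 0) t).
Proof.
move=> n0.
pose g (p : measurableTypeR R * Om) : R[i] := wave p.1 (U 0 p.2).
pose f (p : measurableTypeR R * Om) : R[i] := (posind p.1)%:C * g p.
have mg : cmeas g.
  apply: cmeas_wave2; first exact: measurable_fst.
  exact: (cmeas_comp (u := fun p : measurableTypeR R * Om => p.2) (mU (leq0n n)) measurable_snd).
have mf : cmeas f.
  apply: cmeasM; last exact: mg.
  by apply: cmeasC; exact: (measurableT_comp (measurable_posind) measurable_fst).
have fE t w : 0 < t -> f (t, w) = g (t, w) by move=> t0; rewrite /f /posind t0 mul1r.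
have ms (G : measurableTypeR R * Om -> R[i]) w : cmeas G -> cmeas (fun t => G (t, w)).
  by move=> mG; exact: (cmeas_comp (u := fun t : measurableTypeR R => (t, w)) mG (pair2_measurable w)).
have [j1 _] := integrable_expRN z0.
have U0 w : 0 < cIm (U 0 w) := lt_le_trans z0 (UZ 0 w).
have fU w : cint hl (fun t => f (t, w)) = 'i / U 0 w.
  have [_ <-] := cint_expi (U0 w).
  transitivity (cint hl (fun t => g (t, w))).
    apply: eq_cint_hl; [exact: ms|exact: ms|by move=> t t0; exact: fE].
  by apply: eq_cint => t; exact: waveE.
transitivity ('i * cint P (fun w => cint hl (fun t => f (t, w)))).
  rewrite -cintZl; last first.
    apply: (@cintegrable_prob _ _ _ P _ (cIm z)^-1); first exact: (@cmeas_cint2 _ _ _ _ _ hl f mf).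
    move=> w; rewrite fU cabsM cabsi mul1r cabsV lef_pV2 ?posrE//.
      exact: le_trans (UZ 0 w) (Im_le_cabs _).
    exact: lt_le_trans (U0 w) (Im_le_cabs _).
  apply: eq_cint => w; rewrite (resolvent11_ulev _ _ z0) fU.
  by rewrite mulrA -expr2 sqr_i mulN1r.
congr (_ * _).
have fi : cintegrable (hl \x P)%E f.
  apply: (@cintegrable_prod _ _ _ _ _ hl P f (fun t => expR (- (cIm z * t))) (fun=> 1)).
  - exact: mf.
  - by move=> t; exact: expR_ge0.
  - by move=> _; exact: ler01.
  - exact: j1.
  - exact: (@finite_measure_integrable_cst _ _ _ P setT 1).
  - move=> t w; rewrite mulr1 /f /posind /=; case: (ltP 0 t) => t0.
      rewrite mul1r /g cabs_wave ler_expR lerN2 ler_wpM2r ?(ltW t0)//; exact: (UZ 0 w).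
    by rewrite mul0r cabs0 expR_ge0.
rewrite -(@cint_fubini _ _ _ _ _ hl P f fi).
apply: eq_cint_hl.
- exact: (@cmeas_cint1 _ _ _ _ _ P f mf).
- apply: cmeasM; first exact: cmeas_gwave.
  by apply: cmeas_ghf; exact: mU.
move=> t t0.
have <- := @chf_step _ _ _ P n av bv z (fun k => kap k) z0 mX indX kap0 lawa lawb (Ordinal n0) t (ltW t0).
by apply: eq_cint => w; rewrite fE.
Qed.

(** The free parameter [dl] balances the two terms of the inequality between the arithmetic
    and the geometric mean. *)
Lemma gwave_dev_le (dl : R) t : 0 < dl -> 0 < t -> cabs (gwave z t * dev 0 t) <=
  dl * expR 1 / 2 * expR (- (1 * t)) + (2 * dl)^-1 * (cabs (dev 0 t) ^+ 2 / t).
Proof.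
move=> d0 t0; set x := cabs (gwave z t); set v := cabs (dev 0 t); rewrite cabsM -/x -/v.
have h1 : x ^+ 2 * t <= expR 1 * expR (- (1 * t)).
  rewrite (@le_trans _ _ (expR (- t ^+ 2) * expR t))//.
    rewrite ler_pM ?sqr_ge0 ?(ltW t0) ?gwave_sqr//.
    by have := expR_ge1Dx t; lra.
  by rewrite -!expRD ler_expR; have := sqr_ge0 (t - 1); nra.
have h2 : 2 * (x * v) <= dl * (x ^+ 2 * t) + dl^-1 * (v ^+ 2 / t).
  have tn : t != 0 by rewrite gt_eqF.
  have dn : dl != 0 by rewrite gt_eqF.
  have dt : 0 < dl * t by rewrite mulr_gt0.
  rewrite -(ler_pM2l dt) -subr_ge0.
  have -> : dl * t * (dl * (x ^+ 2 * t) + dl^-1 * (v ^+ 2 / t)) - dl * t * (2 * (x * v)) =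
    (dl * t * x - v) ^+ 2 by field; apply/andP.
  exact: sqr_ge0.
have h3 : dl * (x ^+ 2 * t) <= dl * (expR 1 * expR (- (1 * t))) by rewrite ler_wpM2l ?(ltW d0).
rewrite invfM; lra.
Qed.

(** The stationary part of [ghf] is integrated explicitly by [integral_stationary]. *)
Lemma resolvent11_error (dl : R) : (0 < n)%N -> 0 < dl -> cyl (kap 0) z != 0 ->
  hl.-integrable setT (fun t => (cabs (dev 0 t) ^+ 2 / t)%:E) ->
  cabs (cint P (fun w => resolvent11 (tridiag_mx (fun i => av i w) (fun k => bv k w)) z) -
        'i * (cyl (kap 0 + 1) z / ((kap 0)%:C * cyl (kap 0) z))) <=
  dl * expR 1 / 2 + (2 * dl)^-1 * \int[hl]_t (cabs (dev 0 t) ^+ 2 / t).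
Proof.
move=> n0 d0 Y0 id; have k0 : 0 < kap 0 := kap0 (Ordinal n0).
have kC : (kap 0)%:C != 0 :> R[i] by rewrite C_eq0 gt_eqF.
have [i1 e1] := integral_stationary k0 (ltW z0).
have [j1 j2] := @integrable_expRN R 1 ltr01.
have mg : cmeas (fun t => gwave z t * dev 0 t).
  by apply: cmeasM; [exact: cmeas_gwave|exact: mdev].
have ij : hl.-integrable setT (fun t => (dl * expR 1 / 2 * expR (- (1 * t)) +
    (2 * dl)^-1 * (cabs (dev 0 t) ^+ 2 / t))%:E).
  have k1 := integrableZl measurableT (dl * expR 1 / 2) j1.
  have k2 := integrableZl measurableT (2 * dl)^-1 id.
  by under eq_fun do rewrite EFinD; exact: integrableD.
have ig : cintegrable hl (fun t => gwave z t * dev 0 t).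
  split => //; apply: (le_integrable_hl _ ij) => [|t t0]; first exact: measurable_cabs.
  by rewrite ger0_norm ?cabs_ge0//; exact: gwave_dev_le.
have is_ : cintegrable hl (fun t => (cyl (kap 0) z)^-1 * (gwave z t * cyl (kap 0) (z + t%:C * 'i))).
  exact: cintegrableZl.
rewrite expected_resolvent11// -mulrBr cabsM cabsi mul1r.
have -> : cint hl (fun t => gwave z t * ghf P (U 1) (kap 0) t) - cyl (kap 0 + 1) z / ((kap 0)%:C * cyl (kap 0) z)
    = cint hl (fun t => gwave z t * dev 0 t).
  transitivity (cint hl (fun t => (cyl (kap 0) z)^-1 * (gwave z t * cyl (kap 0) (z + t%:C * 'i)) +
      gwave z t * dev 0 t) - cyl (kap 0 + 1) z / ((kap 0)%:C * cyl (kap 0) z)).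
    by congr (_ - _); apply: eq_cint => t; rewrite /dev /stat; ring.
  rewrite cintD// cintZl// e1; field; exact/andP.
rewrite (le_trans (cabs_cint ig))//.
have -> : dl * expR 1 / 2 = dl * expR 1 / 2 * \int[hl]_t expR (- (1 * t)).
  by rewrite j2 invr1 mulr1.
apply: le_Rintegral_hl2 => // [|t t0]; first exact: measurable_cabs.
by rewrite cabs_ge0/=; exact: gwave_dev_le.
Qed.

End one_matrix.

(** * The limit *)

Lemma geometric_step {R : realType} (x r e a b : R) : 0 < x -> x <= 1 / 4 -> 0 < e ->
  a <= r + e / 2 -> b <= e / 2 -> (1 - x) * ((1 + x) * a + b) <= (1 - x) * (1 + x) * r + e.
Proof.
move=> x0 x1 e0 ha hb.
have h1 : (1 + x) * a + b <= (1 + x) * (r + e / 2) + e / 2.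
  by apply: lerD => //; apply: ler_wpM2l => //; lra.
rewrite (@le_trans _ _ ((1 - x) * ((1 + x) * (r + e / 2) + e / 2)))//.
  by apply: ler_wpM2l => //; lra.
rewrite -subr_ge0.
have -> : (1 - x) * (1 + x) * r + e - (1 - x) * ((1 + x) * (r + e / 2) + e / 2) =
  e / 2 * (x ^+ 2 + x) by field.
by rewrite mulr_ge0 ?divr_ge0 ?addr_ge0 ?sqr_ge0 ?ltW.
Qed.

Section limit.
Context {R : realType} (alpha E : R) (z : nat -> R[i]) (kap : nat -> nat -> R).
Context (d : nat -> measure_display) (Om : forall n, measurableType (d n)).
Context (P : forall n, probability (Om n) R).
Context (av : forall n, 'I_n.+1 -> Om n -> R) (bv : forall n, 'I_n -> Om n -> R).
Arguments av : clear implicits.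
Arguments bv : clear implicits.
Local Notation hl := (@hl R).
Local Notation gau := (@gau R).
Local Notation entry n := (@entry R (d n) (Om n) n (av n) (bv n)).

Hypothesis alpha0 : 0 < alpha.
Hypothesis z0 : forall n, 0 < cIm (z n).
Hypothesis cz : ccvg z E%:C.
Hypothesis kap0 : forall n j, 0 < kap n j.
Hypothesis ckap : forall j, kap n j @[n --> \oo] --> alpha.
Hypothesis mX : forall n i, measurable_fun setT (entry n i).
Hypothesis indX : forall n (J : {set 'I_n.+1 + 'I_n}) (A : 'I_n.+1 + 'I_n -> set (measurableTypeR R)),
  (forall j, j \in J -> measurable (A j)) ->
  P n (\bigcap_(j in [set` J]) (entry n j @^-1` A j)) = (\prod_(j in J) P n (entry n j @^-1` A j))%E.
Hypothesis lawa : forall n i (A : set (measurableTypeR R)), measurable A ->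
  P n (entry n (inl i) @^-1` A) = gau A.
Hypothesis lawb : forall n (k : 'I_n) (A : set (measurableTypeR R)), measurable A ->
  P n (entry n (inr k) @^-1` A) = gam (kap n k) (Num.sqrt @^-1` A).

Let c := cabs (cyl alpha E%:C).

Let c0 : 0 < c. Proof. by rewrite cabs_gt0; exact: cyl_real_neq0. Qed.

Let I := \int[hl]_s cyl_dom (alpha / 2 + 1) (2 * alpha + 1) 0 s.

Let C := 2 / c * I.

Let I0 : 0 <= I.
Proof.
have a2 : 0 < alpha / 2 by rewrite divr_gt0.
have h := @cabs_cylB_le R (alpha / 2) (2 * alpha) 0 alpha 1 0 a2.
rewrite oppr0 mul1r in h; apply: (le_trans (cabs_ge0 _) (h _ _ _)) => //.
by apply/andP; split; have := alpha0; lra.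
Qed.

Let C0 : 0 <= C. Proof. by rewrite mulr_ge0// divr_ge0// ltW. Qed.

(** Uniform bounds that hold at each level for [n] large. *)
Let good n j := [/\ alpha / 2 <= kap n j, kap n j <= 2 * alpha & c / 2 <= cabs (cyl (kap n j) (z n))].

Let near_good j : \forall n \near \oo, good n j.
Proof.
have h1 : \forall n \near \oo, alpha / 2 < kap n j.
  have a1 : alpha / 2 < alpha by have := alpha0; lra.
  exact: (cvgr_gt alpha (@ckap j) _ a1).
have h2 : \forall n \near \oo, kap n j < 2 * alpha.
  have a1 : alpha < 2 * alpha by have := alpha0; lra.
  exact: (cvgr_lt alpha (@ckap j) _ a1).
have cc : ccvg (fun n => cyl (kap n j) (z n)) (cyl alpha E%:C) by exact: ccvg_cyl.
have h3 : \forall n \near \oo, cabs (cyl (kap n j) (z n) - cyl alpha E%:C) < c / 2.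
  by apply: (cvgr_lt 0 cc _); rewrite divr_gt0.
near=> n; split.
- by apply: ltW; near: n.
- by apply: ltW; near: n.
have h : cabs (cyl (kap n j) (z n) - cyl alpha E%:C) < c / 2 by near: n.
have := cabsB (cyl (kap n j) (z n)) (cyl (kap n j) (z n) - cyl alpha E%:C).
by rewrite opprB addrC subrK -/c; lra.
Unshelve. all: by end_near. Qed.

Let good_neq0 n j : good n j -> cyl (kap n j) (z n) != 0.
Proof. by case=> _ _ h; rewrite -cabs_gt0 (lt_le_trans _ h)// divr_gt0. Qed.

Let good_stat n j : good n j -> forall t : R, 0 < t -> cabs (stat (z n) (kap n j) t - 1) <= C * t.
Proof.
move=> g t t0; have Y0 := good_neq0 g; case: g => k1 k2 k3.
have -> : stat (z n) (kap n j) t - 1 =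
    (cyl (kap n j) (z n + t%:C * 'i) - cyl (kap n j) (z n)) / cyl (kap n j) (z n).
  by rewrite /stat; field.
have a2 : 0 < alpha / 2 by rewrite divr_gt0.
have kk : alpha / 2 <= kap n j <= 2 * alpha by rewrite k1.
have M0 : - 0 <= cIm (z n) by rewrite oppr0 ltW.
have h := cabs_cylB_le a2 kk M0 (ltW t0).
have Yc : (cabs (cyl (kap n j) (z n)))^-1 <= 2 / c.
  by rewrite -[2 / c]invrK invf_div lef_pV2 ?posrE ?cabs_gt0// divr_gt0.
rewrite cabsM cabsV (le_trans (ler_pM _ _ h Yc)) ?cabs_ge0 ?invr_ge0 ?cabs_ge0//.
by rewrite /C -/I le_eqVlt; apply/orP; left; apply/eqP; ring.
Qed.

Let jmp n j := jump (z n) (kap n) j.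

Let dv n j := dev (P n) (av n) (bv n) (z n) (kap n) j.

Let jump_sqr n j t : good n j -> good n j.+1 -> 0 < t ->
  cabs (jmp n j t) ^+ 2 <= 4 * C ^+ 2 * (t + t ^+ 2).
Proof.
move=> g1 g2 t0; have h1 := good_stat g1 t0; have h2 := good_stat g2 t0.
have h : cabs (jmp n j t) <= 2 * C * t.
  have -> : jmp n j t = (stat (z n) (kap n j.+1) t - 1) - (stat (z n) (kap n j) t - 1).
    by rewrite /jmp /jump; ring.
  by rewrite (le_trans (cabsB _ _))//; lra.
have : cabs (jmp n j t) ^+ 2 <= (2 * C * t) ^+ 2.
  by rewrite ler_pXn2r ?nnegrE ?cabs_ge0// (le_trans (cabs_ge0 _) h).
move=> h3; rewrite (le_trans h3)//; have := mulr_ge0 (sqr_ge0 C) (ltW t0).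
by rewrite !exprMn; nra.
Qed.

Let cmeas_jmp n j : cmeas (jmp n j).
Proof. by apply: cmeasB; exact: cmeas_stat. Qed.

Let jump_integrable ep n j : good n j -> good n j.+1 ->
  hl.-integrable setT (fun t => (expR (- t ^+ 2) * cabs (jmp n j t) ^+ 2 * weight ep t)%:E).
Proof.
move=> g1 g2; have A0 : 0 <= 4 * C ^+ 2 by rewrite mulr_ge0 ?sqr_ge0.
apply: (proj1 (@weighted_le _ ep _ (fun t => cabs (jmp n j t) ^+ 2) A0 _ _ _)).
- by apply: measurable_cabs2; exact: cmeas_jmp.
- by move=> t _; exact: sqr_ge0.
- by move=> t t0; exact: jump_sqr.
Qed.

Let cvg_stat j t : 0 < t -> ccvg (fun n => stat (z n) (kap n j) t)
  (cyl alpha (E%:C + t%:C * 'i) / cyl alpha E%:C).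
Proof.
move=> t0; apply: ccvgM.
  by apply: ccvg_cyl => //; apply: ccvgD => //; exact: ccvg_cst.
by apply: ccvgV; [exact: cyl_real_neq0|exact: ccvg_cyl].
Qed.

Let cvg_jump ep j : energy ep (jmp n j) @[n --> \oo] --> (0 : R).
Proof.
pose F n t : R[i] := (expR (- t ^+ 2) * cabs (jmp n j t) ^+ 2 * weight ep t)%:C.
have A0 : 0 <= 4 * C ^+ 2 by rewrite mulr_ge0 ?sqr_ge0.
have [j1 j2] := @integrable_expRN R 1 ltr01.
have : ccvg (fun n => cint hl (F n)) (cint hl (fun=> 0)).
  apply: (@cdct_hl _ F _ (fun t => wbound ep (4 * C ^+ 2) * expR (- (1 * t)))).
  - move=> n; apply: cmeasC; apply: measurable_funM; last exact: measurable_weight.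
    by apply: measurable_funM; [exact: measurable_gauss2|apply: measurable_cabs2; exact: cmeas_jmp].
  - exact: cmeas_cst.
  - move=> t t0; apply: ccvgC.
    have h : cabs (jmp n j t) @[n --> \oo] --> (0 : R).
      have := ccvgD (cvg_stat j.+1 t0) (ccvgM (ccvg_cst (-1)) (cvg_stat j t0)).
      by rewrite mulN1r subrr /ccvg; under eq_fun do rewrite mulN1r subr0.
    have -> : (0 : R) = expR (- t ^+ 2) * (0 * 0) * weight ep t by ring.
    by apply: cvgMl; apply: cvgMr; under eq_fun do rewrite expr2; apply: cvgM.
  - by under eq_fun do rewrite EFinM; exact: integrableZl.
  - near=> n => t t0.
    have g1 : good n j by near: n; exact: near_good.
    have g2 : good n j.+1 by near: n; exact: near_good.
    rewrite /F cabsC ger0_norm; last first.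
      by rewrite mulr_ge0 ?weight_ge0// mulr_ge0 ?expR_ge0 ?sqr_ge0.
    by apply: weighted_pointwise => //; [exact: sqr_ge0|exact: jump_sqr].
  - move=> t t0; rewrite cabs0 mulr_ge0 ?expR_ge0// /wbound.
    rewrite mulr_ge0// mulr_ge0 ?expR_ge0// mulr_ge0// addr_ge0// divr_ge0//; exact: sqr_ge0.
move=> /ccvgP[+ _]; rewrite Re_cint /=.
have -> : \int[hl]_x (0 : R) = 0 by apply: Rintegral_eq0.
by under eq_fun do rewrite Re_cint.
Unshelve. all: by end_near. Qed.

Let near_jump e j eta : 0 < eta -> \forall n \near \oo, energy e (jmp n j) <= eta.
Proof. by move=> h; exact: (cvgr_le 0 (@cvg_jump e j) _ h). Qed.

Let K := 2 * alpha.
Let ep := (4 * expR 1 * (K + 1))^-1.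
Let x := ep ^+ 2 / 4.
Let rho := (1 - x) * (1 + x).
Let B := wbound ep (2 * (K * expR 1) + 2 * C ^+ 2).

Let ep0 : 0 < ep.
Proof. by rewrite invr_gt0 !mulr_gt0 ?expR_gt0// addr_gt0// mulr_gt0. Qed.

Let ep1 : ep <= 1.
Proof.
have K0 : 0 < K by rewrite mulr_gt0.
rewrite invf_le1 ?mulr_gt0 ?expR_gt0 ?addr_gt0//.
by have h1 := expR_ge1Dx (1 : R); nra.
Qed.

Let x0 : 0 < x. Proof. by rewrite divr_gt0 ?exprn_gt0. Qed.

Let x1 : x <= 1 / 4.
Proof. by rewrite ler_pM2r ?invr_gt0// expr_le1// ltW. Qed.

Let near_step j : \forall n \near \oo, energy ep (dv n j) <=
  (1 - x) * ((1 + x) * energy ep (dv n j.+1) + (1 + x^-1) * energy ep (jmp n j)).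
Proof.
near=> n.
have g1 : good n j by near: n; exact: near_good.
have g2 : good n j.+1 by near: n; exact: near_good.
have jn : (j.+2 < n)%N by near: n; exact: nbhs_infty_gt.
have [_ k1 _] := g1; have [_ k2 _] := g2.
apply: (@energy_step _ _ _ (P n) n (av n) (bv n) (z n) (kap n) (z0 n) (@mX n) (@indX n) (@lawa n) (@lawb n)
  (fun k => kap0 n k) K ep j jn k1 k2 erefl (good_neq0 g1) (good_neq0 g2)).
exact: jump_integrable.
Unshelve. all: by end_near. Qed.

Let near_apriori j : \forall n \near \oo,
  hl.-integrable setT (fun t => (expR (- t ^+ 2) * cabs (dv n j t) ^+ 2 * weight ep t)%:E) /\
  energy ep (dv n j) <= B.
Proof.
near=> n.
have g1 : good n j by near: n; exact: near_good.
have jn : (j.+1 < n)%N by near: n; exact: nbhs_infty_gt.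
have [_ k1 _] := g1.
exact: (@energy_apriori _ _ _ (P n) n (av n) (bv n) (z n) (kap n) (z0 n) (@mX n) (@indX n) (@lawa n) (@lawb n)
  (fun k => kap0 n k) K ep C j jn k1 C0 (good_stat g1)).
Unshelve. all: by end_near. Qed.

(** The depth [L] is fixed while [n] tends to infinity: only finitely many jumps occur. *)
Let near_geometric L : forall j eta, 0 < eta ->
  \forall n \near \oo, energy ep (dv n j) <= rho ^+ L * B + eta.
Proof.
elim: L => [|L IH] j eta eta0.
  near=> n; rewrite expr0 mul1r.
  have [_ h] : hl.-integrable setT (fun t => (expR (- t ^+ 2) * cabs (dv n j t) ^+ 2 * weight ep t)%:E) /\
    energy ep (dv n j) <= B by near: n; exact: near_apriori.
  by rewrite (le_trans h)// lerDl ltW.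
have e2 : 0 < eta / 2 by rewrite divr_gt0.
have ex : 0 < eta / 2 / (1 + x^-1) by rewrite divr_gt0// addr_gt0// invr_gt0.
near=> n.
have h1 : energy ep (dv n j.+1) <= rho ^+ L * B + eta / 2 by near: n; exact: IH.
have h2 : energy ep (jmp n j) <= eta / 2 / (1 + x^-1) by near: n; exact: near_jump.
have h3 : energy ep (dv n j) <=
  (1 - x) * ((1 + x) * energy ep (dv n j.+1) + (1 + x^-1) * energy ep (jmp n j)).
  by near: n; exact: near_step.
have h4 : (1 + x^-1) * energy ep (jmp n j) <= eta / 2.
  by rewrite mulrC -ler_pdivlMr// addr_gt0// invr_gt0.
by rewrite (le_trans h3)// exprS -mulrA; exact: geometric_step.
Unshelve. all: by end_near. Qed.

(** First [L] is chosen so that the a priori bound has decayed, then [n]. *)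
Let near_energy j eta : 0 < eta -> \forall n \near \oo, energy ep (dv n j) <= eta.
Proof.
move=> eta0; have e2 : 0 < eta / 2 by rewrite divr_gt0.
have h : rho ^+ L * B @[L --> \oo] --> (0 : R).
  rewrite -[X in _ --> X](mul0r B); apply: cvgMl; apply: cvg_expr.
  rewrite /rho -subr_sqr expr1n ger0_norm; have := x0; have := x1; nra.
have [L hL] : exists L, rho ^+ L * B < eta / 2.
  have [L _ hL] : \forall L \near \oo, rho ^+ L * B < eta / 2 by exact: (cvgr_lt _ h _ e2).
  by exists L; apply: hL => /=.
have := near_geometric L j e2; apply: filterS => n hn.
by rewrite (le_trans hn)// [leRHS]splitr lerD2r ltW.
Qed.

Let near_dev0 eta : 0 < eta -> \forall n \near \oo,
  hl.-integrable setT (fun t => (cabs (dv n 0 t) ^+ 2 / t)%:E) /\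
  \int[hl]_t (cabs (dv n 0 t) ^+ 2 / t) <= eta.
Proof.
move=> eta0; have e4 : 0 < eta / 4 by rewrite divr_gt0.
near=> n.
have g0 : good n 0 by near: n; exact: near_good.
have g1 : good n 1 by near: n; exact: near_good.
have n1 : (1 < n)%N by near: n; exact: nbhs_infty_gt.
have [i1 _] : hl.-integrable setT (fun t => (expR (- t ^+ 2) * cabs (dv n 1 t) ^+ 2 * weight ep t)%:E) /\
  energy ep (dv n 1) <= B by near: n; exact: near_apriori.
have [h1 h2] : energy ep (dv n 1) <= eta / 4 /\ energy ep (jmp n 0) <= eta / 4.
  near: n; have := near_jump ep 0 e4; have := near_energy 1 e4.
  by apply: filterS2 => n h1 h2; split; [exact: h1|exact: h2].
have [h3 h4] := @deviation_div_le _ _ _ (P n) n (av n) (bv n) (z n) (kap n) (z0 n) (@mX n) (@indX n) (@lawa n) (@lawb n)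
  (fun k => kap0 n k) ep n1 (good_neq0 g0) i1 (@jump_integrable ep n 0 g0 g1).
split; first exact: h3.
apply: (le_trans h4); rewrite -[leRHS](_ : 2 * (eta / 4) + 2 * (eta / 4) = _); last by field.
exact: (lerD (ler_wpM2l (ler0n R 2) h1) (ler_wpM2l (ler0n R 2) h2)).
Unshelve. all: by end_near. Qed.

Lemma cvg_expected_resolvent11 :
  ccvg (fun n => cint (P n) (fun w => resolvent11 (tridiag_mx (fun i => av n i w) (fun k => bv n k w)) (z n)))
    ('i * (cyl (alpha + 1) E%:C / (alpha%:C * cyl alpha E%:C))).
Proof.
pose s n := 'i * (cyl (kap n 0 + 1) (z n) / ((kap n 0)%:C * cyl (kap n 0) (z n))).
pose m n := cint (P n) (fun w => resolvent11 (tridiag_mx (fun i => av n i w) (fun k => bv n k w)) (z n)).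
have cs : ccvg s ('i * (cyl (alpha + 1) E%:C / (alpha%:C * cyl alpha E%:C))).
  apply: ccvgM; first exact: ccvg_cst.
  have aC : alpha%:C != 0 :> R[i] by rewrite C_eq0 gt_eqF.
  apply: ccvgM.
    by apply: ccvg_cyl => //; [exact: addr_gt0|apply: cvgD => //; exact: cvg_cst].
  apply: ccvgV; first by rewrite mulf_neq0// cyl_real_neq0.
  by apply: ccvgM; [exact: ccvgC|exact: ccvg_cyl].
have cm : ccvg (fun n => m n - s n) 0.
  apply/cvgrPdist_le => eta eta0.
  pose dl := eta / expR 1.
  have dl0 : 0 < dl by rewrite divr_gt0 ?expR_gt0.
  have e0 : 0 < dl * eta by rewrite mulr_gt0.
  near=> n; rewrite sub0r normrN subr0 ger0_norm ?cabs_ge0//.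
  have n0 : (0 < n)%N by near: n; exact: nbhs_infty_gt.
  have g0 : good n 0 by near: n; exact: near_good.
  have [i1 h1] : hl.-integrable setT (fun t => (cabs (dv n 0 t) ^+ 2 / t)%:E) /\
    \int[hl]_t (cabs (dv n 0 t) ^+ 2 / t) <= dl * eta by near: n; exact: near_dev0.
  have h := @resolvent11_error _ _ _ (P n) n (av n) (bv n) (z n) (kap n) (z0 n) (@mX n) (@indX n) (@lawa n) (@lawb n)
    (fun k => kap0 n k) dl n0 dl0 (good_neq0 g0) i1.
  rewrite (le_trans h)//.
  have -> : eta = dl * expR 1 / 2 + (2 * dl)^-1 * (dl * eta).
    by rewrite {1}/dl; field; rewrite !gt_eqF ?expR_gt0.
  by rewrite lerD2l ler_wpM2l// invr_ge0 mulr_ge0// ltW.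
have := ccvgD cm cs; rewrite add0r.
by under eq_fun do rewrite subrK.
Unshelve. all: by end_near. Qed.

End limit.

(** * The counting measure of the eigenvalues *)

Section counting.
Context {R : realType}.

Lemma Rintegral_point_measure n (E : R) (s : n.-tuple R) (f : measurableTypeR R -> R) :
  measurable_fun setT f -> (forall x, 0 <= f x) ->
  \int[point_measure E s]_x f x = \sum_(x <- s) f (n%:R * (x - E)).
Proof.
move=> mf f0; have mfE : measurable_fun setT (EFin \o f) by exact/measurable_EFinP.
rewrite /Rintegral /point_measure ge0_integral_measure_sum//; last first.
  by move=> x _; rewrite lee_fin.
rewrite (big_nth 0) size_tuple big_mkord.
under eq_bigr => j _ do rewrite integral_dirac// diracT mul1e.
by rewrite sumEFin.
Qed.

Lemma measurable_poisson_fun (zeta : R[i]) : measurable_fun setT (poisson_fun zeta).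
Proof.
suff [] : cmeas (fun x : measurableTypeR R => (x%:C - zeta)^-1) by [].
by apply: cmeasV; apply: cmeasB; [exact: cmeas_id|exact: cmeas_cst].
Qed.

Lemma poisson_fun_ge0 (zeta : R[i]) x : 0 < cIm zeta -> 0 <= poisson_fun zeta x.
Proof.
move=> z0; rewrite /poisson_fun -/(cIm _) cImV cImB cImC sub0r opprK.
by rewrite mulr_ge0 ?invr_ge0 ?sqr_ge0 ?(ltW z0).
Qed.

Lemma poisson_fun_scale (zeta : R[i]) (E x : R) n :
  poisson_fun zeta (n.+1%:R * (x - E)) =
  n.+1%:R^-1 * cIm (x%:C - (E%:C + zeta / n.+1%:R))^-1.
Proof.
have N0 : (n.+1%:R : R[i]) != 0 by rewrite pnatr_eq0.
rewrite /poisson_fun -/(cIm _) -cImCM; congr cIm.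
have -> : (n.+1%:R * (x - E))%:C - zeta = n.+1%:R * (x%:C - (E%:C + zeta / n.+1%:R)) :> R[i].
  by rewrite rmorphM rmorphB rmorph_nat; field.
by rewrite invfM fmorphV rmorph_nat.
Qed.

End counting.

Theorem theorem4p18 (R : realType) (alpha E : R) (zeta : R[i])
    (beta : nat -> R)
    (d : nat -> measure_display) (Omega : forall n, measurableType (d n))
    (P : forall n, probability (Omega n) R)
    (a : forall n, 'I_n.+1 -> {RV (P n) >-> R})
    (b : forall n, 'I_n -> {RV (P n) >-> R})
    (lambda : forall n, Omega n -> n.+1.-tuple R) :
  let T n (w : Omega n) : 'M[R]_n.+1 :=
    tridiag_mx (fun i => a n i w) (fun k => b n k w) in
  let xi n (w : Omega n) := point_measure E (lambda n w) in
  let m n (w : Omega n) (z : R[i]) := resolvent11 (T n w) z in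
  0 < alpha ->
  0 < complex.Im zeta ->
  (forall n, (0 < n)%N -> 0 < beta n) ->
  n%:R * beta n @[n --> \oo] --> 2 * alpha ->
  (forall n, tridiag_ensemble (beta n.+1) (a n) (b n)) ->
  (forall n (w : Omega n), eigenvalues_of (T n w) (lambda n w)) ->
  (forall n,
    ('E_(P n)[fun w => (\int[xi n w]_x poisson_fun zeta x)%R] =
     'E_(P n)[fun w => complex.Im (m n w (E%:C + zeta / n.+1%:R))%R])%E) /\
  'E_(P n)[fun w => complex.Im (m n w (E%:C + zeta / n.+1%:R))%R]%E
    @[n --> \oo] --> (pi * mubar alpha E)%:E.
Proof.
move=> T xi m alpha0 zeta0 beta0 cbeta ens eig.
pose z n : R[i] := E%:C + zeta / n.+1%:R.
(* The value 1 for [n <= j] only serves to keep [kap] positive. *)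
pose kap n j : R := if (j < n)%N then (n - j)%:R * beta n.+1 / 2 else 1.
pose av n (i : 'I_n.+1) : Omega n -> R := a n i.
pose bv n (k : 'I_n) : Omega n -> R := b n k.
have zE n : z n = E%:C + (n.+1%:R^-1)%:C * zeta by rewrite fmorphV rmorph_nat mulrC.
have z0 n : 0 < cIm (z n).
  rewrite zE cImD cImC add0r cImCM.
  by rewrite mulr_gt0// invr_gt0 ltr0n.
have kap0 n j : 0 < kap n j.
  rewrite /kap; case: ifP => // jn.
  by rewrite divr_gt0// mulr_gt0 ?beta0// ltr0n subn_gt0.
have kapE n (k : 'I_n) : 2 * kap n k = (n - k)%:R * beta n.+1.
  by rewrite /kap ltn_ord; field.
have mX n i : measurable_fun setT (entry (av n) (bv n) i).
  by case: i => i; [exact: (measurable_funPT (a n i))|exact: (measurable_funPT (b n i))].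
have indX n (J : {set 'I_n.+1 + 'I_n}) (A : 'I_n.+1 + 'I_n -> set (measurableTypeR R)) :
    (forall j, j \in J -> measurable (A j)) ->
    P n (\bigcap_(j in [set` J]) (entry (av n) (bv n) j @^-1` A j)) =
    (\prod_(j in J) P n (entry (av n) (bv n) j @^-1` A j))%E.
  move=> mA; have [_ _ ind] := ens n.
  pose X (j : 'I_n.+1 + 'I_n) : {RV (P n) >-> R} := match j with inl i => a n i | inr k => b n k end.
  have e j : entry (av n) (bv n) j @^-1` A j = X j @^-1` A j by case: j.
  under eq_bigcapr do rewrite e.
  under [RHS]eq_bigr do rewrite e.
  exact: (ind J A mA).
have lawa n i (A : set (measurableTypeR R)) : measurable A ->
    P n (entry (av n) (bv n) (inl i) @^-1` A) = gau A.
  by move=> mA; have [la _ _] := ens n; rewrite gauE -(la i A mA).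
have lawb n (k : 'I_n) (A : set (measurableTypeR R)) : measurable A ->
    P n (entry (av n) (bv n) (inr k) @^-1` A) = gam (kap n k) (Num.sqrt @^-1` A).
  move=> mA; have [_ lb _] := ens n; rewrite gamE.
  by etransitivity; [exact: (lb k A mA)|rewrite /chi_prob /kap ltn_ord subSS].
have cN : (n.+1%:R^-1 : R) @[n --> \oo] --> (0 : R) by exact: cvg_harmonic.
have cb : n.+1%:R * beta n.+1 @[n --> \oo] --> 2 * alpha.
  by have := (cvg_shiftS (fun n => n%:R * beta n) (nbhs (2 * alpha))); rewrite propeqE => -[_ h]; exact: h.
have ckap j : kap n j @[n --> \oo] --> alpha.
  have -> : alpha = (2 * alpha - j.+1%:R * (0 * (2 * alpha))) / 2 by field.
  have : ((n.+1%:R * beta n.+1 - j.+1%:R * (n.+1%:R^-1 * (n.+1%:R * beta n.+1))) / 2)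
      @[n --> \oo] --> (2 * alpha - j.+1%:R * (0 * (2 * alpha))) / 2.
    by apply: cvgMl; apply: cvgB => //; apply: cvgMr; exact: cvgM.
  apply: cvg_trans; apply: near_eq_cvg; near=> n.
  have jn : (j < n)%N by near: n; exact: nbhs_infty_gt.
  have N0 : (n.+1%:R : R) != 0 by rewrite pnatr_eq0.
  rewrite /kap jn natrB ?(ltnW jn)// [_^-1 * (_ * _)]mulrA mulVf// mul1r.
  by rewrite -[n.+1]addn1 -[j.+1]addn1 !natrD; field.
have cz : ccvg z E%:C.
  have := ccvgD (ccvg_cst E%:C) (ccvgM (ccvgC cN) (ccvg_cst zeta)).
  by rewrite mul0r addr0; under eq_fun do rewrite -zE.
have sT n w : (T n w)^T = T n w by exact: tridiag_sym.
pose g n i w := res (T n w) (z n) i i.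
have ig n i : cintegrable (P n) (g n i).
  apply: (@cintegrable_prob _ _ _ _ _ (cIm (z n))^-1) => [|w]; last exact: cabs_res.
  apply: cmeas_res => // k l; apply: measurable_tridiag => j; [exact: (mX n (inl j))|exact: (mX n (inr j))].
have EE n (f : Omega n -> R) : (P n).-integrable setT (EFin \o f) ->
    ('E_(P n)[f] = (\int[P n]_w f w)%:E)%E.
  by move=> fi; rewrite unlock /Rintegral fineK//; exact: integrable_fin_num.
have Eres n : ('E_(P n)[fun w => complex.Im (m n w (z n))] = (cIm (cint (P n) (fun w => m n w (z n))))%:E)%E.
  by rewrite EE ?Im_cint//; exact: (cintegrable_Im (ig n ord0)).
split => [n|].
  have xiE w : \int[xi n w]_x poisson_fun zeta x = n.+1%:R^-1 * cIm (\tr (res (T n w) (z n))).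
    rewrite (trace_res (sT n w) (z0 n) (eig n w)) Rintegral_point_measure//.
    - under eq_bigr do rewrite poisson_fun_scale.
      by rewrite -mulr_sumr cIm_sum.
    - exact: measurable_poisson_fun.
    - by move=> x; exact: poisson_fun_ge0.
  have it : cintegrable (P n) (fun w => \tr (res (T n w) (z n))).
    apply: (@cintegrable_prob _ _ _ _ _ (\sum_(i < n.+1) (cIm (z n))^-1)) => [|w].
      by apply: cmeas_sum => i; case: (ig n i).
    by rewrite (le_trans (cabs_sum _ _ _))// ler_sum// => i _; exact: cabs_res.
  have N0 : (n.+1%:R : R) != 0 by rewrite pnatr_eq0.
  have fE : (fun w => \int[xi n w]_x poisson_fun zeta x) = fun w => n.+1%:R^-1 * cIm (\tr (res (T n w) (z n))).
    exact/funext.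
  rewrite fE EE; last first.
    by have := integrableZl measurableT n.+1%:R^-1 (cintegrable_Im it).
  rewrite RintegralZl//; last exact: (cintegrable_Im it).
  rewrite Eres Im_cint; congr EFin.
  have := @expected_trace _ _ _ (P n) n (av n) (bv n) (z n) (kap n) (z0 n) (mX n) (indX n) (fun k => kap0 n k)
    (lawa n) (lawb n) (beta n.+1) (beta0 n.+1 (ltn0Sn n)) (kapE n) => ->.
  by rewrite mulrA mulVf// mul1r.
under eq_fun do rewrite Eres.
rewrite pi_mubar//; apply: cvg_EFin; first by near=> n.
by have /ccvgP[_ h] := cvg_expected_resolvent11 alpha0 z0 cz kap0 ckap mX indX lawa lawb.
Unshelve. all: by end_near. Qed.
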